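(* Assume that $n\ge2$ and $\Omega\in\mathcal G_{1/n'}$. Let $A$ be a non-degenerate Young function, let $B$ be a Young function, and let $f:\mathbb{R}\to\mathbb{R}$ be a locally Lipschitz continuous function. Let $T_f(u)=f\circ u$. (i) Assume that $$\int^{\infty}\Big(\frac{t}{A(t)}\Big)^{\frac1{n-1}}dt<\infty .$$ Then $T_f$ maps $W^{1,A}(\Omega)$ into $W^{1,A}(\Omega)$ and is continuous in the modular topology. (ii) Assume that $$\int^{\infty}\Big(\frac{t}{A(t)}\Big)^{\frac1{n-1}}dt=\infty ,$$ and that there exist a constant $\kappa>0$ and a non-decreasing continuous function $E:[0,\infty)\to[0,\infty)$, not identically $0$, such that $|f'(t)|\le\kappa E(\kappa|t|)$ for a.e. $t\in\mathbb{R}$. If there exists $t_0\ge0$ such that $$B\big(tE(H_n(t))\big)\le A(t)\quad\text{for } t\ge t_0,$$ then $T_f$ maps $W^{1,A}(\Omega)$ into $W^{1,B}(\Omega)$ and is continuous in the modular topology. Moreover, if $u_k\to u$ modularly in $W^{1,A}(\Omega)$ with constant $\lambda$, then $f(u_k)\to f(u)$ modularly in $W^{1,B}(\Omega)$ with constant $24\kappa\max\{\lambda,\|u\|_{W^{1,A}(\Omega)}\}$.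
   Context: A Young function is a convex, left-continuous function $A:[0,\infty)\to[0,\infty]$ with $A(0)=0$ which is non-constant in $(0,\infty)$; it is non-degenerate if $A(t)>0$ for $t>0$. Two Young functions $A,\widehat A$ are equivalent near infinity if there are $c,t_0>0$ with $A(t/c)\le\widehat A(t)\le A(ct)$ for $t\ge t_0$. The symbol $\int^\infty$ refers to convergence or divergence of the integral at infinity, and $\int_0$ to convergence at zero. The Orlicz space $L^A(\Omega)$ consists of the measurable functions $u$ on $\Omega$ with $\int_\Omega A(|u|/\lambda)\,dx<\infty$ for some $\lambda>0$ (for vector-valued $u$, $|u|$ is the Euclidean length), with Luxemburg norm $\|u\|_{L^A(\Omega)}=\inf\{\lambda>0:\int_\Omega A(|u|/\lambda)\,dx\le1\}$. A sequence $u_k\to u$ modularly in $L^A(\Omega)$ with constant $\lambda>0$ if $\lim_k\int_\Omega A(|u_k-u|/\lambda)\,dx=0$, and modularly if this holds for some $\lambda>0$. $W^{1,A}(\Omega)$ consists of the weakly differentiable $u\in L^A(\Omega)$ with $\nabla u\in L^A(\Omega)$, with norm $\|u\|_{W^{1,A}(\Omega)}=\|u\|_{L^A(\Omega)}+\|\nabla u\|_{L^A(\Omega)}$; modular convergence in $W^{1,A}(\Omega)$ (with constant $\lambda$) means modular convergence (with constant $\lambda$) in $L^A(\Omega)$ of the functions and of their gradients. Continuity of $T_f$ in the modular topology means that modular convergence $u_k\to u$ in the domain space implies modular convergence $f(u_k)\to f(u)$ in the target space. $n'=n/(n-1)$. $\mathcal G_{1/n'}$ is the class of open sets $\Omega\subset\mathbb{R}^n$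 with $|\Omega|<\infty$ for which there is a constant $c>0$ such that $c\,\min\{|G|,|\Omega\setminus G|\}^{1/n'}\le P(G;\Omega)$ for every measurable $G\subseteq\Omega$, where $P(G;\Omega)$ is the perimeter of $G$ relative to $\Omega$ in the sense of geometric measure theory. $H_n(s)=\Big(\int_0^s\big(\tfrac{t}{A(t)}\big)^{\frac1{n-1}}dt\Big)^{1/n'}$ for $s\ge0$. If $\int_0\big(\tfrac{t}{A(t)}\big)^{1/(n-1)}dt=\infty$, then $H_n$ is defined with $A$ replaced by a Young function equivalent to $A$ near infinity for which this integral converges at $0$. *)

(* Defs.v *)
From HB Require Import structures.
From mathcomp Require Import all_boot all_order all_algebra.
From mathcomp Require Import all_classical all_reals all_analysis.

Set Implicit Arguments.
Unset Strict Implicit.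
Unset Printing Implicit Defensive.
Import Order.TTheory GRing.Theory Num.Theory.
Import numFieldNormedType.Exports.

Local Open Scope classical_set_scope.
Local Open Scope ring_scope.

(* For T := R this is the Borel sigma-algebra of R^n.                         *)
Definition measure_rV_display : measure_display -> measure_display.
Proof. exact. Qed.

Section measurable_rV.
Context {d} {T : measurableType d}.
Variable n : nat.

Let coords : 'I_n -> 'rV[T]_n -> T := fun i x => x ord0 i.

Let rV_set0 : g_sigma_preimage coords set0.
Proof. exact: sigma_algebra0. Qed.

Let rV_setC A : g_sigma_preimage coords A -> g_sigma_preimage coords (~` A).
Proof. exact: sigma_algebraC. Qed.

Let rV_bigcup (F : _^nat) : (forall i, g_sigma_preimage coords (F i)) ->
  g_sigma_preimage coords (\bigcup_i (F i)).
Proof. exact: sigma_algebra_bigcup. Qed.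

HB.instance Definition _ := @isMeasurable.Build (measure_rV_display d)
  'rV[T]_n (g_sigma_preimage coords) rV_set0 rV_setC rV_bigcup.

Lemma measurable_coord (i : 'I_n) :
  measurable_fun [set: 'rV[T]_n] (fun x : 'rV[T]_n => x ord0 i).
Proof.
move=> _ Y mY; rewrite setTI; apply: sub_sigma_algebra => /=.
rewrite -bigcup_seq/=; exists i => /=; first by rewrite mem_index_enum.
by exists Y => //; rewrite setTI.
Qed.

Lemma measurable_fun_rVP d1 (T1 : measurableType d1) (f : T1 -> 'rV[T]_n) :
  (forall i, measurable_fun [set: T1] (fun x => f x ord0 i)) ->
  measurable_fun [set: T1] f.
Proof.
move=> mf _ A mA; rewrite setTI.
suff : g_sigma_preimage (fun i => coords i \o f) `<=` measurable.
  by rewrite g_sigma_preimage_comp; apply; exists A => //; rewrite setTI.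
apply: smallest_sub; first exact: sigma_algebra_measurable.
elim/big_ind : _ => [//|B C sB sC X [/sB//|/sC//]|i _ X [Y mY <-]].
exact: mf.
Qed.

End measurable_rV.

Section lebesgue_measure_rV.
Context {R : realType}.

Definition cons_rV n (p : R * 'rV[R]_n) : 'rV[R]_n.+1 :=
  \row_i oapp (fun j => p.2 ord0 j) p.1 (unlift ord0 i).

Definition uncons_rV n (x : 'rV[R]_n.+1) : R * 'rV[R]_n :=
  (x ord0 ord0, \row_j x ord0 (lift ord0 j)).

Lemma cons_rVK n : cancel (@cons_rV n) (@uncons_rV n).
Proof.
move=> [a v]; congr (_, _); first by rewrite mxE unlift_none.
by apply/rowP => j; rewrite !mxE liftK.
Qed.

Lemma uncons_rVK n : cancel (@uncons_rV n) (@cons_rV n).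
Proof.
move=> x; apply/rowP => i; rewrite !mxE.
by case: unliftP => [j ->|->]//=; rewrite mxE.
Qed.

Lemma measurable_cons_rV n : measurable_fun [set: R * 'rV[R]_n] (@cons_rV n).
Proof.
apply: measurable_fun_rVP => i.
under eq_fun do rewrite mxE.
case: unliftP => [j _|_] /=; last exact: measurable_fst.
by apply: (measurableT_comp (measurable_coord j)); exact: measurable_snd.
Qed.

Lemma measurable_uncons_rV n :
  measurable_fun [set: 'rV[R]_n.+1] (@uncons_rV n).
Proof.
apply/measurable_fun_pairP; split; first exact: measurable_coord.
apply: measurable_fun_rVP => j /=.
under eq_fun do rewrite mxE.
exact: measurable_coord.
Qed.

Section step.
Variables (n : nat) (mu : {sigma_finite_measure set 'rV[R]_n -> \bar R}).

Definition lebesgue_rV_step : set 'rV[R]_n.+1 -> \bar R :=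
  pushforward (lebesgue_measure \x mu)%E (@cons_rV n).

Let mcons := @measurable_cons_rV n.

Let lebesgue_rV_step0 : lebesgue_rV_step set0 = 0%E.
Proof. by rewrite /lebesgue_rV_step /pushforward preimage_set0 measure0. Qed.

Let lebesgue_rV_step_ge0 A : (0 <= lebesgue_rV_step A)%E.
Proof. exact: measure_ge0. Qed.

Let lebesgue_rV_step_sigma_additive : semi_sigma_additive lebesgue_rV_step.
Proof.
move=> F mF tF mUF; rewrite /lebesgue_rV_step /pushforward preimage_bigcup.
apply: measure_semi_sigma_additive.
- by move=> k; rewrite -[X in measurable X]setTI; exact: mcons.
- apply/trivIsetP => /= i j _ _ ij; rewrite -preimage_setI.
  by move/trivIsetP : tF => /(_ _ _ _ _ ij) ->//; rewrite preimage_set0.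
- by rewrite -preimage_bigcup -[X in measurable X]setTI; exact: mcons.
Qed.

HB.instance Definition _ := isMeasure.Build _ _ _ lebesgue_rV_step
  lebesgue_rV_step0 lebesgue_rV_step_ge0 lebesgue_rV_step_sigma_additive.

Let lebesgue_rV_step_sigma_finite : sigma_finite setT lebesgue_rV_step.
Proof.
have /sigma_finiteP[F [TF ndF Foo]] :=
  sigma_finiteT (@lebesgue_measure R : {sigma_finite_measure set _ -> \bar _}).
have /sigma_finiteP[G [TG ndG Goo]] := sigma_finiteT mu.
exists (fun k => @uncons_rV n @^-1` (F k `*` G k)).
  rewrite -preimage_bigcup; apply/esym/seteqP; split=> // x _.
  have [i _ Fi] : (\bigcup_i F i) (uncons_rV x).1 by rewrite -TF.
  have [j _ Gj] : (\bigcup_i G i) (uncons_rV x).2 by rewrite -TG.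
  exists (maxn i j) => //; split.
    by move: Fi; exact/subsetPset/ndF/leq_maxl.
  by move: Gj; exact/subsetPset/ndG/leq_maxr.
move=> k; have [mF Fk] := Foo k; have [mG Gk] := Goo k.
split.
  rewrite -[X in measurable X]setTI; apply: measurable_uncons_rV => //.
  exact: measurableX.
rewrite /lebesgue_rV_step /pushforward -comp_preimage.
rewrite (_ : _ \o _ = id); last by apply/funext => p; exact: cons_rVK.
by rewrite preimage_id product_measure1E// lte_mul_pinfty// ge0_fin_numE.
Qed.

HB.instance Definition _ := Measure_isSigmaFinite.Build _ _ _ lebesgue_rV_step
  lebesgue_rV_step_sigma_finite.

End step.

Fixpoint borel_lebesgue_rV n : {sigma_finite_measure set 'rV[R]_n -> \bar R} :=
  match n with
  | 0 => dirac (0 : 'rV[R]_0)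
  | n'.+1 => lebesgue_rV_step (borel_lebesgue_rV n')
  end.

Lemma borel_lebesgue_rV_box n (F : 'I_n -> set R) :
  (forall i, measurable (F i)) ->
  measurable [set x : 'rV[R]_n | forall i, F i (x ord0 i)] /\
  borel_lebesgue_rV n [set x : 'rV[R]_n | forall i, F i (x ord0 i)] =
    (\prod_(i < n) lebesgue_measure (F i))%E.
Proof.
elim: n F => [|n IH] F mF.
  rewrite (_ : mkset _ = setT); last by apply/seteqP; split=> // x _ [].
  by split=> //; rewrite big_ord0 /= diracE mem_set.
have [mS IHF] := IH (fun j => F (lift ord0 j)) (fun j => mF _).
set S := mkset _ in mS IHF.
have FE : @cons_rV n @^-1` [set x | forall i, F i (x ord0 i)] =
    F ord0 `*` S.
  apply/seteqP; split=> -[a v] /=.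
    move=> Fav; split; first by have := Fav ord0; rewrite mxE unlift_none.
    by move=> i; have := Fav (lift ord0 i); rewrite mxE liftK.
  by move=> [Fa Fv] i; rewrite mxE; case: unliftP => [j ->|->] //=.
split.
  rewrite (_ : mkset _ = @uncons_rV n @^-1` (F ord0 `*` S)).
    rewrite -[X in measurable X]setTI; apply: measurable_uncons_rV => //.
    exact: measurableX.
  rewrite -FE -comp_preimage (_ : _ \o _ = id)//.
  by apply/funext => x; exact: uncons_rVK.
rewrite big_ord_recl -IHF [LHS]/= /lebesgue_rV_step /pushforward FE.
by rewrite product_measure1E//; exact: mF.
Qed.

End lebesgue_measure_rV.

(* Lebesgue measure on R^n, with its Lebesgue-measurable sets: the completion *)
(* of the n-fold product of lebesgue_measure. The carrier of lebesgue_space   *)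
(* is 'rV[R]_n.                                                               *)
Definition lebesgue_space (R : realType) (n : nat) :=
  caratheodory_type ((@borel_lebesgue_rV R n)^*)%mu.

Definition volume (R : realType) (n : nat) :
    {measure set (lebesgue_space R n) -> \bar R} :=
  @completed_measure_extension _ _ _ (@borel_lebesgue_rV R n).

Section young.
Context {R : realType}.
Implicit Types (A : R -> \bar R) (t : R) (n : nat).

(* A function on [0, +oo) is a function on R whose values at negative         *)
(* arguments are irrelevant.                                                  *)
Definition young_function A := [/\
  A 0 = 0%E,
  (forall t, 0 <= t -> (0 <= A t)%E),
  (forall s t a : R, 0 <= s -> 0 <= t -> 0 <= a <= 1 ->
     (A (a * s + (1 - a) * t)%R <= a%:E * A s + (1 - a)%:E * A t)%E),
  (forall t, 0 < t -> A x @[x --> t^'-] --> A t) &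
  ~ (exists c, forall t, 0 < t -> A t = c)].

Definition nondegenerate_young A := forall t, 0 < t -> (0 < A t)%E.

Definition equiv_near_infinity (A A' : R -> \bar R) := exists c t0 : R,
  [/\ 0 < c, 0 < t0 & forall t, t0 <= t ->
     (A (t / c)%R <= A' t)%E /\ (A' t <= A (c * t)%R)%E].

Definition conjugate_exponent n : R := n%:R / (n%:R - 1).

Definition sobolev_integrand n A t : \bar R :=
  poweR (t%:E / A t) (n%:R - 1)^-1.

Definition converges_at_infinity n A := exists2 s : R, 0 < s &
  (\int[lebesgue_measure]_(t in `]s, +oo[) sobolev_integrand n A t < +oo)%E.

Definition converges_at_zero n A := exists2 s : R, 0 < s &
  (\int[lebesgue_measure]_(t in `]0%R, s[) sobolev_integrand n A t < +oo)%E.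

Definition sobolev_H n A (s : R) : R :=
  fine (\int[lebesgue_measure]_(t in `]0%R, s[) sobolev_integrand n A t)
    `^ (conjugate_exponent n)^-1.

(* The Young functions A' that may replace A in the definition of H_n: A      *)
(* itself unless the integral diverges at 0.                                  *)
Definition sobolev_representative n A A' :=
  (converges_at_zero n A /\ A' = A) \/
  [/\ ~ converges_at_zero n A, young_function A',
      equiv_near_infinity A A' & converges_at_zero n A'].

End young.

Section differentiation.
Context {R : realType} {n : nat}.
Implicit Types (Om G K : set 'rV[R]_n) (u phi : 'rV[R]_n -> R).

Definition euclidean_norm (v : 'rV[R]_n) : R :=
  Num.sqrt (\sum_i v ord0 i ^+ 2).

Definition partial (i : 'I_n) phi : 'rV[R]_n -> R :=
  fun x => 'D_(delta_mx ord0 i) phi x.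

Definition iterated_partial (s : seq 'I_n) phi : 'rV[R]_n -> R :=
  foldr partial phi s.

Definition class_C (k : nat) phi := forall s : seq 'I_n,
  ((size s < k)%N -> forall i x,
     derivable (iterated_partial s phi) x (delta_mx ord0 i)) /\
  ((size s <= k)%N -> continuous (iterated_partial s phi)).

Definition compactly_supported Om phi :=
  compact (closure [set x | phi x != 0]) /\
  closure [set x | phi x != 0] `<=` Om.

Definition locally_integrable_on Om u :=
  measurable_fun (Om : set (lebesgue_space R n)) u /\
  forall K, compact K -> K `<=` Om ->
    (@volume R n).-integrable K (EFin \o u).

Definition is_weak_gradient Om u (g : 'rV[R]_n -> 'rV[R]_n) := [/\
  locally_integrable_on Om u,
  (forall i, locally_integrable_on Om (fun x => g x ord0 i)) &
  forall phi, (forall k, class_C k phi) -> compactly_supported Om phi ->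
    forall i : 'I_n,
      (\int[@volume R n]_(x in Om) (u x * partial i phi x)%:E =
       - \int[@volume R n]_(x in Om) (g x ord0 i * phi x)%:E)%E].

Definition weakly_differentiable Om u := exists g, is_weak_gradient Om u g.

(* A choice among weak gradients, which agree almost everywhere in Om.        *)
Definition weak_gradient Om u : 'rV[R]_n -> 'rV[R]_n :=
  xget (fun=> 0) [set g | is_weak_gradient Om u g].

Definition divergence (phi : 'rV[R]_n -> 'rV[R]_n) (x : 'rV[R]_n) : R :=
  \sum_i partial i (fun y => phi y ord0 i) x.

(* Total variation in Om of the distributional gradient of \1_G (De Giorgi).  *)
Definition perimeter G Om : \bar R := ereal_sup
  [set (\int[@volume R n]_(x in G) (divergence phi x)%:E)%E |
    phi in [set phi : 'rV[R]_n -> 'rV[R]_n |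
      (forall i, class_C 1 (fun x => phi x ord0 i) /\
                 compactly_supported Om (fun x => phi x ord0 i)) /\
      forall x, euclidean_norm (phi x) <= 1]].

Definition isoperimetric_class Om := [/\
  open Om,
  (@volume R n Om < +oo)%E &
  exists2 c : R, 0 < c &
    forall G, measurable (G : set (lebesgue_space R n)) -> G `<=` Om ->
      (c%:E * poweR (mine (@volume R n G) (@volume R n (Om `\` G)))
                (conjugate_exponent n)^-1 <= perimeter G Om)%E].

End differentiation.

Section orlicz.
Context {R : realType} {n : nat}.
Implicit Types (A : R -> \bar R) (Om : set 'rV[R]_n) (u : 'rV[R]_n -> R).

(* Orlicz notions only depend on the length of a function: w stands for |u|.  *)
Definition modular A Om (w : 'rV[R]_n -> R) (l : R) : \bar R :=
  (\int[@volume R n]_(x in Om) A (w x / l)%R)%E.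

Definition finite_modular A Om (w : 'rV[R]_n -> R) :=
  exists2 l : R, 0 < l & (modular A Om w l < +oo)%E.

Definition luxemburg_norm A Om (w : 'rV[R]_n -> R) : R :=
  inf [set l : R | 0 < l /\ (modular A Om w l <= 1)%E].

Definition abs_fun u : 'rV[R]_n -> R := fun x => `|u x|.

Definition length_fun (g : 'rV[R]_n -> 'rV[R]_n) : 'rV[R]_n -> R :=
  fun x => euclidean_norm (g x).

Definition orlicz A Om u :=
  measurable_fun (Om : set (lebesgue_space R n)) u /\
  finite_modular A Om (abs_fun u).

Definition orlicz_vector A Om (g : 'rV[R]_n -> 'rV[R]_n) :=
  (forall i, measurable_fun (Om : set (lebesgue_space R n))
               (fun x => g x ord0 i)) /\
  finite_modular A Om (length_fun g).

Definition orlicz_sobolev A Om u := [/\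
  weakly_differentiable Om u, orlicz A Om u &
  orlicz_vector A Om (weak_gradient Om u)].

Definition orlicz_sobolev_norm A Om u : R :=
  luxemburg_norm A Om (abs_fun u) +
  luxemburg_norm A Om (length_fun (weak_gradient Om u)).

Definition sobolev_modular_cvg A Om (u_ : nat -> 'rV[R]_n -> R) u (l : R) :=
  modular A Om (abs_fun (u_ k \- u)) l @[k --> \oo] --> 0%E /\
  modular A Om (length_fun (weak_gradient Om (u_ k) \- weak_gradient Om u)) l
    @[k --> \oo] --> 0%E.

Definition superposition (f : R -> R) u : 'rV[R]_n -> R := f \o u.

Definition maps_sobolev (f : R -> R) A B Om :=
  forall u, orlicz_sobolev A Om u -> orlicz_sobolev B Om (superposition f u).

Definition modularly_continuous (f : R -> R) A B Om :=
  forall (u_ : nat -> 'rV[R]_n -> R) u,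
    (forall k, orlicz_sobolev A Om (u_ k)) -> orlicz_sobolev A Om u ->
    (exists2 l, 0 < l & sobolev_modular_cvg A Om u_ u l) ->
    exists2 l, 0 < l &
      sobolev_modular_cvg B Om (fun k => superposition f (u_ k))
        (superposition f u) l.

End orlicz.

Definition locally_lipschitz (R : realType) (f : R -> R) :=
  forall x : R, exists2 U, nbhs x U & [lipschitz f y | y in U].

(* Main.v *)
(** Let [h] be a Borel function with [f' = h] almost everywhere, bounded by
    [W |t|], where [W t = kappa E (kappa t)] in case (ii).

    Chain rule.  A weakly differentiable function has, on every small box and
    along almost every line, an absolutely continuous representative; by a
    one-dimensional substitution and a partition of unity the weak gradient of
    [f o u] is [h(u) grad u].

    Growth.  Testing the relative isoperimetric inequality on the level sets of
    [u] gives [c m^(1/n') (t' - t) <= int_(t < |u| < t') |grad u|] with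
    [m = |{|u| >= t'}|].  Levels [t_j] with [|{|u| > t_j}| <= s / 2^j] then satisfy
    [t_j <= t_0 + C (tau s^(1/n) + eps^(1/n) H_n(b_j))] for some [b_j] with
    [sum_j (s / 2^j) A(b_(j+1)) <= 2 s A(tau) + 2 eps], where [eps] bounds the energy
    of [grad u] on [{|u| > t_0}].  In case (i) the [t_j] are bounded, hence so is [u].
    In case (ii), [kappa |u| <= H_n(b)] implies [B(E(kappa |u|) r) <= A(b) + A(r)],
    whence [B(E(kappa |u|) r) <= C + Q + A(r)] for all [r >= 0], with [int Q] as
    small as desired, uniformly along a modularly convergent sequence.

    Continuity.  If [u_k -> u] and [grad u_k -> grad u] in [L^1], then
    [h(u_k) grad u -> h(u) grad u] weakly, by the chain rule, for every bounded
    Borel [h]; using it for [h] and [h^2] makes the convergence strong.  Hence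
    [grad f(u_k) -> grad f(u)] almost everywhere along a subsequence, and the bounds
    above give convergence of the modulars by dominated convergence. *)
Require Import Defs.
From HB Require Import structures.
From mathcomp Require Import all_boot all_order all_algebra.
From mathcomp Require Import all_classical all_reals all_analysis.
From mathcomp Require Import measurable_realfun ring lra.

Set Implicit Arguments.
Unset Strict Implicit.
Unset Printing Implicit Defensive.
Import Order.TTheory GRing.Theory Num.Theory.
Import numFieldNormedType.Exports.

Local Open Scope classical_set_scope.
Local Open Scope ring_scope.

(** * Boxes *)

(** The coefficient [h] is only Borel, so almost everywhere convergence of u_k says nothing about
    h(u_k), and [u] may map a set of positive measure into a null set. Because of the first
    obstacle, convergence of the coefficients is asked only after multiplication by the components
    of grad u: where a component vanishes, nothing is needed. Because of the second, the bound on
    f', known almost everywhere, is made valid everywhere by clamping [h] on a null set before any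
    composition. An unbounded [h] enters the convergence argument through h / (1 + |h|), a bounded
    quantity that determines [h] continuously.

    All estimates on compositions pass through one interface, [controlled]; the two cases of the
    theorem differ only in how it is established. The mapping properties are read off from constant
    sequences.

    The constant 24 is 2 * 12. Doubling max(lambda, norm) puts it strictly above the Luxemburg norm
    of the gradient, where the modular is finite; the 12 covers the factor 4 that two successive
    uses of midpoint convexity consume. *)

Lemma sigma_algebra_preimage_real (R : realType) T (S : set (set T))
    (f : T -> R) : sigma_algebra setT S ->
  (forall x, S (f @^-1` `]x, +oo[)) -> forall Y, measurable Y -> S (f @^-1` Y).
Proof.
move=> [S0 SC SU] Sf Y mY.
have : (@ocitv R).-sigma.-measurable Y by exact: mY.
rewrite RGenOInfty.measurableE.
suff : <<s @RGenOInfty.G R >> `<=` [set A | S (f @^-1` A)] by apply.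
apply: smallest_sub.
  split; first by rewrite /= preimage_set0.
  - by move=> B /= hB; rewrite setTD preimage_setC -setTD; exact: SC.
  - by move=> F hF /=; rewrite preimage_bigcup; exact: SU.
by move=> _ [x ->] /=; exact: Sf.
Qed.

Lemma negligible_bigcup_countable d (T : measurableType d) (R : realType)
    (mu : {measure set T -> \bar R}) (I : countType) (N : I -> set T) :
  (forall i, mu.-negligible (N i)) -> mu.-negligible (\bigcup_i N i).
Proof.
move=> N0; pose N' (k : nat) := if unpickle k is Some i then N i else set0.
apply: (@negligibleS _ _ _ _ (\bigcup_k N' k)).
  by move=> x [i _ Nix]; exists (pickle i); rewrite ?/N' ?pickleK.
apply: negligible_bigcup => k; rewrite /N'; case: unpickle => [i|]; [exact: N0|exact: negligible_set0].
Qed.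

Section boxes.
Context {R : realType} {n : nat}.
Implicit Types (a b x : 'rV[R]_n) (Om : set 'rV[R]_n).

Definition obox a b : set 'rV[R]_n :=
  [set x | forall i, a ord0 i < x ord0 i < b ord0 i].

Definition cbox a b : set 'rV[R]_n :=
  [set x | forall i, a ord0 i <= x ord0 i <= b ord0 i].

Lemma measurable_obox a b : measurable (obox a b).
Proof.
have [] := @borel_lebesgue_rV_box R n
  (fun i => `]a ord0 i, b ord0 i[%classic) (fun i => measurable_itv _).
move=> + _.
rewrite (_ : obox a b = [set x | forall i,
  `]a ord0 i, b ord0 i[%classic (x ord0 i)])//.
Qed.

Lemma sub_obox_cbox a b : obox a b `<=` cbox a b.
Proof. by move=> x xab i; have /andP[/ltW-> /ltW->] := xab i. Qed.

Lemma nbhs_rV (A : set 'rV[R]_n) x : nbhs x A ->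
  exists2 e : R, 0 < e &
    forall y : 'rV[R]_n, (forall i, `|x ord0 i - y ord0 i| < e) -> A y.
Proof.
move=> /nbhs_ballP[e e0 xeA]; exists e => // y xy; apply: xeA.
split=> // i j; rewrite (ord1 i); exact: xy.
Qed.

Lemma cbox_compact a b : compact (cbox a b).
Proof.
have /rV_compact : forall i : 'I_n, compact (`[a ord0 i, b ord0 i]%classic).
  by move=> i; exact: segment_compact.
by congr compact; apply/seteqP; split=> x /= xab i; have := xab i; rewrite in_itv.
Qed.

Lemma cbox_closed a b : closed (cbox a b).
Proof.
by apply: compact_closed; [exact: norm_hausdorff|exact: cbox_compact].
Qed.

Lemma ratr_between (x e : R) : 0 < e -> exists q : rat, x < ratr q < x + e.
Proof.
move=> e0; have [|q] := @rat_in_itvoo R x (x + e); first by rewrite ltrDl.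
by rewrite in_itv /= => h; exists q.
Qed.

(** The closed box lies in [Om]: functions vanishing off the open box then have compact support in
    [Om], and locally integrable functions are integrable on the closed box. *)
Definition good_box Om a b :=
  (forall i, a ord0 i < b ord0 i) /\ cbox a b `<=` Om.

(** Boxes with rational corners, enumerated by [unpickle]. A code that decodes to nothing, or to a
    box whose closure leaves [Om], contributes the empty set. *)
Lemma open_box_cover Om : open Om -> exists Q : (set 'rV[R]_n)^nat,
  Om = \bigcup_k Q k /\
  forall k, Q k = set0 \/ exists a b, good_box Om a b /\ Q k = obox a b.
Proof.
move=> oOm.
pose T := ('rV[rat]_n * 'rV[rat]_n)%type.
pose lo (q : T) : 'rV[R]_n := map_mx ratr q.1.
pose hi (q : T) : 'rV[R]_n := map_mx ratr q.2.
pose Q k := if unpickle k is Some q then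
  [set x | good_box Om (lo q) (hi q) /\ obox (lo q) (hi q) x] else set0.
exists Q; split; last first.
  move=> k; rewrite /Q; case: (unpickle k : option T) => [q|]; last by left.
  have [gq|ngq] := pselect (good_box Om (lo q) (hi q)).
    by right; exists (lo q), (hi q); split => //; apply/seteqP; split => x //= [].
  by left; apply/seteqP; split => x //= [].
apply/seteqP; split => [x Omx|x [k _]]; last first.
  rewrite /Q; case: (unpickle k : option T) => // q [[_ qOm] xq].
  exact/qOm/sub_obox_cbox.
have /nbhs_rV[e e0 xe] : nbhs x Om by move: oOm; rewrite openE; exact.
have /choice[q1 q1P] (i : 'I_n) : exists q : rat, x ord0 i - e / 2 < ratr q < x ord0 i.
  by have [|q qP] := @ratr_between (x ord0 i - e / 2) (e / 2);
    [lra|exists q; move: qP; rewrite subrK].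
have /choice[q2 q2P] (i : 'I_n) : exists q : rat, x ord0 i < ratr q < x ord0 i + e / 2.
  by apply: ratr_between; lra.
pose q : T := (\row_i q1 i, \row_i q2 i).
exists (pickle q) => //; rewrite /Q pickleK; split; last first.
  by move=> i; rewrite !mxE; have /andP[_ ->] := q1P i; have /andP[->] := q2P i.
split=> [i|y yq].
  by rewrite !mxE; have := q1P i; have := q2P i; lra.
apply: xe => i; have := yq i; rewrite !mxE ltr_norml.
by have := q1P i; have := q2P i; lra.
Qed.

Lemma measurable_open_rV Om : open Om -> measurable Om.
Proof.
move=> /open_box_cover[Q [-> QP]]; apply: bigcupT_measurable => k.
by case: (QP k) => [->//|[a [b [_ ->]]]]; exact: measurable_obox.
Qed.

Lemma measurable_cbox a b : measurable (cbox a b).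
Proof.
rewrite -[cbox a b]setCK; apply: measurableC; apply: measurable_open_rV.
apply: closed_openC; exact: cbox_closed.
Qed.

Lemma obox_open a b : open (obox a b).
Proof.
rewrite openE => x xab.
apply: (@filter_forall _ _ (fun i (y : 'rV[R]_n) =>
  a ord0 i < y ord0 i < b ord0 i) (nbhs x)) => i.
have := @coord_continuous R 1 n ord0 i x => cx.
have /andP[ax xb] := xab i.
have lx : \forall y \near x, a ord0 i < (y : 'rV[R]_n) ord0 i := cx _ (lt_nbhsr ax).
have rx : \forall y \near x, (y : 'rV[R]_n) ord0 i < b ord0 i := cx _ (lt_nbhsl xb).
by apply: filterS2 lx rx => y /= -> ->.
Qed.

Lemma continuous_measurable_rV (f : 'rV[R]_n -> R) :
  continuous f -> measurable_fun setT f.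
Proof.
move=> cf _ Y mY; rewrite setTI; apply: sigma_algebra_preimage_real Y mY.
  exact: sigma_algebra_measurable.
move=> x; apply: measurable_open_rV; apply: open_comp; last exact: interval_open.
by move=> ? _; exact: cf.
Qed.

Lemma oboxI a b a' b' : obox a b `&` obox a' b' =
  obox (\row_i Num.max (a ord0 i) (a' ord0 i))
       (\row_i Num.min (b ord0 i) (b' ord0 i)).
Proof.
apply/seteqP; split=> x /=.
  move=> [h h'] i; rewrite !mxE gt_max lt_min.
  by have /andP[-> ->] := h i; have /andP[-> ->] := h' i.
by move=> h; split=> i; have := h i; rewrite !mxE gt_max lt_min;
  move=> /andP[/andP[h1 h2] /andP[h3 h4]]; apply/andP.
Qed.

(** Open sets are countable unions of boxes, and the preimage of an open ray under a coordinate is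
    open, so boxes generate every coordinate preimage. *)
Lemma measurable_rV_obox :
  @measurable _ 'rV[R]_n = <<s [set S | exists a b, S = obox a b] >>.
Proof.
set G := [set S | _]; apply/seteqP; split => A; last first.
  apply: smallest_sub; first exact: sigma_algebra_measurable.
  by move=> _ [a [b ->]]; exact: measurable_obox.
have oG O : open O -> <<s G >> O.
  move=> /open_box_cover[Q [-> QP]].
  apply: sigma_algebra_bigcup => k.
  case: (QP k) => [->|[a [b [_ ->]]]]; first exact: sigma_algebra0.
  by apply: sub_sigma_algebra; exists a, b.
apply: smallest_sub; first exact: smallest_sigma_algebra.
elim/big_ind : _ => [//|B C sB sC X [/sB//|/sC//]|i _ X [Y mY <-]].
rewrite setTI; apply: sigma_algebra_preimage_real Y mY.
  exact: smallest_sigma_algebra.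
move=> x; apply: oG; apply: open_comp; last exact: interval_open.
by move=> y _; exact: coord_continuous.
Qed.

(* Dynkin's lemma for boxes, localized inside an open set. *)
Lemma box_induction Om (P : set 'rV[R]_n -> Prop) : open Om ->
  P set0 ->
  (forall a b, good_box Om a b -> P (obox a b)) ->
  (forall A B, measurable A -> measurable B -> A `<=` B -> B `<=` Om ->
     P A -> P B -> P (B `\` A)) ->
  (forall F : (set 'rV[R]_n)^nat, (forall k, measurable (F k)) ->
     (forall k, F k `<=` Om) -> trivIset setT F -> (forall k, P (F k)) ->
     P (\bigcup_k F k)) ->
  forall S, measurable S -> S `<=` Om -> P S.
Proof.
move=> oOm P0 Pbox PD PU.
(* Inside one good box the family of [S] with P (S [&] box) is closed under complement, which there
   is a difference of sets contained in [Om]. *)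
have Pin a b S : good_box Om a b -> measurable S -> P (S `&` obox a b).
  move=> gab; have abOm : obox a b `<=` Om.
    by apply: subset_trans gab.2; exact: sub_obox_cbox.
  rewrite measurable_rV_obox.
  apply: (@dynkin_induction _ _ [set S | exists a b, S = obox a b]
    (fun S => P (S `&` obox a b))).
  - exact: measurable_rV_obox.
  - by move=> _ _ [a1 [b1 ->]] [a2 [b2 ->]]; rewrite oboxI; do 2 eexists.
  - by rewrite setTI; exact: Pbox.
  - move=> _ [a1 [b1 ->]]; rewrite oboxI; set a' := \row__ _; set b' := \row__ _.
    have [ab'|] := pselect (forall i, a' ord0 i < b' ord0 i).
      apply: Pbox; split => //; apply: subset_trans gab.2 => x xab i.
      have := xab i; rewrite !mxE ge_max le_min.
      by move=> /andP[/andP[_ ->] /andP[_ ->]].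
    move=> nab; rewrite (_ : obox a' b' = set0)//.
    apply/seteqP; split=> x //= xab; apply: nab => i.
    by have /andP[] := xab i; exact: lt_trans.
  - move=> A mA PA.
    rewrite (_ : _ `&` _ = obox a b `\` (A `&` obox a b)); last first.
      by apply/seteqP; split=> x /=; tauto.
    apply: PD => //; [|exact: measurable_obox|exact: Pbox].
    by apply: measurableI => //; exact: measurable_obox.
  - move=> F mF tF PF; rewrite setI_bigcupl; apply: PU => //.
    + by move=> k; apply: measurableI => //; exact: measurable_obox.
    + by move=> k x [_ /abOm].
    + by apply: trivIset_setIr.
move=> S mS SOm.
have [Q [OmE QP]] := open_box_cover oOm.
have mQ k : measurable (Q k).
  by case: (QP k) => [->//|[a [b [_ ->]]]]; exact: measurable_obox.
(* [seqDU] makes the covering boxes disjoint while each piece stays inside a single good box, where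
   [Pin] applies. *)
rewrite (_ : S = \bigcup_k (S `&` seqDU Q k)); last first.
  by rewrite -setI_bigcupr -seqDU_bigcup_eq -OmE setIidl.
have mDU k : measurable (seqDU Q k).
  by rewrite /seqDU; apply: measurableD => //; exact: bigsetU_measurable.
apply: PU.
- by move=> k; exact: measurableI.
- by move=> k x [/SOm].
- by apply: trivIset_setIl; exact: trivIset_seqDU.
move=> k; case: (QP k) => [Q0|[a [b [gab QE]]]].
  by rewrite /seqDU Q0 set0D setI0.
rewrite /seqDU QE setDE (setIC (obox a b)) setIA; apply: Pin => //.
by apply: measurableI => //; apply: measurableC; exact: bigsetU_measurable.
Qed.

End boxes.

(** * Lebesgue measure as the completion of the Borel product measure *)

Section volume.
Context {R : realType} {n : nat}.
Notation bl := (@borel_lebesgue_rV R n).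
Notation vol := (@volume R n).
Notation LS := (lebesgue_space R n).

Lemma measurable_lebesgue_space (A : set 'rV[R]_n) :
  measurable A -> measurable (A : set LS).
Proof. exact: caratheodory_measurable_mu_ext. Qed.

Lemma volumeE (A : set 'rV[R]_n) : measurable A -> vol A = bl A.
Proof. exact: measurable_mu_extE. Qed.

Let id_LS : LS -> 'rV[R]_n := id.

Let measurable_id_LS : measurable_fun setT id_LS.
Proof. by move=> _ Y mY; rewrite setTI; exact: measurable_lebesgue_space. Qed.

Lemma measurable_fun_lebesgue_space d (T : measurableType d)
    (D : set 'rV[R]_n) (f : 'rV[R]_n -> T) : measurable D ->
  measurable_fun D f -> measurable_fun (D : set LS) (f : LS -> T).
Proof.
by move=> mD mf _ Y mY; apply: measurable_lebesgue_space; exact: mf.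
Qed.

Lemma ge0_integral_volume (D : set 'rV[R]_n) (f : 'rV[R]_n -> \bar R) :
  measurable D -> measurable_fun D f -> (forall x, D x -> (0 <= f x)%E) ->
  (\int[vol]_(x in D) f x = \int[bl]_(x in D) f x)%E.
Proof.
move=> mD mf f0.
transitivity (\int[pushforward vol id_LS]_(x in D) f x)%E.
  by rewrite ge0_integral_pushforward// => x /set_mem; exact: f0.
by apply: eq_measure_integral => A mA _; exact: volumeE.
Qed.

Lemma integral_volume (D : set 'rV[R]_n) (f : 'rV[R]_n -> \bar R) :
  measurable D -> measurable_fun D f ->
  (\int[vol]_(x in D) f x = \int[bl]_(x in D) f x)%E.
Proof.
move=> mD mf; rewrite integralE [RHS]integralE.
by congr (_ - _)%E; apply: ge0_integral_volume => //;
  [exact: measurable_funepos|exact: measurable_funeneg].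
Qed.

Lemma integrable_volume (D : set 'rV[R]_n) (f : 'rV[R]_n -> \bar R) :
  measurable D -> measurable_fun D f ->
  vol.-integrable D f <-> bl.-integrable D f.
Proof.
move=> mD mf; split=> /integrableP[mf' fi]; apply/integrableP; split => //.
- by rewrite -ge0_integral_volume//; exact: measurableT_comp.
- exact: measurable_fun_lebesgue_space.
- by rewrite ge0_integral_volume//; exact: measurableT_comp.
Qed.

Lemma volume_sigma_finite : sigma_finite setT vol.
Proof.
exact/completed_measure_extension_sigma_finite/sigma_finiteT.
Qed.

(** [vol] is an outer measure, so [vol X] makes sense for any set: covers with excess 1/(k+1) are
    intersected. If [vol X] is infinite the whole space serves. *)
Lemma borel_hull (X : set 'rV[R]_n) : exists G : set 'rV[R]_n,
  [/\ measurable G, X `<=` G & vol G = vol X].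
Proof.
have [Xoo|Xfin] := eqVneq (vol X) +oo%E.
  exists setT; split => //; apply/eqP; rewrite eq_le Xoo leey /=.
  by rewrite -Xoo; exact: le_mu_ext.
have /choice[G GP] (k : nat) : exists G : set 'rV[R]_n, [/\ measurable G, X `<=` G &
    (vol G <= vol X + k.+1%:R^-1%:E)%E].
  have Xf : vol X \is a fin_num.
    by rewrite ge0_fin_numE ?lt_neqAle ?Xfin ?leey//; exact: mu_ext_ge0.
  have := @lb_ereal_inf_adherent R
    [set (\sum_(k <oo) bl (A k))%E | A in measurable_cover X] k.+1%:R^-1.
  rewrite invr_gt0 ltr0n => /(_ isT Xf)[_ [F [mF XF] <-]] Fk.
  exists (\bigcup_j F j); split => //; first exact: bigcupT_measurable.
  rewrite volumeE; last exact: bigcupT_measurable.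
  apply: le_trans (ltW Fk).
  by apply: measure_sigma_subadditive => //; exact: bigcupT_measurable.
have mG : measurable (\bigcap_k G k).
  by apply: bigcapT_measurable => k; have [] := GP k.
exists (\bigcap_k G k); split => //.
  by move=> x Xx k _; have [_ + _] := GP k; apply.
apply/eqP; rewrite eq_le; apply/andP; split; last first.
  by apply: le_mu_ext => x Xx k _; have [_ + _] := GP k; apply.
apply/lee_addgt0Pr => e e0.
have [k ke] : exists k : nat, k.+1%:R^-1 < e.
  have [k _ kP] := near_infty_natSinv_lt (PosNum e0).
  by exists k; exact: (kP k (leqnn _)).
apply: (@le_trans _ _ (vol (G k))); first by apply: le_mu_ext => x; apply.
have [_ _ GXk] := GP k; apply: (le_trans GXk).
by apply: leeD => //; rewrite lee_fin ltW.
Qed.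

Lemma negligible_borel (N : set 'rV[R]_n) : vol.-negligible N ->
  exists M : set 'rV[R]_n, [/\ measurable M, bl M = 0%E & N `<=` M].
Proof.
move=> [A [mA A0 NA]]; have [G [mG AG GA]] := borel_hull A.
exists G; split => //; last exact: subset_trans AG.
by rewrite -volumeE// GA.
Qed.

Lemma negligible_volume (N : set 'rV[R]_n) :
  bl.-negligible N -> vol.-negligible N.
Proof.
move=> [A [mA A0 NA]]; exists A; split => //.
- exact: measurable_lebesgue_space.
- exact: etrans (volumeE mA) A0.
Qed.

(** A set of finite measure differs from its Borel hull by a null set; sigma-finiteness reduces the
    general case to this one. *)
Lemma borel_modification_set (A : set 'rV[R]_n) : measurable (A : set LS) ->
  exists B N : set 'rV[R]_n, [/\ measurable B, measurable N, bl N = 0%E &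
    forall x, ~ N x -> (A x <-> B x)].
Proof.
have fin (A' : set 'rV[R]_n) : measurable (A' : set LS) -> (vol A' < +oo)%E ->
    exists B N : set 'rV[R]_n, [/\ measurable B, measurable N, bl N = 0%E &
      forall x, ~ N x -> (A' x <-> B x)].
  move=> mA' Afin; have [G [mG AG GA]] := borel_hull A'.
  have mG' := measurable_lebesgue_space mG.
  have [|N [mN N0 GAN]] := @negligible_borel (G `\` A').
    exists (G `\` A'); split => //; first exact: measurableD.
    have GAfin : (vol G < +oo)%E by have := Afin; rewrite -GA.
    rewrite measureD// setIidr//; transitivity (vol A' - vol A')%E.
      by congr (_ - _)%E.
    by apply: subee; rewrite ge0_fin_numE.
  exists G, N; split => // x Nx; split => [/AG//|Gx].
  by apply: contrapT => Ax; apply: Nx; apply: GAN.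
move=> mA; have [S ST /all_and2[mS Sfin]] := volume_sigma_finite.
have /choice[B /choice[N BNP]] (k : nat) : exists B N : set 'rV[R]_n,
    [/\ measurable B, measurable N, bl N = 0%E &
      forall x, ~ N x -> ((A `&` S k) x <-> B x)].
  apply: fin; first exact: measurableI.
  apply: le_lt_trans (Sfin k); exact: measureIr.
exists (\bigcup_k B k), (\bigcup_k N k); split.
- by apply: bigcupT_measurable => k; have [] := BNP k.
- by apply: bigcupT_measurable => k; have [] := BNP k.
- apply: measure_negligible; last first.
    apply: negligible_bigcup => k; have [_ mN N0 _] := BNP k.
    exact/negligibleP.
  by apply: bigcupT_measurable => k; have [] := BNP k.
move=> x Nx; have xBN k : (A `&` S k) x <-> B k x.
  by have [_ _ _] := BNP k; apply; apply: contra_not Nx; exists k.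
split=> [Ax|[k _ /xBN[]//]].
have [k _ Skx] : (\bigcup_k S k) x by rewrite -ST.
by exists k => //; apply/xBN.
Qed.

(** The superlevel sets at rational heights are replaced by Borel sets; [v] equals [u] off the union
    [M] of the countably many exceptional sets, and 0 elsewhere. *)
Lemma borel_modification (D : set 'rV[R]_n) (u : 'rV[R]_n -> R) :
  measurable D -> measurable_fun (D : set LS) u ->
  exists v : 'rV[R]_n -> R, exists N : set 'rV[R]_n,
    [/\ measurable_fun setT v, measurable N, bl N = 0%E &
      forall x, D x -> ~ N x -> u x = v x].
Proof.
move=> mD mu.
have /choice[B /choice[N BNP]] (q : rat) : exists B N : set 'rV[R]_n,
    [/\ measurable B, measurable N, bl N = 0%E &
      forall x, ~ N x -> ((D `&` u @^-1` `]ratr q, +oo[) x <-> B x)].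
  apply: borel_modification_set; apply: mu => //.
  exact: measurable_lebesgue_space.
pose M := \bigcup_q N q.
have mM : measurable M.
  by apply: bigcupT_measurable_rat => q; have [] := BNP q.
pose v x := if pselect (D x /\ ~ M x) then u x else 0.
exists v, M; split => //; last first.
- by move=> x Dx Mx; rewrite /v; case: pselect => // -[].
- apply: (measure_negligible mM).
  apply: negligible_bigcup_countable => q.
  by have [_ mN N0 _] := BNP q; exact/negligibleP.
move=> _ Y mY; rewrite setTI; apply: sigma_algebra_preimage_real Y mY.
  exact: sigma_algebra_measurable.
move=> x.
(* On D minus M, v > x holds exactly when some rational q > x satisfies u > q; off it, [v] is 0. *)
have -> : v @^-1` `]x, +oo[ = (D `&` ~` M `&` \bigcup_(q in [set q : rat | x < ratr q]) B q)
    `|` ((if x < 0 then setT else set0) `&` ~` (D `&` ~` M)).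
  apply/seteqP; split => y /=.
    rewrite in_itv/= andbT /v; case: pselect => [[Dy My] /= xu|DMy /= x0]; last first.
      by right; rewrite x0; split => //.
    left; split => //; have [q] := rat_in_itvoo xu.
    rewrite in_itv/= => /andP[xq qu]; exists q => //.
    have [_ _ _ Bq] := BNP q.
    by apply/Bq; [move=> Nqy; apply: My; exists q|split => //=; rewrite in_itv/= andbT].
  rewrite in_itv/= andbT /v => -[[[Dy My] [q /= xq Bqy]]|[]].
    case: pselect => [? /=|[]//]; have [_ _ _ Bq] := BNP q.
    have [_ /=] : (D `&` u @^-1` `]ratr q, +oo[) y.
      by apply/Bq => //; apply: contra_not My; exists q.
    by rewrite in_itv/= andbT; exact: lt_trans.
  by case: ifPn => // x0 _ DMy; case: pselect.
have mDM : measurable (D `&` ~` M) by apply: measurableI => //; exact: measurableC.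
apply: measurableU; apply: measurableI => //; last exact: measurableC.
  rewrite bigcup_mkcond; apply: bigcupT_measurable_rat => q.
  by case: ifP => // _; have [] := BNP q.
by case: ifP.
Qed.

End volume.

(** * Smooth bumps *)

Section smooth.
Context {R : realType}.
Implicit Types (f g : R -> R) (p : {poly R}).

(** Records derivability only; for [smooth], the continuity of each derivative comes from
    derivability at the next order. *)
Fixpoint Ck (k : nat) f : Prop :=
  if k is k'.+1 then (forall x, derivable f x 1) /\ Ck k' (derive1 f) else True.

Definition smooth f := forall k, Ck k f.

Lemma CkW k f : Ck k.+1 f -> Ck k f.
Proof. by elim: k f => // k IH f [df /= [df' cf']]; split => //; exact: IH. Qed.

Lemma CkD k f g : Ck k f -> Ck k g -> Ck k (f \+ g).
Proof.
elim: k f g => // k IH f g [df cf] [dg cg]; split.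
  by move=> x; exact: derivableD.
rewrite (_ : derive1 (f \+ g) = derive1 f \+ derive1 g); first exact: IH.
by apply/funext => x; rewrite derive1E deriveD// -!derive1E.
Qed.

Lemma CkM k f g : Ck k f -> Ck k g -> Ck k (f \* g).
Proof.
elim: k f g => // k IH f g cf cg; have [df cf'] := cf; have [dg cg'] := cg.
split; first by move=> x; exact: derivableM.
rewrite (_ : derive1 (f \* g) = (derive1 f \* g) \+ (f \* derive1 g)).
  by apply: CkD; apply: IH => //; exact: CkW.
apply/funext => x; rewrite derive1E deriveM// -!derive1E /= addrC; congr (_ + _).
by rewrite /GRing.scale/= mulrC.
Qed.

Lemma smooth_cst (c : R) : smooth (cst c).
Proof.
move=> k; elim: k c => //= k IH c; split; first by move=> x; exact: derivable_cst.
rewrite (_ : derive1 _ = cst 0)//.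
by apply/funext => x; rewrite derive1_cst.
Qed.

Lemma derive1_affine f (c d x : R) : (forall y, derivable f y 1) ->
  is_derive x 1 (fun y => f (c * y + d)) (c * derive1 f (c * x + d)).
Proof.
move=> df.
have df' : is_derive (c * x + d) 1 f (derive1 f (c * x + d)).
  by rewrite derive1E; exact/derivableP.
have h : is_derive x 1 (fun y => c * y + d) c.
  apply: is_derive_eq; rewrite /GRing.scale /= ; ring.
have := @is_derive1_comp R f (fun y => c * y + d) x _ _ df' h.
by rewrite mulrC.
Qed.

Lemma Ck_affine k f (c d : R) : Ck k f -> Ck k (fun x => f (c * x + d)).
Proof.
elim: k f => // k IH f [df cf]; split.
  by move=> x; have [] := derive1_affine c d x df.
rewrite (_ : derive1 _ = (fun=> c) \* (fun x => derive1 f (c * x + d))).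
  by apply: CkM; [exact: smooth_cst|exact: IH].
by apply/funext => x; rewrite derive1E; have [_ ->] := derive1_affine c d x df.
Qed.

Lemma smooth_derivable f (x : R) : smooth f -> derivable f x 1.
Proof. by move=> /(_ 1%N)[]. Qed.

Lemma smooth_derive f : smooth f -> smooth (derive1 f).
Proof. by move=> sf k; have [] := sf k.+1. Qed.

Lemma smooth_continuous f : smooth f -> continuous f.
Proof.
move=> sf x; apply: differentiable_continuous.
exact/derivable1_diffP/smooth_derivable.
Qed.

(* The functions [p(1/x) exp(-1/x)], extended by [0] to the left of the       *)
(* origin, form a class that is stable under derivation.                      *)
Definition flat p (x : R) : R :=
  if 0 < x then p.[x^-1] * expR (- x^-1) else 0.

(** Each monomial obeys y^i exp(-y) <= i!, by comparison with one term of the exponential series. *)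
Lemma poly_expR_bounded p :
  exists C : R, forall y, 0 <= y -> `|p.[y]| * expR (- y) <= C.
Proof.
have mono i (y : R) : 0 <= y -> y ^+ i * expR (- y) <= i`!%:R.
  move=> y0; rewrite expRN ler_pdivrMr ?expR_gt0//.
  case: i => [|i]; first by rewrite expr0 fact0 mul1r; apply: le_trans (expR_ge1Dx y); lra.
  have := expR_ge1Dxn i y0; have f0 : 0 < i.+1`!%:R :> R by rewrite ltr0n fact_gt0.
  rewrite -(ler_pM2l f0) => h; apply: le_trans h.
  by rewrite mulrDr mulrCA divff ?gt_eqF// !mulr1 lerDr ltW.
exists (\sum_(i < size p) `|p`_i| * i`!%:R) => y y0.
rewrite horner_coef; apply: (@le_trans _ _ ((\sum_(i < size p) `|p`_i| * y ^+ i) * expR (- y))).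
  rewrite ler_wpM2r ?expR_ge0//; apply: le_trans (ler_norm_sum _ _ _) _.
  by apply: ler_sum => i _; rewrite normrM (ger0_norm (exprn_ge0 _ y0)).
rewrite mulr_suml; apply: ler_sum => i _; rewrite -mulrA ler_wpM2l//.
exact: mono.
Qed.

(** The previous bound for [p * 'X^2], at y = 1/x, gains the factor x^2. A quadratic bound makes the
    derivative at the origin vanish. *)
Lemma flat_bound p : exists2 C : R, 0 < C & forall x, `|flat p x| <= C * x ^+ 2.
Proof.
have [C hC] := poly_expR_bounded (p * 'X^2).
exists (Num.max C 1); first by rewrite lt_max ltr01 orbT.
move=> x; rewrite /flat; case: ifPn => x0; last first.
  by rewrite normr0 mulr_ge0 ?sqr_ge0// le_max ler01 orbT.
have xV0 : 0 <= x^-1 by rewrite invr_ge0 ltW.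
have := hC _ xV0; rewrite hornerM hornerXn => h.
have h2 : `|p.[x^-1] * expR (- x^-1)| <= C * x ^+ 2.
  rewrite -ler_pdivrMr ?exprn_gt0// normrM (ger0_norm (expR_ge0 _)).
  apply: le_trans h; rewrite normrM (@ger0_norm _ (_ ^+ 2)) ?exprn_ge0//.
  by rewrite exprVn mulrAC.
by apply: (le_trans h2); rewrite ler_wpM2r ?sqr_ge0// le_max lexx.
Qed.

(** With y = 1/x, the derivative of p(y) exp(-y) in x is y^2 (p - p')(y) exp(-y). *)
Lemma is_derive_flat p (x : R) :
  is_derive x 1 (flat p) (flat ('X^2 * (p - p^`())) x).
Proof.
have [x0|x0|->] := ltrgt0P x.
- rewrite {2}/flat x0.
  have xN0 : x != 0 by rewrite gt_eqF.
  apply: (@near_eq_is_derive _ R R (fun y => p.[y^-1] * expR (- y^-1))).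
    near=> y; rewrite /flat ifT//; near: y; exact: lt_nbhsr.
  have dV : is_derive x 1 (fun y : R => y^-1) (- x ^- 2).
    by apply: is_derive_eq (is_deriveV xN0 (is_derive_id x (1:R))) _;
      rewrite /GRing.scale/= mulr1.
  have dp := is_derive1_comp (is_derive_poly p x^-1) dV.
  have dN : is_derive x 1 (fun y : R => - y^-1) (x ^- 2).
    by apply: is_derive_eq; rewrite opprK.
  have de := @is_derive1_comp R expR (fun y => - y^-1) x _ _ (is_derive_expR (- x^-1)) dN.
  apply: (is_derive_eq (is_deriveM dp de)).
  rewrite /GRing.scale/= hornerM hornerXn hornerD hornerN exprVn; ring.
- rewrite {2}/flat ltNge ltW//=.
  apply: (@near_eq_is_derive _ R R (cst 0)).
  near=> y; rewrite /flat ifF//; apply/negbTE; rewrite -leNgt ltW//.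
  by near: y; exact: lt_nbhsl.
have -> : flat ('X^2 * (p - p^`())) 0 = 0 by rewrite /flat ltxx.
have [C C0 hC] := flat_bound p.
suff : h^-1 *: (flat p (h *: 1 + 0) - flat p 0) @[h --> 0^'] --> (0 : R).
  move=> h; apply: DeriveDef; first by apply/cvg_ex; exists 0.
  exact/cvg_lim.
apply/cvgrPdist_le => e e0; near=> h.
have h0 : h != 0 by near: h; exact: nbhs_dnbhs_neq.
rewrite sub0r normrN [flat p 0]/flat ltxx subr0 addr0 [h *: 1]mulr1.
rewrite /GRing.scale/= normrM normfV ler_pdivrMl ?normr_gt0//.
apply: (le_trans (hC h)); rewrite -real_normK ?num_real// expr2 mulrA mulrC.
rewrite ler_wpM2l// -ler_pdivlMl//.
by near: h; apply: dnbhs0_le; rewrite mulr_gt0// invr_gt0.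
Unshelve. all: by end_near. Qed.

Lemma flat_smooth p : smooth (flat p).
Proof.
move=> k; elim: k p => //= k IH p; split=> [x|].
  by have [] := is_derive_flat p x.
rewrite (_ : derive1 _ = flat ('X^2 * (p - p^`()))); first exact: IH.
by apply/funext => x; rewrite derive1E; have [_ ->] := is_derive_flat p x.
Qed.

Definition sbump (m a b : R) : R -> R :=
  (fun x => flat 1 (m * x + - (m * a))) \* (fun x => flat 1 ((- m) * x + m * b)).

Arguments sbump : simpl never.

Lemma sbump_smooth m a b : smooth (sbump m a b).
Proof. by move=> k; apply: CkM; apply: Ck_affine; exact: flat_smooth. Qed.

Lemma flat1_ge0 x : 0 <= flat 1 x <= 1.
Proof.
rewrite /flat; case: ifPn => x0; last by rewrite lexx ler01.
by rewrite hornerC mul1r expR_ge0 -expR0 ler_expR oppr_le0 invr_ge0 ltW.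
Qed.

Lemma sbump_ge0 m a b x : 0 <= sbump m a b x <= 1.
Proof.
rewrite /sbump/=; set u := flat _ _; set v := flat _ _.
have /andP[u0 u1] : 0 <= u <= 1 := flat1_ge0 _.
have /andP[v0 v1] : 0 <= v <= 1 := flat1_ge0 _.
by rewrite mulr_ge0//= mulr_ile1.
Qed.

Lemma sbump_norm_le1 m a b x : `|sbump m a b x| <= 1.
Proof. by have /andP[? ?] := sbump_ge0 m a b x; rewrite ger0_norm. Qed.

Lemma sbump_out m a b x : 0 < m -> ~~ (a < x < b) -> sbump m a b x = 0.
Proof.
move=> m0; rewrite negb_and -!leNgt /sbump /= /flat => /orP[xa|bx].
  by rewrite ifF ?mul0r//; apply/negbTE; rewrite -leNgt subr_le0 ler_pM2l.
rewrite [X in _ * X]ifF ?mulr0//; apply/negbTE.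
by rewrite -leNgt mulNr addrC subr_le0 ler_pM2l.
Qed.

Lemma sbump_gt0 m a b x : 0 < m -> a < x < b -> 0 < sbump m a b x.
Proof.
move=> m0 /andP[ax xb]; rewrite /sbump/= /flat !ifT ?subr_gt0 ?ltr_pM2l//.
  by rewrite !hornerC !mul1r mulr_gt0 ?expR_gt0.
by rewrite mulNr addrC subr_gt0 ltr_pM2l.
Qed.

Lemma sbump_cvg a b x :
  sbump k.+1%:R a b x @[k --> \oo] --> (\1_(`]a, b[%classic) x : R).
Proof.
rewrite indicE; have [xab|xab] := boolP (a < x < b); last first.
  rewrite memNset ?in_itv//=; last by rewrite in_itv; apply/negP.
  apply: cvg_near_cst; near=> k; exact: sbump_out.
rewrite mem_set ?in_itv//=.
have flat_cvg (y : R) : 0 < y -> flat 1 (k.+1%:R * y) @[k --> \oo] --> (1 : R).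
  move=> y0.
  rewrite (_ : (fun _ => _) = (fun k : nat => expR (- (k.+1%:R^-1 * y^-1)))); last first.
    by apply/funext => k; rewrite /flat ifT ?hornerC ?mul1r ?invfM// mulr_gt0.
  rewrite -[X in _ --> X]expR0; apply: continuous_cvg; first exact: continuous_expR.
  rewrite -[X in _ --> X]oppr0; apply: cvgN.
  rewrite -[X in _ --> X](mul0r y^-1); apply: cvgM; last exact: cvg_cst.
  exact: cvg_harmonic.
have /andP[ax xb] := xab.
rewrite -[X in _ --> X](mulr1 1); apply: cvgM.
- rewrite (_ : (fun _ => _) = (fun k : nat => flat 1 (k.+1%:R * (x - a)))).
    by apply: flat_cvg; rewrite subr_gt0.
  by apply/funext => k; rewrite mulrBr.
- rewrite (_ : (fun _ => _) = (fun k : nat => flat 1 (k.+1%:R * (b - x)))).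
    by apply: flat_cvg; rewrite subr_gt0.
  by apply/funext => k; congr flat; ring.
Unshelve. all: by end_near. Qed.



End smooth.

(** * Tensor products of one-variable test functions *)

Section tensor.
Context {R : realType} {n : nat}.
Implicit Types (th : 'I_n -> R -> R) (x a b : 'rV[R]_n) (Om : set 'rV[R]_n).

Definition tens th x : R := \prod_i th i (x ord0 i).

Definition tens_partial (j : 'I_n) th : 'I_n -> R -> R :=
  fun i => if i == j then derive1 (th i) else th i.

Lemma is_derive_partial (j : 'I_n) (f : 'rV[R]_n -> R) x (l : R) :
  is_derive (0 : R) (1 : R) (fun h : R => f (h *: delta_mx ord0 j + x)) l ->
  derivable f x (delta_mx ord0 j) /\ partial j f x = l.
Proof.
move=> [d dl]; have E : (fun h : R => h^-1 *: (f (h *: delta_mx ord0 j + x) - f x)) =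
   (fun h : R => h^-1 *: (f ((h *: 1 + 0) *: delta_mx ord0 j + x) - f (0 *: delta_mx ord0 j + x))).
  by apply/funext => h; rewrite addr0 [h *: 1]mulr1 scale0r add0r.
split; first by rewrite /derivable E.
by rewrite /partial /derive E.
Qed.

Lemma is_derive_tens th j x : (forall y, derivable (th j) y 1) ->
  derivable (tens th) x (delta_mx ord0 j) /\
  partial j (tens th) x = tens (tens_partial j th) x.
Proof.
move=> dth; apply: is_derive_partial.
pose C := \prod_(i < n | i != j) th i (x ord0 i).
have E : (fun h : R => tens th (h *: delta_mx ord0 j + x)) =
    (fun h => th j (1 * h + x ord0 j) * C).
  apply/funext => h; rewrite /tens (bigD1 j)//= !mxE !eqxx mulr1 mul1r.
  congr (_ * _); apply: eq_bigr => i ij.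
  by rewrite !mxE (negbTE ij) andbF mulr0 add0r.
rewrite E; have d1 := derive1_affine 1 (x ord0 j) 0 dth.
have := is_deriveM d1 (is_derive_cst C (0 : R) (1 : R)) => /is_derive_eq; apply.
rewrite /tens (bigD1 j)//= /tens_partial eqxx /GRing.scale/= mulr0 add0r mulr0 add0r mul1r.
rewrite mulrC; congr (_ * _).
by apply: eq_bigr => i /negbTE ->.
Qed.

Lemma tens_smooth_continuous th : (forall i, smooth (th i)) -> continuous (tens th).
Proof.
move=> sth x; rewrite /tens.
have : forall s : seq 'I_n, {for x, continuous (fun y : 'rV[R]_n => \prod_(i <- s) th i (y ord0 i))}.
  elim=> [|i s IH].
    rewrite (_ : (fun _ => _) = cst 1); first exact: cst_continuous.
    by apply/funext => y; rewrite big_nil.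
  rewrite (_ : (fun _ => _) = (fun y : 'rV[R]_n => th i (y ord0 i)) \*
      (fun y => \prod_(i <- s) th i (y ord0 i))).
    apply: continuousM => //.
    apply: (@continuous_comp _ _ _ (fun y : 'rV[R]_n => y ord0 i) (th i)).
      exact: coord_continuous.
    exact: smooth_continuous.
  by apply/funext => y; rewrite big_cons.
exact.
Qed.

Lemma tens_partial_smooth th j : (forall i, smooth (th i)) ->
  forall i, smooth (tens_partial j th i).
Proof.
by move=> sth i; rewrite /tens_partial; case: eqP => // _; exact: smooth_derive.
Qed.

(** A partial derivative of a tensor product is again a tensor product of smooth factors, so
    iterated partials never leave the class. *)
Lemma tens_class_C th k : (forall i, smooth (th i)) -> class_C k (tens th).
Proof.
move=> sth s.
have [th' sth' ->] : exists2 th', forall i, smooth (th' i) &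
    iterated_partial s (tens th) = tens th'.
  elim: s => [|j s [th' sth' IH]]; first by exists th.
  exists (tens_partial j th'); first exact: tens_partial_smooth.
  apply/funext => x; rewrite /iterated_partial /= -/(iterated_partial s _) IH.
  by have [] := is_derive_tens x (fun y => @smooth_derivable R _ y (sth' j)).
split=> _; last exact: tens_smooth_continuous.
by move=> i x; have [] := is_derive_tens x (fun y => @smooth_derivable R _ y (sth' i)).
Qed.

Lemma tens_out th a b x :
  (forall i (t : R), ~~ (a ord0 i < t < b ord0 i) -> th i t = 0) ->
  ~ obox a b x -> tens th x = 0.
Proof.
move=> th0 /existsNP[i /negP xi]; rewrite /tens (bigD1 i)//= th0//.
by rewrite mul0r.
Qed.

Lemma support_in_cbox Om a b (phi : 'rV[R]_n -> R) : cbox a b `<=` Om ->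
  (forall x, ~ cbox a b x -> phi x = 0) -> compactly_supported Om phi.
Proof.
move=> abOm phi0.
have cl : closure [set x | phi x != 0] `<=` cbox a b.
  rewrite closureE; apply: smallest_sub; first exact: cbox_closed.
  by move=> x /= px; apply: contrapT => /phi0; exact/eqP.
split; last exact: subset_trans abOm.
apply: subclosed_compact (@cbox_compact _ _ a b) cl; exact: closed_closure.
Qed.

Definition box_bump (m : R) a b : 'rV[R]_n -> R :=
  tens (fun i => sbump m (a ord0 i) (b ord0 i)).

Lemma box_bump_ge0 m a b x : 0 <= box_bump m a b x <= 1.
Proof.
apply/andP; split.
  by apply: prodr_ge0 => i _; have /andP[] := sbump_ge0 m (a ord0 i) (b ord0 i) (x ord0 i).
apply: prodr_ile1 => i _; exact: sbump_ge0.
Qed.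

Lemma tens_cvg (F : nat -> 'I_n -> R -> R) th x :
  (forall i, F k i (x ord0 i) @[k --> \oo] --> th i (x ord0 i)) ->
  tens (F k) x @[k --> \oo] --> tens th x.
Proof.
by move=> Fth; apply: cvg_big => // -[y z]; exact: mul_continuous.
Qed.
End tensor.


(** * Dominated convergence and bounded multipliers for real-valued integrals *)

Section Rintegral_tools.
Context d (T : measurableType d) (R : realType).
Variables (mu : {measure set T -> \bar R}) (D : set T) (mD : measurable D).
Implicit Types (f g : T -> R).

Lemma Rdominated_convergence (f_ : nat -> T -> R) f g :
  (forall k, measurable_fun D (f_ k)) -> measurable_fun D f ->
  {ae mu, forall x, D x -> f_ k x @[k --> \oo] --> f x} ->
  mu.-integrable D (EFin \o g) ->
  (forall k x, D x -> `|f_ k x| <= g x) ->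
  (\int[mu]_(x in D) f_ k x) @[k --> \oo] --> \int[mu]_(x in D) f x.
Proof.
move=> mf_ mf f_f ig fg.
have [|||||if_f _ cv] := @dominated_convergence d T R mu D mD
  (fun k => EFin \o f_ k) (EFin \o f) (EFin \o g) => //.
- by move=> k; exact/measurable_EFinP.
- exact/measurable_EFinP.
- apply: filterS f_f => x f_fx Dx.
  by apply: cvg_EFin; [exact: nearW|exact: f_fx].
- by apply: aeW => x k Dx /=; rewrite lee_fin; exact: fg.
apply: fine_cvg; rewrite fineK; first exact: cv.
exact: integrable_fin_num.
Qed.

Lemma EFin_Rintegral f : mu.-integrable D (EFin \o f) ->
  (\int[mu]_(x in D) f x)%:E = (\int[mu]_(x in D) (f x)%:E)%E.
Proof. by move=> fi; rewrite /Rintegral fineK//; exact: integrable_fin_num. Qed.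

Lemma integrableMb f g (C : R) : measurable_fun D g ->
  mu.-integrable D (EFin \o f) -> (forall x, D x -> `|g x| <= C) ->
  mu.-integrable D (EFin \o (fun x => g x * f x)).
Proof.
move=> mg fi gC; have mf : measurable_fun D f.
  by apply/measurable_EFinP; exact: measurable_int fi.
apply: (le_integrable mD _ _ (integrableZl mD `|C| fi)).
  by apply/measurable_EFinP; exact: measurable_funM.
move=> x Dx /=; rewrite lee_fin !normrM normr_id ler_wpM2r//.
by apply: le_trans (gC _ Dx) _; exact: ler_norm.
Qed.

Lemma integrable_Rle f g : measurable_fun D f ->
  mu.-integrable D (EFin \o g) -> (forall x, D x -> `|f x| <= g x) ->
  mu.-integrable D (EFin \o f).
Proof.
move=> mf gi fg; apply: (le_integrable mD _ _ gi); first exact/measurable_EFinP.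
by move=> x Dx /=; rewrite lee_fin; apply: le_trans (fg _ Dx) _; exact: ler_norm.
Qed.

Lemma integrable_Rcst (c : R) : (mu D < +oo)%E ->
  mu.-integrable D (EFin \o cst c).
Proof.
move=> Dfin; apply: measurable_bounded_integrable => //.
exact: bounded_cst.
Qed.

End Rintegral_tools.

(** * A functional monotone class theorem *)

Section bounded_class.
Import HBNNSimple.
Context d (T : measurableType d) (R : realType).
Variable H : (T -> R) -> Prop.
Hypothesis HD : forall f g : T -> R, measurable_fun setT f ->
  measurable_fun setT g -> H f -> H g -> H (f \+ g).
Hypothesis HZ : forall (c : R) (f : T -> R), measurable_fun setT f -> H f -> H (c \*o f).
Hypothesis Hlim : forall (f_ : nat -> T -> R) (f : T -> R) (L : R),
  (forall k, measurable_fun setT (f_ k)) -> measurable_fun setT f ->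
  (forall k x, `|f_ k x| <= L) ->
  (forall x, f_ k x @[k --> \oo] --> f x) -> (forall k, H (f_ k)) -> H f.

(** Linearity gives [H] for simple functions. The shifted function f + L is nonnegative, hence an
    increasing limit of simple functions bounded by 2 L; the constant is then removed. *)
Lemma bounded_class_sets (f : T -> R) (L : R) :
  (forall S, measurable S -> H \1_S) ->
  measurable_fun setT f -> (forall x, `|f x| <= L) -> H f.
Proof.
move=> HS mf fL.
have H0 : H (cst 0).
  rewrite (_ : cst 0 = \1_(@set0 T)); first exact: HS.
  by apply/funext => x; rewrite indic0.
have Hsum (s : seq R) (E : nat -> set T) : (forall i, measurable (E i)) ->
    H (fun x => \sum_(i < size s) s`_i * \1_(E i) x).
  move=> mE; elim/last_ind: s => [|s r IH].
    rewrite (_ : (fun _ => _) = cst 0)//.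
    by apply/funext => x; rewrite big_ord0.
  rewrite (_ : (fun _ => _) = (fun x => \sum_(i < size s) s`_i * \1_(E i) x) \+
      (r \*o \1_(E (size s)))).
    apply: HD => //.
    - by apply: measurable_sum => i; apply: measurable_funM => //; exact: measurable_indic.
    - by apply: measurable_funM => //; exact: measurable_indic.
    - by apply: HZ; [exact: measurable_indic|exact: HS].
  apply/funext => x; rewrite size_rcons big_ord_recr /= nth_rcons ltnn eqxx.
  congr (_ + _); apply: eq_bigr => i _.
  by rewrite nth_rcons ltn_ord.
have HSF (g : {nnsfun T >-> R}) : H g.
  have -> : (g : T -> R) = _ := funext (fimfunEord g).
  set s := finmap.enum_fset _.
  apply: (Hsum s (fun i => g @^-1` [set s`_i])) => i.
  by rewrite -[X in measurable X]setTI; exact: (measurable_funP g).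
pose h x := (f x + L)%:E.
have mh : measurable_fun setT h.
  by apply/measurable_EFinP; exact: measurable_funD.
have h0 x : setT x -> (0 <= h x)%E.
  by move=> _; rewrite lee_fin; have := fL x; rewrite ler_norml; lra.
pose A := nnsfun_approx (@measurableT _ T) mh.
have Ah x : A k x @[k --> \oo] --> f x + L.
  have := cvg_nnsfun_approx (@measurableT _ T) mh h0 (I : setT x).
  by move/fine_cvg.
have HfL : H (fun x => f x + L).
  apply: (Hlim (f_ := fun k => A k) (L := 2 * L)) => //.
  - exact: measurable_funD.
  - move=> k x; rewrite ger0_norm//.
    have ndA : {homo A ^~ x : i j / (i <= j)%N >-> i <= j}.
      by move=> i j ij; have := nd_nnsfun_approx (@measurableT _ T) mh ij => /lefP.
    have := nondecreasing_cvgn_le ndA (cvgP _ (Ah x)) k.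
    rewrite (cvg_lim _ (Ah x))// => /le_trans; apply.
    by have := fL x; rewrite ler_norml; lra.
rewrite (_ : f = (fun x => f x + L) \+ (- L \*o \1_setT)).
  apply: HD => //.
  - exact: measurable_funD.
  - by apply: measurable_funM => //; exact: measurable_indic.
  - by apply: HZ; [exact: measurable_indic|exact: HS].
by apply/funext => x /=; rewrite indicT mulr1 addrK.
Qed.

(** Dynkin's lemma for the sets whose indicator satisfies [H]; a countable disjoint union is the
    bounded limit of its finite subunions. *)
Lemma bounded_class (G : set (set T)) (f : T -> R) (L : R) :
  @measurable _ T = <<s G >> -> setI_closed G ->
  H \1_setT -> (forall S, G S -> H \1_S) ->
  measurable_fun setT f -> (forall x, `|f x| <= L) -> H f.
Proof.
move=> mG GI HT HG; apply: bounded_class_sets.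
rewrite mG; apply: (@dynkin_induction _ _ G (fun S => H \1_S)) => //.
- move=> S mS HS.
  rewrite (_ : \1_(~` S) = (\1_setT : T -> R) \+ (-1 \*o \1_S)).
    apply: HD => //; try by exact: measurable_indic.
      by apply: measurable_funM => //; exact: measurable_indic.
    by apply: HZ => //; exact: measurable_indic.
  apply/funext => x /=; rewrite !indicE in_setC in_setT.
  by case: (x \in S) => /=; rewrite ?mulr1 ?mulr0 ?subrr ?addr0.
move=> F mF tF HF.
have E k : \1_(\bigcup_(i < k) F i) = (fun x => \sum_(i < k) \1_(F i) x) :> (T -> R).
  elim: k => [|k IH].
    by apply/funext => x; rewrite big_ord0 bigcup_mkord big_ord0 indic0.
  apply/funext => x; rewrite big_ord_recr /= -[X in X + _](congr1 (fun g => g x) IH).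
  rewrite bigcup_mkord big_ord_recr /= -bigcup_mkord !indicE in_setU.
  have [xk|xk] := boolP (x \in F k); last by rewrite orbF addr0.
  rewrite orbT memNset ?add0r// => -[i /= ik Fix].
  have /trivIsetP/(_ i k I I) := tF; rewrite lt_eqF// => /(_ isT)/seteqP[+ _].
  by move=> /(_ x); apply; split => //; exact: set_mem.
have mU k : measurable (\bigcup_(i < k) F i) by apply: bigcup_measurable.
apply: (Hlim (f_ := fun k => \1_(\bigcup_(i < k) F i)) (L := 1)).
- by move=> k; exact: measurable_indic.
- by apply: measurable_indic; exact: bigcupT_measurable.
- by move=> k x; rewrite indicE; case: (_ \in _); rewrite ?normr1 ?normr0.
- move=> x; rewrite indicE; have [[i _ Fix]|nx] := pselect ((\bigcup_i F i) x).
    rewrite mem_set//; last by exists i.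
    apply: cvg_near_cst; near=> k; rewrite indicE mem_set//.
    by exists i => //=; near: k; exists i.+1.
  rewrite memNset//; apply: cvg_near_cst; apply: nearW => k.
  by rewrite indicE memNset// => -[i _ Fix]; apply: nx; exists i.
- elim=> [|k IH]; first by rewrite E; rewrite (_ : (fun _ => _) = 0 \*o \1_setT);
    [apply: HZ => //; exact: measurable_indic|apply/funext => x /=; rewrite big_ord0 mul0r].
  rewrite E (_ : (fun _ => _) = \1_(\bigcup_(i < k) F i) \+ \1_(F k)).
    by apply: HD => //; exact: measurable_indic.
  by apply/funext => x; rewrite big_ord_recr E.
Unshelve. all: by end_near. Qed.

End bounded_class.

(** * Chain rule on a line *)

Section ac_chain.
Context {R : realType}.
Notation leb := (@lebesgue_measure R).
Implicit Types (F h th G : R -> R) (a b c : R).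

Lemma lebesgue_itv_lty (a b : R) : (leb (`[a, b]%classic) < +oo)%E.
Proof.
by rewrite /= lebesgue_measure_itv/=; case: ifPn => // _; rewrite -EFinB ltry.
Qed.

Lemma integrable_itv_bounded h (a b L : R) : measurable_fun setT h ->
  (forall x, `|h x| <= L) -> leb.-integrable `[a, b] (EFin \o h).
Proof.
move=> mh hL; apply: (@integrable_Rle _ _ _ _ _ _ _ (cst L)) => //.
- exact: measurable_funTS.
- by apply: integrable_Rcst => //; exact: lebesgue_itv_lty.
Qed.

Definition ac_fun c a G (x : R) : R := c + \int[leb]_(t in `[a, x]) G t.

(** The integrated form of F' = h. It asks no pointwise derivative of [F] and is insensitive to
    changes of [h] on null sets. *)
Definition primitive F h := forall s t, s <= t ->
  F t - F s = \int[leb]_(x in `[s, t]) h x.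

Section fixed.
Variables (a b : R) (th : R -> R).
Hypothesis (ab : a < b) (dth : forall x, derivable th x 1)
  (cth : continuous (derive1 th)) (tha : th a = 0) (thb : th b = 0).

Let Iab := `[a, b]%classic.
Let mI : measurable (Iab : set (measurableTypeR R)). Proof. exact: measurable_itv. Qed.

Let cont_th : continuous th.
Proof.
by move=> x; apply: differentiable_continuous; exact/derivable1_diffP/dth.
Qed.

Let bounded_on (k : R -> R) : {within Iab, continuous k} ->
  exists2 M : R, 0 < M & forall x, Iab x -> `|k x| <= M.
Proof.
move=> ck; have /compact_bounded[M [_ hM]] :=
  continuous_compact ck (@segment_compact R a b).
exists (Num.max (M + 1) 1); first by rewrite lt_max ltr01 orbT.
move=> x Ix; apply: (hM (Num.max (M + 1) 1)); last by exists x.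
by rewrite lt_max ltrDl ltr01.
Qed.

Let within_cont (k : R -> R) : continuous k -> {within Iab, continuous k}.
Proof. by move=> ck; exact: continuous_subspaceT. Qed.

Let meas_within (k : R -> R) : {within Iab, continuous k} -> measurable_fun (Iab : set (measurableTypeR R)) k.
Proof. by move=> ck; exact: subspace_continuous_measurable_fun. Qed.

Let within_comp (V k : R -> R) : {within Iab, continuous V} -> continuous k ->
  {within Iab, continuous (k \o V)}.
Proof. by move=> cV ck x; exact: (@continuous_comp (subspace Iab) R R V k x (cV x) (ck _)). Qed.

Lemma ac_fun_continuous c G : leb.-integrable Iab (EFin \o G) ->
  {within Iab, continuous (ac_fun c a G)}.
Proof.
move=> iG x; apply: cvgD; first exact: cvg_cst.
exact: (parameterized_integral_continuous (ltW ab) iG).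
Qed.

Lemma sub_integrable G x : leb.-integrable Iab (EFin \o G) -> x <= b ->
  leb.-integrable `[a, x] (EFin \o G).
Proof.
move=> iG xb; apply: integrableS iG => //.
by apply: subset_itvl; rewrite bnd_simp.
Qed.

Lemma ac_ibp_C1 c G F h : continuous G -> continuous h ->
  (forall t, derivable F t 1 /\ derive1 F t = h t) ->
  \int[leb]_(x in Iab) (F (ac_fun c a G x) * derive1 th x) =
  - \int[leb]_(x in Iab) (h (ac_fun c a G x) * G x * th x).
Proof.
move=> cG ch dF.
have iG : leb.-integrable Iab (EFin \o G).
  apply: continuous_compact_integrable; first exact: segment_compact.
  exact: within_cont.
set U := ac_fun c a G.
have cU : {within Iab, continuous U} by exact: ac_fun_continuous.
have cF : continuous F.
  move=> x; apply: differentiable_continuous; apply/derivable1_diffP.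
  by have [] := dF x.
have dU x : x \in `]a, b[ -> is_derive x 1 U (G x).
  rewrite in_itv/= => /andP[ax xb].
  have [d1 d2] := @continuous_FTC1_closed R G a x b xb iG ax (cG x).
  have : is_derive x 1 (fun y => \int[leb]_(t in `[a, y]) G t) (G x).
    by apply: DeriveDef; [exact: d1|rewrite -derive1E; exact: d2].
  move=> d; rewrite /U /ac_fun.
  have := is_deriveD (is_derive_cst c x (1:R)) d; rewrite add0r; exact.
have dFU x : x \in `]a, b[ -> is_derive x 1 (F \o U) (h (U x) * G x).
  move=> xab; have dFx : is_derive (U x) 1 F (h (U x)).
    by have [d1 d2] := dF (U x); apply: DeriveDef; [exact: d1|rewrite -derive1E; exact: d2].
  exact: is_derive1_comp dFx (dU _ xab).
have /= := @Rintegration_by_parts R (F \o U) th (fun x => h (U x) * G x) (derive1 th) a b ab.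
rewrite tha thb !mulr0 subrr sub0r; apply.
- move=> x; apply: continuousM; last exact: within_cont.
  apply: continuous_comp; [exact: cU|exact: ch].
- have : {within Iab, continuous (F \o U)}.
    exact: within_comp.
  move=> /(continuous_within_itvP _ ab)[_ FUa FUb]; split => //.
  by move=> x xab; have [] := dFU _ xab.
- by move=> x xab; rewrite derive1E; have [_ ->] := dFU _ xab.
- exact: within_cont.
- split; [by move=> x _; exact: dth| |].
    by apply: cvg_at_right_filter; exact: cont_th.
  by apply: cvg_at_left_filter; exact: cont_th.
- by [].
Qed.

(** [G] is approximated in L^1 by continuous functions; their primitives converge uniformly, with
    error at most the L^1 distance [e m], so both sides of the smooth identity pass to the limit. *)
Lemma ac_ibp_continuous c G F h (L : R) : leb.-integrable Iab (EFin \o G) ->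
  continuous h -> (forall t, `|h t| <= L) ->
  (forall t, derivable F t 1 /\ derive1 F t = h t) ->
  (forall s t, `|F s - F t| <= L * `|s - t|) ->
  \int[leb]_(x in Iab) (F (ac_fun c a G x) * derive1 th x) =
  - \int[leb]_(x in Iab) (h (ac_fun c a G x) * G x * th x).
Proof.
move=> iG ch hL dF Flip.
have L0 : 0 <= L by apply: le_trans (hL 0).
have Ifin := lebesgue_itv_lty a b.
have [Gm [cGm iGm Gmcv]] := approximation_continuous_integrable mI Ifin iG.
set U := ac_fun c a G; pose Um m := ac_fun c a (Gm m).
have cU : {within Iab, continuous U} by exact: ac_fun_continuous.
have cUm m : {within Iab, continuous (Um m)} by exact: ac_fun_continuous.
have mG : measurable_fun (Iab : set (measurableTypeR R)) G by apply/measurable_EFinP; exact: measurable_int iG.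
have mGm m : measurable_fun (Iab : set (measurableTypeR R)) (Gm m) by apply: measurable_funTS; exact: continuous_measurable_fun.
have cF : continuous F.
  move=> x; apply: differentiable_continuous; apply/derivable1_diffP.
  by have [] := dF x.
have iD m : leb.-integrable Iab (EFin \o (G \- Gm m)).
  have := integrableB mI iG (iGm m).
  by apply: eq_integrable => // x _ /=; rewrite EFinB.
have iDa m : leb.-integrable Iab (EFin \o (fun x => `|G x - Gm m x|)).
  have := integrable_abse (iD m).
  by apply: eq_integrable => // x _ /=; rewrite EFinB.
pose e m := \int[leb]_(x in Iab) `|G x - Gm m x|.
have e0 : e m @[m --> \oo] --> (0 : R).
  have /fine_cvg := Gmcv; apply.
have UUm m x : Iab x -> `|U x - Um m x| <= e m.
  rewrite /Iab /= in_itv/= => /andP[ax xb].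
  have -> : U x - Um m x = \int[leb]_(t in `[a, x]) (G t - Gm m t).
    rewrite /U /Um /ac_fun RintegralB//; first by ring.
    - exact: sub_integrable.
    - exact: sub_integrable.
  apply: le_trans (le_normr_Rintegral _ _) _ => //.
    exact: (@sub_integrable (G \- Gm m)).
  rewrite /e /Rintegral; apply: fine_le.
  - by apply: integrable_fin_num => //; exact: (@sub_integrable (fun x => `|G x - Gm m x|)).
  - by apply: integrable_fin_num => //; exact: iDa.
  apply: ge0_subset_integral => //.
  - exact: (measurable_int _ (iDa m)).
  - by apply: subset_itvl; rewrite bnd_simp.
have Umcv x : Iab x -> Um m x @[m --> \oo] --> U x.
  move=> Ix; apply/cvgrPdist_le => eps eps0.
  have /cvgrPdist_le/(_ _ eps0) := e0; apply: filterS => m.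
  rewrite sub0r normrN => h1; apply: le_trans (UUm m _ Ix) _.
  exact: le_trans (ler_norm _) h1.
have [Mt Mt0 thM] := bounded_on (within_cont cont_th).
have [Md Md0 dthM] := bounded_on (within_cont cth).
have [MU MU0 UM] := bounded_on cU.
have [e1 _ he1] : exists2 e1 : R, True & forall m, `|e m| <= e1.
  have /cvgP/cvg_seq_bounded[M [_ hM]] := e0.
  by exists (M + 1) => // m; apply: hM => //; rewrite ltrDl.
have mhU (V : R -> R) : {within Iab, continuous V} -> measurable_fun (Iab : set (measurableTypeR R)) (h \o V).
  by move=> cV; apply: meas_within; exact: within_comp.
have mFU (V : R -> R) : {within Iab, continuous V} -> measurable_fun (Iab : set (measurableTypeR R)) (F \o V).
  by move=> cV; apply: meas_within; exact: within_comp.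
have mth : measurable_fun (Iab : set (measurableTypeR R)) th by apply: measurable_funTS; exact: continuous_measurable_fun.
have mdth : measurable_fun (Iab : set (measurableTypeR R)) (derive1 th) by apply: measurable_funTS; exact: continuous_measurable_fun.
have lhs : (\int[leb]_(x in Iab) (F (Um m x) * derive1 th x)) @[m --> \oo] -->
    \int[leb]_(x in Iab) (F (U x) * derive1 th x).
  apply: (@Rdominated_convergence _ _ _ _ _ _ _ _
    (cst ((`|F 0| + L * (MU + e1)) * Md))) => //.
  - by move=> m; apply: measurable_funM => //; exact: mFU.
  - by apply: measurable_funM => //; exact: mFU.
  - apply: aeW => x Ix; apply: cvgM; last exact: cvg_cst.
    by apply: continuous_cvg; [exact: cF|exact: Umcv].
  - exact: integrable_Rcst.
  - move=> m x Ix /=; rewrite normrM; apply: ler_pM => //; last exact: dthM.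
    have := Flip (Um m x) 0; rewrite subr0 => h1.
    have h2 : `|F (Um m x)| <= `|F 0| + `|F (Um m x) - F 0|.
      by rewrite -[X in `|X| <= _](subrK (F 0)) addrC; exact: ler_normD.
    apply: (le_trans h2); rewrite lerD2l; apply: (le_trans h1).
    rewrite ler_wpM2l//.
    have := UUm m _ Ix; have := UM _ Ix; have := he1 m.
    by rewrite !ler_norml; move: (e m) (Um m x) (U x) => *; lra.
have rhs1 : (\int[leb]_(x in Iab) (h (Um m x) * G x * th x)) @[m --> \oo] -->
    \int[leb]_(x in Iab) (h (U x) * G x * th x).
  apply: (@Rdominated_convergence _ _ _ _ _ _ _ _ (fun x : measurableTypeR R => (L * Mt) * `|G x|)) => //.
  - by move=> m; apply: measurable_funM => //; apply: measurable_funM => //; exact: mhU.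
  - by apply: measurable_funM => //; apply: measurable_funM => //; exact: mhU.
  - apply: aeW => x Ix; apply: cvgM; last exact: cvg_cst.
    apply: cvgM; last exact: cvg_cst.
    by apply: continuous_cvg; [exact: ch|exact: Umcv].
  - have := integrableZl mI (L * Mt) (integrable_abse iG).
    by apply: eq_integrable => // x _ /=.
  - move=> m x Ix /=; rewrite !normrM mulrAC ler_wpM2r//.
    by apply: ler_pM => //; exact: thM.
have iterm (V W : R -> R) : {within Iab, continuous V} ->
    leb.-integrable Iab (EFin \o W) ->
    leb.-integrable Iab (EFin \o (fun x => h (V x) * W x * th x)).
  move=> cV iW; have := @integrableMb _ _ _ leb _ mI W
    (fun x => h (V x) * th x) (L * Mt) _ iW.
  rewrite (_ : (fun x => _ * W x) = (fun x => h (V x) * W x * th x)); last first.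
    by apply/funext => x; rewrite mulrAC.
  apply; first by apply: measurable_funM => //; exact: mhU.
  by move=> x Ix; rewrite normrM; apply: ler_pM => //; exact: thM.
(* [rhs1] handles the change from h(U_m) to h(U) against the fixed [G]; the remaining G - G_m is
   multiplied by at most L * Mt. *)
have rhs : (\int[leb]_(x in Iab) (h (Um m x) * Gm m x * th x)) @[m --> \oo] -->
    \int[leb]_(x in Iab) (h (U x) * G x * th x).
  apply/cvgrPdist_le => eps eps0.
  have LM0 : 0 < L * Mt + 1 by rewrite ltr_wpDl// mulr_ge0// ltW.
  have /cvgrPdist_le/(_ (eps / 2)) := rhs1; rewrite divr_gt0// => /(_ isT) h1.
  have /cvgrPdist_le/(_ (eps / 2 / (L * Mt + 1))) := e0.
  rewrite !divr_gt0// => /(_ isT); apply: filterS2 h1 => m h1 h2.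
  set X := \int[leb]_(x in Iab) (h (U x) * G x * th x) in h1 *.
  set Y := \int[leb]_(x in Iab) (h (Um m x) * G x * th x) in h1 *.
  have h3 : `|Y - \int[leb]_(x in Iab) (h (Um m x) * Gm m x * th x)| <= L * Mt * e m.
    rewrite /Y -RintegralB//; [|exact: iterm..].
    apply: le_trans (le_normr_Rintegral _ _) _ => //.
      have := integrableB mI (iterm _ _ (cUm m) iG) (iterm _ _ (cUm m) (iGm m)).
      by apply: eq_integrable => // x _ /=; rewrite EFinB.
    have iM : leb.-integrable Iab (EFin \o (fun x => L * Mt * `|G x - Gm m x|)).
      have := integrableZl mI (L * Mt) (iDa m).
      by apply: eq_integrable => // x _ /=.
    rewrite /e -RintegralZl//; apply: le_Rintegral => //.
      apply: (integrable_Rle mI _ iM).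
        apply: measurableT_comp => //; apply: measurable_funB;
          do 2 (apply: measurable_funM => //); exact: mhU.
      move=> x Ix; rewrite normr_id.
      rewrite -mulrBl -mulrBr !normrM mulrAC ler_wpM2r//.
      by apply: ler_pM => //; exact: thM.
    move=> x Ix; rewrite -mulrBl -mulrBr !normrM mulrAC ler_wpM2r//.
    by apply: ler_pM => //; exact: thM.
  move: h2; rewrite sub0r normrN ler_pdivlMr// => h2.
  have h4 : L * Mt * e m <= eps / 2.
    apply: le_trans h2; rewrite mulrC; apply: le_trans (ler_wpM2r _ (ler_norm (e m))) _.
      by rewrite mulr_ge0// ltW.
    by rewrite ler_wpM2l// lerDl.
  set Z := (X in `|_ - X| <= _ * _) in h3.
  rewrite -/Z (_ : X - Z = (X - Y) + (Y - Z)); last by ring.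
  apply: le_trans (ler_normD _ _) _; rewrite [leRHS]splitr; apply: lerD => //.
  exact: le_trans h4.
apply: (cvg_unique (@Rhausdorff R) lhs).
rewrite (_ : (fun m : nat => _) = (fun m =>
    - \int[leb]_(x in Iab) (h (Um m x) * Gm m x * th x))); first exact: cvgN.
by apply/funext => m; exact: ac_ibp_C1.
Qed.

Lemma ac_test_cst_integrable (C : R) :
  leb.-integrable Iab (EFin \o (fun x => C * derive1 th x)).
Proof.
have [Md Md0 dthM] := bounded_on (within_cont cth).
apply: (@integrable_Rle _ _ _ _ _ _ _ (cst (`|C| * Md))) => //.
- apply: measurable_funM => //; apply: measurable_funTS.
  exact: continuous_measurable_fun.
- by apply: integrable_Rcst => //; exact: lebesgue_itv_lty.
- by move=> x Ix /=; rewrite normrM ler_wpM2l//; exact: dthM.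
Qed.

Section bounded.
Variables (c : R) (G : R -> R).
Hypothesis iG : leb.-integrable Iab (EFin \o G).

Let U := ac_fun c a G.

Lemma ac_fun_bounded : exists2 M : R, 0 < M & forall x, Iab x -> `|U x| < M.
Proof.
have [M M0 hM] := bounded_on (@ac_fun_continuous c G iG).
exists (M + 1); first by rewrite addr_gt0.
by move=> x Ix; apply: le_lt_trans (hM _ Ix) _; rewrite ltrDl.
Qed.

Lemma ac_test_cst (C : R) : \int[leb]_(x in Iab) (C * derive1 th x) = 0.
Proof.
have dC (t : R) : derivable (cst C : R -> R) t 1 /\ derive1 (cst C) t = (cst 0 : R -> R) t.
  by split; [exact: derivable_cst|rewrite derive1_cst].
have := @ac_ibp_C1 c (cst 0) (cst C) (cst 0) _ _ dC => ->; try exact: cst_continuous.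
rewrite (_ : (fun _ => _) = cst 0); last by apply/funext => x /=; rewrite !mul0r.
by rewrite Rintegral_cst// mul0r oppr0.
Qed.

Variable M : R.
Hypothesis (UM : forall x, Iab x -> `|U x| < M).

(** Based at - M, below all values of [U], so that the interval of integration is never reversed. *)
Let Pr h t := \int[leb]_(x in `[- M, t]) h x.

Let mU : measurable_fun (Iab : set (measurableTypeR R)) U.
Proof. by apply: meas_within; exact: ac_fun_continuous. Qed.

Let mG : measurable_fun (Iab : set (measurableTypeR R)) G.
Proof. by apply/measurable_EFinP; exact: measurable_int iG. Qed.

Let mth : measurable_fun (Iab : set (measurableTypeR R)) th.
Proof. by apply: measurable_funTS; exact: continuous_measurable_fun. Qed.

Let mdth : measurable_fun (Iab : set (measurableTypeR R)) (derive1 th).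
Proof. by apply: measurable_funTS; exact: continuous_measurable_fun. Qed.

Let bounded h := measurable_fun setT h /\ exists L : R, forall x, `|h x| <= L.

Let acH h := \int[leb]_(x in Iab) (Pr h (U x) * derive1 th x) =
  - \int[leb]_(x in Iab) (h (U x) * G x * th x).

Lemma Rintegral_itv_le h (s t L : R) : s <= t -> measurable_fun setT h ->
  (forall x, s <= x <= t -> `|h x| <= L) ->
  `|\int[leb]_(x in `[s, t]) h x| <= L * (t - s).
Proof.
move=> st mh hL; have mst : measurable (`[s, t]%classic : set (measurableTypeR R)) by [].
have iL : leb.-integrable `[s, t] (EFin \o cst L).
  by apply: integrable_Rcst => //; exact: lebesgue_itv_lty.
have mhst : measurable_fun (`[s, t]%classic : set (measurableTypeR R)) h.
  exact: measurable_funTS.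
have ih : leb.-integrable `[s, t] (EFin \o h).
  by apply: (integrable_Rle mst mhst iL) => x /=; rewrite in_itv/=; exact: hL.
apply: le_trans (le_normr_Rintegral mst ih) _.
have -> : L * (t - s) = \int[leb]_(x in `[s, t]) L.
  rewrite Rintegral_cst//; congr (_ * _).
  move: st; rewrite /= lebesgue_measure_itv/= lte_fin le_eqVlt.
  by move=> /predU1P[->|->//]; rewrite ltxx subrr.
apply: le_Rintegral => //; first exact: integrable_abse ih.
Qed.

Let Pr_itv h s t : bounded h -> - M <= s -> s <= t ->
  Pr h t - Pr h s = \int[leb]_(x in `[s, t]) h x.
Proof.
move=> [mh [L hL]] Ms st; rewrite /Pr Rintegral_itvB ?bnd_simp//.
  rewrite Rintegral_itv_obnd_cbnd//.
  apply: integrableS (integrable_itv_bounded s t mh hL) => //.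
  by apply: subset_itvr; rewrite bnd_simp.
exact: integrable_itv_bounded.
Qed.

Let Pr_lip h (L : R) : measurable_fun setT h -> (forall x, `|h x| <= L) ->
  forall s t, - M <= s -> - M <= t -> `|Pr h s - Pr h t| <= L * `|s - t|.
Proof.
move=> mh hL; have bh : bounded h by split => //; exists L.
suff wlog s t : - M <= s -> s <= t -> `|Pr h s - Pr h t| <= L * `|s - t|.
  move=> s t Ms Mt; have [st|/ltW ts] := leP s t; first exact: wlog.
  by rewrite distrC (distrC s); exact: wlog.
move=> Ms st; rewrite distrC Pr_itv// distrC (ger0_norm (_ : 0 <= t - s)) ?subr_ge0//.
by apply: Rintegral_itv_le.
Qed.

Let UMlo x : Iab x -> - M <= U x.
Proof. by move=> /UM; rewrite ltr_norml => /andP[/ltW]. Qed.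

Let Pr_bound h (L : R) x : measurable_fun setT h -> (forall x, `|h x| <= L) ->
  Iab x -> `|Pr h (U x)| <= L * (2 * M).
Proof.
move=> mh hL Ix; apply: le_trans (Rintegral_itv_le (UMlo Ix) mh (fun x _ => hL x)) _.
rewrite ler_wpM2l//; first by apply: le_trans (hL 0).
by have := UM Ix; rewrite ltr_norml; lra.
Qed.

Let mPr h : bounded h -> measurable_fun (Iab : set (measurableTypeR R)) (fun x => Pr h (U x)).
Proof.
move=> [mh [L hL]]; have L0 : 0 <= L by apply: le_trans (hL 0).
apply: meas_within => x.
have /subspace_continuousP cU : {within Iab, continuous U} := @ac_fun_continuous c G iG.
move: x; apply/subspace_continuousP => x Ix; apply/cvgrPdist_le => e e0.
have L1 : 0 < L + 1 by rewrite ltr_wpDl.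
have /cvgrPdist_le/(_ (e / (L + 1))) := cU x Ix.
rewrite divr_gt0// => /(_ isT) h1; near=> y.
apply: le_trans (Pr_lip mh hL (UMlo Ix) (UMlo _)) _.
  by near: y; exact: withinT.
have : `|U x - U y| <= e / (L + 1) by near: y.
rewrite ler_pdivlMr// mulrC => h2; apply: le_trans h2.
by rewrite ler_wpM2r// lerDl.
Unshelve. all: by end_near. Qed.

Lemma ac_bounded_integrable h : bounded h ->
  leb.-integrable Iab (EFin \o (fun x => Pr h (U x) * derive1 th x)).
Proof.
move=> bh; have [mh [L hL]] := bh.
have [Md Md0 dthM] := bounded_on (within_cont cth).
apply: (@integrable_Rle _ _ _ _ _ _ _ (cst (L * (2 * M) * Md))) => //.
- by apply: measurable_funM => //; exact: mPr.
- by apply: integrable_Rcst => //; exact: lebesgue_itv_lty.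
- move=> x Ix /=; rewrite normrM; apply: ler_pM => //; last exact: dthM.
  exact: Pr_bound.
Qed.

Let mhU h : measurable_fun setT h ->
  measurable_fun (Iab : set (measurableTypeR R)) (fun x => h (U x)).
Proof. by move=> mh; exact: (measurableT_comp mh mU). Qed.

Let ihU h : bounded h ->
  leb.-integrable Iab (EFin \o (fun x => h (U x) * G x * th x)).
Proof.
move=> [mh [L hL]]; have [Mt Mt0 thM] := bounded_on (within_cont cont_th).
have := @integrableMb _ _ _ leb _ mI G (fun x => h (U x) * th x) (L * Mt) _ iG.
rewrite (_ : (fun x => _ * G x) = (fun x => h (U x) * G x * th x)); last first.
  by apply/funext => x; rewrite mulrAC.
apply; first by apply: measurable_funM => //; exact: mhU.
by move=> x Ix; rewrite normrM; apply: ler_pM => //; exact: thM.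
Qed.

(** Two primitives of [h] differ by a constant on the range of [U], and constants integrate to 0
    against [derive1 th] because [th] vanishes at both ends. *)
Let acH_primitive h F : bounded h -> (forall s t, - M <= s -> s <= t ->
    F t - F s = \int[leb]_(x in `[s, t]) h x) ->
  \int[leb]_(x in Iab) (F (U x) * derive1 th x) =
  \int[leb]_(x in Iab) (Pr h (U x) * derive1 th x).
Proof.
move=> bh Fh.
rewrite (@eq_Rintegral _ _ _ _ _ (fun x : measurableTypeR R => Pr h (U x) * derive1 th x +
    F (- M) * derive1 th x)); last first.
  move=> x /set_mem Ix; rewrite -mulrDl; congr (_ * _).
  by rewrite /Pr -Fh ?UMlo//; ring.
rewrite RintegralD//; last 2 first.
- exact: ac_bounded_integrable.
- exact: ac_test_cst_integrable.
by rewrite ac_test_cst addr0.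
Qed.

Let acH_continuous h F (L : R) : continuous h -> (forall t, `|h t| <= L) ->
  (forall t, derivable F t 1 /\ derive1 F t = h t) ->
  primitive F h -> acH h.
Proof.
move=> ch hL dF pF; have mh : measurable_fun setT h by exact: continuous_measurable_fun.
have bh : bounded h by split => //; exists L.
rewrite /acH -(acH_primitive bh (fun s t _ => pF s t)).
apply: (@ac_ibp_continuous _ _ _ _ L) => // s t.
wlog st : s t / s <= t => [hw|].
  by have [st|/ltW ts] := leP s t; [exact: hw|rewrite distrC (distrC s); exact: hw].
rewrite distrC pF// distrC (ger0_norm (_ : 0 <= t - s)) ?subr_ge0//.
by apply: Rintegral_itv_le.
Qed.

(** A monotone class argument: the identity is linear in [h], stable under bounded pointwise limits,
    and known for continuous [h]. It remains to reach the indicators of open rays, which generate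
    the Borel sets. *)
Lemma ac_chain_bounded h : bounded h -> acH h.
Proof.
move=> [mh [L hL]]; suff [] : bounded h /\ acH h by [].
apply: (@bounded_class _ _ R (fun h => bounded h /\ acH h) _ _ _ (@RGenOInfty.G R) h L _ _ _ _ mh hL).
- move=> f g mf mg [bf Hf] [bg Hg].
  have [_ [Lf fL]] := bf; have [_ [Lg gL]] := bg.
  have bfg : bounded (f \+ g).
    split; first exact: measurable_funD.
    by exists (Lf + Lg) => x; apply: le_trans (ler_normD _ _) _; exact: lerD.
  split => //; rewrite /acH.
  rewrite (@eq_Rintegral _ _ _ _ _ (fun x : measurableTypeR R => Pr f (U x) * derive1 th x + Pr g (U x) * derive1 th x)); last first.
    move=> x _; rewrite -mulrDl; congr (_ * _); rewrite /Pr RintegralD//;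
      exact: integrable_itv_bounded.
  rewrite RintegralD//; [|exact: ac_bounded_integrable..]; rewrite Hf Hg -opprD -RintegralD//; [|exact: ihU..].
  by congr (- _); apply: eq_Rintegral => x _ /=; rewrite -!mulrDl.
- move=> k f mf [bf Hf]; have [_ [Lf fL]] := bf.
  have bkf : bounded (k \*o f).
    split; first exact: measurable_funM.
    by exists (`|k| * Lf) => x; rewrite normrM ler_wpM2l.
  split => //; rewrite /acH.
  rewrite (@eq_Rintegral _ _ _ _ _ (fun x : measurableTypeR R => k * (Pr f (U x) * derive1 th x))); last first.
    move=> x _; rewrite mulrA; congr (_ * _); rewrite /Pr RintegralZl//.
    exact: integrable_itv_bounded.
  rewrite RintegralZl//; last exact: ac_bounded_integrable.
  rewrite Hf mulrN -RintegralZl//; last exact: ihU.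
  by congr (- _); apply: eq_Rintegral => x _ /=; rewrite -!mulrA.
- move=> f_ f K mf_ mf fK f_f Hf_.
  have fK' x : `|f x| <= K.
    by apply: (cvgr_to_le (cvg_norm (f_f x))); apply: nearW => k; exact: fK.
  have bf : bounded f by split => //; exists K.
  have K0 : 0 <= K by apply: le_trans (fK' 0).
  split => //; rewrite /acH.
  have [Md Md0 dthM] := bounded_on (within_cont cth).
  have [Mt Mt0 thM] := bounded_on (within_cont cont_th).
  have lhs : (\int[leb]_(x in Iab) (Pr (f_ k) (U x) * derive1 th x)) @[k --> \oo] -->
      \int[leb]_(x in Iab) (Pr f (U x) * derive1 th x).
    apply: (Rdominated_convergence mI (g := cst (K * (2 * M) * Md))).
    - by move=> k; apply: measurable_funM => //; apply: mPr; have [] := Hf_ k.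
    - by apply: measurable_funM => //; exact: mPr.
    - apply: aeW => x Ix; apply: cvgM; last exact: cvg_cst.
      apply: (Rdominated_convergence _ (g := cst K)) => //.
      + by move=> k; apply: measurable_funTS; exact: mf_.
      + by apply: measurable_funTS; exact: mf.
      + by apply: aeW => y _; exact: f_f.
      + by apply: integrable_Rcst => //; exact: lebesgue_itv_lty.
    - by apply: integrable_Rcst => //; exact: lebesgue_itv_lty.
    - move=> k x Ix /=; rewrite normrM; apply: ler_pM => //; last exact: dthM.
      exact: Pr_bound.
  have rhs : (\int[leb]_(x in Iab) (f_ k (U x) * G x * th x)) @[k --> \oo] -->
      \int[leb]_(x in Iab) (f (U x) * G x * th x).
    apply: (Rdominated_convergence mI (g := fun x : measurableTypeR R => (K * Mt) * `|G x|)).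
    - by move=> k; apply: measurable_funM => //; apply: measurable_funM => //; exact: mhU.
    - by apply: measurable_funM => //; apply: measurable_funM => //; exact: mhU.
    - apply: aeW => x Ix; apply: cvgM; last exact: cvg_cst.
      by apply: cvgM; [exact: f_f|exact: cvg_cst].
    - have := integrableZl mI (K * Mt) (integrable_abse iG).
      by apply: eq_integrable => // x _ /=.
    - move=> k x Ix /=; rewrite !normrM mulrAC ler_wpM2r//.
      by apply: ler_pM => //; exact: thM.
  apply: (cvg_unique (@Rhausdorff R) lhs).
  rewrite (_ : (fun k : nat => _) = (fun k =>
      - \int[leb]_(x in Iab) (f_ k (U x) * G x * th x))); first exact: cvgN.
  by apply/funext => k; have [_] := Hf_ k.
- exact: RGenOInfty.measurableE.
- move=> _ _ [x ->] [y ->]; exists (Num.max x y).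
  apply/seteqP; split=> z /=; rewrite !in_itv/= !andbT gt_max.
    by move=> [-> ->].
  by move=> /andP.
- split; first by split; [exact: measurable_indic|exists 1 => x; rewrite indicT normr1].
  apply: (@acH_continuous _ id 1).
  + rewrite (_ : \1_setT = cst 1); first exact: cst_continuous.
    by apply/funext => x; rewrite indicT.
  + by move=> t; rewrite indicT normr1.
  + by move=> t; split; [exact: derivable_id|rewrite indicT derive1_id].
  + move=> s t st; rewrite (@eq_Rintegral _ _ _ _ _ (cst 1)); last by move=> x _; rewrite indicT.
    rewrite Rintegral_cst// mul1r.
    move: st; rewrite /= lebesgue_measure_itv/= lte_fin le_eqVlt.
    by move=> /predU1P[->|->//]; rewrite ltxx subrr.
- move=> _ [r ->]; split.
    split; first exact: measurable_indic.
    by exists 1 => x; rewrite indicE; case: (_ \in _); rewrite ?normr1 ?normr0.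
  (* Ramps that vanish up to [r] and then rise with slope j+1 to the value 1; they converge to the
     indicator of ]r, +oo[. *)
  pose hj (j : nat) (t : R) : R := Num.min 1 (Num.max 0 (j.+1%:R * (t - r))).
  have hj01 j t : 0 <= hj j t <= 1.
    by rewrite /hj ge_min lexx/= le_min ler01 le_max lexx.
  have hj0 j t : t <= r -> hj j t = 0.
    move=> tr; rewrite /hj (max_idPl _) ?min_r//.
    by rewrite mulr_ge0_le0// subr_le0.
  have hj1 j t : `|hj j t| <= 1 by have /andP[? ?] := hj01 j t; rewrite ger0_norm.
  have chj j : continuous (hj j).
    move=> t; have h1 : {for t, continuous (fun t : R => j.+1%:R * (t - r))}.
      apply: continuousM; first exact: cst_continuous.
      by apply: continuousB; [move=> ?; exact: cvg_id|exact: cst_continuous].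
    have c0 : {for t, continuous (cst 0 : R -> R)} by exact: cst_continuous.
    have c1 : {for t, continuous (cst 1 : R -> R)} by exact: cst_continuous.
    exact: (@continuous_min R R _ _ t c1 (@continuous_max R R _ _ t c0 h1)).
  have mhj j : measurable_fun setT (hj j) by exact: continuous_measurable_fun.
  have ihj j u : leb.-integrable `]-oo, u] (EFin \o hj j).
    have ii := @integrable_indic_itv R r u true false.
    have : leb.-integrable (`]-oo, u]%classic : set (measurableTypeR R))
        (EFin \o \1_(`[r, u]%classic)).
      exact: integrableS ii.
    move=> i1; apply: (integrable_Rle _ _ i1) => //.
      by apply: measurable_funTS; exact: mhj.
    move=> x /=; rewrite in_itv/= => xu; rewrite indicE.
    have [rx|/ltW xr] := leP r x; first by rewrite mem_set ?hj1//= in_itv/= rx.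
    by rewrite hj0// normr0.
  (* The integral may start at -oo because [hj] vanishes on the left of [r]; the fundamental theorem
     then holds at every point. *)
  pose Fj j t := \int[leb]_(x in `]-oo, t]) hj j x.
  have Hj j : acH (hj j).
    apply: (@acH_continuous _ (Fj j) 1) => //.
      move=> t; have tu : t < t + 1 by rewrite ltrDl.
      exact: (@continuous_FTC1 R (hj j) -oo%O t (t + 1) tu (ihj j _) (ltNyr _) (chj j t)).
    move=> s t st; rewrite /Fj Rintegral_itvB ?bnd_simp//.
    rewrite Rintegral_itv_obnd_cbnd//.
    by apply: integrableS (ihj j t) => // x; rewrite /= !in_itv/= => /andP[].
  have bhj j : bounded (hj j) by split => //; exists 1.
  have [Md Md0 dthM] := bounded_on (within_cont cth).
  have [Mt Mt0 thM] := bounded_on (within_cont cont_th).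
  have hjcv t : hj j t @[j --> \oo] --> (\1_(`]r, +oo[%classic) t : R).
    rewrite indicE; have [tr|rt] := leP t r.
      rewrite memNset; last by rewrite /= in_itv/= andbT; apply/negP; rewrite -leNgt.
      by apply: cvg_near_cst; apply: nearW => j; exact: hj0.
    rewrite mem_set/= ?in_itv/= ?rt//.
    have tr0 : 0 < t - r by rewrite subr_gt0.
    apply: cvg_near_cst; near=> j; rewrite /hj.
    have h1 : 1 <= j.+1%:R * (t - r).
      rewrite -ler_pdivrMr// mul1r.
      apply: le_trans (_ : j%:R <= _); last by rewrite ler_nat.
      by near: j; exact: nbhs_infty_ger.
    by rewrite (max_idPr _) ?(min_idPl _)//; apply: le_trans h1.
  apply: (cvg_unique (@Rhausdorff R) (_ : (\int[leb]_(x in Iab) (Pr (hj j) (U x) * derive1 th x))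
      @[j --> \oo] --> _)).
    apply: (Rdominated_convergence mI (g := cst (1 * (2 * M) * Md))).
    - by move=> k; apply: measurable_funM => //; exact: mPr.
    - apply: measurable_funM => //; apply: mPr; split; first exact: measurable_indic.
      by exists 1 => x; rewrite indicE; case: (_ \in _); rewrite ?normr1 ?normr0.
    - apply: aeW => x Ix; apply: cvgM; last exact: cvg_cst.
      apply: (Rdominated_convergence _ (g := cst 1)) => //.
      + by move=> k; apply: measurable_funTS; exact: mhj.
      + by apply: aeW => y _; exact: hjcv.
      + by apply: integrable_Rcst => //; exact: lebesgue_itv_lty.
    - by apply: integrable_Rcst => //; exact: lebesgue_itv_lty.
    - move=> k x Ix /=; rewrite normrM; apply: ler_pM => //; last exact: dthM.
      exact: Pr_bound.
  rewrite (_ : (fun j : nat => _) = (fun j =>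
      - \int[leb]_(x in Iab) (hj j (U x) * G x * th x))); last first.
    by apply/funext => j; exact: Hj.
  apply: cvgN.
  apply: (Rdominated_convergence mI (g := fun x : measurableTypeR R => (1 * Mt) * `|G x|)).
  - by move=> k; apply: measurable_funM => //; apply: measurable_funM => //; exact: mhU.
  - apply: measurable_funM => //; apply: measurable_funM => //; apply: mhU.
    exact: measurable_indic.
  - apply: aeW => x Ix; apply: cvgM; last exact: cvg_cst.
    by apply: cvgM; [exact: hjcv|exact: cvg_cst].
  - have := integrableZl mI (1 * Mt) (integrable_abse iG).
    by apply: eq_integrable => // x _ /=.
  - move=> k x Ix /=; rewrite !normrM mulrAC ler_wpM2r//.
    by apply: ler_pM => //; exact: thM.
Unshelve. all: by end_near. Qed.

End bounded.

(** [ac_fun c a G] stays in some [-M, M], so cutting [h] off outside that interval changes nothing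
    and reduces to the bounded case. *)
Lemma ac_chain c G F h : leb.-integrable Iab (EFin \o G) ->
  measurable_fun setT h -> (forall M, exists L, forall t, `|t| <= M -> `|h t| <= L) ->
  primitive F h ->
  \int[leb]_(x in Iab) (F (ac_fun c a G x) * derive1 th x) =
  - \int[leb]_(x in Iab) (h (ac_fun c a G x) * G x * th x).
Proof.
move=> iG mh hloc pF.
have [M M0 UM] := ac_fun_bounded c iG.
have [L hL] := hloc M.
pose hM := h \* \1_(`[- M, M]%classic).
have mhM : measurable_fun setT hM by apply: measurable_funM => //; exact: measurable_indic.
have hML x : `|hM x| <= Num.max L 0.
  rewrite /hM /= indicE; case: (boolP (x \in _)) => [/set_mem /=|_].
    by rewrite in_itv/= -ler_norml mulr1 => /hL; rewrite le_max => ->.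
  by rewrite mulr0 normr0 le_max lexx orbT.
have hME t : `|t| <= M -> hM t = h t.
  move=> tM; rewrite /hM /= indicE mem_set ?mulr1//=.
  by rewrite in_itv/= -ler_norml.
have bhM : measurable_fun setT hM /\ exists L0 : R, forall x, `|hM x| <= L0.
  by split => //; exists (Num.max L 0).
have := ac_chain_bounded iG UM bhM => /= E.
transitivity (\int[leb]_(x in Iab)
  ((\int[leb]_(y in `[(- M), (ac_fun c a G x)]) hM y) * derive1 th x)); last first.
  rewrite E; congr (- _); apply: eq_Rintegral => x /set_mem Ix.
  by rewrite hME// ltW// UM.
transitivity (\int[leb]_(x in Iab)
  ((\int[leb]_(y in `[(- M), (ac_fun c a G x)]) hM y) * derive1 th x + F (- M) * derive1 th x)).
  apply: eq_Rintegral => x /set_mem Ix; rewrite -mulrDl; congr (_ * _).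
  have := UM _ Ix; rewrite ltr_norml => /andP[/ltW U1 /ltW U2].
  rewrite -[LHS](subrK (F (- M))) pF//; congr (_ + _).
  apply: eq_Rintegral => y; rewrite inE/= in_itv/= => /andP[y1 y2].
  by rewrite hME// ler_norml y1 (le_trans y2).
rewrite RintegralD//; last 2 first.
- exact: ac_bounded_integrable.
- exact: ac_test_cst_integrable.
by rewrite (ac_test_cst c (F (- M))) [LHS]addr0.
Qed.

End fixed.
End ac_chain.

(** * The fundamental lemma of the calculus of variations on a box *)

Section fundamental_lemma.
Context {R : realType} {n : nat}.
Notation bl := (@borel_lebesgue_rV R n).
Notation leb := (@lebesgue_measure R).
Implicit Types (a b : 'rV[R]_n) (w : 'rV[R]_n -> R).

Lemma box_lty a b : (bl (cbox a b) < +oo)%E.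
Proof.
have [_ E] := @borel_lebesgue_rV_box R n
  (fun i => `[a ord0 i, b ord0 i]%classic) (fun i => measurable_itv _).
rewrite (_ : cbox a b = [set x | forall i,
    `[a ord0 i, b ord0 i]%classic (x ord0 i)]); last first.
  by apply/seteqP; split => x /= xab i; have := xab i; rewrite in_itv.
rewrite E; suff /andP[] : (0 <= \prod_(i < n) leb `[a ord0 i, b ord0 i]%classic)%E &&
  (\prod_(i < n) leb `[a ord0 i, b ord0 i]%classic < +oo)%E by [].
elim/big_ind : _ => [|x y /andP[x0 xoo] /andP[y0 yoo]|i _].
- by rewrite lee_fin ler01 ltry.
- by rewrite mule_ge0//= lte_mul_pinfty// ge0_fin_numE.
- by rewrite measure_ge0 lebesgue_itv_lty.
Qed.

Lemma zero_of_box_integrals a b w : measurable_fun setT w ->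
  bl.-integrable (obox a b) (EFin \o w) ->
  (forall a' b', good_box (obox a b) a' b' ->
    (\int[bl]_(x in obox a' b') (w x)%:E = 0)%E) ->
  {ae bl, forall x, obox a b x -> w x = 0}.
Proof.
move=> mw iw w0; have mab := measurable_obox a b.
have ae0 : ae_eq bl (obox a b) (EFin \o w) (cst 0).
  apply: integral_ae_eq => //.
  move=> E Eab mE; rewrite [RHS]integral0_eq//.
  apply: (@box_induction R n (obox a b) (fun S => \int[bl]_(x in S) (w x)%:E = 0)%E _ _ w0) => //.
  - exact: obox_open.
  - by rewrite integral_set0.
  - move=> A B mA mB AB Bab A0 B0.
    have : (\int[bl]_(x in A `|` (B `\` A)) (w x)%:E = 0)%E by rewrite setDUK.
    rewrite integral_setU_EFin ?A0 ?add0e//.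
    + exact: measurableD.
    + by apply: measurable_funTS.
    + by apply/disj_setPS => x [Ax []].
  - move=> F mF Fab tF F0.
    rewrite integral_bigcup//; first exact: eseries0.
    by apply: integrableS iw => //; [exact: bigcupT_measurable|move=> x [k _ /Fab]].
by apply: filterS ae0 => x /= h abx; have [] := h abx.
Qed.

Lemma box_indic_cvg a b x :
  box_bump k.+1%:R a b x @[k --> \oo] --> (\1_(obox a b) x : R).
Proof.
have := @tens_cvg R n (fun k i => sbump k.+1%:R (a ord0 i) (b ord0 i))
  (fun i => \1_(`]a ord0 i, b ord0 i[%classic)) x (fun i => @sbump_cvg R _ _ _).
rewrite (_ : tens _ x = \1_(obox a b) x)//.
rewrite /tens indicE; have [abx|] := pselect (obox a b x).
  rewrite mem_set// big1// => i _; rewrite indicE mem_set//= in_itv/=; exact: abx.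
move=> nabx; rewrite memNset//; move/existsNP : nabx => [i xi].
rewrite (bigD1 i)//= indicE memNset ?mul0r//= in_itv/=; exact: xi.
Qed.

Lemma box_bump_out (m : R) a b x : 0 < m -> ~ obox a b x -> box_bump m a b x = 0.
Proof.
by move=> m0; apply: tens_out => i t; exact: sbump_out.
Qed.

Lemma box_bump_measurable (m : R) a b : measurable_fun setT (box_bump m a b).
Proof.
apply: continuous_measurable_rV; apply: tens_smooth_continuous => i.
exact: sbump_smooth.
Qed.

(** Bumps on smaller boxes are tensor tests and converge boundedly to indicators, so [w] has zero
    integral over every box, hence over every Borel set. *)
Lemma zero_of_tests a b w : measurable_fun setT w ->
  bl.-integrable (cbox a b) (EFin \o w) ->
  (forall th : 'I_n -> R -> R, (forall i, smooth (th i)) ->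
     (forall i (t : R), ~~ (a ord0 i < t < b ord0 i) -> th i t = 0) ->
     \int[bl]_(x in cbox a b) (w x * tens th x) = 0) ->
  {ae bl, forall x, obox a b x -> w x = 0}.
Proof.
move=> mw iw w0; have mab := measurable_cbox a b.
have oc := @sub_obox_cbox R n a b.
apply: zero_of_box_integrals => //.
  by apply: integrableS iw => //; exact: measurable_obox.
move=> a' b' [ab' ab'ab].
have iw' : bl.-integrable (obox a' b') (EFin \o w).
  apply: integrableS iw => //; first exact: measurable_obox.
  by move=> x /sub_obox_cbox /ab'ab /oc.
rewrite -(EFin_Rintegral (measurable_obox _ _) iw'); suff -> : \int[bl]_(x in obox a' b') w x = 0 by [].
have cv : (\int[bl]_(x in cbox a b) (w x * box_bump k.+1%:R a' b' x)) @[k --> \oo] -->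
    \int[bl]_(x in cbox a b) (w x * \1_(obox a' b') x).
  apply: (Rdominated_convergence mab (g := fun x => `|w x|)).
  - move=> k; apply: measurable_funTS; apply: measurable_funM => //.
    exact: box_bump_measurable.
  - apply: measurable_funTS; apply: measurable_funM => //.
    by apply: measurable_indic; exact: measurable_obox.
  - apply: aeW => x _; apply: cvgM; first exact: cvg_cst.
    exact: box_indic_cvg.
  - exact: integrable_abse iw.
  - move=> k x _; rewrite normrM ler_piMr//.
    by have /andP[? ?] := box_bump_ge0 k.+1%:R a' b' x; rewrite ger0_norm.
have -> : \int[bl]_(x in obox a' b') w x = \int[bl]_(x in cbox a b) (w x * \1_(obox a' b') x).
  rewrite /Rintegral; congr fine.
  rewrite [LHS]integral_mkcond [RHS]integral_mkcond; apply: eq_integral => x _.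
  rewrite !patchE indicE; have [xab'|xab'] := boolP (x \in obox a' b').
    rewrite mem_set ?mulr1//; apply/oc/ab'ab/sub_obox_cbox; exact: set_mem.
  by rewrite mulr0; case: ifP.
apply: (cvg_unique (@Rhausdorff R) cv).
rewrite (_ : (fun k : nat => _) = cst 0); first exact: cvg_cst.
apply/funext => k; apply: w0 => [i|i t]; first exact: sbump_smooth.
rewrite negb_and -!leNgt => h; apply: sbump_out => //; rewrite negb_and -!leNgt.
have /andP[aa bb] : a ord0 i <= a' ord0 i <= b ord0 i.
  have : cbox a' b' a' by move=> j; rewrite lexx ltW.
  by move=> /ab'ab/oc /(_ i).
have /andP[aa' bb'] : a ord0 i <= b' ord0 i <= b ord0 i.
  have : cbox a' b' b' by move=> j; rewrite lexx ltW.
  by move=> /ab'ab/oc /(_ i).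
by case/orP: h => h; apply/orP; [left|right]; [exact: le_trans aa|exact: le_trans h].
Qed.

End fundamental_lemma.

(** * Singling out one coordinate, and Fubini along its lines *)

Section insert.
Context {R : realType} {m : nat} (i : 'I_m.+1).
Notation leb := (@lebesgue_measure R).
Notation bl := (@borel_lebesgue_rV R m).
Notation bl1 := (@borel_lebesgue_rV R m.+1).

Definition ins (p : 'rV[R]_m * R) : 'rV[R]_m.+1 :=
  \row_j oapp (fun k => p.1 ord0 k) p.2 (unlift i j).

Definition del (x : 'rV[R]_m.+1) : 'rV[R]_m := \row_k x ord0 (lift i k).

Lemma ins_i p : ins p ord0 i = p.2.
Proof. by rewrite mxE unlift_none. Qed.

Lemma ins_lift p k : ins p ord0 (lift i k) = p.1 ord0 k.
Proof. by rewrite mxE liftK. Qed.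

Lemma ins_del x : ins (del x, x ord0 i) = x.
Proof.
by apply/rowP => j; rewrite mxE; case: unliftP => [k ->|->] //=; rewrite mxE.
Qed.

Lemma measurable_ins : measurable_fun setT ins.
Proof.
apply: measurable_fun_rVP => j; under eq_fun do rewrite mxE.
case: unliftP => [k _|_] /=; last exact: measurable_snd.
by apply: (measurableT_comp (measurable_coord k)); exact: measurable_fst.
Qed.

Lemma preimage_ins_obox a b :
  ins @^-1` obox a b = obox (del a) (del b) `*` `]a ord0 i, b ord0 i[%classic.
Proof.
apply/seteqP; split => -[y t] /=.
  move=> h; split; last by have := h i; rewrite ins_i in_itv.
  by move=> k; rewrite !mxE; have := h (lift i k); rewrite ins_lift.
move=> [h1 h2] j; rewrite mxE; case: unliftP => [k ->|->] /=; last by rewrite in_itv in h2.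
by have := h1 k; rewrite !mxE.
Qed.

Lemma preimage_ins_cbox a b (y : 'rV[R]_m) (t : R) :
  cbox a b (ins (y, t)) <-> cbox (del a) (del b) y /\ a ord0 i <= t <= b ord0 i.
Proof.
split.
  move=> h; split; last by have := h i; rewrite ins_i.
  by move=> k; rewrite !mxE; have := h (lift i k); rewrite ins_lift.
move=> [h1 h2] j; rewrite mxE; case: unliftP => [k ->|->] //=.
by have := h1 k; rewrite !mxE.
Qed.

Lemma obox_volume n (a b : 'rV[R]_n) : borel_lebesgue_rV n (obox a b) =
  (\prod_(j < n) leb `]a ord0 j, b ord0 j[%classic)%E.
Proof.
have [_ <-] := @borel_lebesgue_rV_box R n
  (fun j => `]a ord0 j, b ord0 j[%classic) (fun j => measurable_itv _).
by congr (borel_lebesgue_rV n _).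
Qed.

(** The product measure is built by adding coordinates at the front; that any coordinate may be
    split off follows by uniqueness, both measures agreeing on boxes. *)
Lemma ins_volume A : measurable A ->
  bl1 A = pushforward (bl \x leb)%E ins A.
Proof.
move=> mA.
pose g (k : nat) : set 'rV[R]_m.+1 := obox (const_mx (- k%:R)) (const_mx k%:R).
apply: (@measure_unique _ R _ [set S | exists a b, S = obox a b] g _ _ _ _
   bl1 (pushforward (bl \x leb)%E ins)) => //.
- exact: measurable_rV_obox.
- by move=> _ _ [a1 [b1 ->]] [a2 [b2 ->]]; rewrite oboxI; do 2 eexists.
- by move=> k; do 2 eexists.
- apply/seteqP; split => // x _.
  pose S := \sum_j `|x ord0 j|.
  exists (Num.bound S) => // j; rewrite !mxE -ltr_norml.
  apply: le_lt_trans (archi_boundP _); last exact: sumr_ge0.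
  by rewrite /S (bigD1 j)//= lerDl sumr_ge0.
- exact: measurable_ins.
- move=> ms _ [a [b ->]].
  transitivity ((bl \x leb)%E (obox (del a) (del b) `*` `]a ord0 i, b ord0 i[%classic));
    last by rewrite /pushforward -preimage_ins_obox.
  rewrite product_measure1E//; last exact: measurable_obox.
  apply: etrans (obox_volume a b) _.
  rewrite (bigD1_ord i)//= muleC; congr (_ * _)%E.
  apply: etrans (esym (obox_volume (del a) (del b))).
  by apply: eq_bigr => k _; rewrite !mxE.
- move=> k; apply: le_lt_trans (box_lty (const_mx (- k%:R)) (const_mx k%:R)).
  by apply: le_measure; rewrite ?inE; [exact: measurable_obox|exact: measurable_cbox|exact: sub_obox_cbox].
Qed.

Section fubini.
Variables (a b : 'rV[R]_m.+1) (F : 'rV[R]_m.+1 -> R).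
Hypothesis (mF : measurable_fun setT F)
  (iF : bl1.-integrable (cbox a b) (EFin \o F)).

Let f (p : 'rV[R]_m * R) : \bar R := ((EFin \o F) \_ (cbox a b)) (ins p).

Let iF0 : bl1.-integrable setT ((EFin \o F) \_ (cbox a b)).
Proof. by apply/integrable_restrict => //; rewrite ?setTI//; exact: measurable_cbox. Qed.

Let if_ : (bl \x leb)%E.-integrable setT f.
Proof.
have mF0 := measurable_int _ iF0.
apply/integrableP; split; first exact: measurableT_comp mF0 measurable_ins.
move: iF0 => /integrableP[_]; apply: le_lt_trans.
rewrite [leRHS](_ : _ = \int[pushforward (bl \x leb)%E ins]_x `|((EFin \o F) \_ (cbox a b)) x|)%E.
  rewrite ge0_integral_pushforward//; first exact: measurable_ins.
  exact: measurableT_comp.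
by apply: eq_measure_integral => [|mi A mA _]; [exact: measurable_ins|exact: ins_volume].
Qed.

Let fE y t : f (y, t) = if (y \in cbox (del a) (del b)) && (t \in `[a ord0 i, b ord0 i])
  then (F (ins (y, t)))%:E else 0%E.
Proof.
rewrite /f patchE /=; case: ifPn => [/set_mem/preimage_ins_cbox[h1 h2]|h].
  by rewrite mem_set// in_itv/= h2.
case: ifPn => // /andP[/set_mem h1]; rewrite in_itv/= => h2.
by move: h; rewrite mem_set//; apply/preimage_ins_cbox.
Qed.

Lemma ins_ae_integrable : {ae bl, forall y, cbox (del a) (del b) y ->
  leb.-integrable `[a ord0 i, b ord0 i] (fun t => (F (ins (y, t)))%:E)}.
Proof.
have := ae_integrable1 if_; apply: filterS => y iy yab.
rewrite -[X in leb.-integrable X](setTI) integrable_restrict//.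
move: iy; apply: eq_integrable => // t _ /=.
rewrite fE mem_set//= patchE /=; congr (if _ then _ else _).
by apply/idP/idP => [/mem_set|/set_mem].
Qed.

Let inner y := \int[leb]_(t in `[a ord0 i, b ord0 i]) F (ins (y, t)).

Let fubini_FE y : cbox (del a) (del b) y ->
  (\int[leb]_t f (y, t) = \int[leb]_(t in `[a ord0 i, b ord0 i]) (F (ins (y, t)))%:E)%E.
Proof.
move=> yab; rewrite [RHS]integral_mkcond; apply: eq_integral => t _.
rewrite fE mem_set//= patchE /=; congr (if _ then _ else _).
by apply/idP/idP => [/mem_set|/set_mem].
Qed.

Lemma ins_inner_integrable : bl.-integrable (cbox (del a) (del b))
  (fun y => \int[leb]_(t in `[a ord0 i, b ord0 i]) (F (ins (y, t)))%:E)%E.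
Proof.
have := integrable_fubini_F if_ => iFF.
have : bl.-integrable (cbox (del a) (del b)) (fubini_F leb f).
  by apply: integrableS iFF => //; exact: measurable_cbox.
apply: eq_integrable; first exact: measurable_cbox.
by move=> y /set_mem yab; exact: fubini_FE.
Qed.

Lemma ins_fubini : (\int[bl1]_(x in cbox a b) (F x)%:E =
  \int[bl]_(y in cbox (del a) (del b))
    \int[leb]_(t in `[a ord0 i, b ord0 i]) (F (ins (y, t)))%:E)%E.
Proof.
transitivity (\int[(bl \x leb)%E]_p f p)%E.
  rewrite integral_mkcond.
  transitivity (\int[pushforward (bl \x leb)%E ins]_x ((EFin \o F) \_ (cbox a b)) x)%E.
    by apply: eq_measure_integral => [|mi A mA _]; [exact: measurable_ins|exact: ins_volume].
  rewrite integral_pushforward//; first exact: measurable_ins.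
    exact: measurable_int iF0.
rewrite -(integral12_prod_meas1 if_) [RHS]integral_mkcond.
apply: eq_integral => y _; rewrite patchE; case: ifPn => [/set_mem yab|yab].
  exact: fubini_FE.
rewrite /fubini_F integral0_eq// => t _.
by rewrite fE (negbTE yab).
Qed.

End fubini.

End insert.

(** * Absolute continuity on lines *)

Lemma integral_support d (T : measurableType d) (R : realType)
    (mu : {measure set T -> \bar R}) (D E : set T) (f : T -> \bar R) :
  E `<=` D -> (forall x, D x -> ~ E x -> f x = 0%E) ->
  (\int[mu]_(x in D) f x = \int[mu]_(x in E) f x)%E.
Proof.
move=> ED f0; rewrite [LHS]integral_mkcond [RHS]integral_mkcond.
apply: eq_integral => x _; rewrite !patchE.
have [Ex|nEx] := pselect (E x); first by rewrite !mem_set//; exact: ED.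
rewrite (memNset nEx); case: ifPn => // /set_mem Dx; exact: f0.
Qed.

Section weak_derivative_1d.
Context {R : realType}.
Notation leb := (@lebesgue_measure R).
Variables (a b : R).
Hypothesis ab : a < b.

Let Iab := `[a, b]%classic.
Let mI : measurable (Iab : set (measurableTypeR R)). Proof. exact: measurable_itv. Qed.

Definition bump_mass (m : nat) (p q : R) : R :=
  \int[leb]_(t in Iab) sbump m.+1%:R p q t.

(* Test functions are obtained as primitives of differences of two           *)
(* normalized bumps.                                                          *)
Definition bumpdiff (m : nat) (p q : R) : R -> R :=
  (cst (bump_mass m p q)^-1 \* sbump m.+1%:R p q) \+
  (cst (- (bump_mass m a b)^-1) \* sbump m.+1%:R a b).

Definition bumpprim (m : nat) (p q : R) (t : R) : R :=
  \int[leb]_(x in `]-oo, t]) bumpdiff m p q x.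

Lemma bumpdiff_smooth m p q : smooth (bumpdiff m p q).
Proof.
by move=> k; apply: CkD; apply: CkM; [exact: smooth_cst|exact: sbump_smooth|
  exact: smooth_cst|exact: sbump_smooth].
Qed.

Lemma bumpdiff_out m p q t : a <= p -> q <= b -> ~~ (a < t < b) -> bumpdiff m p q t = 0.
Proof.
move=> ap qb tab; rewrite /bumpdiff /= (sbump_out _ tab)// mulr0 addr0.
rewrite (@sbump_out R) ?mulr0//; apply: contra tab => /andP[pt tq].
by rewrite (le_lt_trans ap pt) (lt_le_trans tq qb).
Qed.

Lemma sbump_integrable m p q :
  leb.-integrable Iab (EFin \o sbump m.+1%:R p q).
Proof.
apply: (@integrable_itv_bounded R _ a b 1).
  by apply: continuous_measurable_fun; exact/smooth_continuous/sbump_smooth.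
by move=> x; have /andP[? ?] := sbump_ge0 m.+1%:R p q x; rewrite ger0_norm.
Qed.

Lemma bump_mass_gt0 m p q : a <= p -> p < q -> q <= b -> 0 < bump_mass m p q.
Proof.
move=> ap pq qb; have i1 := sbump_integrable m p q.
have b0 x : 0 <= sbump m.+1%:R p q x by have /andP[] := sbump_ge0 m.+1%:R p q x.
rewrite lt_neqAle Rintegral_ge0// andbT eq_sym; apply/eqP => N0.
have : (\int[leb]_(x in Iab) `|(EFin \o sbump m.+1%:R p q) x| = 0)%E.
  transitivity (\int[leb]_(x in Iab) (sbump m.+1%:R p q x)%:E)%E.
    by apply: eq_integral => x _ /=; rewrite ger0_norm.
  by rewrite -(EFin_Rintegral mI i1); exact: (congr1 EFin N0).
move=> /(ae_eq_integral_abs _ mI (measurable_int _ i1))[Z [mZ Z0 subZ]].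
have : (leb `]p, q[%classic <= leb Z)%E.
  apply: le_measure; rewrite ?inE// => x /=; rewrite in_itv/= => pxq.
  apply: subZ => /= h; have : Iab x.
    rewrite /Iab /= in_itv/=; have /andP[px xq] := pxq.
    by rewrite (le_trans ap (ltW px)) (le_trans (ltW xq) qb).
  move=> /h [] sb0; have := @sbump_gt0 R m.+1%:R p q x (ltr0Sn _ _) pxq.
  by rewrite sb0 ltxx.
rewrite [leb Z]Z0 lebesgue_measure_itv/= lte_fin pq -EFinB lee_fin subr_le0 leNgt.
by rewrite pq.
Qed.

Lemma bumpdiff_integrable m p q : leb.-integrable Iab (EFin \o bumpdiff m p q).
Proof.
have := integrableD mI (integrableZl mI (bump_mass m p q)^-1 (sbump_integrable m p q))
  (integrableZl mI (- (bump_mass m a b)^-1) (sbump_integrable m a b)).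
by apply: eq_integrable => // x _.
Qed.

Lemma bumpdiff_integral m p q : a <= p -> p < q -> q <= b ->
  \int[leb]_(t in Iab) bumpdiff m p q t = 0.
Proof.
move=> ap pq qb; rewrite /bumpdiff /= RintegralD//; last 2 first.
- have := integrableZl mI (bump_mass m p q)^-1 (sbump_integrable m p q).
  by apply: eq_integrable => // x _.
- have := integrableZl mI (- (bump_mass m a b)^-1) (sbump_integrable m a b).
  by apply: eq_integrable => // x _.
rewrite !RintegralZl//; [|exact: sbump_integrable..].
rewrite mulVf ?gt_eqF ?bump_mass_gt0// mulNr.
by rewrite mulVf ?gt_eqF ?bump_mass_gt0// subrr.
Qed.

Lemma bumpdiff_integrableNy m p q u : a <= p -> q <= b ->
  leb.-integrable `]-oo, u] (EFin \o bumpdiff m p q).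
Proof.
move=> ap qb.
have mu : measurable (`]-oo, u]%classic : set (measurableTypeR R)) by [].
have : leb.-integrable setT ((EFin \o bumpdiff m p q) \_ Iab).
  by apply/integrable_restrict => //; rewrite setTI; exact: bumpdiff_integrable.
move=> /(integrableS measurableT mu (@subsetT _ _)); apply: eq_integrable => //.
move=> x _; rewrite patchE; case: ifPn => // xab; apply/esym; congr EFin; apply: bumpdiff_out => //.
by move: xab; apply: contra => /andP[ax xb]; rewrite mem_set//= /Iab/= in_itv/= !ltW.
Qed.

Lemma bumpprim_derive m p q t : a <= p -> q <= b ->
  derivable (bumpprim m p q) t 1 /\ derive1 (bumpprim m p q) t = bumpdiff m p q t.
Proof.
move=> ap qb; have tu : t < t + 1 by rewrite ltrDl.
apply: (@continuous_FTC1 R (bumpdiff m p q) -oo%O t (t + 1) tu _ (ltNyr _)).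
  exact: bumpdiff_integrableNy.
exact/smooth_continuous/bumpdiff_smooth.
Qed.

Lemma bumpprim_smooth m p q : a <= p -> q <= b -> smooth (bumpprim m p q).
Proof.
move=> ap qb [//|k]; split=> [x|]; first by have [] := bumpprim_derive m x ap qb.
rewrite (_ : derive1 _ = bumpdiff m p q); first exact: bumpdiff_smooth.
by apply/funext => x; have [] := bumpprim_derive m x ap qb.
Qed.

Lemma bumpprim_out m p q t : a <= p -> p < q -> q <= b -> ~~ (a < t < b) ->
  bumpprim m p q t = 0.
Proof.
move=> ap pq qb; rewrite negb_and -!leNgt /bumpprim => /orP[ta|bt].
  rewrite /Rintegral integral0_eq// => x /=; rewrite in_itv/= => xt.
  rewrite bumpdiff_out// negb_and -!leNgt (le_trans xt ta)//.
rewrite -[RHS](bumpdiff_integral m ap pq qb) /Rintegral; congr fine.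
apply: integral_support => x; rewrite /Iab /= !in_itv/=.
  by move=> /andP[_ /le_trans]; exact.
move=> _ /negP xab; rewrite bumpdiff_out//; apply: contra xab => /andP[ax xb].
by rewrite !ltW.
Qed.

(** The primitive [Phi] of [K] is continuous, equal at all rationals of ]a, b[, and 0 at [a]. Hence
    it vanishes, and [K] is its derivative almost everywhere. *)
Lemma zero_of_rat_integrals (K : R -> R) : leb.-integrable Iab (EFin \o K) ->
  (forall p q : rat, a < ratr p -> ratr p < ratr q :> R -> ratr q < b ->
     \int[leb]_(t in `]ratr p, ratr q[) K t = 0) ->
  {ae leb, forall t, Iab t -> K t = 0}.
Proof.
move=> iK K0; pose Phi x := \int[leb]_(t in `[a, x]) K t.
have cPhi : {within Iab, continuous Phi}.
  exact: (parameterized_integral_continuous (ltW ab) iK).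
have [cPhi_in cPhia _] := (continuous_within_itvP _ ab).1 cPhi.
have Phia : Phi a = 0 by rewrite /Phi set_itv1 Rintegral_set1.
have Phi_rat (p q : rat) : a < ratr p -> ratr p < ratr q :> R -> ratr q < b ->
    Phi (ratr p) = Phi (ratr q).
  move=> ap pq qb; apply/esym/eqP; rewrite -subr_eq0; apply/eqP.
  rewrite /Phi Rintegral_itvB ?bnd_simp; [|by apply: integrableS iK => //;
    apply: subset_itvl; rewrite bnd_simp ltW|exact: ltW|exact: ltW].
  rewrite -Rintegral_itv_bndo_bndc; first exact: K0.
  apply: integrableS iK => // x /=; rewrite /Iab /= !in_itv/= => /andP[px xq].
  by rewrite (ltW (lt_trans ap px)) (ltW (lt_trans xq qb)).
have Phi0 x : a < x < b -> Phi x = 0.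
  move=> /andP[ax xb]; apply/eqP; rewrite -normr_le0; apply/ler_addgt0Pr => e e0.
  rewrite add0r.
  have cx : Phi y @[y --> x] --> Phi x by apply: cPhi_in; rewrite in_itv/= ax.
  have e20 : 0 < e / 2 by rewrite divr_gt0.
  have /cvgrPdist_le/(_ _ e20)/nbhs_ballP[r /= r0 hr] := cx.
  have /cvgrPdist_le/(_ _ e20) := cPhia; rewrite near_withinE => -[s /= s0 hs].
  (* A rational [p] just right of [x] and a rational [q] just right of [a] link Phi x to Phi p = Phi
     q and then to Phi a = 0. *)
  pose r' := Num.min r (Num.min (x - a) (b - x)).
  have r'0 : 0 < r' by rewrite !lt_min r0 !subr_gt0 ax xb.
  have [p /andP[px1 px2]] := @ratr_between R x _ r'0.
  pose s' := Num.min s (x - a).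
  have s'0 : 0 < s' by rewrite lt_min s0 subr_gt0.
  have [q /andP[qx1 qx2]] := @ratr_between R a _ s'0.
  have pr : ratr p < x + r.
    by apply: lt_le_trans px2 _; rewrite lerD2l ge_min lexx.
  have pb : ratr p < b.
    apply: lt_le_trans px2 _; rewrite -lerBrDl.
    by rewrite /r' !ge_min lexx !orbT.
  have qs : ratr q < a + s.
    by apply: lt_le_trans qx2 _; rewrite lerD2l ge_min lexx.
  have qx : ratr q < x.
    by apply: lt_le_trans qx2 _; rewrite -lerBrDl /s' ge_min lexx orbT.
  have h1 : `|Phi x - Phi (ratr p)| <= e / 2.
    by apply: hr; rewrite /ball/= distrC ger0_norm ?subr_ge0 ?(ltW px1)// ltrBlDl.
  have h2 : `|Phi a - Phi (ratr q)| <= e / 2.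
    by apply: hs => //=; rewrite distrC ger0_norm ?subr_ge0 ?(ltW qx1)// ltrBlDl.
  move: h2; rewrite Phia sub0r normrN (Phi_rat q p)//; last exact: lt_trans px1.
  move=> h2; rewrite -[Phi x](subrK (Phi (ratr p))).
  apply: le_trans (ler_normD _ _) _; rewrite [leRHS]splitr; exact: lerD.
pose K' := K \_ Iab.
have iK' y : leb.-integrable `[a, y] (EFin \o K').
  have : leb.-integrable setT ((EFin \o K) \_ Iab).
    by apply/integrable_restrict => //; rewrite setTI.
  rewrite -restrict_EFin.
  by move=> /integrableS; apply.
have locK' : locally_integrable setT K' by exact: integrable_locally.
have /= FTC := FTC1 iK' locK'.
have ae_neq (c : R) : {ae leb, forall x, x != c}.
  exists [set c]; split => //; first exact: lebesgue_measure_set1.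
  by move=> x /= /negP; rewrite negbK => /eqP.
have FF := ae_filter_ringOfSetsType leb.
apply: filterS3 FTC (ae_neq a) (ae_neq b) => x hx xa xb.
rewrite /Iab /= in_itv/= => /andP[ax xb'].
have ax' : a < x by rewrite lt_neqAle eq_sym xa.
have xb'' : x < b by rewrite lt_neqAle xb.
have [|_ ] := hx; first by rewrite lte_fin.
rewrite /K' patchE mem_set /=; last by rewrite /Iab /= in_itv/= ax.
move=> <-; rewrite derive1E; rewrite (@near_eq_derive _ _ _ _ (cst 0)); last first.
  near=> y; rewrite -[RHS](Phi0 y); last first.
    by apply/andP; split; near: y; [exact: lt_nbhsr|exact: lt_nbhsl].
  rewrite /Phi; apply: eq_Rintegral => t; rewrite inE/= in_itv/= => /andP[at1 ty].
  rewrite patchE mem_set// /Iab /= in_itv/= at1/= (le_trans ty)//.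
  by apply: ltW; near: y; exact: lt_nbhsl.
by rewrite -derive1E derive1_cst.
Unshelve. all: by end_near. Qed.

(** W = U - int G integrates to 0 against [bumpdiff], so its mean against a normalized bump on ]p,
    q[ equals the one on ]a, b[. Letting the bumps sharpen, [W] has the same mean over all rational
    subintervals, hence is constant. Only countably many tests occur, so that exceptional sets of
    lines can later be united. *)
Lemma weak_1d (U G : R -> R) :
  leb.-integrable Iab (EFin \o U) -> leb.-integrable Iab (EFin \o G) ->
  (forall m (p q : rat), a < ratr p -> ratr p < ratr q :> R -> ratr q < b ->
     \int[leb]_(t in Iab) (U t * bumpdiff m (ratr p) (ratr q) t) =
     - \int[leb]_(t in Iab) (G t * bumpprim m (ratr p) (ratr q) t)) ->
  exists c, {ae leb, forall t, Iab t -> U t = ac_fun c a G t}.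
Proof.
move=> iU iG UG; pose W t := U t - ac_fun 0 a G t.
have cV := @ac_fun_continuous R a b ab 0 G iG.
have [M M0 VM] := @ac_fun_bounded R a b ab 0 G iG.
have mV : measurable_fun (Iab : set (measurableTypeR R)) (ac_fun 0 a G).
  exact: subspace_continuous_measurable_fun.
have iV : leb.-integrable Iab (EFin \o ac_fun 0 a G).
  apply: (@integrable_Rle _ _ _ _ _ _ _ (cst M)) => //.
    by apply: integrable_Rcst => //; exact: lebesgue_itv_lty.
  by move=> x /VM /ltW.
have iW : leb.-integrable Iab (EFin \o W).
  have := integrableB mI iU iV; by apply: eq_integrable => // x _.
have iWb m p q : leb.-integrable Iab (EFin \o (fun t => W t * sbump m.+1%:R p q t)).
  have := @integrableMb _ _ _ leb _ mI W (sbump m.+1%:R p q) 1 _ iW.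
  rewrite (_ : (fun x => _ * W x) = (fun t => W t * sbump m.+1%:R p q t)); last first.
    by apply/funext => t; rewrite mulrC.
  apply; first by apply: measurable_funTS; apply: continuous_measurable_fun; exact/smooth_continuous/sbump_smooth.
  by move=> x _; have /andP[? ?] := sbump_ge0 m.+1%:R p q x; rewrite ger0_norm.
have W0 m (p q : rat) : a < ratr p -> ratr p < ratr q :> R -> ratr q < b ->
    \int[leb]_(t in Iab) (W t * bumpdiff m (ratr p) (ratr q) t) = 0.
  move=> ap pq qb; have ap' := ltW ap; have qb' := ltW qb.
  have dth x : derivable (bumpprim m (ratr p) (ratr q)) x 1 by have [] := bumpprim_derive m x ap' qb'.
  have dthE : derive1 (bumpprim m (ratr p) (ratr q)) = bumpdiff m (ratr p) (ratr q).
    by apply/funext => x; have [] := bumpprim_derive m x ap' qb'.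
  have cdth : continuous (derive1 (bumpprim m (ratr p) (ratr q))).
    by rewrite dthE; exact/smooth_continuous/bumpdiff_smooth.
  have tha : bumpprim m (ratr p) (ratr q) a = 0 by apply: bumpprim_out => //; rewrite ltxx.
  have thb : bumpprim m (ratr p) (ratr q) b = 0 by apply: bumpprim_out => //; rewrite ltxx andbF.
  have := @ac_chain R a b _ ab dth cdth tha thb 0 G id (cst 1) iG (@measurable_cst _ _ _ _ _ _).
  rewrite dthE => AC.
  have ie (V : R -> R) : leb.-integrable Iab (EFin \o V) ->
      leb.-integrable Iab (EFin \o (fun t => V t * bumpdiff m (ratr p) (ratr q) t)).
    move=> iV'; have [K hK] : exists K : R, forall x, Iab x -> `|bumpdiff m (ratr p) (ratr q) x| <= K.
      exists (`|(bump_mass m (ratr p) (ratr q))^-1| + `|- (bump_mass m a b)^-1|) => x _.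
      have sb c p' q' : `|c * sbump m.+1%:R p' q' x| <= `|c|.
        by rewrite normrM -[leRHS]mulr1; apply: ler_wpM2l => //; exact: sbump_norm_le1.
      by apply: le_trans (ler_normD _ _) _; apply: lerD; exact: sb.
    have := @integrableMb _ _ _ leb _ mI V (bumpdiff m (ratr p) (ratr q)) K _ iV'.
    rewrite (_ : (fun x => _ * V x) = (fun t => V t * bumpdiff m (ratr p) (ratr q) t)); last first.
      by apply/funext => t; rewrite mulrC.
    apply => //; apply: measurable_funTS; apply: continuous_measurable_fun.
    exact/smooth_continuous/bumpdiff_smooth.
  transitivity (\int[leb]_(t in Iab) (U t * bumpdiff m (ratr p) (ratr q) t - ac_fun 0 a G t * bumpdiff m (ratr p) (ratr q) t)).
    by apply: eq_Rintegral => t _; rewrite /W mulrBl.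
  rewrite RintegralB//; [|exact: ie..]; rewrite UG// AC.
  - apply/eqP; rewrite subr_eq0; apply/eqP; congr (- _).
    by apply: eq_Rintegral => t _ /=; rewrite mul1r.
  - by move=> K; exists 1 => t _; rewrite normr1.
  - move=> s t st; rewrite Rintegral_cst// mul1r.
    move: st; rewrite /= lebesgue_measure_itv/= lte_fin le_eqVlt.
    by move=> /predU1P[->|->//]; rewrite ltxx subrr.
have cvW p q : a <= p -> p <= q -> q <= b ->
    (\int[leb]_(t in Iab) (W t * sbump m.+1%:R p q t)) @[m --> \oo] --> \int[leb]_(t in `]p, q[) W t.
  move=> ap pq qb.
  have -> : \int[leb]_(t in `]p, q[) W t = \int[leb]_(t in Iab) (W t * \1_(`]p, q[%classic) t).
    rewrite /Rintegral; congr fine; apply/esym.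
    transitivity (\int[leb]_(t in `]p, q[) (W t * \1_(`]p, q[%classic) t)%:E)%E.
      apply: (@integral_support _ (measurableTypeR R)).
        move=> t; rewrite /Iab/= !in_itv/= => /andP[pt tq].
        by rewrite (le_trans ap (ltW pt)) (le_trans (ltW tq) qb).
      by move=> t _ tpq; rewrite indicE memNset// mulr0.
    by apply: eq_integral => t tpq; rewrite indicE tpq mulr1.
  apply: (Rdominated_convergence mI (g := fun t : measurableTypeR R => `|W t|)).
  - by move=> m; apply/measurable_EFinP; exact: measurable_int (iWb m p q).
  - apply: measurable_funM; last by apply: measurable_indic.
    by apply/measurable_EFinP; exact: measurable_int iW.
  - apply: aeW => t _; apply: cvgM; first exact: cvg_cst.
    exact: sbump_cvg.
  - exact: integrable_abse iW.
  - move=> m t _; rewrite normrM ler_piMr//.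
    by have /andP[? ?] := sbump_ge0 m.+1%:R p q t; rewrite ger0_norm.
have cvN p q : a <= p -> p <= q -> q <= b -> bump_mass m p q @[m --> \oo] --> q - p.
  move=> ap pq qb.
  have -> : q - p = \int[leb]_(t in Iab) (\1_(`]p, q[%classic) t).
    rewrite /Rintegral integral_indic// setIidl; last first.
      move=> t; rewrite /Iab/= !in_itv/= => /andP[pt tq].
      by rewrite (le_trans ap (ltW pt)) (le_trans (ltW tq) qb).
    move: pq; rewrite [X in _ -> _ = fine X](@lebesgue_measure_itv R)/= lte_fin le_eqVlt.
    by move=> /predU1P[->|->//]; rewrite ltxx subrr.
  apply: (Rdominated_convergence mI (g := cst 1)).
  - by move=> m; apply/measurable_EFinP; exact: measurable_int (sbump_integrable m p q).
  - exact: measurable_indic.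
  - by apply: aeW => t _; exact: sbump_cvg.
  - by apply: integrable_Rcst => //; exact: lebesgue_itv_lty.
  - by move=> m t _ /=; have /andP[? ?] := sbump_ge0 m.+1%:R p q t; rewrite ger0_norm.
(* The constant is the mean of [W] over the whole interval. *)
pose c := (b - a)^-1 * \int[leb]_(t in `]a, b[) W t.
exists c.
have ba0 : b - a != 0 by rewrite subr_eq0 gt_eqF.
have Wpq (p q : rat) : a < ratr p -> ratr p < ratr q :> R -> ratr q < b ->
    \int[leb]_(t in `]ratr p, ratr q[) W t = c * (ratr q - ratr p).
  move=> ap pq qb; have pq0 : ratr q - ratr p != 0 :> R by rewrite subr_eq0 gt_eqF.
  have E m : (bump_mass m (ratr p) (ratr q))^-1 * (\int[leb]_(t in Iab) (W t * sbump m.+1%:R (ratr p) (ratr q) t)) =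
      (bump_mass m a b)^-1 * (\int[leb]_(t in Iab) (W t * sbump m.+1%:R a b t)).
    have := W0 m p q ap pq qb.
    rewrite (@eq_Rintegral _ _ _ _ _ (fun t : measurableTypeR R =>
       (bump_mass m (ratr p) (ratr q))^-1 * (W t * sbump m.+1%:R (ratr p) (ratr q) t) -
       (bump_mass m a b)^-1 * (W t * sbump m.+1%:R a b t))); last first.
      by move=> t _; rewrite /bumpdiff/=; ring.
    have i1 k r p' q' : leb.-integrable Iab
        (EFin \o (fun t : measurableTypeR R => r * (W t * sbump k.+1%:R p' q' t))).
      by have := integrableZl mI r (iWb k p' q'); apply: eq_integrable => // x _.
    rewrite (RintegralB mI (i1 _ _ _ _) (i1 _ _ _ _)).
    rewrite (RintegralZl _ mI (iWb _ _ _)) (RintegralZl _ mI (iWb _ _ _)).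
    by move/eqP; rewrite subr_eq0 => /eqP.
  have cv1 := cvgM (cvgV pq0 (cvN _ _ (ltW ap) (ltW pq) (ltW qb))) (cvW _ _ (ltW ap) (ltW pq) (ltW qb)).
  have cv2 := cvgM (cvgV ba0 (cvN _ _ (lexx a) (ltW ab) (lexx b))) (cvW _ _ (lexx a) (ltW ab) (lexx b)).
  have cv3 : (bump_mass m (ratr p) (ratr q))^-1 * (\int[leb]_(t in Iab) (W t * sbump m.+1%:R (ratr p) (ratr q) t))
      @[m --> \oo] --> (b - a)^-1 * \int[leb]_(t in `]a, b[) W t.
    by under eq_fun do rewrite E; exact: cv2.
  have E' := cvg_unique (@Rhausdorff R) (cv1 _ _) cv3.
  by rewrite /c -E' mulrAC mulVf// mul1r.
have icst : leb.-integrable Iab (EFin \o cst c).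
  by apply: integrable_Rcst => //; exact: lebesgue_itv_lty.
have iWc : leb.-integrable Iab (EFin \o (W \- cst c)).
  by have := integrableB mI iW icst; apply: eq_integrable => // x _.
have sub p q : a <= p -> q <= b -> `]p, q[ `<=` Iab.
  move=> ap qb t; rewrite /Iab/= !in_itv/= => /andP[pt tq].
  by rewrite (le_trans ap (ltW pt)) (le_trans (ltW tq) qb).
have Z (p q : rat) : a < ratr p -> ratr p < ratr q :> R -> ratr q < b ->
    \int[leb]_(t in `]ratr p, ratr q[) (W \- cst c) t = 0.
  move=> ap pq qb.
  have S := sub _ _ (ltW ap) (ltW qb).
  rewrite RintegralB//; [|exact: integrableS iW|exact: integrableS icst].
  rewrite Wpq// Rintegral_cst//.
  by rewrite /= lebesgue_measure_itv/= lte_fin pq subrr.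
have FF := ae_filter_ringOfSetsType leb.
apply: filterS (zero_of_rat_integrals iWc Z) => t h abt.
have := h abt; rewrite /W /= /ac_fun add0r => /eqP.
by rewrite subr_eq0 subr_eq => /eqP.
Qed.

End weak_derivative_1d.

(** * Absolutely continuous representatives on almost every line *)

Section line_representation.
Context {R : realType}.
Notation leb := (@lebesgue_measure R).
Notation bl m := (@borel_lebesgue_rV R m).

Lemma continuous_cbox_bounded n (a b : 'rV[R]_n) (f : 'rV[R]_n -> R) :
  continuous f -> exists K : R, forall x, cbox a b x -> `|f x| <= K.
Proof.
move=> cf.
have : compact (f @` cbox a b).
  by apply: continuous_compact; [exact: continuous_subspaceT|exact: cbox_compact].
move=> /compact_bounded[K [_ hK]]; exists (K + 1) => x abx.
by apply: (hK (K + 1)); [rewrite ltrDl|exists x].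
Qed.

Lemma integrable_mul_continuous n (a b : 'rV[R]_n) (v f : 'rV[R]_n -> R) :
  continuous f -> (bl n).-integrable (cbox a b) (EFin \o v) ->
  (bl n).-integrable (cbox a b) (EFin \o (fun x => v x * f x)).
Proof.
move=> cf iv; have [K hK] := continuous_cbox_bounded a b cf.
have := @integrableMb _ _ _ (bl n) _ (measurable_cbox a b) v f K _ iv.
rewrite (_ : (fun x => _ * v x) = (fun t => v t * f t)); last first.
  by apply/funext => t; rewrite mulrC.
by apply => //; apply: measurable_funTS; exact: continuous_measurable_rV.
Qed.

Lemma itv_integrable_mul_continuous (a b : R) (U f : R -> R) : continuous f ->
  leb.-integrable `[a, b] (EFin \o U) ->
  leb.-integrable `[a, b] (EFin \o (fun t => U t * f t)).
Proof.
move=> cf iU.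
have : compact (f @` `[a, b]%classic).
  by apply: continuous_compact; [exact: continuous_subspaceT|exact: segment_compact].
move=> /compact_bounded[K [_ hK]].
have := @integrableMb _ _ _ leb _ (measurable_itv `[a, b]) U f (K + 1) _ iU.
rewrite (_ : (fun x => _ * U x) = (fun t => U t * f t)); last first.
  by apply/funext => t; rewrite mulrC.
apply; first by apply: measurable_funTS; exact: continuous_measurable_fun.
by move=> x xab; apply: (hK (K + 1)); [rewrite ltrDl|exists x].
Qed.

Section ins_Rfubini.
Variables (m : nat) (i : 'I_m.+1) (a b : 'rV[R]_m.+1) (F : 'rV[R]_m.+1 -> R).
Hypothesis (iF : (bl m.+1).-integrable (cbox a b) (EFin \o F)).
Let w y := \int[leb]_(t in `[a ord0 i, b ord0 i]) F (ins i (y, t)).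

Lemma ins_Rinner_integrable : (bl m).-integrable (cbox (del i a) (del i b)) (EFin \o w).
Proof.
have iI := @ins_inner_integrable R m i a b F iF.
have mI := measurable_int _ iI.
apply: (le_integrable (measurable_cbox _ _) _ _ iI) => [|y _].
  by apply/measurable_EFinP; exact: measurableT_comp.
rewrite /w /Rintegral /=; case: integral => [r| |]//=; by rewrite normr0 leey.
Qed.

Lemma ins_Rfubini : \int[bl m.+1]_(x in cbox a b) F x =
  \int[bl m]_(y in cbox (del i a) (del i b)) w y.
Proof.
rewrite /Rintegral; congr fine; rewrite (@ins_fubini R m i a b F iF).
apply: ae_eq_integral; first exact: measurable_cbox.
- exact: measurable_int (@ins_inner_integrable R m i a b F iF).
- exact: measurable_int ins_Rinner_integrable.
- have := @ins_ae_integrable R m i a b F iF; apply: filterS => y h /h iy.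
  by rewrite /= EFin_Rintegral.
Qed.

End ins_Rfubini.

Lemma ins_tens m (i : 'I_m.+1) (th : 'I_m.+1 -> R -> R) y t :
  tens th (ins i (y, t)) = th i t * tens (fun k => th (lift i k)) y.
Proof.
rewrite /tens (bigD1_ord i)//= ins_i; congr (_ * _).
by apply: eq_bigr => k _; rewrite ins_lift.
Qed.

Variables (m : nat) (i : 'I_m.+1) (a b : 'rV[R]_m.+1).
Hypothesis ab : forall j, a ord0 j < b ord0 j.
Variables (v G : 'rV[R]_m.+1 -> R).
Hypotheses (mv : measurable_fun setT v) (mG : measurable_fun setT G)
  (iv : (bl m.+1).-integrable (cbox a b) (EFin \o v))
  (iG : (bl m.+1).-integrable (cbox a b) (EFin \o G)).
Hypothesis vG : forall th : 'I_m.+1 -> R -> R, (forall j, smooth (th j)) ->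
  (forall j (t : R), ~~ (a ord0 j < t < b ord0 j) -> th j t = 0) ->
  \int[bl m.+1]_(x in cbox a b) (v x * tens (tens_partial i th) x) =
  - \int[bl m.+1]_(x in cbox a b) (G x * tens th x).

Let ai := a ord0 i.
Let bi := b ord0 i.

(** The weak identity is tested with [bumpprim] in the [i]-th variable times an arbitrary tensor
    product in the others; by Fubini the inner integral is orthogonal to all of the latter. *)
Lemma line_test_zero k (p q : R) : ai <= p -> p < q -> q <= bi ->
  {ae bl m, forall y, obox (del i a) (del i b) y ->
    \int[leb]_(t in `[ai, bi])
      (v (ins i (y, t)) * @bumpdiff R ai bi k p q t + G (ins i (y, t)) * @bumpprim R ai bi k p q t) = 0}.
Proof.
move=> ap pq qb; have abi : ai < bi := ab i.
pose bumpdiff' := @bumpdiff R ai bi k p q; pose bumpprim' := @bumpprim R ai bi k p q.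
have ceta : continuous bumpdiff' by exact/smooth_continuous/bumpdiff_smooth.
have seta : smooth bumpdiff' by exact: bumpdiff_smooth.
have stheta : smooth bumpprim' by exact: bumpprim_smooth.
have ctheta : continuous bumpprim' by exact: smooth_continuous.
have ccoord (f : R -> R) : continuous f -> continuous (fun x : 'rV[R]_m.+1 => f (x ord0 i)).
  move=> cf x; apply: continuous_comp; last exact: cf.
  exact: coord_continuous.
pose F x := v x * bumpdiff' (x ord0 i) + G x * bumpprim' (x ord0 i).
have mF : measurable_fun setT F.
  by apply: measurable_funD; apply: measurable_funM => //;
    apply: continuous_measurable_rV; exact: ccoord.
have iF : (bl m.+1).-integrable (cbox a b) (EFin \o F).
  have := integrableD (measurable_cbox a b) (integrable_mul_continuous (ccoord _ ceta) iv)
    (integrable_mul_continuous (ccoord _ ctheta) iG).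
  by apply: eq_integrable => //; exact: measurable_cbox.
pose w y := \int[leb]_(t in `[ai, bi]) F (ins i (y, t)).
have iw : (bl m).-integrable (cbox (del i a) (del i b)) (EFin \o w) by exact: ins_Rinner_integrable.
(* Extension by 0 makes the inner integral measurable on the whole space, as [zero_of_tests]
   requires. *)
pose w' := w \_ (cbox (del i a) (del i b)).
have mw' : measurable_fun setT w'.
  apply/(measurable_restrictT _ (measurable_cbox _ _)).
  by apply/measurable_EFinP; exact: measurable_int iw.
have w'E y : cbox (del i a) (del i b) y -> w' y = w y by move=> h; rewrite /w' patchE mem_set.
have iw' : (bl m).-integrable (cbox (del i a) (del i b)) (EFin \o w').
  move: iw; apply: eq_integrable; first exact: measurable_cbox.
  by move=> y /set_mem h; rewrite /= w'E.
have w0 : {ae bl m, forall y, obox (del i a) (del i b) y -> w' y = 0}.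
  apply: (zero_of_tests mw' iw') => th' sth' th'0.
  pose th (f : R -> R) (j : 'I_m.+1) : R -> R := if unlift i j is Some k' then th' k' else f.
  have thi f : th f i = f by rewrite /th unlift_none.
  have thl f j : th f (lift i j) = th' j by rewrite /th liftK.
  have sth f : smooth f -> forall j, smooth (th f j).
    by move=> sf j; case: (unliftP i j) => [j' ->|->]; rewrite ?thl ?thi.
  have tensE f y t : tens (th f) (ins i (y, t)) = f t * tens th' y.
    by rewrite ins_tens thi; congr (_ * _); apply: eq_bigr => j _; rewrite thl.
  have dthE : derive1 bumpprim' = bumpdiff'.
    by apply/funext => x; have [] := @bumpprim_derive R ai bi k p q x ap qb.
  have partE : tens_partial i (th bumpprim') = th bumpdiff'.
    apply/funext => j; rewrite /tens_partial; case: (unliftP i j) => [j' ->|->].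
      by rewrite eq_sym (negbTE (neq_lift _ _)) !thl.
    by rewrite eqxx !thi.
  have tiE f x : tens (th f) x = f (x ord0 i) * tens th' (del i x).
    by rewrite -{1}(ins_del i x) tensE.
  have ith f (V : 'rV[R]_m.+1 -> R) : smooth f ->
      (bl m.+1).-integrable (cbox a b) (EFin \o V) ->
      (bl m.+1).-integrable (cbox a b) (EFin \o (fun x => V x * tens (th f) x)).
    by move=> sf; apply: integrable_mul_continuous; apply: tens_smooth_continuous; exact: sth.
  have sum0 : \int[bl m.+1]_(x in cbox a b) (v x * tens (th bumpdiff') x + G x * tens (th bumpprim') x) = 0.
    rewrite (RintegralD (measurable_cbox a b) (ith _ _ seta iv) (ith _ _ stheta iG)).
    rewrite -partE vG ?addNr//; first exact: sth.
    move=> j t; case: (unliftP i j) => [j' ->|->]; rewrite ?thl ?thi.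
      by move=> h; apply: th'0; rewrite !mxE.
    by move=> h; apply: bumpprim_out.
  have iS : (bl m.+1).-integrable (cbox a b)
      (EFin \o (fun x => v x * tens (th bumpdiff') x + G x * tens (th bumpprim') x)).
    have := integrableD (measurable_cbox a b) (ith _ _ seta iv) (ith _ _ stheta iG).
    by apply: eq_integrable => //; exact: measurable_cbox.
  rewrite (@ins_Rfubini m i a b _ iS) in sum0; rewrite -[RHS]sum0.
  have ct : continuous (tens th') by exact: tens_smooth_continuous.
  rewrite /Rintegral; congr fine; apply: ae_eq_integral.
  - exact: measurable_cbox.
  - exact: measurable_int (integrable_mul_continuous ct iw').
  - exact: measurable_int (@ins_Rinner_integrable m i a b _ iS).
  - have := @ins_ae_integrable R m i a b F iF; apply: filterS => y iy yab.
    rewrite w'E// /w -RintegralZr//; last exact: iy.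
    congr EFin; apply: eq_Rintegral => t _.
    by rewrite /F !tensE ins_i /= mulrDl !mulrA.
apply: filterS w0 => y h yab; rewrite -[RHS](h yab) w'E; last exact: sub_obox_cbox.
by apply: eq_Rintegral => t _; rewrite /F ins_i.
Qed.

(** The lines that fail one of the countably many one-dimensional tests form a null set; on every
    other line where [v] and [G] are integrable, [weak_1d] applies. *)
Lemma line_representation : {ae bl m, forall y, obox (del i a) (del i b) y -> [/\
  leb.-integrable `[ai, bi] (fun t => (v (ins i (y, t)))%:E),
  leb.-integrable `[ai, bi] (fun t => (G (ins i (y, t)))%:E) &
  exists c, {ae leb, forall t, `[ai, bi]%classic t ->
    v (ins i (y, t)) = ac_fun c ai (fun s => G (ins i (y, s))) t}]}.
Proof.
pose bad (z : nat * rat * rat) := [set y : 'rV[R]_m |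
   [&& ai < ratr z.1.2, (ratr z.1.2 : R) < ratr z.2 & ratr z.2 < bi] /\
   obox (del i a) (del i b) y /\
   \int[leb]_(t in `[ai, bi]) (v (ins i (y, t)) * bumpdiff ai bi z.1.1 (ratr z.1.2) (ratr z.2) t
      + G (ins i (y, t)) * bumpprim ai bi z.1.1 (ratr z.1.2) (ratr z.2) t) <> 0].
have nbad z : (bl m).-negligible (bad z).
  case: (boolP [&& ai < ratr z.1.2, (ratr z.1.2 : R) < ratr z.2 & ratr z.2 < bi]) => [/and3P[z1 z2 z3]|h].
    apply: negligibleS (@line_test_zero z.1.1 (ratr z.1.2) (ratr z.2) (ltW z1) z2 (ltW z3)).
    by move=> y [_ [yab h]] /(_ yab).
  rewrite (_ : bad z = set0); first exact: negligible_set0.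
  by apply/seteqP; split => // y [z1 _]; move: h; rewrite z1.
have nb : {ae bl m, forall y z, ~ bad z y}.
  apply: negligibleS (negligible_bigcup_countable (fun z => nbad z)).
  by move=> y /existsNP[z /contrapT h]; exists z.
have FF := ae_filter_ringOfSetsType (bl m).
apply: filterS3 nb (@ins_ae_integrable R m i a b v iv) (@ins_ae_integrable R m i a b G iG).
move=> y yb yv yG yab; have yab' := sub_obox_cbox yab.
have abi : ai < bi := ab i.
split; [exact: yv|exact: yG|].
have {}yv := yv yab'; have {}yG := yG yab'.
apply: (weak_1d abi yv yG) => k p q ap pq qb; apply/eqP; rewrite -addr_eq0 -RintegralD//.
- by apply/eqP; apply: contrapT => h; apply: (yb (k, p, q)); rewrite /bad /= ap pq qb.
- by apply: itv_integrable_mul_continuous yv; exact/smooth_continuous/bumpdiff_smooth.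
- apply: itv_integrable_mul_continuous yG; apply/smooth_continuous.
  by apply: bumpprim_smooth; apply: ltW.
Qed.
End line_representation.

Lemma ae_eq_Rintegral d (T : measurableType d) (R : realType)
    (mu : {measure set T -> \bar R}) (D : set T) (f g : T -> R) :
  measurable D -> measurable_fun D f -> measurable_fun D g ->
  {ae mu, forall x, D x -> f x = g x} ->
  \int[mu]_(x in D) f x = \int[mu]_(x in D) g x.
Proof.
move=> mD mf mg fg; rewrite /Rintegral; congr fine.
apply: ae_eq_integral => //; [exact/measurable_EFinP|exact/measurable_EFinP|].
by apply: filterS fg => x h /h ->.
Qed.

(** * Test functions of class C^1 *)

Section class_C1.
Context {R : realType} {n : nat}.
Implicit Types (phi r : 'rV[R]_n -> R).

Lemma class_C1P phi : class_C 1 phi <-> continuous phi /\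
  forall i, (forall x, derivable phi x (delta_mx ord0 i)) /\ continuous (partial i phi).
Proof.
split=> [C1|[cphi dphi] [|i [|? ?]]].
  split; first by have [_ ] := C1 [::]; exact.
  move=> i; split; first by have [h _] := C1 [::]; exact: h.
  by have [_ ] := C1 [:: i]; exact.
- by split => // _ i; have [] := dphi i.
- by split => // _; have [] := dphi i.
- by split.
Qed.

(* The support of [phi] may be entered only through points where [phi] and its *)
(* partial derivatives vanish.                                                 *)
Lemma class_C1_mul phi r (r' : 'I_n -> 'rV[R]_n -> R) : class_C 1 phi ->
  (forall x, closure [set x | phi x != 0] x -> {for x, continuous r} /\
     forall i, {for x, continuous (r' i)} /\
       \forall y \near x, is_derive y (delta_mx ord0 i) r (r' i y)) ->
  class_C 1 (phi \* r) /\
  forall x i, closure [set x | phi x != 0] x ->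
    partial i (phi \* r) x = partial i phi x * r x + phi x * r' i x.
Proof.
move=> /class_C1P[cphi dphi] hr; set K := closure _ in hr *.
have cK : closed K by exact: closed_closure.
have phiK x : ~ K x -> phi x = 0.
  by move=> xK; apply: contrapT => /eqP px; apply: xK; exact: subset_closure.
have nearK x : ~ K x -> \forall y \near x, ~ K y.
  by move=> xK; apply: (open_nbhs_nbhs (conj (closed_openC cK) xK)).
pose D i x := if pselect (K x) then partial i phi x * r x + phi x * r' i x else 0.
have pphi0 i x : ~ K x -> partial i phi x = 0.
  move=> /nearK nK; rewrite /partial (@near_eq_derive _ _ _ _ (cst 0)).
  - exact: derive_cst.
  - by apply: filterS nK => y; exact: phiK.
have dD i x : is_derive x (delta_mx ord0 i) (phi \* r) (D i x).
  rewrite /D; case: pselect => [Kx|nKx].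
    have [_ /(_ i)[_ /nbhs_singleton dr]] := hr x Kx.
    have dp : is_derive x (delta_mx ord0 i) phi (partial i phi x).
      by apply: DeriveDef => //; have [] := dphi i.
    apply: is_derive_eq; rewrite /GRing.scale /= addrC; congr (_ + _).
    exact: mulrC.
  have e : \forall y \near x, cst (0 : R) y = (phi \* r) y.
    by apply: filterS (nearK _ nKx) => y /phiK /= ->; rewrite mul0r.
  by apply: (near_eq_is_derive e).
have cD i : continuous (D i).
  move=> x; have [Kx|nKx] := pselect (K x).
    have [cr /(_ i)[cr' _]] := hr x Kx.
    have E y : K y \/ True -> D i y = partial i phi y * r y + phi y * r' i y.
      move=> _; rewrite /D; case: pselect => // nK.
      by rewrite pphi0// phiK// !mul0r addr0.
    rewrite (_ : D i = (partial i phi \* r) \+ (phi \* r' i)); last first.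
      by apply/funext => y; apply: E; right.
    have h1 : {for x, continuous (partial i phi)} by have [_] := dphi i; exact.
    exact: (continuousD (continuousM h1 cr) (continuousM (cphi x) cr')).
  have e : \forall y \near x, cst (0 : R) y = D i y.
    by apply: filterS (nearK _ nKx) => y nK; rewrite /D; case: pselect.
  have D0 : D i x = 0 by rewrite /D; case: pselect.
  rewrite /continuous_at D0; by apply: (cvg_trans (near_eq_cvg e)); exact: cvg_cst.
have partE i : partial i (phi \* r) = D i.
  by apply/funext => x; have [_ <-] := dD i x.
split; last by move=> x i Kx; rewrite partE /D; case: pselect.
apply/class_C1P; split => [x|i]; last first.
  by rewrite partE; split => // x; have [] := dD i x.
have [Kx|nKx] := pselect (K x).
  by have [cr _] := hr x Kx; exact: (continuousM (cphi x) cr).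
have e : \forall y \near x, cst (0 : R) y = (phi \* r) y.
  by apply: filterS (nearK _ nKx) => y /phiK /= ->; rewrite mul0r.
have p0 : (phi \* r) x = 0 by rewrite /= phiK// mul0r.
rewrite /continuous_at p0; by apply: (cvg_trans (near_eq_cvg e)); exact: cvg_cst.
Qed.

End class_C1.

Section primitive_continuous.
Context {R : realType}.
Notation leb := (@lebesgue_measure R).
Variables (F h : R -> R).
Hypotheses (mh : measurable_fun setT h)
  (hloc : forall M, exists L, forall t, `|t| <= M -> `|h t| <= L) (pF : primitive F h).

Lemma primitive_lipschitz (M : R) : exists2 L : R, 0 <= L &
  forall s t, `|s| <= M -> `|t| <= M -> `|F t - F s| <= L * `|t - s|.
Proof.
have [L hL] := hloc M; exists (Num.max L 0); first by rewrite le_max lexx orbT.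
move=> s t; wlog st : s t / s <= t.
  move=> H sM tM; have /orP[st|ts] := le_total s t; first exact: H.
  by rewrite distrC [leRHS](_ : _ = Num.max L 0 * `|s - t|) 1?(distrC t)//; exact: H.
move=> sM tM; rewrite pF// [X in _ <= _ * X]ger0_norm ?subr_ge0//.
apply: Rintegral_itv_le => // x /andP[sx xt].
apply: le_trans (hL _ _) _; last by rewrite le_max lexx.
move: sM tM; rewrite !ler_norml => /andP[Ms _] /andP[_ tM].
by rewrite (le_trans Ms sx) (le_trans xt tM).
Qed.

Lemma primitive_continuous : continuous F.
Proof.
move=> x; have [L L0 hL] := primitive_lipschitz (`|x| + 1).
apply/cvgrPdist_le => e e0; near=> y.
rewrite distrC; apply: le_trans (hL _ _ _ _) _.
- by rewrite lerDl.
- have : `|x - y| <= 1 by near: y; exact: cvgr_dist_le.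
  rewrite distrC => xy; rewrite -[y](subrK x) addrC (le_trans (ler_normD _ _))//.
  by rewrite lerD2l.
- have : `|x - y| <= e / (L + 1).
    by near: y; apply: cvgr_dist_le => //; rewrite divr_gt0// ltr_wpDl.
  rewrite distrC ler_pdivlMr ?ltr_wpDl// => /(le_trans _); apply.
  by rewrite mulrC ler_wpM2l// lerDl.
Unshelve. all: by end_near. Qed.

End primitive_continuous.

(** * The chain rule on a box *)

Section box_chain.
Context {R : realType} (m : nat) (i : 'I_m.+1) (a b : 'rV[R]_m.+1).
Notation leb := (@lebesgue_measure R).
Notation bl m := (@borel_lebesgue_rV R m).
Hypothesis ab : forall j, a ord0 j < b ord0 j.

Lemma partial_line (phi : 'rV[R]_m.+1 -> R) y (t : R) :
  derivable phi (ins i (y, t)) (delta_mx ord0 i) ->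
  is_derive t 1 (fun t => phi (ins i (y, t))) (partial i phi (ins i (y, t))).
Proof.
move=> d.
have E : (fun h : R => h^-1 *: (phi (ins i (y, h *: 1 + t)) - phi (ins i (y, t)))) =
    (fun h : R => h^-1 *: ((phi \o shift (ins i (y, t))) (h *: delta_mx ord0 i) - phi (ins i (y, t)))).
  apply/funext => h; congr (_ *: (phi _ - _)).
  apply/rowP => j; rewrite !mxE; case: unliftP => [k ->|->] /=.
    by rewrite eq_sym (negbTE (neq_lift _ _)) mulr0 add0r.
  by rewrite !eqxx.
apply: DeriveDef; rewrite /derivable /derive /= E//; exact: d.
Qed.

Lemma continuous_ins y : continuous (fun t : R => ins i (y, t)).
Proof.
have E : (fun t : R => ins i (y, t)) = (fun t : R => t *: delta_mx ord0 i + ins i (y, 0)).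
  apply/funext => t; apply/rowP => j; rewrite !mxE; case: unliftP => [k ->|->] /=.
    by rewrite eq_sym (negbTE (neq_lift _ _)) mulr0 add0r.
  by rewrite !eqxx mulr1 addr0.
rewrite E => t; apply: (@cvgD _ _ _ _ _ _ _ (t *: delta_mx ord0 i)); last exact: cvg_cst.
exact: (@scalel_continuous _ _ (delta_mx ord0 i) t).
Qed.

Variables (v G : 'rV[R]_m.+1 -> R) (F h : R -> R).
Hypotheses (mv : measurable_fun setT v) (mG : measurable_fun setT G)
  (iv : (bl m.+1).-integrable (cbox a b) (EFin \o v))
  (iG : (bl m.+1).-integrable (cbox a b) (EFin \o G)).
Hypothesis vG : forall th : 'I_m.+1 -> R -> R, (forall j, smooth (th j)) ->
  (forall j (t : R), ~~ (a ord0 j < t < b ord0 j) -> th j t = 0) ->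
  \int[bl m.+1]_(x in cbox a b) (v x * tens (tens_partial i th) x) =
  - \int[bl m.+1]_(x in cbox a b) (G x * tens th x).
Hypotheses (mh : measurable_fun setT h)
  (hloc : forall M, exists L, forall t, `|t| <= M -> `|h t| <= L) (pF : primitive F h).
Hypotheses (iFv : (bl m.+1).-integrable (cbox a b) (EFin \o (F \o v)))
  (ihG : (bl m.+1).-integrable (cbox a b) (EFin \o (fun x => h (v x) * G x))).

(** Fubini along direction [i]: on almost every line [v] is a primitive of [G], and [ac_chain]
    applies with the restriction of [phi], which vanishes at the ends of the line because they lie
    outside the open box. *)
Lemma box_chain phi : class_C 1 phi -> (forall x, ~ obox a b x -> phi x = 0) ->
  \int[bl m.+1]_(x in cbox a b) (F (v x) * partial i phi x) =
  - \int[bl m.+1]_(x in cbox a b) (h (v x) * G x * phi x).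
Proof.
move=> /class_C1P[cphi dphi] phi0; have [dphii cphii] := dphi i.
pose p1 x := F (v x) * partial i phi x; pose p2 x := h (v x) * G x * phi x.
have ip1 : (bl m.+1).-integrable (cbox a b) (EFin \o p1) by exact: integrable_mul_continuous.
have ip2 : (bl m.+1).-integrable (cbox a b) (EFin \o p2) by exact: integrable_mul_continuous.
pose p x := p1 x + p2 x.
have ip : (bl m.+1).-integrable (cbox a b) (EFin \o p).
  have := integrableD (measurable_cbox a b) ip1 ip2.
  by apply: eq_integrable => //; exact: measurable_cbox.
apply/eqP; rewrite -addr_eq0 -(RintegralD (measurable_cbox a b) ip1 ip2); apply/eqP.
rewrite (@ins_Rfubini R m i a b p ip) /Rintegral.
rewrite (_ : integral _ _ _ = 0%E)//.
rewrite (@ae_eq_integral _ _ _ _ _ (cst 0%E))//.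
- by rewrite integral0.
- exact: measurable_cbox.
- exact: measurable_int (@ins_Rinner_integrable R m i a b p ip).
have FF := ae_filter_ringOfSetsType (bl m).
have Lv := @line_representation R m i a b ab v G mv mG iv iG vG.
apply: filterS3 Lv (@ins_ae_integrable R m i a b p1 ip1) (@ins_ae_integrable R m i a b p2 ip2).
move=> y; set ai := a ord0 i; set bi := b ord0 i => Ly iy1 iy2 yab.
have {}iy1 := iy1 yab; have {}iy2 := iy2 yab.
have dline (t : R) : is_derive t 1 (fun t => phi (ins i (y, t))) (partial i phi (ins i (y, t))).
  exact: partial_line.
change ((\int[leb]_(t in `[ai, bi]) (p1 (ins i (y, t)) + p2 (ins i (y, t))))%:E = 0%:E); rewrite (@RintegralD _ (measurableTypeR R) R leb `[ai, bi]%classic (fun t => p1 (ins i (y, t))) (fun t => p2 (ins i (y, t))) (measurable_itv _) iy1 iy2); congr EFin; apply/eqP; rewrite addr_eq0; apply/eqP.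
pose th t := phi (ins i (y, t)).
have dth : derive1 th = fun t => partial i phi (ins i (y, t)).
  by apply/funext => t; rewrite derive1E; have [_ ->] := dline t.
have th0 t : ~ obox (del i a) (del i b) y \/ ~~ (ai < t < bi) -> th t = 0.
  move=> yt; apply: phi0 => yab'; have := preimage_ins_obox i a b; move=> /seteqP[/(_ (y, t) yab')].
  move=> [/= o1]; rewrite in_itv/= => o2 _; case: yt => // /negP; apply.
  exact: o2.
have cdth : continuous (derive1 th).
  rewrite dth => t; apply: continuous_comp; last exact: cphii.
  exact: continuous_ins.
(* Lines through the boundary of the cross-section carry no representation of [v], but [phi]
   vanishes along them, and so does its partial. *)
have [oy|noy] := pselect (obox (del i a) (del i b) y); last first.
  have thE : th = cst 0 by apply/funext => t; apply: th0; left.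
  have dthE t : partial i phi (ins i (y, t)) = 0.
    by have := congr1 (fun g => g t) dth; rewrite thE derive1_cst => <-.
  rewrite /Rintegral !integral0_eq ?fine0 ?oppr0// => t _.
    by rewrite /p2 -/(th t) thE mulr0.
  by rewrite /p1 dthE mulr0.
have [iyv iyG [c vc]] := Ly oy.
have abi : ai < bi by exact: ab.
have := @ac_chain R ai bi th abi _ cdth _ _ c (fun s => G (ins i (y, s))) F h iyG mh hloc pF.
set U := ac_fun c ai _ => AC.
have FL := ae_filter_ringOfSetsType leb.
have mU : measurable_fun (`[ai, bi]%classic : set (measurableTypeR R)) U.
  by apply: subspace_continuous_measurable_fun => //; exact: ac_fun_continuous.
have cF := primitive_continuous mh hloc pF.
have cth : continuous th.
  by move=> t; apply: continuous_comp; [exact: continuous_ins|exact: cphi].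
transitivity (\int[leb]_(t in `[ai, bi]) (F (U t) * derive1 th t)).
  apply: ae_eq_Rintegral; first exact: measurable_itv.
  - by apply/measurable_EFinP; exact: measurable_int iy1.
  - apply: measurable_funM.
      by apply: measurableT_comp mU; exact: continuous_measurable_fun.
    by apply: measurable_funTS; exact: continuous_measurable_fun.
  - by apply: filterS vc => t vt tab; rewrite /p1 vt// dth.
rewrite AC.
- congr (- _); apply: ae_eq_Rintegral; first exact: measurable_itv.
  + apply: measurable_funM.
      apply: measurable_funM; first exact: measurableT_comp mU.
      by apply/measurable_EFinP; exact: measurable_int iyG.
    by apply: measurable_funTS; exact: continuous_measurable_fun.
  + by apply/measurable_EFinP; exact: measurable_int iy2.
  + by apply: filterS vc => t vt tab; rewrite /p2 vt.
- by move=> t; have [] := dline t.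
- by apply: th0; right; rewrite ltxx.
- by apply: th0; right; rewrite ltxx andbF.
Qed.
End box_chain.

(** * Chain rule for weak gradients *)

Section class_C1_algebra.
Context {R : realType} {n : nat}.
Implicit Types (phi psi : 'rV[R]_n -> R).

Lemma class_C1D phi psi : class_C 1 phi -> class_C 1 psi ->
  class_C 1 (phi \+ psi) /\
  forall i x, partial i (phi \+ psi) x = partial i phi x + partial i psi x.
Proof.
move=> /class_C1P[c1 d1] /class_C1P[c2 d2].
have pE i x : partial i (phi \+ psi) x = partial i phi x + partial i psi x.
  by rewrite /partial deriveD//; [have [] := d1 i|have [] := d2 i].
split => //; apply/class_C1P; split=> [x|i].
  by apply: continuousD; [exact: c1|exact: c2].
have [d1i cd1] := d1 i; have [d2i cd2] := d2 i; split=> x.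
  exact: derivableD.
have -> : partial i (phi \+ psi) = partial i phi \+ partial i psi by apply/funext => y; exact: pE.
by apply: continuousD; [exact: cd1|exact: cd2].
Qed.

Lemma class_C1_0 : class_C 1 (0 : 'rV[R]_n -> R).
Proof.
apply/class_C1P; split=> [|i]; first by move=> x; exact: cst_continuous.
split=> [x|]; first exact: derivable_cst.
have -> : partial i (0 : 'rV[R]_n -> R) = cst 0.
  by apply/funext => x; rewrite /partial derive_cst.
by move=> x; exact: cst_continuous.
Qed.

Lemma partial0 i : partial i (0 : 'rV[R]_n -> R) = cst 0.
Proof. by apply/funext => x; rewrite /partial derive_cst. Qed.

(** The pieces are phi * (bump_k / s), where [s] sums the bumps of a finite subcover of the support.
    The quotient is regular only where s > 0, that is near the support, which is all that
    [class_C1_mul] asks. *)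
Lemma class_C1_partition (Om : set 'rV[R]_n) phi : open Om -> class_C 1 phi ->
  compactly_supported Om phi -> exists (s : seq nat) (phi_ : nat -> 'rV[R]_n -> R),
    phi = \sum_(k <- s) phi_ k /\
    forall k, k \in s -> class_C 1 (phi_ k) /\ exists a b, good_box Om a b /\
      forall x, ~ obox a b x -> phi_ k x = 0.
Proof.
move=> oOm C1 [cK KOm]; set K := closure _ in cK KOm.
have [Q [OmQ Qbox]] := open_box_cover oOm.
have /choice[ab abP] : forall k, exists ab : 'rV[R]_n * 'rV[R]_n, Q k <> set0 ->
    good_box Om ab.1 ab.2 /\ Q k = obox ab.1 ab.2.
  move=> k.
  have [Q0|[a [b Qab]]] := Qbox k; first by exists (0, 0).
  by exists (a, b).
have := cK; rewrite compact_cover => /(_ nat [set k | Q k <> set0] Q).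
case=> [k /abP[_ ->]|x /KOm|D' D'D KD']; first exact: obox_open.
  by rewrite {1}OmQ => -[k _ Qk]; exists k => // Qk0; rewrite Qk0 in Qk.
pose l : seq nat := finmap.enum_fset D'.
pose bmp k := box_bump 1 (ab k).1 (ab k).2.
pose s := \sum_(k <- l) bmp k.
have C1b k : class_C 1 (bmp k) by apply: tens_class_C => i; exact: sbump_smooth.
have C1s : class_C 1 s.
  rewrite /s; elim/big_ind: _ => [|f g cf cg|k _]; [exact: class_C1_0| |exact: C1b].
  by have [] := class_C1D cf cg.
have bge0 k x : 0 <= bmp k x by have /andP[] := box_bump_ge0 1 (ab k).1 (ab k).2 x.
have sE x : s x = \sum_(k <- l) bmp k x by rewrite /s fct_sumE.
have s0 x : K x -> 0 < s x.
  move=> /KD'[k /= kD' Qkx]; rewrite sE (big_rem k)//=.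
  apply: ltr_pwDl; last by apply: sumr_ge0.
  apply: prodr_gt0 => i _; apply: sbump_gt0 => //.
  have /D'D := kD'; rewrite inE => /abP[_ QE]; rewrite QE in Qkx; exact: Qkx.
have [cs ds] := (class_C1P s).1 C1s.
pose r k := bmp k \* (fun x => (s x)^-1).
pose r' k i x := bmp k x * (- (s x) ^- 2 * partial i s x) + (s x)^-1 * partial i (bmp k) x.
have rP k x : K x -> {for x, continuous (r k)} /\ forall i, {for x, continuous (r' k i)} /\
       \forall y \near x, is_derive y (delta_mx ord0 i) (r k) (r' k i y).
  move=> Kx; have sx0 : s x != 0 by rewrite gt_eqF// s0.
  have [cb db] := (class_C1P (bmp k)).1 (C1b k).
  have csV : {for x, continuous (fun x => (s x)^-1)} by apply: continuousV => //; exact: cs.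
  split; first by apply: continuousM => //; exact: cb.
  move=> i; have [dbi cdbi] := db i; have [dsi cdsi] := ds i; split.
    apply: continuousD; apply: continuousM => //; [exact: cb| |exact: cdbi].
    apply: continuousM; last exact: cdsi.
    apply: continuousN; apply: continuousV; first by rewrite expf_neq0.
    rewrite (_ : (fun _ => _) = s \* s); last by apply/funext => z; rewrite expr2.
    exact: continuousM (cs x) (cs x).
  have : \forall y \near x, s y != 0.
    have := cs x => /cvgr_neq0; exact.
  apply: filterS => y sy0.
  have dp1 : is_derive y (delta_mx ord0 i) s (partial i s y) by apply: DeriveDef; [exact: dsi|].
  have dp2 : is_derive y (delta_mx ord0 i) (bmp k) (partial i (bmp k) y) by apply: DeriveDef; [exact: dbi|].
  have dp3 : is_derive y (delta_mx ord0 i) (fun z => (s z)^-1) (- (s y) ^- 2 *: partial i s y).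
    by apply: DeriveDef; [exact: derivableV|rewrite deriveV].
  have := is_deriveM dp2 dp3 => /is_derive_eq; apply.
  by rewrite /r' /GRing.scale /=.
exists l, (fun k => phi \* r k); split.
  apply/funext => x; rewrite fct_sumE /=.
  have [Kx|nKx] := pselect (K x); last first.
    have -> : phi x = 0 by apply: contrapT => /eqP px; apply: nKx; exact: subset_closure.
    by rewrite big1// => k _; rewrite mul0r.
  by rewrite -mulr_sumr /r /= -mulr_suml -sE mulfV ?mulr1// gt_eqF// s0.
move=> k kD'; split; first by have [] := class_C1_mul C1 (rP k).
have [gb _] := abP k (set_mem (D'D _ kD')).
exists (ab k).1, (ab k).2; split => // x nx.
by rewrite /r /= /bmp box_bump_out// mul0r mulr0.
Qed.

End class_C1_algebra.

Section chain_rule.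
Context {R : realType} {m : nat}.
Notation bl := (@borel_lebesgue_rV R m.+1).
Variables (Om : set 'rV[R]_m.+1).
Hypothesis oOm : open Om.

Definition box_integrable (w : 'rV[R]_m.+1 -> R) := measurable_fun setT w /\
  forall a b, good_box Om a b -> bl.-integrable (cbox a b) (EFin \o w).

(** The weak derivative seen only by tensor products supported in good boxes, in the form consumed
    on lines. *)
Definition box_weak_partial (i : 'I_m.+1) (v G : 'rV[R]_m.+1 -> R) :=
  forall a b (th : 'I_m.+1 -> R -> R), good_box Om a b ->
  (forall j, smooth (th j)) ->
  (forall j (t : R), ~~ (a ord0 j < t < b ord0 j) -> th j t = 0) ->
  \int[bl]_(x in cbox a b) (v x * tens (tens_partial i th) x) =
  - \int[bl]_(x in cbox a b) (G x * tens th x).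

Lemma integrable_box_support w psi a b : box_integrable w -> good_box Om a b ->
  continuous psi -> (forall x, ~ cbox a b x -> psi x = 0) ->
  bl.-integrable Om (EFin \o (fun x => w x * psi x)) /\
  \int[bl]_(x in Om) (w x * psi x) = \int[bl]_(x in cbox a b) (w x * psi x).
Proof.
move=> [mw iw] gb cpsi psi0; have [_ abOm] := gb; have mOm := measurable_open_rV oOm.
have mab := measurable_cbox a b.
split; last first.
  rewrite /Rintegral; congr fine; apply: integral_support => // x _ /psi0 ->.
  by rewrite mulr0.
have i1 := integrable_mul_continuous cpsi (iw _ _ gb).
have : bl.-integrable setT ((EFin \o (fun x => w x * psi x)) \_ (cbox a b)).
  by apply/integrable_restrict => //; rewrite setTI.
move=> /(integrableS measurableT mOm (@subsetT _ _)); apply: eq_integrable => // x _.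
rewrite patchE; case: ifPn => // xab /=; rewrite psi0 ?mulr0// => h.
by move: xab; rewrite mem_set.
Qed.

Lemma chain_rule i (v G : 'rV[R]_m.+1 -> R) (F h : R -> R) phi :
  box_integrable v -> box_integrable G -> box_weak_partial i v G ->
  measurable_fun setT h -> (forall M, exists L, forall t, `|t| <= M -> `|h t| <= L) ->
  primitive F h ->
  box_integrable (F \o v) -> box_integrable (fun x => h (v x) * G x) ->
  class_C 1 phi -> compactly_supported Om phi ->
  [/\ bl.-integrable Om (EFin \o (fun x => F (v x) * partial i phi x)),
      bl.-integrable Om (EFin \o (fun x => h (v x) * G x * phi x)) &
      \int[bl]_(x in Om) (F (v x) * partial i phi x) =
      - \int[bl]_(x in Om) (h (v x) * G x * phi x)].
Proof.
move=> bv bG vG mh hloc pF bF bh C1 cs; have mOm := measurable_open_rV oOm.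
pose P psi := class_C 1 psi /\ [/\ bl.-integrable Om (EFin \o (fun x => F (v x) * partial i psi x)),
      bl.-integrable Om (EFin \o (fun x => h (v x) * G x * psi x)) &
      \int[bl]_(x in Om) (F (v x) * partial i psi x) =
      - \int[bl]_(x in Om) (h (v x) * G x * psi x)].
have [s [phi_ [-> phiP]]] := class_C1_partition oOm C1 cs.
suff : P (\sum_(k <- s) phi_ k) by case.
rewrite big_seq; elim/big_ind: _ => [|f g [Cf [f1 f2 f3]] [Cg [g1 g2 g3]]|k ks].
- split; first exact: class_C1_0.
  have E1 : (fun x => F (v x) * partial i 0 x) = cst 0.
    by apply/funext => x; rewrite partial0 mulr0.
  have E2 : (fun x => h (v x) * G x * (0 : 'rV[R]_m.+1 -> R) x) = cst 0.
    by apply/funext => x; rewrite mulr0.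
  rewrite E1 E2; have i0 := @integrable0 _ _ R bl Om; split; [exact: i0|exact: i0|].
  by rewrite /Rintegral integral0 fine0 oppr0.
- have [C1fg pfg] := class_C1D Cf Cg; split => //.
  have E1 : (fun x => F (v x) * partial i (f + g) x) = (fun x => F (v x) * partial i f x + F (v x) * partial i g x).
    by apply/funext => x; rewrite -mulrDr -pfg.
  have E2 : (fun x => h (v x) * G x * (f + g) x) = (fun x => h (v x) * G x * f x + h (v x) * G x * g x).
    by apply/funext => x; rewrite mulrDr.
  rewrite E1 E2; split.
  + by have := integrableD mOm f1 g1; exact: eq_integrable.
  + by have := integrableD mOm f2 g2; exact: eq_integrable.
  + by rewrite (RintegralD mOm f1 g1) (RintegralD mOm f2 g2) f3 g3 opprD.
- have [Ck [a [b [gb k0]]]] := phiP _ ks; have [ck dk] := (class_C1P _).1 Ck.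
  have [dki cki] := dk i.
  have k0' x : ~ cbox a b x -> phi_ k x = 0 by move=> nx; apply: k0 => /sub_obox_cbox.
  have pk0 x : ~ cbox a b x -> partial i (phi_ k) x = 0.
    move=> nx; rewrite /partial (@near_eq_derive _ _ _ _ (cst 0)); first exact: derive_cst.
    have := open_nbhs_nbhs (conj (closed_openC (@cbox_closed _ _ a b)) nx).
    by apply: filterS => y; exact: k0'.
  have [i1 e1] := integrable_box_support bF gb cki pk0.
  have [i2 e2] := integrable_box_support bh gb ck k0'.
  split => //; split; [exact: i1|exact: i2|].
  rewrite e2 [LHS]e1; have [ab _] := gb.
  apply: (@box_chain R m i a b ab v G F h) => //; [by have [] := bv|by have [] := bG|
   by have [_] := bv; exact|by have [_] := bG; exact| |by have [_] := bF; exact|by have [_] := bh; exact].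
  by move=> th sth th0; exact: vG.
Qed.

End chain_rule.

(** * Integrals of functions equal off a Borel null set *)

Section volume_transfer.
Context {R : realType} {n : nat}.
Notation LS := (lebesgue_space R n).
Notation vol := (@volume R n).
Notation bl := (@borel_lebesgue_rV R n).
Variables (D N : set 'rV[R]_n).
Hypotheses (mD : measurable D) (mN : measurable N) (N0 : bl N = 0%E).
Implicit Types u v : 'rV[R]_n -> R.

Let mDL : measurable (D : set LS). Proof. exact: measurable_lebesgue_space. Qed.

Lemma null_set_ae (P : 'rV[R]_n -> Prop) : (forall x, ~ N x -> P x) ->
  {ae vol, forall x, P x}.
Proof.
move=> NP; have : vol.-negligible N by apply: negligible_volume; exists N; split.
by apply: negligibleS => x; apply: contra_notP => /NP.
Qed.

Lemma integrable_modification u v : measurable_fun (D : set LS) u ->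
  measurable_fun setT v -> (forall x, D x -> ~ N x -> u x = v x) ->
  vol.-integrable D (EFin \o u) <-> bl.-integrable D (EFin \o v).
Proof.
move=> mu mv uv; have mvD : measurable_fun D v by exact: measurable_funTS.
have mvL : measurable_fun (D : set LS) v by exact: measurable_fun_lebesgue_space.
rewrite -(integrable_volume mD); last exact/measurable_EFinP.
have E : (\int[vol]_(x in D) `|(EFin \o u) x| = \int[vol]_(x in D) `|(EFin \o v) x|)%E.
  apply: ae_eq_integral; first exact: mDL.
  - by apply: measurableT_comp; [exact: abse_measurable|exact/measurable_EFinP].
  - by apply: measurableT_comp; [exact: abse_measurable|exact/measurable_EFinP].
  - by apply: null_set_ae => x Nx Dx /=; rewrite uv.
split=> /integrableP[_ h]; apply/integrableP; split; [exact/measurable_EFinP| |exact/measurable_EFinP|].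
  by rewrite -E.
by rewrite E.
Qed.

Lemma integral_modification u v : measurable_fun (D : set LS) u ->
  measurable_fun setT v -> (forall x, D x -> ~ N x -> u x = v x) ->
  \int[vol]_(x in D) u x = \int[bl]_(x in D) v x.
Proof.
move=> mu mv uv; have mvD : measurable_fun D v by exact: measurable_funTS.
have mvL : measurable_fun (D : set LS) v by exact: measurable_fun_lebesgue_space.
rewrite /Rintegral -integral_volume//; last exact/measurable_EFinP.
congr fine; apply: ae_eq_integral; [exact: mDL|exact/measurable_EFinP|exact/measurable_EFinP|].
by apply: null_set_ae => x Nx Dx /=; rewrite uv.
Qed.

End volume_transfer.

(** * Weak gradients in the Lebesgue-measurable setting *)

Section weak_gradient.
Context {R : realType} {m : nat}.
Notation LS := (lebesgue_space R m.+1).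
Notation vol := (@volume R m.+1).
Notation bl := (@borel_lebesgue_rV R m.+1).
Variables (Om : set 'rV[R]_m.+1).
Hypothesis oOm : open Om.
Implicit Types (u phi : 'rV[R]_m.+1 -> R) (g : 'rV[R]_m.+1 -> 'rV[R]_m.+1).

Lemma compactly_supported_bounded phi (psi : 'rV[R]_m.+1 -> R) : compactly_supported Om phi ->
  continuous psi -> (forall x, ~ closure [set x | phi x != 0] x -> psi x = 0) ->
  exists M : R, forall x, `|psi x| <= M.
Proof.
set K := closure _ => -[cK _] cpsi psi0.
have : compact (psi @` K) by apply: continuous_compact => //; exact: continuous_subspaceT.
move=> /compact_bounded[M [_ hM]]; exists (Num.max (M + 1) 0) => x.
have [Kx|/psi0 ->] := pselect (K x).
  by rewrite le_max; apply/orP; left; apply: (hM (M + 1)); [rewrite ltrDl|exists x].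
by rewrite normr0 le_max lexx orbT.
Qed.

Lemma test_bounded phi i : class_C 1 phi -> compactly_supported Om phi ->
  exists M : R, forall x, `|phi x| <= M /\ `|partial i phi x| <= M.
Proof.
move=> /class_C1P[cphi /(_ i)[_ cp]] cs; pose K := closure [set x | phi x != 0].
have phi0 x : ~ K x -> phi x = 0.
  by move=> nKx; apply: contrapT => /eqP px; apply: nKx; exact: subset_closure.
have p0 x : ~ K x -> partial i phi x = 0.
  move=> nx; rewrite /partial (@near_eq_derive _ _ _ _ (cst 0)); first exact: derive_cst.
  have cK : closed K by exact: closed_closure.
  have := open_nbhs_nbhs (conj (closed_openC cK) nx).
  by apply: filterS => y; exact: phi0.
have [M1 h1] := compactly_supported_bounded cs cphi phi0.
have [M2 h2] := compactly_supported_bounded cs cp p0.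
by exists (Num.max M1 M2) => x; rewrite !le_max h1 h2 orbT.
Qed.

(** Slicing along lines uses the Borel product measure; the function and all components of its
    gradient are therefore replaced by Borel ones off a common null set. *)
Lemma weak_gradient_borel u g : is_weak_gradient Om u g ->
  exists (v : 'rV[R]_m.+1 -> R) (G : 'I_m.+1 -> 'rV[R]_m.+1 -> R) (N : set 'rV[R]_m.+1),
  [/\ measurable N, bl N = 0%E,
      forall x, Om x -> ~ N x -> u x = v x /\ forall i, g x ord0 i = G i x,
      box_integrable Om v &
      forall i, box_integrable Om (G i) /\ box_weak_partial Om i v (G i)].
Proof.
move=> [[mu iu] gl ug]; have mOm := measurable_open_rV oOm.
have [v [N [mv mN N0 uv]]] := borel_modification mOm mu.
have /choice[GN GNP] : forall i, exists p : ('rV[R]_m.+1 -> R) * set 'rV[R]_m.+1,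
    [/\ measurable_fun setT p.1, measurable p.2, bl p.2 = 0%E &
     forall x, Om x -> ~ p.2 x -> g x ord0 i = p.1 x].
  by move=> i; have [G [N' h]] := borel_modification mOm (gl i).1; exists (G, N').
pose N1 := N `|` \bigcup_i (GN i).2.
have mN1 : measurable N1.
  apply: measurableU => //; apply: fin_bigcup_measurable => //.
  by move=> i _; have [] := GNP i.
have N10 : bl N1 = 0%E.
  apply/negligibleP => //; apply: negligibleU; first by exists N; split.
  apply: negligible_bigcup_countable => i.
  by have [_ ? ? _] := GNP i; exists (GN i).2; split.
have gG i x : Om x -> ~ N1 x -> g x ord0 i = (GN i).1 x.
  move=> Omx Nx; have [_ _ _] := GNP i; apply => // h; apply: Nx; right; exists i => //.
have uv1 x : Om x -> ~ N1 x -> u x = v x.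
  by move=> Omx Nx; apply: uv => // h; apply: Nx; left.
have mG i : measurable_fun setT (GN i).1 by have [] := GNP i.
have bl_int w w' a b : measurable_fun setT w' ->
    locally_integrable_on Om w -> (forall x, Om x -> ~ N1 x -> w x = w' x) ->
    good_box Om a b -> bl.-integrable (cbox a b) (EFin \o w').
  move=> mw' [mw iw] ww' [ab abOm]; have mab := measurable_cbox a b.
  apply/(integrable_modification mab mN1 N10 (u := w)) => //.
  - by apply: measurable_funS mw => //; exact: measurable_lebesgue_space.
  - by move=> x /abOm; exact: ww'.
  - by apply: iw => //; exact: cbox_compact.
have bv : box_integrable Om v.
  by split => // a b gb; exact: (bl_int u).
have bG i : box_integrable Om (GN i).1.
  by split => // a b gb; exact: (bl_int (fun x => g x ord0 i) _ _ _ _ (gl i) (gG i)).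
exists v, (fun i => (GN i).1), N1; split => //.
  by move=> x Omx Nx; split; [exact: uv1|move=> i; exact: gG].
move=> i; split => // a b th gb sth th0.
have [ab abOm] := gb; have mab := measurable_cbox a b.
have t0 x : ~ cbox a b x -> tens th x = 0.
  by move=> nx; apply: (tens_out th0) => /sub_obox_cbox.
have cs : compactly_supported Om (tens th) by exact: support_in_cbox t0.
have C1 : class_C 1 (tens th) by exact: tens_class_C.
have := ug (tens th) (fun k => tens_class_C k sth) cs i.
have pE : partial i (tens th) = tens (tens_partial i th).
  by apply/funext => x; have [] := is_derive_tens x (fun y => @smooth_derivable R _ y (sth i)).
have ct := tens_smooth_continuous sth.
have ctp := tens_smooth_continuous (tens_partial_smooth i sth).
have pt0 x : ~ cbox a b x -> tens (tens_partial i th) x = 0.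
  move=> nx; rewrite -pE /partial (@near_eq_derive _ _ _ _ (cst 0)); first exact: derive_cst.
  have := open_nbhs_nbhs (conj (closed_openC (@cbox_closed _ _ a b)) nx).
  by apply: filterS => y; exact: t0.
rewrite pE => /(congr1 fine); rewrite fineN.
have mtL (w psi : 'rV[R]_m.+1 -> R) : measurable_fun (Om : set LS) w -> continuous psi ->
    measurable_fun (Om : set LS) (fun x => w x * psi x).
  move=> mw cpsi; apply: measurable_funM => //.
  apply: measurable_fun_lebesgue_space => //; apply: measurable_funTS.
  exact: continuous_measurable_rV.
have mtB (w psi : 'rV[R]_m.+1 -> R) : measurable_fun setT w -> continuous psi ->
    measurable_fun setT (fun x => w x * psi x).
  by move=> mw cpsi; apply: measurable_funM => //; exact: continuous_measurable_rV.
rewrite -![fine _]/(Rintegral _ _ _).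
rewrite (integral_modification mOm mN1 N10 (mtL _ _ mu ctp) (mtB _ _ mv ctp)); last first.
  by move=> x Omx Nx; rewrite uv1.
rewrite (integral_modification mOm mN1 N10 (mtL _ _ (gl i).1 ct) (mtB _ _ (mG i) ct)); last first.
  by move=> x Omx Nx; rewrite gG.
have [_ ->] := integrable_box_support oOm bv gb ctp pt0.
by have [_ ->] := integrable_box_support oOm (bG i) gb ct t0.
Qed.

(** In each good box the difference of the two gradients is orthogonal to all tensor tests;
    countably many boxes cover [Om]. Since [weak_gradient] is a choice, this identifies it with any
    explicit gradient. *)
Lemma weak_gradient_unique u g g' : is_weak_gradient Om u g ->
  is_weak_gradient Om u g' -> {ae vol, forall x, Om x -> g x = g' x}.
Proof.
move=> /weak_gradient_borel[v [G [N [mN N0 ugN bv bG]]]].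
move=> /weak_gradient_borel[v' [G' [N' [mN' N'0 ugN' bv' bG']]]].
have mOm := measurable_open_rV oOm.
have [Q [OmQ Qbox]] := open_box_cover oOm.
pose bad (ki : nat * 'I_m.+1) := [set x | Q ki.1 x /\ G ki.2 x <> G' ki.2 x].
have nbad ki : bl.-negligible (bad ki).
  case: ki => k i; rewrite /bad /=; have [->|[a [b [gb ->]]]] := Qbox k.
    rewrite (_ : mkset _ = set0); first exact: negligible_set0.
    by apply/seteqP; split => // x [].
  have [ab abOm] := gb; have mab := measurable_cbox a b.
  have [[mG iG] wG] := bG i; have [[mG' iG'] wG'] := bG' i.
  have [mv iv] := bv; have [mv' iv'] := bv'.
  have iGG : bl.-integrable (cbox a b) (EFin \o (fun x => G i x - G' i x)).
    have := integrableB mab (iG _ _ gb) (iG' _ _ gb); by apply: eq_integrable.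
  have := zero_of_tests (w := fun x => G i x - G' i x) (measurable_funB mG mG') iGG.
  case=> [th sth th0|N1 [mN1 N10 hN1]]; last first.
    exists N1; split => //; apply: subset_trans hN1 => x [xab GG'] /(_ xab) /eqP.
    by rewrite subr_eq0 => /eqP.
  have ct := tens_smooth_continuous sth.
  have ctp := tens_smooth_continuous (tens_partial_smooth i sth).
  transitivity (\int[bl]_(x in cbox a b) (G i x * tens th x - G' i x * tens th x)).
    by apply: eq_Rintegral => x _; rewrite mulrBl.
  rewrite (RintegralB mab (integrable_mul_continuous ct (iG _ _ gb)) (integrable_mul_continuous ct (iG' _ _ gb))).
  apply/eqP; rewrite subr_eq0 -eqr_opp -(wG _ _ _ gb sth th0) -(wG' _ _ _ gb sth th0); apply/eqP.
  apply: ae_eq_Rintegral => //.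
  - by apply/measurable_EFinP; exact: measurable_int (integrable_mul_continuous ctp (iv _ _ gb)).
  - by apply/measurable_EFinP; exact: measurable_int (integrable_mul_continuous ctp (iv' _ _ gb)).
  - exists (N `|` N'); split; [exact: measurableU| |].
      apply/eqP; rewrite -measure_le0; apply: le_trans (measureU2 _ mN mN') _.
      by rewrite [X in (X + _)%E]N0 [X in (_ + X)%E]N'0 addr0.
    move=> x; apply: contra_notP => /not_orP[nN nN'] xab.
    have [<- _] := ugN x (abOm _ xab) nN; have [<- _] := ugN' x (abOm _ xab) nN'.
    by [].
have : bl.-negligible (N `|` N' `|` \bigcup_ki bad ki).
  apply: negligibleU; last exact: negligible_bigcup_countable.
  by apply: negligibleU; [exists N; split|exists N'; split].
move=> /negligible_volume; apply: negligibleS => x; apply: contra_notP.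
move=> /not_orP[/not_orP[nN nN'] nb] Omx; apply/rowP => i.
have [_ ->] := ugN x Omx nN; have [_ ->] := ugN' x Omx nN'.
apply: contrapT => GG'; apply: nb; move: Omx; rewrite {1}OmQ => -[k _ Qkx].
by exists (k, i).
Qed.

(** The test function is only of class C^1, because this identity is also applied to the vector
    fields in the definition of the perimeter. *)
Lemma weak_gradient_chain u g (F h : R -> R) i phi : is_weak_gradient Om u g ->
  measurable_fun setT h -> (forall M, exists L, forall t, `|t| <= M -> `|h t| <= L) ->
  primitive F h ->
  vol.-integrable Om (EFin \o (F \o u)) ->
  vol.-integrable Om (EFin \o (fun x => h (u x) * g x ord0 i)) ->
  class_C 1 phi -> compactly_supported Om phi ->
  \int[vol]_(x in Om) (F (u x) * partial i phi x) =
  - \int[vol]_(x in Om) (h (u x) * g x ord0 i * phi x).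
Proof.
move=> wg mh hloc pF iF ih C1 cs; have mOm := measurable_open_rV oOm.
have [v [G [N [mN N0 ugN bv /(_ i)[bG wG]]]]] := weak_gradient_borel wg.
have [[mu _] /(_ i)[mg _] _] := wg.
have [mv _] := bv; have [mG _] := bG.
have mOmL : measurable (Om : set LS) by exact: measurable_lebesgue_space.
have cF := primitive_continuous mh hloc pF.
have mF : measurable_fun setT F by exact: continuous_measurable_fun.
have mFv : measurable_fun setT (F \o v) by exact: measurableT_comp.
have mhG : measurable_fun setT (fun x => h (v x) * G i x).
  exact: measurable_funM (measurableT_comp mh mv) mG.
have uv x : Om x -> ~ N x -> u x = v x by move=> Omx /(ugN _ Omx)[].
have gG x : Om x -> ~ N x -> g x ord0 i = G i x by move=> Omx /(ugN _ Omx)[].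
have iFv : bl.-integrable Om (EFin \o (F \o v)).
  apply/(integrable_modification mOm mN N0 (u := F \o u)) => //.
    exact: measurableT_comp.
  by move=> x Omx Nx /=; rewrite uv.
have mhg : measurable_fun (Om : set LS) (fun x => h (u x) * g x ord0 i).
  exact: measurable_funM (measurableT_comp mh mu) mg.
have ihG : bl.-integrable Om (EFin \o (fun x => h (v x) * G i x)).
  apply/(integrable_modification mOm mN N0 (u := fun x => h (u x) * g x ord0 i)) => //.
  by move=> x Omx Nx /=; rewrite uv// gG.
have bF : box_integrable Om (F \o v).
  by split => // a b [_ abOm]; apply: integrableS iFv => //; exact: measurable_cbox.
have bh : box_integrable Om (fun x => h (v x) * G i x).
  by split => // a b [_ abOm]; apply: integrableS ihG => //; exact: measurable_cbox.
have [_ _ E] := chain_rule oOm bv bG wG mh hloc pF bF bh C1 cs.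
have [cphi /(_ i)[_ cp]] := (class_C1P phi).1 C1.
have mtL (w psi : 'rV[R]_m.+1 -> R) : measurable_fun (Om : set LS) w -> continuous psi ->
    measurable_fun (Om : set LS) (fun x => w x * psi x).
  move=> mw cpsi; apply: measurable_funM => //.
  apply: measurable_fun_lebesgue_space => //; apply: measurable_funTS.
  exact: continuous_measurable_rV.
have mtB (w psi : 'rV[R]_m.+1 -> R) : measurable_fun setT w -> continuous psi ->
    measurable_fun setT (fun x => w x * psi x).
  by move=> mw cpsi; apply: measurable_funM => //; exact: continuous_measurable_rV.
rewrite (integral_modification mOm mN N0 (mtL _ _ (measurableT_comp mF mu) cp) (mtB _ _ mFv cp)); last first.
  by move=> x Omx Nx /=; rewrite uv.
rewrite (integral_modification mOm mN N0 (mtL _ _ mhg cphi) (mtB _ _ mhG cphi)); last first.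
  by move=> x Omx Nx /=; rewrite uv// gG.
exact: E.
Qed.

Lemma weak_gradient_superposition u g (F h : R -> R) : is_weak_gradient Om u g ->
  measurable_fun setT h -> (forall M, exists L, forall t, `|t| <= M -> `|h t| <= L) ->
  primitive F h ->
  vol.-integrable Om (EFin \o (F \o u)) ->
  (forall i, vol.-integrable Om (EFin \o (fun x => h (u x) * g x ord0 i))) ->
  is_weak_gradient Om (F \o u) (fun x => h (u x) *: g x).
Proof.
move=> wg mh hloc pF iF ih; have mOm := measurable_open_rV oOm.
have mOmL : measurable (Om : set LS) by exact: measurable_lebesgue_space.
have loc (w : 'rV[R]_m.+1 -> R) : vol.-integrable Om (EFin \o w) -> locally_integrable_on Om w.
  move=> iw; split; first by apply/measurable_EFinP; exact: measurable_int iw.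
  move=> K cK KOm; apply: integrableS iw => //.
  apply: measurable_lebesgue_space.
  have := closed_openC (compact_closed (@norm_hausdorff _ _) cK) => /measurable_open_rV.
  by move=> /measurableC; rewrite setCK.
have gE i : (fun x => (h (u x) *: g x) ord0 i) = fun x => h (u x) * g x ord0 i.
  by apply/funext => x; rewrite mxE.
split; [exact: loc|by move=> i; rewrite gE; exact: loc|].
move=> phi sphi cs i.
have C1 := sphi 1%N; have [cphi /(_ i)[_ cp]] := (class_C1P phi).1 C1.
have E := weak_gradient_chain wg mh hloc pF iF (ih i) C1 cs.
have [M hM] := test_bounded i C1 cs.
have iM (w psi : 'rV[R]_m.+1 -> R) : vol.-integrable Om (EFin \o w) -> continuous psi ->
    (forall x, `|psi x| <= M) -> vol.-integrable Om (EFin \o (fun x => w x * psi x)).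
  move=> iw cpsi psiM.
  have := @integrableMb _ _ _ vol _ mOmL w psi M _ iw.
  rewrite (_ : (fun x => _ * w x) = (fun t => w t * psi t)); last first.
    by apply/funext => t; rewrite mulrC.
  apply => //; apply: measurable_fun_lebesgue_space => //; apply: measurable_funTS.
  exact: continuous_measurable_rV.
have hM1 x : `|phi x| <= M by have [] := hM x.
have hM2 x : `|partial i phi x| <= M by have [] := hM x.
rewrite -(EFin_Rintegral mOmL (iM _ _ iF cp hM2)) E EFinN; congr (- _)%E.
rewrite (EFin_Rintegral mOmL (iM _ _ (ih i) cphi hM1)).
by apply: eq_integral => x _; rewrite mxE.
Qed.

End weak_gradient.

(** * Derivatives of locally Lipschitz functions *)

Section lipschitz_density.
Context {R : realType}.
Notation leb := (@lebesgue_measure R).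

Lemma lipschitz1_density (w : R -> R) (M : R) :
  (forall s t, `|w s - w t| <= `|s - t|) ->
  exists2 p : R -> R, leb.-integrable setT (EFin \o p) &
    forall s t, - M <= s -> s <= t -> t <= M ->
      w t - w s = \int[leb]_(x in `[s, t]) p x.
Proof.
move=> wlip.
have cw : continuous w.
  move=> x; apply/cvgrPdist_le => e e0; near=> y.
  by apply: le_trans (wlip _ _) _; near: y; exact: cvgr_dist_le.
pose g (c : R) (x : R) := (x + c * w x) / 2.
have cg c : continuous (g c).
  move=> x; apply: cvgM; last exact: cvg_cst.
  by apply: cvgD => //; apply: cvgM; [exact: cvg_cst|exact: cw].
have ndg c : `|c| <= 1 -> nondecreasing (g c).
  move=> c1 x y xy; rewrite ler_pM2r ?invr_gt0// -subr_ge0.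
  have -> : y + c * w y - (x + c * w x) = (y - x) + c * (w y - w x) by ring.
  rewrite -lerBlDl sub0r -[leRHS]opprK lerN2.
  apply: le_trans (ler_norm _) _; rewrite normrN normrM.
  apply: le_trans (_ : 1 * `|w y - w x| <= _); first exact: ler_wpM2r.
  by rewrite mul1r; apply: le_trans (wlip _ _) _; rewrite ger0_norm ?subr_ge0.
pose G (c : R) (c1 : `|c| <= 1) : cumulative R R := HB.pack (g c)
  (isCumulative.Build _ _ _ (g c) (ndg c c1) (right_continuousW (cg c))).
have c1 : `|1 : R| <= 1 by rewrite normr1.
have cN1 : `|- 1 : R| <= 1 by rewrite normrN1.
pose mp := lebesgue_stieltjes_measure (G 1 c1).
pose mn := lebesgue_stieltjes_measure (G (-1) cN1).
have lsE c (hc : `|c| <= 1) s t : s <= t ->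
    lebesgue_stieltjes_measure (G c hc) `]s, t] = (g c t - g c s)%:E.
  move=> st; rewrite /lebesgue_stieltjes_measure /measure_extension measurable_mu_extE/=; last exact: is_ocitv.
  by rewrite wlength_itv_bnd.
have addE A : measurable A -> leb A = (mp A + mn A)%E.
  move=> mA; rewrite -measure_addE.
  apply: lebesgue_stieltjes_measure_unique => // X [[a b] _ <-] /=.
  rewrite [RHS](measure_addE mp mn).
  have [ab|ba] := leP a b; last first.
    by rewrite set_itv_ge ?measure0 ?adde0// bnd_simp -leNgt ltW.
  transitivity ((g 1 b - g 1 a)%:E + (g (-1) b - g (-1) a)%:E)%E; last first.
    by congr (_ + _)%E; apply/esym; exact: lsE.
  rewrite -EFinD /lebesgue_stieltjes_measure /measure_extension measurable_mu_extE/=; last exact: is_ocitv.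
  rewrite wlength_itv_bnd; last exact: ab.
  by congr EFin; rewrite /g /=; field.
(* Restriction to a bounded interval makes the first Stieltjes measure finite, hence a charge. *)
pose D := `]- M, M]%classic : set (measurableTypeR R).
have mD : measurable D by exact: measurable_itv.
have Dfin : (mp D < +oo)%E.
  apply: le_lt_trans (_ : leb D < +oo)%E; first by rewrite addE// leeDl.
  rewrite /D /= lebesgue_measure_itv; case: ifP => // _.
  exact: ltry.
pose nu := charge_of_finite_measure (mfrestr mD Dfin).
have dom : nu `<< leb.
  apply/null_content_dominatesP => A mA A0.
  apply/eqP; rewrite eq_le measure_ge0 andbT /nu /= /mfrestr /mrestr.
  have -> : (0 = leb A)%E by [].
  rewrite addE//; apply: le_trans (_ : mp A <= _)%E; last by rewrite leeDl.
  by apply: le_measure; rewrite ?inE//; exact: measurableI.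
have iq := @Radon_Nikodym_integrable _ _ _ nu leb dom.
have fq x := @Radon_Nikodym_fin_num _ _ _ nu leb x dom.
pose q x := fine (Radon_Nikodym nu leb x).
have qE : EFin \o q = Radon_Nikodym nu leb by apply/funext => x; rewrite /= fineK.
have iq' : leb.-integrable setT (EFin \o q) by rewrite qE.
have iD : leb.-integrable setT (EFin \o \1_D).
  have Dlty : (leb D < +oo)%E.
    by rewrite /D [X in (X < _)%E]lebesgue_measure_itv; case: ifP => // _; exact: ltry.
  have : leb.-integrable D (EFin \o cst 1) by exact: integrable_Rcst.
  rewrite -[X in leb.-integrable X]setTI => /integrable_restrict => /(_ mD measurableT).
  apply: eq_integrable => // x _; rewrite patchE /= indicE.
  by case: ifP.
(* [q] is the density of (x + w)/2 on [D], so that of [w] is 2 q - 1. *)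
pose p x := 2 * q x - \1_D x.
have i2q : leb.-integrable setT (EFin \o (fun x => 2 * q x)).
  by have := integrableZl measurableT 2 iq'; apply: eq_integrable.
have ip : leb.-integrable setT (EFin \o p).
  by have := integrableB measurableT i2q iD; apply: eq_integrable.
exists p => // s t Ms st tM.
have mst : measurable (`]s, t]%classic : set (measurableTypeR R)) by [].
have stD : `]s, t] `<=` D.
  by move=> x /=; rewrite /D /= !in_itv/= => /andP[/(le_lt_trans Ms) -> /le_trans ->].
have E : g 1 t - g 1 s = \int[leb]_(x in `]s, t]) q x.
  have := @Radon_Nikodym_integral _ _ _ nu leb _ dom mst.
  rewrite -qE -(EFin_Rintegral mst); last exact: integrableS iq'.
  rewrite /nu /= /mfrestr /mrestr setIidl// /mp lsE//; exact: EFin_inj.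
have sub1 (f : R -> R) : leb.-integrable setT (EFin \o f) -> leb.-integrable `]s, t] (EFin \o f).
  by move=> h; exact: integrableS h.
rewrite -Rintegral_itv_obnd_cbnd; last first.
  exact: sub1 _ ip.
rewrite (RintegralB mst (sub1 _ i2q) (sub1 _ iD)) (RintegralZl _ mst (sub1 _ iq')) -E.
have -> : \int[leb]_(x in `]s, t]) (\1_D x : R) = t - s.
  transitivity (\int[leb]_(x in `]s, t]) (1 : R)).
    by apply: eq_Rintegral => x /set_mem /stD xD; rewrite indicE mem_set.
  rewrite Rintegral_cst// mul1r [X in fine X](@lebesgue_measure_itv R)/= lte_fin.
  by move: st; rewrite le_eqVlt => /predU1P[->|->//]; rewrite ltxx subrr.
by rewrite /g; field.
Unshelve. all: by end_near. Qed.

End lipschitz_density.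

Section locally_lipschitz.
Context {R : realType}.
Notation leb := (@lebesgue_measure R).
Variable f : R -> R.
Hypothesis flip : locally_lipschitz f.

Lemma locally_lipschitz_near (x : R) : exists k : R, 0 < k /\
  \forall e \near (0 : R)^'+, forall s t, `|s - x| < e -> `|t - x| < e -> `|f s - f t| <= k * `|s - t|.
Proof.
have [U Ux Ulip] := flip x.
move: Ulip; rewrite /dominated_by /= => [[K [_ hK]]].
exists (Num.max (K + 1) 1); split; first by rewrite lt_max ltr01 orbT.
have /nbhs_ballP[r /= r0 rU] := Ux.
near=> e => s t se te.
have er : e < r by near: e; exact: nbhs_right_lt.
have Us : U s by apply: rU; rewrite /ball/= distrC (lt_trans se).
have Ut : U t by apply: rU; rewrite /ball/= distrC (lt_trans te).
have K1 : K < Num.max (K + 1) 1 by rewrite lt_max ltrDl ltr01.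
exact: (hK _ K1 (s, t)).
Unshelve. all: by end_near. Qed.

Lemma locally_lipschitz_continuous : continuous f.
Proof.
move=> x; have [k [k0 hk]] := locally_lipschitz_near x.
have [e /= e0 he] : exists2 e : R, 0 < e & forall s t, `|s - x| < e -> `|t - x| < e -> `|f s - f t| <= k * `|s - t|.
  near (0 : R)^'+ => e; exists e; first by [].
  by near: e; exact: hk.
apply/cvgrPdist_le => d d0; near=> y.
apply: le_trans (he x y _ _) _; first by rewrite subrr normr0.
  by rewrite distrC; near: y; exact: cvgr_dist_lt.
rewrite mulrC -ler_pdivlMr//; near: y; apply: cvgr_dist_le => //.
exact: divr_gt0.
Unshelve. all: by end_near. Qed.

(** By compactness a single [n] bounds increments over distances below 1/(n+1) at every point of
    [-M, M]; over larger distances the boundedness of [f] gives the estimate. *)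
Lemma locally_lipschitz_compact (M : R) : exists2 L : R, 0 < L &
  forall s t, `|s| <= M -> `|t| <= M -> `|f s - f t| <= L * `|s - t|.
Proof.
have cI : compact `[- M, M]%classic by exact: segment_compact.
pose P (n : nat) (x : R) := forall y, `|x - y| < n.+1%:R^-1 -> `|f x - f y| <= n%:R * `|x - y|.
have : \forall n \near \oo, `[- M, M]%classic `<=` P n.
  move: (cI); rewrite compact_near_coveringP => /(_ nat \oo P); apply => x _.
  have [k [k0 hk]] := locally_lipschitz_near x.
  have [e /= e0 he] : exists2 e : R, 0 < e & forall s t, `|s - x| < e -> `|t - x| < e -> `|f s - f t| <= k * `|s - t|.
    near (0 : R)^'+ => e; exists e; first by [].
    by near: e; exact: hk.
  have e20 : 0 < e / 2 by rewrite divr_gt0.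
  near=> z n => y zy.
  have zx : `|x - z| < e / 2 by near: z; apply: cvgr_dist_lt => //; rewrite divr_gt0.
  have ne : n.+1%:R^-1 < e / 2.
    by near: n; exact: (near_infty_natSinv_lt (PosNum e20)).
  have kn : k <= n%:R by near: n; exact: nbhs_infty_ger.
  apply: le_trans (he _ _ _ _) _.
  - by rewrite distrC (lt_trans zx)// ltr_pdivrMr// ltr_pMr// ltr1n.
  - rewrite -(subrK z y) -addrA (le_lt_trans (ler_normD _ _))// (splitr e).
    by rewrite ltrD// 1?distrC// (lt_trans zy).
  - exact: ler_wpM2r.
move=> [n _ /(_ n (leqnn n)) Pn].
have : compact (f @` `[- M, M]%classic).
  by apply: continuous_compact => //; apply: continuous_subspaceT; exact: locally_lipschitz_continuous.
move=> /compact_bounded[B [_ hB]]; pose B' := Num.max (B + 1) 1.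
have B'0 : 0 < B' by rewrite lt_max ltr01 orbT.
have fB s : `|s| <= M -> `|f s| <= B'.
  move=> sM; apply: (hB B'); first by rewrite lt_max ltrDl ltr01.
  by exists s => //=; rewrite in_itv/= -ler_norml.
exists (n%:R + 2 * B' * n.+1%:R); first by rewrite ltr_wpDl// !mulr_gt0.
move=> s t sM tM; have [st|st] := ltP `|s - t| n.+1%:R^-1.
  apply: le_trans (Pn s _ t st) _; first by rewrite /= in_itv/= -ler_norml.
  by apply: ler_wpM2r => //; rewrite lerDl !mulr_ge0// ltW.
apply: le_trans (ler_normB _ _) _; apply: le_trans (lerD (fB _ sM) (fB _ tM)) _.
apply: le_trans (_ : 2 * B' * n.+1%:R * `|s - t| <= _); last first.
  by apply: ler_wpM2r => //; rewrite lerDr.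
rewrite -mulrA -[leLHS]mulr1 (_ : B' + B' = 2 * B'); last by ring.
apply: ler_wpM2l; first by rewrite mulr_ge0// ltW.
by rewrite -ler_pdivrMl ?mulr1.
Unshelve. all: by end_near. Qed.

Let q (k : nat) (x : R) := (f (x + k.+1%:R^-1) - f x) * k.+1%:R.

(** The upper limit of forward difference quotients along 1/(k+1) is defined everywhere, Borel and
    locally bounded, and equals f' wherever [f] is derivable. *)
Definition upper_derivative (x : R) : R := limn_sup (q ^~ x).

Let q_bound (M : R) : exists L : R, forall k x, `|x| <= M -> `|q k x| <= L.
Proof.
have [L L0 hL] := locally_lipschitz_compact (M + 1).
exists L => k x xM; rewrite /q normrM normr_nat -ler_pdivlMr//.
have k1 : `|k.+1%:R^-1 : R| <= 1.
  by rewrite ger0_norm ?invr_ge0// invf_le1 ?ler1n.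
have -> : L / k.+1%:R = L * `|x + k.+1%:R^-1 - x|.
  by rewrite addrAC subrr add0r ger0_norm ?invr_ge0.
apply: hL; last by apply: le_trans xM _; rewrite lerDl.
by apply: le_trans (ler_normD _ _) _; exact: lerD.
Qed.

Lemma measurable_upper_derivative : measurable_fun setT upper_derivative.
Proof.
apply: measurable_fun_limn_sup => [x _|x _|k].
- have [L hL] := q_bound `|x|; exists L => _ [k _ <-].
  by apply: le_trans (ler_norm _) _; exact: hL.
- have [L hL] := q_bound `|x|; exists (- L) => _ [k _ <-].
  by have := hL k x (lexx _); rewrite ler_norml => /andP[].
- apply: continuous_measurable_fun => x; apply: cvgM; last exact: cvg_cst.
  have cf := locally_lipschitz_continuous.
  apply: cvgB; last exact: cf.
  apply: continuous_comp; last exact: cf.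
  by apply: cvgD; [exact: cvg_id|exact: cvg_cst].
Qed.

Lemma upper_derivative_bounded (M : R) :
  exists L, forall t, `|t| <= M -> `|upper_derivative t| <= L.
Proof.
have [L hL] := q_bound M; exists L => t tM.
have bq : bounded_fun (q ^~ t).
  exists L; split; first exact: num_real.
  by move=> L' /ltW LL' k _; apply: le_trans (hL k t tM) LL'.
rewrite /upper_derivative limn_supE//.
have hL' k : - L <= q k t <= L by rewrite -ler_norml; exact: hL.
have ub k : has_ubound (sdrop (q ^~ t) k).
  by exists L => _ [l _ <-]; have /andP[] := hL' l.
have supsL k : - L <= sups (q ^~ t) k <= L.
  apply/andP; split.
    have /andP[qk _] := hL' k; apply: le_trans qk _; apply: ub_le_sup; first exact: ub.
    by exists k => /=.
  apply: ge_sup; first by exists (q k t), k => /=.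
  by move=> _ [l _ <-]; have /andP[] := hL' l.
rewrite ler_norml; apply/andP; split.
  apply: lb_le_inf; first by exists (sups (q ^~ t) 0), 0%N.
  by move=> _ [k _ <-]; have /andP[] := supsL k.
have /andP[_ s0] := supsL 0%N; apply: le_trans s0; apply: ge_inf; last by exists 0%N.
by exists (- L) => _ [k _ <-]; have /andP[] := supsL k.
Qed.

Lemma upper_derivativeE (x : R) : derivable f x 1 -> upper_derivative x = derive1 f x.
Proof.
move=> dfx; have : q k x @[k --> \oo] --> derive1 f x.
  have := dfx => /cvg_ex[l dl].
  have -> : derive1 f x = l by rewrite derive1E; apply: cvg_lim dl; exact: Rhausdorff.
  have inv0 : (k.+1%:R^-1 : R) @[k --> \oo] --> (0 : R)^'.
    move=> A A0; have [d /= d0 hd] := A0.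
    apply: filterS (near_infty_natSinv_lt (PosNum d0)) => k kd; apply: hd => /=.
      by rewrite sub0r normrN ger0_norm ?invr_ge0.
    by rewrite invr_eq0.
  have := cvg_comp _ _ inv0 dl; apply: cvg_trans; apply: near_eq_cvg; apply: nearW => k /=.
  by rewrite invrK [_%:A]mulr1 [_ + x]addrC /GRing.scale /= [LHS]mulrC.
by move=> /cvg_limn_inf_sup[].
Unshelve. all: by end_near. Qed.

(* On [[- M, M]], [f] agrees with a rescaling of a 1-Lipschitz function.      *)
Lemma locally_lipschitz_density (M : R) : 0 < M ->
  exists2 p : R -> R, leb.-integrable setT (EFin \o p) &
    forall s t, - M <= s -> s <= t -> t <= M ->
      f t - f s = \int[leb]_(x in `[s, t]) p x.
Proof.
move=> M0; have [L L0 hL] := locally_lipschitz_compact M.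
pose cl (x : R) := Num.max (- M) (Num.min x M).
have clM x : `|cl x| <= M.
  rewrite ler_norml /cl le_max lexx/= ge_max ge_min lexx orbT andbT.
  by rewrite -subr_ge0 opprK addr_ge0// ltW.
have cllip s t : `|cl s - cl t| <= `|s - t|.
  wlog st : s t / s <= t.
    move=> H; have /orP[|ts] := le_total s t; first exact: H.
    by rewrite distrC (distrC s); exact: H.
  rewrite distrC (distrC s) ger0_norm ?subr_ge0; last first.
    by rewrite /cl; apply: le_max2 => //; exact: le_min2.
  rewrite ger0_norm ?subr_ge0//.
  have mincl : Num.min s M <= cl s by rewrite /cl le_max lexx orbT.
  have Mcl : - M <= cl s by rewrite /cl le_max lexx.
  rewrite lerBlDr [leLHS]/cl ge_max; apply/andP; split.
    by apply: le_trans Mcl _; rewrite lerDr subr_ge0.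
  rewrite ge_min; move: mincl; case: (leP s M) => sM mincl; apply/orP; [left|right].
    by rewrite -lerBlDl opprB addrC subrK.
  by apply: le_trans mincl _; rewrite lerDr subr_ge0.
have cl_id x : - M <= x -> x <= M -> cl x = x.
  by move=> Mx xM; rewrite /cl min_l// max_r.
have [s t|p ip pE] := @lipschitz1_density R (fun x => L^-1 * f (cl x)) M.
  rewrite -mulrBr normrM ger0_norm ?invr_ge0 ?(ltW L0)// ler_pdivrMl//.
  apply: le_trans (hL _ _ (clM _) (clM _)) _.
  by apply: ler_wpM2l => //; exact: ltW.
have iLp : leb.-integrable setT (EFin \o (fun x => L * p x)).
  by have := integrableZl measurableT L ip; apply: eq_integrable.
exists (fun x => L * p x) => // s t Ms st tM.
have mst : measurable (`[s, t]%classic : set (measurableTypeR R)) by [].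
rewrite (RintegralZl _ mst); last exact: integrableS ip.
rewrite -pE// !cl_id//; [|exact: le_trans tM|exact: le_trans st].
by rewrite -mulrBr mulrA mulfV ?mul1r// gt_eqF.
Qed.

Lemma locally_lipschitz_ae (M : R) (p : R -> R) : 0 < M ->
  leb.-integrable setT (EFin \o p) ->
  (forall s t, - M <= s -> s <= t -> t <= M ->
      f t - f s = \int[leb]_(x in `[s, t]) p x) ->
  {ae leb, forall x, - M < x < M -> derivable f x 1 /\ upper_derivative x = p x}.
Proof.
move=> M0 ip pE.
have locp : locally_integrable setT p.
  by have := integrable_locally measurableT ip; rewrite patch_setT.
have ipy y : leb.-integrable `[- M, y] (EFin \o p) by exact: integrableS ip.
have := @FTC1 R p (BLeft (- M)) ipy locp; set F := fun x => _ => FF.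
have FL := ae_filter_ringOfSetsType leb.
apply: filterS FF => x hx /andP[Mx xM].
have [|dF dFE] := hx; first by rewrite lte_fin.
have e : \forall y \near x, F y + f (- M) = f y.
  near=> y; rewrite /F -pE ?subrK//.
    by apply: ltW; near: y; exact: lt_nbhsr.
  by apply: ltW; near: y; exact: lt_nbhsl.
have d1 : is_derive x 1 (fun y => F y + f (- M)) (p x).
  have h : is_derive x 1 F (p x) by rewrite -dFE derive1E; exact/derivableP.
  by have := is_deriveD h (is_derive_cst (f (- M)) x 1); rewrite addr0.
have [df dfE] := near_eq_is_derive e d1.
by split => //; rewrite upper_derivativeE// derive1E.
Unshelve. all: by end_near. Qed.

Lemma locally_lipschitz_ae_derivable : {ae leb, forall x, derivable f x 1}.
Proof.
have : {ae leb, forall x (n : nat), - n.+1%:R < x < n.+1%:R -> derivable f x 1}.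
  apply: ae_foralln => n; have n0 : (0 : R) < n.+1%:R by [].
  have [p ip pE] := locally_lipschitz_density n0.
  have FL := ae_filter_ringOfSetsType leb.
  by apply: filterS (locally_lipschitz_ae n0 ip pE) => x h /h[].
have FL := ae_filter_ringOfSetsType leb.
apply: filterS => x h; apply: (h (Num.bound `|x|)).
rewrite -ltr_norml; apply: lt_le_trans (Num.Theory.archi_boundP (normr_ge0 x)) _.
by rewrite ler_nat.
Qed.

Lemma locally_lipschitz_primitive : primitive f upper_derivative.
Proof.
move=> s t st; pose M := `|s| + `|t| + 1.
have M0 : 0 < M by rewrite ltr_wpDl// addr_ge0.
have [p ip pE] := locally_lipschitz_density M0.
have sM : - M < s by rewrite ltrNl /M (le_lt_trans (ler_norm _))// normrN -addrA ltrDl ltr_wpDl.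
have tM : t < M by rewrite /M (le_lt_trans (ler_norm _))// addrAC ltrDr ltr_wpDl.
rewrite pE ?(ltW sM) ?(ltW tM)//.
have mst : measurable (`[s, t]%classic : set (measurableTypeR R)) by [].
apply: (ae_eq_Rintegral mst).
- by apply/measurable_EFinP; apply: measurable_int; exact: integrableS ip.
- exact: measurable_funTS measurable_upper_derivative.
- have FL := ae_filter_ringOfSetsType leb.
  apply: filterS (locally_lipschitz_ae M0 ip pE) => x h.
  rewrite /= in_itv/= => /andP[sx xt]; have [|_ ->//] := h.
  by rewrite (lt_le_trans sM sx) (le_lt_trans xt tM).
Qed.

End locally_lipschitz.

(** * Isoperimetric inequality on level sets *)

Section Rintegral_lemmas.
Context d (T : measurableType d) (R : realType).
Variables (mu : {measure set T -> \bar R}) (D : set T) (mD : measurable D).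
Implicit Types (w psi f : T -> R).

Lemma integrable_mul_bounded w psi (M : R) : measurable_fun D psi ->
  mu.-integrable D (EFin \o w) -> (forall x, D x -> `|psi x| <= M) ->
  mu.-integrable D (EFin \o (fun x => w x * psi x)).
Proof.
move=> mpsi iw psiM; have := integrableMb mD mpsi iw psiM.
by apply: eq_integrable => // x _; rewrite /= mulrC.
Qed.

Lemma Rintegral_sum (I : Type) (s : seq I) (F : I -> T -> R) :
  (forall i, mu.-integrable D (EFin \o F i)) ->
  mu.-integrable D (EFin \o (fun x => \sum_(i <- s) F i x)) /\
  \int[mu]_(x in D) (\sum_(i <- s) F i x) = \sum_(i <- s) \int[mu]_(x in D) F i x.
Proof.
move=> iF; elim: s => [|k s [IH1 IH2]].
  have -> : (fun x => \sum_(i <- [::]) F i x) = cst 0 by apply/funext => x; rewrite big_nil.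
  split; first exact: integrable0.
  by rewrite big_nil /Rintegral integral0.
have -> : (fun x => \sum_(i <- k :: s) F i x) = (fun x => F k x + \sum_(i <- s) F i x).
  by apply/funext => x; rewrite big_cons.
split; first by have := integrableD mD (iF k) IH1; apply: eq_integrable.
by rewrite (RintegralD mD (iF k) IH1) IH2 big_cons.
Qed.

Lemma Rintegral_mul_indic (E : set T) f : measurable E -> E `<=` D ->
  mu.-integrable D (EFin \o f) ->
  mu.-integrable D (EFin \o (fun x => \1_E x * f x)) /\
  \int[mu]_(x in D) (\1_E x * f x) = \int[mu]_(x in E) f x.
Proof.
move=> mE ED fi; split.
  apply: (integrableMb mD _ fi (C := 1)); first exact: measurable_indic.
  by move=> x _; rewrite indicE; case: (_ \in _); rewrite ?normr1 ?normr0.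
rewrite /Rintegral; congr fine; rewrite (integral_support mu ED); last first.
  by move=> x _ Ex; rewrite indicE memNset// mul0r.
by apply: eq_integral => x xE; rewrite indicE xE mul1r.
Qed.

End Rintegral_lemmas.

(** * Truncations and ramps *)

Section ramp.
Context {R : realType}.
Notation leb := (@lebesgue_measure R).

Lemma primitive_clamp (a b : R) : a <= b ->
  primitive (fun t => Num.max a (Num.min t b)) (\1_(`]a, b[%classic) : R -> R).
Proof.
move=> ab s t st.
have mst : measurable (`[s, t]%classic : set (measurableTypeR R)) by exact: measurable_itv.
have mab : measurable (`]a, b[%classic : set (measurableTypeR R)) by exact: measurable_itv.
rewrite /Rintegral (_ : (\int[leb]_(x in `[s, t]) (\1_`]a, b[ x)%:E)%E = leb (`]a, b[ `&` `[s, t])); last first.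
  exact: integral_indic.
pose p := Num.max a s; pose q := Num.min b t.
have sub1 : `]p, q[ `<=` `]a, b[ `&` `[s, t].
  move=> x /=; rewrite !in_itv/= /p /q gt_max lt_min => /andP[/andP[ax sx] /andP[xb xt]].
  by rewrite ax xb !ltW.
have sub2 : `]a, b[ `&` `[s, t] `<=` `[p, q].
  move=> x /=; rewrite !in_itv/= /p /q ge_max le_min => -[/andP[ax xb] /andP[sx xt]].
  by rewrite sx xt !ltW.
have mpq : measurable (`]p, q[%classic : set (measurableTypeR R)) by exact: measurable_itv.
have mpq' : measurable (`[p, q]%classic : set (measurableTypeR R)) by exact: measurable_itv.
have -> : leb (`]a, b[ `&` `[s, t]) = leb `]p, q[%classic.
  apply/eqP; rewrite eq_le; apply/andP; split; last first.
    by apply: le_measure; rewrite ?inE//; exact: measurableI.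
  apply: (@le_trans _ _ (leb `[p, q]%classic)).
    by apply: le_measure; rewrite ?inE//; exact: measurableI.
  by rewrite !(@lebesgue_measure_itv R) lexx.
rewrite (@lebesgue_measure_itv R)/= lte_fin.
have [pq|qp] := ltP p q.
  rewrite /=; have qb : q <= b by rewrite /q ge_min lexx.
  have sp : s <= p by rewrite /p le_max lexx orbT.
  have ap : a <= p by rewrite /p le_max lexx.
  rewrite (min_l (_ : s <= b)); last by lra.
  by rewrite minC -/q (max_r (_ : a <= q))//; lra.
rewrite /=; move: qp; rewrite /p /q.
by case: (leP t b) => tb; case: (leP s b) => sb; case: (leP a s) => as_;
  case: (leP a t) => at_; rewrite ?(max_r ab) ?(max_l ab); lra.
Qed.

Lemma primitive_scaleD (F h F' h' : R -> R) (c c' : R) :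
  measurable_fun setT h -> measurable_fun setT h' ->
  (exists L, forall t, `|h t| <= L) -> (exists L, forall t, `|h' t| <= L) ->
  primitive F h -> primitive F' h' ->
  primitive (fun t => c * F t + c' * F' t) (fun t => c * h t + c' * h' t).
Proof.
move=> mh mh' [L hL] [L' hL'] pF pF' s t st.
have mst : measurable (`[s, t]%classic : set (measurableTypeR R)) by exact: measurable_itv.
have ib (k : R -> R) K : measurable_fun setT k -> (forall t, `|k t| <= K) ->
    leb.-integrable `[s, t] (EFin \o k).
  move=> mk kK; apply: (integrable_Rle mst (g := cst K)) => //.
  - exact: measurable_funTS.
  - by apply: integrable_Rcst => //; exact: lebesgue_itv_lty.
have i1 := ib _ _ mh hL; have i2 := ib _ _ mh' hL'.
have ci1 : leb.-integrable `[s, t] (EFin \o (fun x => c * h x)).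
  by have := integrableZl mst c i1; apply: eq_integrable.
have ci2 : leb.-integrable `[s, t] (EFin \o (fun x => c' * h' x)).
  by have := integrableZl mst c' i2; apply: eq_integrable.
rewrite (RintegralD mst ci1 ci2) (RintegralZl _ mst i1) (RintegralZl _ mst i2).
by rewrite -pF// -pF'//; ring.
Qed.

Lemma primitive_shift (F h : R -> R) (c : R) : primitive F h ->
  primitive (fun t => F t + c) h.
Proof. by move=> pF s t st; rewrite -pF//; ring. Qed.

(** For r >= 0 and d > 0 this is min(1, max(0, (|t| - r)/d)), written with clamps so that its slope
    comes from [primitive_clamp]; the last term cancels the value at t = 0. *)
Definition ramp (r d t : R) : R :=
  d^-1 * Num.max r (Num.min t (r + d)) +
  - d^-1 * Num.max (- r - d) (Num.min t (- r)) + (- d^-1 * (2 * r)).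

Definition ramp_slope (r d t : R) : R :=
  d^-1 * \1_(`]r, (r + d)[%classic) t + - d^-1 * \1_(`](- r - d), (- r)[%classic) t.

Lemma measurable_ramp_slope r d : measurable_fun setT (ramp_slope r d).
Proof.
by apply: measurable_funD; apply: measurable_funM => //; exact: measurable_indic.
Qed.

Lemma primitive_ramp r d : 0 < d -> primitive (ramp r d) (ramp_slope r d).
Proof.
move=> d0; apply: primitive_shift; apply: primitive_scaleD; try exact: measurable_indic.
- by exists 1 => t; rewrite indicE; case: (_ \in _); rewrite ?normr1 ?normr0.
- by exists 1 => t; rewrite indicE; case: (_ \in _); rewrite ?normr1 ?normr0.
- by apply: primitive_clamp; rewrite lerDl ltW.
- by apply: primitive_clamp; rewrite gerDl lerNl oppr0 ltW.
Qed.

Lemma ramp_slope_le r d t : 0 <= r -> 0 < d ->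
  `|ramp_slope r d t| <= d^-1 * \1_([set t : R | r < `|t| < r + d]) t.
Proof.
move=> r0 d0; have di : 0 <= d^-1 by rewrite invr_ge0 ltW.
rewrite /ramp_slope !indicE.
have [h1|h1] := boolP (t \in `]r, (r + d)[%classic).
  move: (h1); rewrite inE /= in_itv/= => /andP[rt tr].
  have t0 : 0 < t by exact: le_lt_trans rt.
  rewrite memNset ?mulr0 ?addr0 ?mulr1; last by rewrite /= in_itv/=; lra.
  rewrite mem_set ?mulr1 ?ger0_norm//.
  by rewrite /= gtr0_norm// rt tr.
have [h2|h2] := boolP (t \in `](- r - d), (- r)[%classic).
  move: (h2); rewrite inE /= in_itv/= => /andP[rt tr].
  have t0 : t < 0 by lra.
  rewrite mulr0 add0r mulr1 normrN ger0_norm// mem_set ?mulr1//.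
  by rewrite /= ltr0_norm//; lra.
by rewrite !mulr0 addr0 normr0 mulr_ge0.
Qed.

Lemma ramp_low r d t : 0 <= r -> 0 < d -> `|t| <= r -> ramp r d t = 0.
Proof.
move=> r0 d0; rewrite ler_norml => /andP[rt tr].
rewrite /ramp min_l; last by lra.
rewrite (max_l tr) (min_r rt) max_r; last by lra.
by ring.
Qed.

Lemma ramp_high r d t : 0 <= r -> 0 < d -> r + d <= `|t| -> ramp r d t = 1.
Proof.
move=> r0 d0; rewrite /ramp; case: (ger0P t) => t0 rt.
  rewrite (min_r rt) (min_r (_ : - r <= t)); last by lra.
  rewrite max_r; last by lra.
  by rewrite max_r; [field; rewrite gt_eqF|lra].
rewrite (min_l (_ : t <= r + d)); last by lra.
rewrite (min_l (_ : t <= - r)); last by lra.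
rewrite max_l; last by lra.
by rewrite max_l; [field; rewrite gt_eqF|lra].
Qed.

Lemma ramp_bounded r d t : 0 <= r -> 0 < d -> 0 <= ramp r d t <= 1.
Proof.
move=> r0 d0; have di : 0 < d^-1 by rewrite invr_gt0.
have -> : ramp r d t = d^-1 * (Num.max r (Num.min t (r + d)) - Num.max (- r - d) (Num.min t (- r)) - 2 * r).
  by rewrite /ramp; ring.
rewrite mulr_ge0 ?(ltW di)//=; last first.
  case: (leP t (r + d)) => h1; case: (leP t (- r)) => h2;
    case: (leP r _) => h3; case: (leP (- r - d) _) => h4; lra.
have d1 : d != 0 by rewrite gt_eqF.
rewrite -[leRHS](mulVf d1) ler_pM2l//.
case: (leP t (r + d)) => h1; case: (leP t (- r)) => h2;
    case: (leP r _) => h3; case: (leP (- r - d) _) => h4; lra.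
Qed.

End ramp.

Section cauchy_schwarz.
Context {R : realType} {n : nat}.
Implicit Types v w : 'rV[R]_n.

Lemma euclidean_norm_ge0 v : 0 <= euclidean_norm v.
Proof. exact: sqrtr_ge0. Qed.

Lemma sqr_euclidean_norm v : euclidean_norm v ^+ 2 = \sum_i v ord0 i ^+ 2.
Proof. by rewrite sqr_sqrtr// sumr_ge0// => i _; exact: sqr_ge0. Qed.

Lemma cauchy_schwarz v w :
  `|\sum_i v ord0 i * w ord0 i| <= euclidean_norm v * euclidean_norm w.
Proof.
set a := euclidean_norm v; set b := euclidean_norm w.
have a0 : 0 <= a by exact: euclidean_norm_ge0.
have b0 : 0 <= b by exact: euclidean_norm_ge0.
set S := \sum_i _.
(* The sign [s] treats both signs of the scalar product at once; the inequality comes from expanding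
   the squares (b v_i - s a w_i)^2, and a b = 0 needs a separate argument. *)
have Q (s : R) : `|s| = 1 -> s * S <= a * b.
  move=> s1; have s2 : s ^+ 2 = 1 by rewrite -real_normK ?num_real// s1 expr1n.
  have : 0 <= \sum_i (b * v ord0 i - s * (a * w ord0 i)) ^+ 2.
    by apply: sumr_ge0 => i _; exact: sqr_ge0.
  have -> : \sum_i (b * v ord0 i - s * (a * w ord0 i)) ^+ 2 =
      b ^+ 2 * a ^+ 2 + a ^+ 2 * b ^+ 2 - 2 * (a * b) * (s * S).
    rewrite (_ : b ^+ 2 * a ^+ 2 = \sum_i b ^+ 2 * v ord0 i ^+ 2); last first.
      by rewrite -mulr_sumr -sqr_euclidean_norm.
    rewrite (_ : a ^+ 2 * b ^+ 2 = \sum_i a ^+ 2 * w ord0 i ^+ 2); last first.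
      by rewrite -mulr_sumr -sqr_euclidean_norm.
    rewrite /S !mulr_sumr -big_split -sumrB /=.
    apply: eq_bigr => i _.
    transitivity (b ^+ 2 * v ord0 i ^+ 2 + s ^+ 2 * (a ^+ 2 * w ord0 i ^+ 2) - 2 * (a * b) * (s * (v ord0 i * w ord0 i))); first by ring.
    by rewrite s2 mul1r.
  move=> h; have h' : (a * b) * (s * S) <= (a * b) * (a * b) by rewrite -subr_ge0; nra.
  have [ab0|ab0] := eqVneq (a * b) 0; last by rewrite ler_pM2l// in h'; rewrite lt_neqAle eq_sym ab0 mulr_ge0.
  have vw i : v ord0 i * w ord0 i = 0.
    have z (x : 'rV[R]_n) : euclidean_norm x = 0 -> x ord0 i = 0.
      move=> /(congr1 (fun y => y ^+ 2)); rewrite sqr_euclidean_norm expr0n /= => /eqP.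
      rewrite psumr_eq0; last by move=> k _; exact: sqr_ge0.
      by move=> /allP/(_ i); rewrite mem_index_enum sqrf_eq0 => /(_ isT)/eqP.
    by move/eqP: ab0; rewrite mulf_eq0 => /orP[/eqP/z ->|/eqP/z ->]; rewrite ?mul0r ?mulr0.
  by rewrite ab0 /S big1 ?mulr0.
case: (ger0P S) => _; first by have := Q 1 (normr1 _); rewrite mul1r.
by rewrite -mulN1r Q// normrN normr1.
Qed.

Lemma norm_coord_le v i : `|v ord0 i| <= euclidean_norm v.
Proof.
rewrite -ler_sqr ?nnegrE ?euclidean_norm_ge0// sqr_euclidean_norm real_normK ?num_real//.
by rewrite (bigD1 i)//= lerDl sumr_ge0// => k _; exact: sqr_ge0.
Qed.

End cauchy_schwarz.

(** * Perimeters of superlevel sets *)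

Section level_sets.
Context {R : realType} {m : nat}.
Notation LS := (lebesgue_space R m.+1).
Notation vol := (@volume R m.+1).
Variables (Om : set 'rV[R]_m.+1) (u : 'rV[R]_m.+1 -> R) (g : 'rV[R]_m.+1 -> 'rV[R]_m.+1).
Hypotheses (oOm : open Om) (Omlty : (vol Om < +oo)%E) (wg : is_weak_gradient Om u g).
Hypothesis ig : vol.-integrable Om (EFin \o length_fun g).

Let mOm : measurable Om. Proof. exact: measurable_open_rV. Qed.
Let mOmL : measurable (Om : set LS). Proof. exact: measurable_lebesgue_space. Qed.
Let mu : measurable_fun (Om : set LS) u. Proof. by have [[]] := wg. Qed.
Let mg i : measurable_fun (Om : set LS) (fun x => g x ord0 i).
Proof. by have [_ /(_ i)[]] := wg. Qed.

Definition band (s t : R) : set 'rV[R]_m.+1 := Om `&` [set x | s < `|u x| < t].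

Lemma measurable_band s t : measurable (band s t : set LS).
Proof.
have : measurable_fun (Om : set LS) (fun x => `|u x|) by exact: measurableT_comp.
move=> /(_ mOmL `]s, t[%classic (measurable_itv _)); congr (measurable _).
Qed.

Definition super_level (t : R) : set 'rV[R]_m.+1 := Om `&` [set x | t < `|u x|].

Lemma measurable_super_level t : measurable (super_level t : set LS).
Proof.
have : measurable_fun (Om : set LS) (fun x => `|u x|) by exact: measurableT_comp.
move=> /(_ mOmL `]t, +oo[%classic (measurable_itv _)); congr (measurable _).
by apply/seteqP; split => x [Omx] /=; rewrite in_itv/= andbT.
Qed.

Definition closed_level (t : R) : set 'rV[R]_m.+1 := Om `&` [set x | t <= `|u x|].

Lemma measurable_closed_level t : measurable (closed_level t : set LS).
Proof.
have : measurable_fun (Om : set LS) (fun x => `|u x|) by exact: measurableT_comp.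
move=> /(_ mOmL `[t, +oo[%classic (measurable_itv _)); congr (measurable _).
by apply/seteqP; split => x [Omx] /=; rewrite in_itv/= andbT.
Qed.

Lemma integrable_ramp_slope r d i : 0 <= r -> 0 < d ->
  vol.-integrable Om (EFin \o (fun x => ramp_slope r d (u x) * g x ord0 i)).
Proof.
move=> r0 d0; have igi : vol.-integrable Om (EFin \o (fun x => g x ord0 i)).
  by apply: (integrable_Rle mOmL (mg i) ig) => x _; exact: norm_coord_le.
have := @integrableMb _ _ _ vol _ mOmL (fun x => g x ord0 i) (fun x => ramp_slope r d (u x)) d^-1.
apply; [exact: measurableT_comp (measurable_ramp_slope r d) mu|exact: igi|].
move=> x _; apply: le_trans (ramp_slope_le _ r0 d0) _.
by rewrite indicE; case: (_ \in _); rewrite ?mulr1// mulr0 invr_ge0 ltW.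
Qed.

(** The chain rule moves the derivatives onto the ramp of [u], whose slope is at most 1/d and is
    carried by the band; Cauchy-Schwarz uses |phi| <= 1. *)
Lemma ramp_divergence_le r d (phi : 'rV[R]_m.+1 -> 'rV[R]_m.+1) : 0 <= r -> 0 < d ->
  (forall i, class_C 1 (fun x => phi x ord0 i) /\
     compactly_supported Om (fun x => phi x ord0 i)) ->
  (forall x, euclidean_norm (phi x) <= 1) ->
  \int[vol]_(x in Om) (ramp r d (u x) * divergence phi x) <=
  d^-1 * \int[vol]_(x in band r (r + d)) length_fun g x.
Proof.
move=> r0 d0 Cphi phi1.
have ir : vol.-integrable Om (EFin \o (ramp r d \o u)).
  apply: (integrable_Rle mOmL (g := cst 1)).
  - apply: measurableT_comp => //; apply: continuous_measurable_fun.
    apply: (primitive_continuous (@measurable_ramp_slope R r d) _ (primitive_ramp r d0)).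
    move=> M; exists d^-1 => t _; apply: le_trans (ramp_slope_le _ r0 d0) _.
    by rewrite indicE; case: (_ \in _); rewrite ?mulr1// mulr0 invr_ge0 ltW.
  - exact: integrable_Rcst.
  - move=> x _ /=; have /andP[? ?] := ramp_bounded (u x) r0 d0.
    by rewrite ger0_norm.
have hloc : forall M : R, exists L : R, forall t, `|t| <= M -> `|ramp_slope r d t| <= L.
  move=> M; exists d^-1 => t _; apply: le_trans (ramp_slope_le _ r0 d0) _.
  by rewrite indicE; case: (_ \in _); rewrite ?mulr1// mulr0 invr_ge0 ltW.
have E i := weak_gradient_chain oOm wg (@measurable_ramp_slope R r d) hloc (primitive_ramp r d0)
  ir (integrable_ramp_slope i r0 d0) (Cphi i).1 (Cphi i).2.
have psiM (w psi : 'rV[R]_m.+1 -> R) M : vol.-integrable Om (EFin \o w) -> continuous psi ->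
    (forall x, `|psi x| <= M) -> vol.-integrable Om (EFin \o (fun x => w x * psi x)).
  move=> iw cpsi psiM; apply: (integrable_mul_bounded mOmL _ iw (fun x _ => psiM x)).
  apply: measurable_fun_lebesgue_space; first exact: mOm.
  by apply: measurable_funTS; exact: continuous_measurable_rV.
have i1 i : vol.-integrable Om (EFin \o (fun x => ramp r d (u x) * partial i (fun y => phi y ord0 i) x)).
  have [M hM] := test_bounded i (Cphi i).1 (Cphi i).2.
  have [_ /(_ i)[_ cp]] := (class_C1P _).1 (Cphi i).1.
  by apply: (psiM _ _ M) => // x; have [] := hM x.
have i2 i : vol.-integrable Om (EFin \o (fun x => ramp_slope r d (u x) * g x ord0 i * phi x ord0 i)).
  have [M hM] := test_bounded i (Cphi i).1 (Cphi i).2.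
  have [cp _] := (class_C1P _).1 (Cphi i).1.
  apply: (psiM (fun x => ramp_slope r d (u x) * g x ord0 i) _ M) => //; first exact: integrable_ramp_slope.
  by move=> x; have [] := hM x.
have [_ e1] := Rintegral_sum mOmL (index_enum 'I_m.+1) i1.
have [id2 e2] := Rintegral_sum mOmL (index_enum 'I_m.+1) i2.
have -> : \int[vol]_(x in Om) (ramp r d (u x) * divergence phi x) =
    - \int[vol]_(x in Om) \sum_i (ramp_slope r d (u x) * g x ord0 i * phi x ord0 i).
  rewrite e2 -sumrN -(eq_bigr _ (fun i _ => E i)) -e1.
  by apply: eq_Rintegral => x _; rewrite /divergence mulr_sumr.
have [ib2 <-] := Rintegral_mul_indic mOmL (measurable_band r (r + d)) (@subIsetl _ _ _) ig.
rewrite -(RintegralZl _ mOmL ib2).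
apply: le_trans (ler_norm _) _; rewrite normrN.
apply: le_trans (le_normr_Rintegral mOmL id2) _.
have ib3 : vol.-integrable Om (EFin \o (fun x => d^-1 * (\1_(band r (r + d)) x * length_fun g x))).
  by have := integrableZl mOmL d^-1 ib2; apply: eq_integrable.
apply: (le_Rintegral mOmL _ ib3); first exact: integrable_abse id2.
move=> x Omx.
have -> : \sum_i ramp_slope r d (u x) * g x ord0 i * phi x ord0 i =
   ramp_slope r d (u x) * \sum_i (g x ord0 i * phi x ord0 i).
  by rewrite mulr_sumr; apply: eq_bigr => i _; rewrite mulrA.
rewrite normrM mulrA; apply: ler_pM => //.
  apply: le_trans (ramp_slope_le (u x) r0 d0) _; rewrite !indicE.
  apply: ler_wpM2l; first by rewrite invr_ge0 ltW.
  have [h|h] := boolP (u x \in _); last by case: (_ \in _).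
  by rewrite mem_set//; split => //; exact: set_mem h.
apply: le_trans (cauchy_schwarz _ _) _; rewrite -[leRHS]mulr1.
by apply: ler_wpM2l => //; exact: euclidean_norm_ge0.
Qed.

(** As d -> 0 the ramps converge to the indicator of the superlevel set, while the hypothesis keeps
    the bounds of [ramp_divergence_le] below [q]. *)
Lemma perimeter_super_level_le r q d0 : 0 <= r -> 0 < d0 ->
  (forall d, 0 < d -> d <= d0 ->
     \int[vol]_(x in band r (r + d)) length_fun g x <= q * d) ->
  (perimeter (super_level r) Om <= q%:E)%E.
Proof.
move=> r0 d00 hq; apply: ge_ereal_sup => _ [phi [Cphi phi1] <-].
have mS := measurable_super_level r.
have cdiv : continuous (divergence phi).
  rewrite /divergence -fct_sumE; apply: (@big_ind _ (fun f => continuous f)).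
  - by move=> x; exact: cst_continuous.
  - by move=> f1 f2 c1 c2 x; apply: continuousD; [exact: c1|exact: c2].
  - by move=> i _; have [_ /(_ i)[_]] := (class_C1P _).1 (Cphi i).1.
have [M hM] : exists M : R, forall x, `|divergence phi x| <= M.
  have /choice[M hM] : forall i, exists M : R, forall x, `|partial i (fun y => phi y ord0 i) x| <= M.
    move=> i; have [M hM] := test_bounded i (Cphi i).1 (Cphi i).2.
    by exists M => x; have [] := hM x.
  exists (\sum_i M i) => x; rewrite /divergence.
  by apply: le_trans (ler_norm_sum _ _ _) _; apply: ler_sum => i _.
have mdiv : measurable_fun (Om : set LS) (divergence phi).
  apply: measurable_fun_lebesgue_space; first exact: mOm.
  by apply: measurable_funTS; exact: continuous_measurable_rV.
have idiv : vol.-integrable Om (EFin \o divergence phi).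
  apply: (integrable_Rle mOmL mdiv (g := cst M)); last by move=> x _; exact: hM.
  exact: integrable_Rcst.
have idS : vol.-integrable (super_level r) (EFin \o divergence phi).
  by apply: (integrableS mOmL mS _ idiv) => x [].
rewrite -(EFin_Rintegral mS idS) lee_fin.
have [_ <-] := Rintegral_mul_indic mOmL mS (@subIsetl _ _ _) idiv.
pose dk (k : nat) := d0 / k.+1%:R.
have dk0 k : 0 < dk k by rewrite divr_gt0.
have mramp k : measurable_fun (Om : set LS) (fun x => ramp r (dk k) (u x)).
  have := primitive_continuous (@measurable_ramp_slope R r (dk k)) _ (primitive_ramp r (dk0 k)).
  move=> /(_ _)/continuous_measurable_fun h; apply: (measurableT_comp (h _)) mu.
  move=> K; exists (dk k)^-1 => t _; apply: le_trans (ramp_slope_le _ r0 (dk0 k)) _.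
  by rewrite indicE; case: (_ \in _); rewrite ?mulr1// mulr0 invr_ge0 ltW.
have cv : (\int[vol]_(x in Om) (ramp r (dk k) (u x) * divergence phi x)) @[k --> \oo] -->
    \int[vol]_(x in Om) (\1_(super_level r) x * divergence phi x).
  apply: (Rdominated_convergence mOmL (g := cst M)).
  - by move=> k; exact: measurable_funM (mramp k) mdiv.
  - by apply: measurable_funM mdiv; exact: measurable_indic.
  - apply: aeW => x Omx; apply: cvgM; last exact: cvg_cst.
    have [ru|ur] := ltP r `|u x|; last first.
      rewrite indicE memNset; last by move=> [_ /=]; rewrite ltNge ur.
      rewrite (_ : (fun k => _) = cst 0); first exact: cvg_cst.
      by apply/funext => k; rewrite ramp_low.
    rewrite indicE mem_set//; apply: cvg_near_cst.
    have e0 : 0 < (`|u x| - r) / d0 by rewrite divr_gt0// subr_gt0.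
    apply: filterS (near_infty_natSinv_lt (PosNum e0)) => k /=.
    rewrite ltr_pdivlMr// => h; rewrite ramp_high//.
    by rewrite -lerBrDl /dk mulrC ltW.
  - exact: integrable_Rcst.
  - move=> k x _; rewrite normrM; have /andP[h1 h2] := ramp_bounded (u x) r0 (dk0 k).
    rewrite (ger0_norm h1) -[leRHS]mul1r; apply: ler_pM => //; exact: hM.
rewrite -(cvg_lim (@Rhausdorff R) cv); apply: limr_le.
  by apply/cvg_ex; eexists; exact: cv.
apply: nearW => k.
apply: le_trans (ramp_divergence_le r0 (dk0 k) Cphi phi1) _.
rewrite ler_pdivrMl// mulrC; apply: hq => //.
by rewrite /dk ler_pdivrMr// ler_peMr ?ler1n// ltW.
Qed.

(** A continuation argument in place of differentiation: the supremum of the levels up to which the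
    bound holds satisfies it too, by monotonicity of [V], and could be pushed further if it were
    below t'. *)
Lemma band_integral_ge q t t' : t <= t' ->
  (forall r d0, t <= r -> r < t' -> 0 < d0 -> exists2 d, 0 < d <= d0 &
     q * d <= \int[vol]_(x in band r (r + d)) length_fun g x) ->
  q * (t' - t) <= \int[vol]_(x in band t t') length_fun g x.
Proof.
move=> tt' hq; pose V s := \int[vol]_(x in band t s) length_fun g x.
have ib s s' : vol.-integrable (band s s') (EFin \o length_fun g).
  by apply: (integrableS mOmL (measurable_band s s') _ ig) => x [].
have VU s s' : t <= s -> s <= s' ->
    V s + \int[vol]_(x in band s s') length_fun g x <= V s'.
  move=> ts ss'; rewrite /V.
  have mU := measurableU _ _ (measurable_band t s) (measurable_band s s').
  have sU : band t s `|` band s s' `<=` band t s'.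
    move=> x [[Omx /= /andP[tx xs]]|[Omx /= /andP[sx xs]]]; split => //=.
      by rewrite tx (lt_le_trans xs).
    by rewrite xs (le_lt_trans ts).
  rewrite -Rintegral_setU; last 4 first.
  - exact: measurable_band.
  - exact: measurable_band.
  - by apply: (integrableS mOmL mU _ ig) => x [[]|[]].
  - apply/disj_setPS => x [[_ /= /andP[_ xs]] [_ /= /andP[sx _]]].
    by move: (lt_trans xs sx); rewrite ltxx.
  rewrite -lee_fin (EFin_Rintegral mU) ?(EFin_Rintegral (measurable_band t s')); last 2 first.
  - exact: ib.
  - by apply: (integrableS mOmL mU _ ig) => x [[]|[]].
  apply: ge0_subset_integral; [exact: mU|exact: measurable_band| | |exact: sU].
  - exact: measurable_int (ib _ _).
  - by move=> x _; rewrite lee_fin; exact: euclidean_norm_ge0.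
have Vge0 s s' : 0 <= \int[vol]_(x in band s s') length_fun g x.
  by apply: Rintegral_ge0 => // x _; exact: euclidean_norm_ge0.
have Vmono s s' : t <= s -> s <= s' -> V s <= V s'.
  by move=> ts ss'; apply: le_trans (VU _ _ ts ss'); rewrite lerDl.
pose S := [set s | t <= s <= t' /\ q * (s - t) <= V s].
have St : S t by split; [rewrite lexx|rewrite subrr mulr0; exact: Vge0].
have Sub : has_ubound S by exists t' => s [/andP[]].
pose r := sup S.
have tr : t <= r by apply: ub_le_sup.
have rt' : r <= t' by apply: ge_sup; [exists t|move=> s [/andP[]]].
have Sr : q * (r - t) <= V r.
  have [q0|q0] := leP q 0.
    by apply: le_trans (Vge0 _ _); rewrite mulr_le0_ge0// subr_ge0.
  rewrite mulrC -ler_pdivlMr// lerBlDr; apply: ge_sup; first by exists t.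
  move=> s Ss; have [/andP[ts _] h] := Ss; rewrite -lerBlDr ler_pdivlMr// mulrC.
  by apply: le_trans h (Vmono _ _ ts _); exact: ub_le_sup.
have [->//|rt] := eqVneq t' r.
have {}rt : r < t' by rewrite lt_neqAle eq_sym rt.
have [|d /andP[d0 dr] hd] := hq r (t' - r) tr rt; first by rewrite subr_gt0.
have : S (r + d).
  split; first by rewrite (le_trans tr) ?lerDl ?(ltW d0)//= -lerBrDl.
  have rd : r <= r + d by rewrite lerDl ltW.
  apply: le_trans (VU _ _ tr rd); apply: le_trans (lerD Sr hd).
  by rewrite -mulrDr (_ : r - t + d = r + d - t)//; ring.
by move=> /(ub_le_sup Sub); rewrite -/r gerDl leNgt d0.
Qed.

(** If the bands at some level [r] grew slower than rate c mm^p - e, the superlevel set at [r] would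
    have perimeter at most this rate, against the isoperimetric inequality. The condition on half
    the volume makes [mm] a lower bound for both sides of the minimum. *)
Lemma isoperimetric_band (c t t' : R) : 0 < c ->
  (forall G, measurable (G : set LS) -> G `<=` Om ->
      (c%:E * poweR (mine (vol G) (vol (Om `\` G)))
                (conjugate_exponent m.+1)^-1 <= perimeter G Om)%E) ->
  0 <= t -> t <= t' -> 2 * fine (vol (super_level t)) <= fine (vol Om) ->
  forall mm : R, 0 <= mm -> (mm%:E <= vol (closed_level t'))%E ->
  c * mm `^ (@conjugate_exponent R m.+1)^-1 * (t' - t) <=
  \int[vol]_(x in band t t') length_fun g x.
Proof.
move=> c0 iso t0 tt' half mm mm0 hmm; set p := (conjugate_exponent m.+1)^-1.
have p0 : 0 <= p.
  by rewrite invr_ge0 /conjugate_exponent divr_ge0// subr_ge0 ler1n.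
have [tt|tt] := eqVneq t t'.
  by rewrite tt subrr mulr0; apply: Rintegral_ge0 => // x _; exact: euclidean_norm_ge0.
have {}tt : 0 < t' - t by rewrite subr_gt0 lt_neqAle tt.
have fin (G : set 'rV[R]_m.+1) : measurable (G : set LS) -> G `<=` Om -> vol G \is a fin_num.
  move=> mG GOm; rewrite ge0_fin_numE; last exact: measure_ge0.
  by apply: le_lt_trans Omlty; apply: le_measure; rewrite ?inE.
rewrite -ler_pdivlMr//; apply/ler_addgt0Pl => e e0.
rewrite -lerBlDl ler_pdivlMr//; apply: band_integral_ge => // r d0 tr rt' d00.
apply: contrapT => nd.
have {}nd d : 0 < d -> d <= d0 -> \int[vol]_(x in band r (r + d)) length_fun g x <= (c * mm `^ p - e) * d.
  move=> d1 d2; rewrite leNgt; apply/negP => h; apply: nd; exists d; first by rewrite d1 d2.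
  exact: ltW.
have r0 : 0 <= r by exact: le_trans tr.
have P1 := perimeter_super_level_le r0 d00 nd.
have mS := measurable_super_level r.
have SOm s : super_level s `<=` Om by move=> x [].
have P2 := le_trans (iso _ mS (@SOm r)) P1.
have mD : measurable (Om `\` super_level r : set LS) by exact: measurableD.
have fS := fin _ mS (@SOm r).
have fD := fin _ mD (@subDsetl _ _ _).
have fOm : vol Om \is a fin_num by exact: fin.
have mSt := measurable_super_level t.
have fSt := fin _ mSt (@SOm t).
have St_le : fine (vol (super_level r)) <= fine (vol (super_level t)).
  apply: fine_le => //; apply: le_measure; rewrite ?inE// => x [Omx /= h]; split => //=.
  exact: le_lt_trans h.
have mm_le : mm <= fine (vol (super_level r)).
  rewrite -lee_fin fineK//; apply: le_trans hmm _; apply: le_measure; rewrite ?inE//.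
    exact: measurable_closed_level.
  by move=> x [Omx /= h]; split => //=; exact: lt_le_trans h.
have DE : fine (vol (Om `\` super_level r)) = fine (vol Om) - fine (vol (super_level r)).
  by rewrite (measureD mOmL mS Omlty) setIidr// fineB.
move: P2; rewrite -(fineK fS) -(fineK fD) -EFin_min poweR_EFin -EFinM lee_fin DE.
apply/negP; rewrite -ltNge.
apply: lt_le_trans (_ : c * mm `^ p <= _); first by rewrite gtrDl oppr_lt0.
apply: ler_wpM2l; first exact: ltW.
apply: ge0_ler_powR => //; rewrite ?nnegrE//.
  by rewrite le_min -DE !fine_ge0.
by rewrite le_min mm_le/=; lra.
Qed.

End level_sets.

(** * Levels with prescribed distribution *)

Section level_of_measure.
Context {R : realType} {m : nat}.
Notation LS := (lebesgue_space R m.+1).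
Notation vol := (@volume R m.+1).
Variables (Om : set 'rV[R]_m.+1) (u : 'rV[R]_m.+1 -> R).
Hypotheses (mOm : measurable (Om : set LS)) (Omlty : (vol Om < +oo)%E)
  (mu : measurable_fun (Om : set LS) u).

Let mS t : measurable (super_level Om u t : set LS).
Proof.
have : measurable_fun (Om : set LS) (fun x => `|u x|) by exact: measurableT_comp.
move=> /(_ mOm `]t, +oo[%classic (measurable_itv _)); congr (measurable _).
by apply/seteqP; split => x [Omx] /=; rewrite in_itv/= andbT.
Qed.

Let Slty t : (vol (super_level Om u t) < +oo)%E.
Proof. by apply: le_lt_trans Omlty; apply: le_measure; rewrite ?inE// => x []. Qed.

Definition level_set_of (s : R) := [set t : R | 0 <= t /\ (vol (super_level Om u t) <= s%:E)%E].

(** The decreasing rearrangement of |u| at [s]. *)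
Definition level_of (s : R) : R := inf (level_set_of s).

Lemma super_levelS t t' : t <= t' -> super_level Om u t' `<=` super_level Om u t.
Proof. by move=> tt' x [Omx /= h]; split => //=; exact: le_lt_trans h. Qed.

Lemma level_set_of_nonempty s : 0 < s -> level_set_of s !=set0.
Proof.
move=> s0; have h : vol (super_level Om u k%:R) @[k --> \oo] --> vol (\bigcap_k super_level Om u k%:R).
  apply: nonincreasing_cvg_mu => //.
    exact: bigcap_measurable.
  by move=> k l kl; apply/subsetPset; apply: super_levelS; rewrite ler_nat.
have e : \bigcap_k super_level Om u k%:R = set0.
  apply/seteqP; split => // x /(_ (Num.bound `|u x|) I)[_ /=].
  by rewrite ltNge ltW// Num.Theory.archi_boundP.
rewrite e measure0 in h.
apply: contrapT => ne; suff : (s%:E <= 0)%E by rewrite lee_fin leNgt s0.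
rewrite -(cvg_lim _ h)//; apply: lime_ge; first by apply/cvg_ex; eexists; exact: h.
apply: nearW => k; apply: ltW; rewrite ltNge; apply/negP => hk.
by apply: ne; exists k%:R; split.
Qed.

Let lb s : has_lbound (level_set_of s).
Proof. by exists 0 => t []. Qed.

Lemma level_of_ge0 s : 0 < s -> 0 <= level_of s.
Proof.
by move=> s0; apply: lb_le_inf; [exact: level_set_of_nonempty|move=> t []].
Qed.

Lemma level_of_le s t : 0 <= t -> (vol (super_level Om u t) <= s%:E)%E -> level_of s <= t.
Proof. by move=> t0 h; apply: ge_inf. Qed.

Lemma level_of_anti s s' : 0 < s -> s <= s' -> level_of s' <= level_of s.
Proof.
move=> s0 ss'; apply: lb_le_inf; first exact: level_set_of_nonempty.
move=> t [t0 h]; apply: ge_inf => //; split => //.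
by apply: le_trans h _; rewrite lee_fin.
Qed.

Lemma super_level_of s : 0 < s -> (vol (super_level Om u (level_of s)) <= s%:E)%E.
Proof.
move=> s0; set t := level_of s.
have h : vol (super_level Om u (t + k.+1%:R^-1)) @[k --> \oo] -->
    vol (\bigcup_k super_level Om u (t + k.+1%:R^-1)).
  apply: nondecreasing_cvg_mu => //; first exact: bigcup_measurable.
  move=> k l kl; apply/subsetPset; apply: super_levelS.
  by rewrite lerD2l lef_pV2 ?posrE// ler_nat.
have e : \bigcup_k super_level Om u (t + k.+1%:R^-1) = super_level Om u t.
  apply/seteqP; split.
    by move=> x [k _]; apply: super_levelS; rewrite lerDl invr_ge0.
  move=> x [Omx /= tu].
  have d0 : 0 < `|u x| - t by rewrite subr_gt0.
  have [k _ /(_ k (leqnn k)) hk] := near_infty_natSinv_lt (PosNum d0).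
  by exists k => //; split => //=; rewrite -ltrBrDl.
rewrite e in h; rewrite -(cvg_lim _ h)//.
apply: lime_le; first by apply/cvg_ex; eexists; exact: h.
apply: nearW => k.
have [t' [t'0 ht'] t't] : exists2 t', level_set_of s t' & t' < t + k.+1%:R^-1.
  have hi : has_inf (level_set_of s) by split; [exact: level_set_of_nonempty|].
  by apply: inf_adherent => //; rewrite invr_gt0.
apply: le_trans ht'; apply: le_measure; rewrite ?inE//.
by apply: super_levelS; exact: ltW.
Qed.

(** Every level strictly between 0 and t = [level_of s], and 0 itself, has a superlevel set of
    measure above [s]; these sets decrease to {|u| >= t}. Such levels exist only if t > 0. *)
Lemma closed_level_of s : 0 < s -> 0 < level_of s ->
  (s%:E <= vol (closed_level Om u (level_of s)))%E.
Proof.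
move=> s0; set t := level_of s => t0.
pose r k := t - t / k.+1%:R.
have r0 k : 0 <= r k.
  by rewrite subr_ge0 ler_pdivrMr// ler_peMr ?ler1n// ltW.
have rt k : r k < t by rewrite gtrDl oppr_lt0 divr_gt0.
have h : vol (super_level Om u (r k)) @[k --> \oo] --> vol (\bigcap_k super_level Om u (r k)).
  apply: nonincreasing_cvg_mu => //.
    exact: bigcap_measurable.
  move=> k l kl; apply/subsetPset; apply: super_levelS.
  by rewrite lerD2l lerN2 ler_pM2l// lef_pV2 ?posrE// ler_nat.
have e : \bigcap_k super_level Om u (r k) = closed_level Om u t.
  apply/seteqP; split => x.
    move=> hx; have [Omx _] := hx 0%N I; split => //=.
    rewrite leNgt; apply/negP => ut.
    have d0 : 0 < (t - `|u x|) / t by rewrite divr_gt0// subr_gt0.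
    have [k _ /(_ k (leqnn k)) /= hk] := near_infty_natSinv_lt (PosNum d0).
    have [_ /=] := hx k I; rewrite ltNge => /negP; apply.
    by rewrite /r lerBrDr -lerBrDl mulrC -ler_pdivlMr// ltW.
  by move=> [Omx /= tu] k _; split => //=; exact: lt_le_trans tu.
rewrite e in h; rewrite -(cvg_lim _ h)//.
apply: lime_ge; first by apply/cvg_ex; eexists; exact: h.
apply: nearW => k; rewrite leNgt; apply/negP => hk.
have : level_of s <= r k by apply: level_of_le => //; exact: ltW.
by rewrite leNgt rt.
Qed.

End level_of_measure.

(** * Young functions *)

Section young_facts.
Context {R : realType}.
Variable A : R -> \bar R.
Hypothesis yA : young_function A.

Lemma young0 : A 0 = 0%E. Proof. by case: yA. Qed.

Lemma young_ge0 t : 0 <= t -> (0 <= A t)%E. Proof. by case: yA => _ + _ _ _; exact. Qed.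

Lemma young_convex (s t a : R) : 0 <= s -> 0 <= t -> 0 <= a <= 1 ->
  (A (a * s + (1 - a) * t)%R <= a%:E * A s + (1 - a)%:E * A t)%E.
Proof. by case: yA => _ _ + _ _; exact. Qed.

Lemma young_scale (a t : R) : 0 <= a <= 1 -> 0 <= t -> (A (a * t)%R <= a%:E * A t)%E.
Proof.
move=> a01 t0; have := young_convex t0 (lexx 0) a01.
by rewrite mulr0 addr0 young0 mule0 adde0.
Qed.

(** Monotonicity of A(t)/t, multiplied out so that it also covers s = 0 and infinite values. *)
Lemma young_slope (s t : R) : 0 <= s -> s <= t -> (t%:E * A s <= s%:E * A t)%E.
Proof.
move=> s0 st; have t0 : 0 <= t by exact: le_trans st.
have [tE|tn0] := eqVneq t 0.
  have sE : s = 0 by apply/eqP; rewrite eq_le s0 -tE st.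
  by rewrite tE sE.
have tp : 0 < t by rewrite lt_neqAle eq_sym tn0.
have a01 : 0 <= s / t <= 1 by rewrite divr_ge0//= ler_pdivrMr// mul1r.
have := young_scale a01 t0; rewrite mulfVK// => /(lee_wpmul2l (_ : (0%:E <= t%:E)%E)).
rewrite lee_fin => /(_ t0); rewrite muleA -EFinM mulrC mulfVK//.
Qed.

Lemma young_nd (s t : R) : 0 <= s -> s <= t -> (A s <= A t)%E.
Proof.
move=> s0 st; have t0 : 0 <= t by exact: le_trans st.
have [tE|tn0] := eqVneq t 0.
  have sE : s = 0 by apply/eqP; rewrite eq_le s0 -tE st.
  by rewrite tE sE.
have tp : 0 < t by rewrite lt_neqAle eq_sym tn0.
have a01 : 0 <= s / t <= 1 by rewrite divr_ge0//= ler_pdivrMr// mul1r.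
have := young_scale a01 t0; rewrite mulfVK// => /le_trans; apply.
by apply: gee_pMl; [|exact: young_ge0|rewrite lee_fin; case/andP: a01].
Qed.

Lemma young_mid (s t : R) : 0 <= s -> 0 <= t ->
  (A ((s + t) / 2)%R <= 2^-1%:E * (A s + A t))%E.
Proof.
move=> s0 t0; have h : 0 <= (2^-1 : R) <= 1 by rewrite invr_ge0 ler0n/= invf_le1 ?ler1n.
have := young_convex s0 t0 h; rewrite (_ : (1 - 2^-1 : R) = 2^-1); last by field.
rewrite ge0_muleDr ?young_ge0//; congr (A _ <= _)%E; by field.
Qed.

Lemma young_add (s t : R) : 0 <= s -> 0 <= t -> (A ((s + t) / 2)%R <= A s + A t)%E.
Proof.
move=> s0 t0; apply: le_trans (young_mid s0 t0) _.
apply: gee_pMl; rewrite ?adde_ge0 ?young_ge0// lee_fin.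
by rewrite invf_le1 ?ler1n.
Qed.

Lemma young_max (s t : R) : 0 <= s -> 0 <= t -> (A (Num.max s t) <= A s + A t)%E.
Proof.
move=> s0 t0; have [st|ts] := leP s t.
  by rewrite leeDr// young_ge0.
by rewrite leeDl// young_ge0.
Qed.

Lemma young_finite_near0 : exists2 t, 0 < t & (A t < +oo)%E.
Proof.
have [_ _ _ _ nc] := yA; apply: contrapT => h; apply: nc; exists +oo%E => t t0.
by apply/eqP; rewrite -leye_eq leNgt; apply/negP => h'; apply: h; exists t.
Qed.

Lemma measurable_young : measurable_fun (`[0, +oo[%classic : set (measurableTypeR R)) A.
Proof.
move=> mD; apply: (measurability _ (ErealGenOInfty.measurableE R)) => //.
move=> _ [_ [x ->] <-]; apply: is_interval_measurable => s t [s0 As] [t0 At] r /andP[sr rt].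
have r0 : 0 <= r by move: s0; rewrite /= in_itv/= andbT => /le_trans; apply.
split; first by rewrite /= in_itv/= r0.
move: As; rewrite /= !in_itv/= !andbT => /lt_le_trans; apply; apply: young_nd => //.
by move: s0; rewrite /= in_itv/= andbT.
Qed.

End young_facts.

(** Summation by parts against a geometric sequence: a weighted sum of values is traded for a
    weighted sum of increments. *)
Lemma abel_geometric {R : realType} (b sig : nat -> R) (rho : R) J :
  (forall j, sig j.+1 = rho * sig j) ->
  (1 - rho) * \sum_(j < J) b j.+1 * sig j + b J * sig J =
  b 0%N * sig 0%N + \sum_(j < J) (b j.+1 - b j) * sig j.
Proof.
move=> sigS; elim: J => [|J IH]; first by rewrite !big_ord0 mulr0 add0r addr0.
rewrite !big_ord_recr /= mulrDr sigS.
transitivity ((1 - rho) * (\sum_(i < J) b i.+1 * sig i) + b J * sig J + (b J.+1 - b J) * sig J).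
  by ring.
by rewrite IH; ring.
Qed.

(** * A discrete estimate for the heights of the layers *)

Section sum_estimate.
Context {R : realType}.
Variables (n : nat) (A : R -> \bar R).
Hypotheses (n2 : (2 <= n)%N) (yA : young_function A).
Variables (tau eps : R) (I : R -> R) (a s x : nat -> R).
Hypotheses (tau0 : 0 < tau) (eps0 : 0 < eps) (Atau : (0 < A tau)%E).
Hypotheses (a0 : forall j, 0 <= a j) (x0 : forall j, 0 <= x j) (s0 : forall j, 0 < s j)
  (sS : forall j, s j.+1 = s j / 2).
Hypothesis Aa : forall j, tau <= a j -> (A (a j) <= (x j / s j)%:E)%E.
Hypothesis Ige0 : forall t, 0 <= I t.
Hypothesis Ige : forall p b, tau <= p -> p <= b -> (A b < +oo)%E ->
  (b - p) * (b / fine (A b)) `^ (n%:R - 1)^-1 <= I b - I p.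

Let q : R := n%:R^-1.
Let q' : R := (@conjugate_exponent R n)^-1.
Let n0 : (0 : R) < n%:R. Proof. by rewrite ltr0n; exact: leq_trans n2. Qed.
Let n1 : (0 : R) < n%:R - 1. Proof. by rewrite subr_gt0 ltr1n. Qed.
Let qq' : q + q' = 1.
Proof. by rewrite /q /q' /conjugate_exponent; field; rewrite !gt_eqF. Qed.
Let rq' : (n%:R - 1)^-1 * q' = q.
Proof. by rewrite /q /q' /conjugate_exponent; field; rewrite !gt_eqF. Qed.
Let q0 : 0 < q. Proof. by rewrite invr_gt0. Qed.
Let q'0 : 0 < q'. Proof. by rewrite invr_gt0 divr_gt0. Qed.

(** The heights [a] need not be monotone. Their running maximum is, so the increments of [I] along
    it telescope, and only indices where the maximum grows count. *)
Fixpoint running_max (j : nat) : R :=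
  if j is j'.+1 then Num.max (running_max j') (a j') else tau.
Let b := running_max.

Lemma running_max_nd j k : (j <= k)%N -> b j <= b k.
Proof.
move=> jk; rewrite -(subnK jk); elim: (k - j)%N => [|i IH]; first by rewrite add0n.
by apply: le_trans IH _; rewrite addSn /b /= le_max lexx.
Qed.

Lemma running_max_ge j : tau <= b j. Proof. exact: (@running_max_nd 0). Qed.

Let rho : R := 2^-1 `^ q.
Let sig j := s j `^ q.

Let rho1 : rho < 1.
Proof.
have -> : (1 : R) = 1 `^ q by rewrite powR1.
rewrite /rho; apply: gt0_ltr_powR => //; rewrite ?nnegrE//.
by rewrite invf_lt1// ltr1n.
Qed.

Let sigS j : sig j.+1 = rho * sig j.
Proof. by rewrite /sig sS powRM ?invr_ge0 ?(ltW (s0 _))// mulrC. Qed.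

(** With p the old maximum, al the new one and F = A(al), the product (al - p) s^q splits as (s
    (F/al)(al - p))^q ((al - p)(al/F)^(1/(n-1)))^q', since q'/(n-1) = q and q + q' = 1. The first
    base is at most [x j], the second at most the increment of [I]. *)
Let term j : (b j.+1 - b j) * sig j <= x j `^ q * (I (b j.+1) - I (b j)) `^ q'.
Proof.
rewrite /b /=; case: (leP (running_max j) (a j)) => ba; last first.
  by rewrite subrr mul0r mulr_ge0 ?powR_ge0.
set p := running_max j; set al := a j.
have tp : tau <= p := running_max_ge j.
have ta : tau <= al by exact: le_trans ba.
have al0 : 0 < al by exact: lt_le_trans ta.
have Aal := Aa ta; have Alty : (A al < +oo)%E by apply: le_lt_trans Aal _; exact: ltry.
have Apos : (0 < A al)%E by apply: lt_le_trans Atau _; apply: young_nd => //; exact: ltW.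
have fA : A al \is a fin_num by rewrite ge0_fin_numE ?(ltW Apos).
set F := fine (A al); have F0 : 0 < F by rewrite fine_gt0// Apos.
have FE : (A al) = F%:E by rewrite fineK.
have d0 : 0 <= al - p by rewrite subr_ge0.
have IK := Ige tp ba Alty.
have xs : s j * F <= x j.
  by move: Aal; rewrite FE lee_fin ler_pdivlMr// mulrC.
have dal : al - p <= al by rewrite gerBl (le_trans (ltW tau0)).
have xs' : s j * (F / al * (al - p)) <= x j.
  apply: le_trans xs; apply: ler_wpM2l; first exact: ltW.
  by rewrite -mulrA ger_pMr// mulrC ler_pdivrMr// mul1r.
have g1 : 0 <= F / al by rewrite divr_ge0 ?ltW.
have g2 : 0 <= al / F by rewrite divr_ge0 ?ltW.
have -> : (al - p) * sig j = (s j * (F / al * (al - p))) `^ q *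
    ((al - p) * (al / F) `^ (n%:R - 1)^-1) `^ q'.
  have e1 : (s j * (F / al * (al - p))) `^ q = s j `^ q * ((F / al) `^ q * (al - p) `^ q).
    by rewrite powRM; [rewrite powRM|exact: ltW|exact: mulr_ge0].
  have e2 : ((al - p) * (al / F) `^ (n%:R - 1)^-1) `^ q' = (al - p) `^ q' * (al / F) `^ q.
    by rewrite powRM; [rewrite -powRrM rq'|exact: d0|exact: powR_ge0].
  rewrite e1 e2.
  transitivity (s j `^ q * ((al - p) `^ q * (al - p) `^ q') * ((F / al) `^ q * (al / F) `^ q)); last by ring.
  rewrite -powRM// (_ : F / al * (al / F) = 1); last by field; rewrite !gt_eqF.
  rewrite powR1 mulr1 -powRD ?qq' ?powRr1//; last by rewrite oner_eq0.
  by rewrite mulrC.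
apply: ler_pM; rewrite ?powR_ge0//; apply: ge0_ler_powR; rewrite ?nnegrE ?(ltW q0) ?(ltW q'0)//.
- by rewrite mulr_ge0 ?(ltW (s0 j))// mulr_ge0.
- by rewrite mulr_ge0 ?powR_ge0.
- by apply: le_trans IK; rewrite mulr_ge0 ?powR_ge0.
Qed.

Let Ind j : 0 <= I (b j.+1) - I (b j).
Proof.
rewrite /b /=; case: (leP (running_max j) (a j)) => ba; last by rewrite subrr.
have ta : tau <= a j by apply: le_trans ba; exact: running_max_ge.
have Alty : (A (a j) < +oo)%E by apply: le_lt_trans (Aa ta) _; exact: ltry.
apply: le_trans (Ige (running_max_ge j) ba Alty).
by rewrite mulr_ge0 ?powR_ge0// subr_ge0.
Qed.

Lemma sum_estimate J : \sum_(j < J) x j <= eps ->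
  \sum_(j < J) a j * s j `^ q <=
  (1 - rho)^-1 * (tau * s 0%N `^ q + eps `^ q * I (b J) `^ q').
Proof.
move=> xeps; have r1 : 0 < 1 - rho by rewrite subr_gt0.
have ab : \sum_(j < J) a j * s j `^ q <= \sum_(j < J) b j.+1 * sig j.
  apply: ler_sum => j _; apply: ler_wpM2r; first exact: powR_ge0.
  by rewrite /b /= le_max lexx orbT.
apply: le_trans ab _; rewrite -ler_pdivrMl ?invr_gt0// invrK.
apply: le_trans (_ : tau * sig 0%N + \sum_(j < J) (b j.+1 - b j) * sig j <= _).
  rewrite -[tau]/(b 0%N) -(abel_geometric b J sigS) lerDl mulr_ge0 ?powR_ge0// (le_trans (ltW tau0))//; exact: running_max_ge.
rewrite lerD2l.
apply: le_trans (_ : \sum_(j < J) x j `^ q * (I (b j.+1) - I (b j)) `^ q' <= _).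
  by apply: ler_sum => j _; exact: term.
have Isum : \sum_(j < J) (I (b j.+1) - I (b j)) <= I (b J).
  by rewrite -(big_mkord xpredT (fun j => I (b j.+1) - I (b j))) telescope_sumr// gerBl.
(* The normalization below divides by I(b J); if it is 0, every increment of [I] is 0. *)
have [IJ0|IJ0] := eqVneq (I (b J)) 0.
  have z (j : 'I_J) : I (b j.+1) - I (b j) = 0.
    apply/eqP; rewrite eq_le Ind andbT -IJ0; apply: le_trans Isum.
    by rewrite (bigD1 j)//= lerDl sumr_ge0// => k _; exact: Ind.
  rewrite big1 => [|j _]; first by rewrite mulr_ge0 ?powR_ge0.
  by rewrite z powR0 ?mulr0// gt_eqF.
have IJp : 0 < I (b J) by rewrite lt_neqAle eq_sym IJ0 Ige0.
set K := I (b J) in Isum IJ0 IJp *.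
have e0 : 0 <= eps `^ q * K `^ q' by rewrite mulr_ge0 ?powR_ge0.
(* Hoelder's inequality with exponents n and n', proved by applying Young's inequality to each term
   after dividing the energies by eps and the increments by K. *)
apply: le_trans (_ : eps `^ q * K `^ q' *
    \sum_(j < J) (q * (x j / eps) + q' * ((I (b j.+1) - I (b j)) / K)) <= _).
  rewrite mulr_sumr; apply: ler_sum => j _.
  set y := I (b j.+1) - I (b j); have y0 : 0 <= y := Ind j.
  have xe0 : 0 <= x j / eps by rewrite divr_ge0 ?(ltW eps0).
  have yK0 : 0 <= y / K by rewrite divr_ge0 ?(ltW IJp).
  have -> : x j `^ q * y `^ q' = eps `^ q * K `^ q' * ((x j / eps) `^ q * (y / K) `^ q').
    transitivity ((eps `^ q * (x j / eps) `^ q) * (K `^ q' * (y / K) `^ q')); last by ring.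
    by rewrite -!powRM ?(ltW eps0) ?(ltW IJp)// ![_ * (_ / _)]mulrC !divfK ?gt_eqF.
  apply: ler_wpM2l => //.
  have qi : 0 < q^-1 by rewrite invr_gt0.
  have q'i : 0 < q'^-1 by rewrite invr_gt0.
  have qqi : q^-1^-1 + q'^-1^-1 = 1 by rewrite (invrK q) (invrK q').
  have := @conjugate_powR R ((x j / eps) `^ q) ((y / K) `^ q') _ _ (powR_ge0 _ _) (powR_ge0 _ _) qi q'i qqi.
  rewrite -!powRrM (mulfV (_ : q != 0)) ?gt_eqF// (mulfV (_ : q' != 0)) ?gt_eqF//.
  by rewrite !powRr1// (invrK q) (invrK q') ![_ / _ * _]mulrC.
rewrite -[leRHS]mulr1; apply: ler_wpM2l => //.
rewrite big_split -!mulr_sumr -!mulr_suml -qq'; apply: lerD; rewrite -[leRHS]mulr1;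
  apply: ler_wpM2l; rewrite ?(ltW q0) ?(ltW q'0)// ler_pdivrMr// mul1r.
  exact: xeps.
exact: Isum.
Qed.

End sum_estimate.

(** * The integrand of H_n and its partial integrals *)

Section sobolev_integral.
Context {R : realType}.
Notation leb := (@lebesgue_measure R).
Variables (n : nat) (A : R -> \bar R).
Hypotheses (n2 : (2 <= n)%N) (yA : young_function A).
Let k := sobolev_integrand n A.
Let r : R := (n%:R - 1)^-1.
Let n1 : (0 : R) < n%:R - 1. Proof. by rewrite subr_gt0 ltr1n. Qed.
Let r0 : 0 < r. Proof. by rewrite invr_gt0. Qed.

Lemma sobolev_ratio_ge0 t : 0 <= t -> (0 <= t%:E / A t)%E.
Proof. by move=> t0; rewrite mule_ge0 ?lee_fin// inve_ge0 young_ge0. Qed.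

(** This is [young_slope] divided out; A s = 0 makes the right side +oo, and A t = +oo makes the
    left side 0. *)
Lemma sobolev_ratio_anti s t : 0 < s -> s <= t -> (t%:E / A t <= s%:E / A s)%E.
Proof.
move=> s0 st; have t0 : 0 < t by exact: lt_le_trans st.
have As0 := young_ge0 yA (ltW s0).
have Ast := young_nd yA (ltW s0) st; have sl := young_slope yA (ltW s0) st.
have [Asz|Asn] := eqVneq (A s) 0%E.
  by rewrite Asz inve0 gt0_muley ?lte_fin// leey.
have Asp : (0 < A s)%E by rewrite lt_neqAle eq_sym Asn.
have [Aty|Atn] := eqVneq (A t) +oo%E.
  by rewrite Aty invey mule0 sobolev_ratio_ge0// ltW.
have At0 : (0 < A t)%E by exact: lt_le_trans Ast.
have fAt : A t \is a fin_num by rewrite ge0_fin_numE ?(ltW At0)// ltey.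
have fAs : A s \is a fin_num.
  by rewrite ge0_fin_numE// (le_lt_trans Ast)// ltey.
move: sl; rewrite -(fineK fAt) -(fineK fAs).
have at0 : 0 < fine (A t) by rewrite fine_gt0// At0 ltey.
have as0 : 0 < fine (A s) by rewrite fine_gt0// Asp (le_lt_trans Ast)// ltey.
rewrite !inver !gt_eqF// -!EFinM !lee_fin => h.
by rewrite ler_pdivrMr// mulrAC ler_pdivlMr.
Qed.

Lemma sobolev_integrand_ge0 t : (0 <= k t)%E.
Proof. exact: poweR_ge0. Qed.

Lemma sobolev_integrand_anti s t : 0 < s -> s <= t -> (k t <= k s)%E.
Proof.
move=> s0 st; apply: gt0_ler_poweR; first exact: ltW.
- by rewrite in_itv/= leey andbT sobolev_ratio_ge0// ltW// (lt_le_trans s0).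
- by rewrite in_itv/= leey andbT sobolev_ratio_ge0// ltW.
- exact: sobolev_ratio_anti.
Qed.

Lemma measurable_sobolev_integrand : measurable_fun (`]0, +oo[%classic : set (measurableTypeR R)) k.
Proof.
move=> mD; apply: (measurability _ (ErealGenOInfty.measurableE R)) => //.
move=> _ [_ [x ->] <-]; apply: is_interval_measurable => s t [s0 As] [t0 At] y /andP[sy yt].
have s0' : 0 < s by move: s0; rewrite /= in_itv/= andbT.
have y0 : 0 < y by exact: lt_le_trans sy.
split; first by rewrite /= in_itv/= y0.
move: At; rewrite /= !in_itv/= !andbT => /lt_le_trans; apply.
exact: sobolev_integrand_anti.
Qed.

Let mitv l s : 0 <= l -> measurable_fun (`]l, s[%classic : set (measurableTypeR R)) k.
Proof.
move=> l0; apply: measurable_funS measurable_sobolev_integrand => //.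
by move=> x /=; rewrite !in_itv/= andbT => /andP[lx _]; exact: le_lt_trans lx.
Qed.

(** The lower limit is a parameter: 0 gives the integral in H_n, while a positive one is used when
    only convergence at infinity is known. *)
Definition partial_sobolev (l s : R) : \bar R := (\int[leb]_(t in `]l, s[) k t)%E.

Lemma partial_sobolev_ge0 l s : (0 <= partial_sobolev l s)%E.
Proof. by apply: integral_ge0 => t _; exact: sobolev_integrand_ge0. Qed.

Lemma partial_sobolev_split l p b : 0 <= l -> l <= p -> p <= b ->
  (partial_sobolev l p + partial_sobolev p b <= partial_sobolev l b)%E.
Proof.
move=> l0 lp pb; have p0 : 0 <= p by exact: le_trans lp.
have m1 : measurable (`]l, p[%classic : set (measurableTypeR R)) by exact: measurable_itv.
have m2 : measurable (`]p, b[%classic : set (measurableTypeR R)) by exact: measurable_itv.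
have sU : `]l, p[ `|` `]p, b[ `<=` `]l, b[.
  move=> x /= [|]; rewrite !in_itv/= => /andP[h1 h2].
    by rewrite h1 (lt_le_trans h2).
  by rewrite h2 (le_lt_trans lp).
rewrite /partial_sobolev -ge0_integral_setU//; last 3 first.
- by apply/measurable_funU => //; split; exact: mitv.
- by move=> x _; exact: sobolev_integrand_ge0.
- apply/disj_setPS => x [/=]; rewrite !in_itv/= => /andP[_ xp] /andP[px _].
  by move: (lt_trans xp px); rewrite ltxx.
apply: ge0_subset_integral => //; first exact: measurableU.
  exact: mitv.
by move=> x _; exact: sobolev_integrand_ge0.
Qed.

Lemma partial_sobolev_gt0 l b : 0 <= l -> l <= b ->
  ((b - l)%:E * k b <= partial_sobolev l b)%E.
Proof.
move=> l0; rewrite le_eqVlt => /predU1P[->|lb].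
  by rewrite subrr mul0e partial_sobolev_ge0.
have m1 : measurable (`]l, b[%classic : set (measurableTypeR R)) by exact: measurable_itv.
have -> : ((b - l)%:E * k b)%E = (\int[leb]_(t in `]l, b[) k b)%E.
  rewrite integral_cst// muleC; congr (_ * _)%E.
  by rewrite [RHS](@lebesgue_measure_itv R)/= lte_fin lb.
apply: ge0_le_integral => //.
- by move=> x _; exact: sobolev_integrand_ge0.
- exact: mitv.
- move=> x /=; rewrite in_itv/= => /andP[lx xb].
  by apply: sobolev_integrand_anti; [exact: le_lt_trans lx|exact: ltW].
Qed.

Lemma partial_sobolev_lty l b : 0 < l -> (k l < +oo)%E -> (partial_sobolev l b < +oo)%E.
Proof.
move=> l0 kl; have [lb|bl] := ltP l b; last first.
  by rewrite /partial_sobolev set_itv_ge ?integral_set0// bnd_simp -leNgt.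
have m1 : measurable (`]l, b[%classic : set (measurableTypeR R)) by exact: measurable_itv.
apply: (@le_lt_trans _ _ (\int[leb]_(t in `]l, b[) k l)%E).
  apply: ge0_le_integral => //.
  - by move=> x _; exact: sobolev_integrand_ge0.
  - by apply: mitv; exact: ltW.
  - move=> x /=; rewrite in_itv/= => /andP[lx xb].
    by apply: sobolev_integrand_anti => //; exact: ltW.
rewrite integral_cst//; apply: lte_mul_pinfty => //; first exact: sobolev_integrand_ge0.
  by rewrite ge0_fin_numE ?sobolev_integrand_ge0.
by rewrite [X in (X < _)%E](@lebesgue_measure_itv R)/= lte_fin lb ltry.
Qed.

Lemma sobolev_integrand_lty t : 0 < t -> (0 < A t)%E -> (k t < +oo)%E.
Proof.
move=> t0 At0; apply: poweR_lty; have [Ay|Aty] := eqVneq (A t) +oo%E.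
  by rewrite Ay invey mule0 ltry.
have fA : A t \is a fin_num by rewrite ge0_fin_numE ?(ltW At0)// ltey.
by rewrite -(fineK fA) inver gt_eqF ?fine_gt0 ?At0 ?ltey// -EFinM ltry.
Qed.

Lemma sobolev_integrandE t : 0 < t -> (0 < A t)%E -> (A t < +oo)%E ->
  k t = ((t / fine (A t)) `^ r)%:E.
Proof.
move=> t0 At0 Aty; have fA : A t \is a fin_num by rewrite ge0_fin_numE ?(ltW At0).
rewrite /k /sobolev_integrand -{1}(fineK fA) inver gt_eqF; last by rewrite fine_gt0// At0.
by rewrite -EFinM poweR_EFin.
Qed.

(** The integrand is nonincreasing, so over ]p, b[ it is at least its value at [b]. This supplies
    the hypothesis [Ige] of the discrete estimate. *)
Lemma partial_sobolev_increment l p b : 0 <= l -> l <= p -> 0 < p -> p <= b ->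
  (forall s, (partial_sobolev l s < +oo)%E) -> (0 < A p)%E -> (A b < +oo)%E ->
  (b - p) * (b / fine (A b)) `^ r <=
  fine (partial_sobolev l b) - fine (partial_sobolev l p).
Proof.
move=> l0 lp p0 pb fin Ap Ab.
have fl s : partial_sobolev l s \is a fin_num by rewrite ge0_fin_numE ?partial_sobolev_ge0.
have b0 : 0 < b by exact: lt_le_trans pb.
have Abp : (0 < A b)%E by apply: lt_le_trans Ap _; exact: young_nd (ltW p0) pb.
rewrite lerBrDr -lee_fin EFinD (fineK (fl _)) (fineK (fl _)) EFinM -sobolev_integrandE// addeC.
apply: le_trans (partial_sobolev_split l0 lp pb); apply: leeD2l.
by apply: partial_sobolev_gt0 => //; exact: ltW.
Qed.

(** Convergence near 0 forces a finite value of the integrand at some point, and beyond that point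
    the integrand is bounded. *)
Lemma converges_at_zero_lty : converges_at_zero n A ->
  forall s, (partial_sobolev 0 s < +oo)%E.
Proof.
move=> [s0 s00 h] s.
have [t /andP[t0 ts] kt] : exists2 t, 0 < t < s0 & (k t < +oo)%E.
  apply: contrapT => nk; move: h; rewrite ltNge => /negP; apply.
  have m1 : measurable (`]0, s0[%classic : set (measurableTypeR R)) by exact: measurable_itv.
  rewrite (_ : +oo%E = \int[leb]_(t in `]0%R, s0[) cst +oo t)%E.
    have mk : measurable_fun (`]0, s0[%classic : set (measurableTypeR R)) k by exact: mitv.
    apply: ge0_le_integral => //; move=> x; rewrite /= in_itv/= => x0s;
      (exact: sobolev_integrand_ge0 || (rewrite leNgt; apply/negP => kx; by apply: nk; exists x)).
  rewrite integral_cst// [X in (_ * X)%E](@lebesgue_measure_itv R)/= lte_fin s00 sube0.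
  by rewrite gt0_mulye// lte_fin.
have [st|ts'] := leP s t.
  apply: le_lt_trans h; apply: ge0_subset_integral => //; try exact: measurable_itv.
  - exact: mitv.
  - by move=> x _; exact: sobolev_integrand_ge0.
  - move=> x /=; rewrite !in_itv/= => /andP[-> xs] /=.
    by apply: lt_trans ts; exact: lt_le_trans xs st.
have m1 : measurable (`]0, t]%classic : set (measurableTypeR R)) by exact: measurable_itv.
have m2 : measurable (`]t, s[%classic : set (measurableTypeR R)) by exact: measurable_itv.
have e : `]0, s[%classic = `]0, t] `|` `]t, s[.
  by rewrite -itv_bndbnd_setU// bnd_simp// ltW.
rewrite /partial_sobolev e ge0_integral_setU//; last 3 first.
- rewrite -e; exact: mitv.
- by move=> x _; exact: sobolev_integrand_ge0.
- apply/disj_setPS => x [/=]; rewrite !in_itv/= => /andP[_ xp] /andP[px _].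
  by move: (le_lt_trans xp px); rewrite ltxx.
apply: lte_add_pinfty; last exact: partial_sobolev_lty.
apply: le_lt_trans h; apply: ge0_subset_integral => //; try exact: measurable_itv.
- exact: mitv.
- by move=> x _; exact: sobolev_integrand_ge0.
- move=> x /=; rewrite !in_itv/= => /andP[-> xs] /=.
  exact: le_lt_trans xs ts.
Qed.

End sobolev_integral.

Section young_mean.
Context d (T : measurableType d) (R : realType).
Variables (mu : {measure set T -> \bar R}) (D : set T) (mD : measurable D).
Variables (A : R -> \bar R) (yA : young_function A).

(* No use of Jensen's inequality: [A t / t] is nondecreasing, so the part of  *)
(* [e] above [a] already carries enough energy.                               *)
Lemma young_mean (e : T -> R) (a s x : R) : 0 <= a -> 0 < s ->
  (forall y, 0 <= e y) -> mu.-integrable D (EFin \o e) ->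
  (mu D <= s%:E)%E -> measurable_fun D (fun y => A (e y)) ->
  (\int[mu]_(y in D) A (e y) <= x%:E)%E ->
  2 * a * s <= \int[mu]_(y in D) e y -> (A a <= (x / s)%:E)%E.
Proof.
move=> a0 s0 e0 ie Ds mAe Aex ae.
have x0 : 0 <= x.
  by rewrite -lee_fin; apply: le_trans Aex; apply: integral_ge0 => y _; exact: young_ge0.
have [az|an] := eqVneq a 0; first by rewrite az young0// lee_fin divr_ge0// ltW.
have ap : 0 < a by rewrite lt_neqAle eq_sym an.
have Dlty : (mu D < +oo)%E by apply: le_lt_trans Ds _; exact: ltry.
(* Working with finite y <= A a covers A a = +oo as well: y = x/s + 1 would then be a
   contradiction. *)
have key y : 0 <= y -> (y%:E <= A a)%E -> y <= x / s.
  move=> y0 yAa; rewrite ler_pdivlMr//.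
  have ya : 0 <= y / a by rewrite divr_ge0.
  have ica : mu.-integrable D (EFin \o cst a) by exact: integrable_Rcst.
  have iea : mu.-integrable D (EFin \o (fun z => e z - a)).
    by have := integrableB mD ie ica; apply: eq_integrable.
  have iyea : mu.-integrable D (EFin \o (fun z => y / a * (e z - a))).
    by have := integrableZl mD (y / a) iea; apply: eq_integrable.
  have le1 : (\int[mu]_(z in D) (y / a * (e z - a))%:E <= \int[mu]_(z in D) A (e z))%E.
    have iA : mu.-integrable D (fun z => A (e z)).
      apply/integrableP; split => //; apply: le_lt_trans (ltry x).
      apply: le_trans Aex; rewrite le_eqVlt; apply/orP; left; apply/eqP.
      by apply: eq_integral => z _; rewrite gee0_abs// young_ge0.
    apply: (le_integral mD iyea iA) => z Dz; rewrite /=.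
    have [az|za] := leP a (e z); last first.
      apply: le_trans (_ : (0%:E <= _)%E); last exact: young_ge0.
      by rewrite lee_fin mulr_ge0_le0// subr_le0 ltW.
    have := young_slope yA (ltW ap) az; case: (A (e z)) (young_ge0 yA (e0 z)) => [w w0|_ _|//].
      have : ((e z * y)%:E <= (e z)%:E * A a)%E.
        by rewrite EFinM; apply: lee_wpmul2l => //; rewrite lee_fin.
      move=> /le_trans h /h; rewrite -EFinM !lee_fin => h'.
      apply: le_trans (_ : y / a * e z <= _); first by apply: ler_wpM2l => //; rewrite gerBl.
      by rewrite mulrAC ler_pdivrMr// mulrC [w * a]mulrC.
    by rewrite leey.
  have E : \int[mu]_(z in D) (y / a * (e z - a)) = y / a * (\int[mu]_(z in D) e z - a * fine (mu D)).
    by rewrite (RintegralZl _ mD iea) (RintegralB mD ie ica) Rintegral_cst.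
  have Ds' : fine (mu D) <= s.
    rewrite -lee_fin fineK// ge0_fin_numE//.
  rewrite -lee_fin; apply: le_trans Aex; apply: le_trans le1.
  rewrite -(EFin_Rintegral mD iyea) lee_fin E.
  apply: le_trans (_ : y / a * (2 * a * s - a * s) <= _); last first.
    by apply: ler_wpM2l => //; apply: lerB => //; apply: ler_wpM2l.
  by rewrite (_ : 2 * a * s - a * s = a * s); [rewrite mulrA mulfVK|ring].
have [Ay|Ay] := eqVneq (A a) +oo%E.
  have := key (x / s + 1) _ _; rewrite Ay leey => /(_ _ isT).
  by rewrite addr_ge0 ?divr_ge0 ?(ltW s0)// => /(_ isT); rewrite gerDl ler10.
have fA : A a \is a fin_num by rewrite ge0_fin_numE ?young_ge0// ltey.
by rewrite -(fineK fA) lee_fin; apply: key; rewrite ?fineK// fine_ge0// young_ge0.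
Qed.

End young_mean.

(** * Layers of |u| between levels of halving measure *)

Section layers.
Context {R : realType} {m : nat}.
Notation LS := (lebesgue_space R m.+1).
Notation vol := (@volume R m.+1).
Variables (Om : set 'rV[R]_m.+1) (u : 'rV[R]_m.+1 -> R) (g : 'rV[R]_m.+1 -> 'rV[R]_m.+1).
Hypotheses (m0 : (0 < m)%N) (oOm : open Om) (Omlty : (vol Om < +oo)%E) (wg : is_weak_gradient Om u g).
Hypothesis ig : vol.-integrable Om (EFin \o length_fun g).
Variable c : R.
Hypotheses (c0 : 0 < c) (iso : forall G, measurable (G : set LS) -> G `<=` Om ->
      (c%:E * poweR (mine (vol G) (vol (Om `\` G)))
                (conjugate_exponent m.+1)^-1 <= perimeter G Om)%E).
Variables (A A' : R -> \bar R) (yA : young_function A) (yA' : young_function A').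
Variables (La cp tau s eps : R) (I : R -> R).
Hypotheses (La0 : 0 < La) (cp1 : 1 <= cp) (tau0 : 0 < tau) (s0 : 0 < s) (eps0 : 0 < eps).
Hypotheses (A'tau : (0 < A' tau)%E) (s2 : 2 * s <= fine (vol Om)).
Hypothesis AA' : forall t, tau <= t -> (A' t <= A (cp * t)%R)%E.
Hypothesis Aeps : (\int[vol]_(x in super_level Om u (level_of Om u s))
   A (length_fun g x / La)%R <= eps%:E)%E.
Hypothesis Ige0 : forall t, 0 <= I t.
Hypothesis Ige : forall p b, tau <= p -> p <= b -> (A' b < +oo)%E ->
  (b - p) * (b / fine (A' b)) `^ (m.+1%:R - 1)^-1 <= I b - I p.

Let cp0 : 0 < cp. Proof. exact: lt_le_trans cp1. Qed.
Let mOm : measurable Om. Proof. exact: measurable_open_rV. Qed.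
Let mOmL : measurable (Om : set LS). Proof. exact: measurable_lebesgue_space. Qed.
Let mu : measurable_fun (Om : set LS) u. Proof. by have [[]] := wg. Qed.
Let mlen : measurable_fun (Om : set LS) (length_fun g).
Proof. by apply/measurable_EFinP; exact: measurable_int ig. Qed.

Lemma measurable_energy (l : R) : 0 < l ->
  measurable_fun (Om : set LS) (fun x => A (length_fun g x / l)).
Proof.
move=> l0; have mf : measurable_fun (Om : set LS) (fun x => length_fun g x / l).
  by apply: measurable_funM => //; exact: measurable_cst.
apply: (measurable_comp (F := `[0, +oo[%classic : set (measurableTypeR R)) _ _ (measurable_young yA) mf).
  exact: measurable_itv.
by move=> _ [x _ <-] /=; rewrite in_itv/= andbT divr_ge0 ?euclidean_norm_ge0 ?ltW.
Qed.

Let sj (j : nat) : R := s / 2 ^+ j.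
Let sj0 j : 0 < sj j. Proof. by rewrite divr_gt0// exprn_gt0. Qed.
Let sjS j : sj j.+1 = sj j / 2.
Proof. by rewrite /sj exprSr invfM mulrA. Qed.
Let sj_le j : sj j <= s.
Proof. by rewrite /sj ler_pdivrMr ?exprn_gt0// ler_peMr ?exprn_ege1 ?ler1n// ltW. Qed.

Let t j := level_of Om u (sj j).
Let t0 j : 0 <= t j. Proof. exact: level_of_ge0. Qed.
Let tS j : t j <= t j.+1.
Proof.
apply: level_of_anti => //.
by rewrite sjS ler_pdivrMr// ler_peMr ?ler1n// ltW.
Qed.
Let St j : (vol (super_level Om u (t j)) <= (sj j)%:E)%E.
Proof. exact: super_level_of. Qed.

Let q : R := m.+1%:R^-1.
Let q' : R := (@conjugate_exponent R m.+1)^-1.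
(** One factor 2 is the one required by [young_mean], the other comes from s_(j+1)^q' >= s_j^q' / 2;
    [La] rescales the gradient and 1/c is the isoperimetric constant. *)
Let C0 : R := 4 / c * La.
Let C00 : 0 < C0. Proof. by rewrite !mulr_gt0 ?invr_gt0. Qed.
Let a j : R := (t j.+1 - t j) / (C0 * sj j `^ q).
Let sq0 j : 0 < sj j `^ q. Proof. exact: powR_gt0. Qed.
Let a0 j : 0 <= a j.
Proof. by rewrite divr_ge0 ?subr_ge0// mulr_ge0// ltW. Qed.
Let ta j : t j.+1 - t j = C0 * (a j * sj j `^ q).
Proof. by rewrite /a; field; rewrite !gt_eqF. Qed.
Let x j : R := fine (\int[vol]_(y in band Om u (t j) (t j.+1)) A (length_fun g y / La)%R).
Let e y := length_fun g y / La.
Let e0 y : 0 <= e y. Proof. by rewrite divr_ge0 ?euclidean_norm_ge0 ?ltW. Qed.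
Let mband p b : measurable (band Om u p b : set LS).
Proof. exact: measurable_band oOm wg p b. Qed.
Let bandOm p b : band Om u p b `<=` Om. Proof. by move=> y []. Qed.
Let mAe p b : measurable_fun (band Om u p b : set LS) (fun y => A (e y)).
Proof. by apply: (measurable_funS mOmL (@bandOm p b)); exact: measurable_energy. Qed.

Let band_sub p b : t 0%N <= p -> (\int[vol]_(y in band Om u p b) A (e y) <= eps%:E)%E.
Proof.
move=> tp; apply: le_trans Aeps.
have t0E : t 0%N = level_of Om u s by rewrite /t /sj expr0 divr1.
rewrite -t0E.
have mS := measurable_super_level oOm wg (t 0%N).
apply: ge0_subset_integral; [exact: mband|exact: mS| | |].
- by apply: (measurable_funS mOmL (@subIsetl _ _ _)); exact: measurable_energy.
- by move=> y _; exact: young_ge0.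
- by move=> y [Omy /= /andP[py _]]; split => //=; exact: le_lt_trans py.
Qed.

Let t_mono i j : (i <= j)%N -> t i <= t j.
Proof.
move=> ij; rewrite -(subnK ij); elim: (j - i)%N => // k IH.
by rewrite addSn; exact: le_trans (tS _).
Qed.

Let xE j : (\int[vol]_(y in band Om u (t j) (t j.+1)) A (e y) = (x j)%:E)%E.
Proof.
rewrite /x fineK// ge0_fin_numE; last by apply: integral_ge0 => y _; exact: (young_ge0 yA (e0 y)).
by apply: le_lt_trans (band_sub _ (t_mono (leq0n j))) _; exact: ltry.
Qed.

Let x0 j : 0 <= x j.
Proof. by rewrite -lee_fin -xE; apply: integral_ge0 => y _; exact: young_ge0. Qed.

Let sum_x J : (\sum_(j < J) x j <= eps).
Proof.
have : ((\sum_(j < J) x j)%:E <= \int[vol]_(y in band Om u (t 0%N) (t J)) A (e y))%E.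
  elim: J => [|J IH].
    by rewrite big_ord0; apply: integral_ge0 => y _; exact: young_ge0.
  rewrite big_ord_recr EFinD -xE.
  apply: le_trans (leeD2r _ IH) _.
  have mU := measurableU _ _ (mband (t 0%N) (t J)) (mband (t J) (t J.+1)).
  rewrite -ge0_integral_setU; last 5 first.
  - exact: mband.
  - exact: mband.
  - by apply: (measurable_funS mOmL); [move=> y [[]|[]]|exact: measurable_energy].
  - by move=> y _; exact: young_ge0.
  - apply/disj_setPS => y [[_ /= /andP[_ yt]] [_ /= /andP[ty _]]].
    by move: (lt_trans yt ty); rewrite ltxx.
  apply: ge0_subset_integral; [exact: mU|exact: mband|exact: mAe| |].
  - by move=> y _; exact: young_ge0.
  - move=> y [[Omy /= /andP[h1 h2]]|[Omy /= /andP[h1 h2]]]; split => //=.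
      by rewrite h1 (lt_le_trans h2).
    by rewrite h2 (le_lt_trans (t_mono (leq0n J))).
move=> h; rewrite -lee_fin; apply: le_trans h _; exact: band_sub.
Qed.

(** The isoperimetric estimate bounds the integral of |grad u| on the layer from below by 2 La a_j
    s_j, with a_j the normalized height; [young_mean] converts this into energy. A level t_(j+1) = 0
    is set apart since [closed_level_of] needs positivity. *)
Let Aa j : (A (a j) <= (x j / sj j)%:E)%E.
Proof.
have [tz|tz] := eqVneq (t j.+1) 0.
  have aj0 : a j = 0.
    by rewrite /a (_ : t j.+1 - t j = 0) ?mul0r//; apply/eqP; rewrite eq_le subr_le0 tz t0/= subr_ge0 -tz.
  by rewrite aj0 (young0 yA) lee_fin divr_ge0// ltW.
have tp : 0 < t j.+1 by rewrite lt_neqAle eq_sym tz t0.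
have igb : vol.-integrable (band Om u (t j) (t j.+1)) (EFin \o length_fun g).
  exact: (integrableS mOmL (mband _ _) (@bandOm _ _) ig).
have ie : vol.-integrable (band Om u (t j) (t j.+1)) (EFin \o e).
  have := integrableZl (mband (t j) (t j.+1)) La^-1 igb.
  by apply: eq_integrable; [exact: mband|move=> y _; rewrite /= /e mulrC EFinM].
have bs : (vol (band Om u (t j) (t j.+1)) <= (sj j)%:E)%E.
  apply: le_trans (St j); apply: le_measure; rewrite ?inE; [exact: mband| |].
    exact: measurable_super_level oOm wg (t j).
  by move=> y [Omy /= /andP[h _]].
have YM := @young_mean _ LS R vol _ (mband (t j) (t j.+1)) A yA e (a j) (sj j) (x j) (a0 j) (sj0 j) e0 ie bs (@mAe _ _).
apply: YM; first by rewrite xE.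
have hf : 2 * fine (vol (super_level Om u (t j))) <= fine (vol Om).
  apply: le_trans s2; apply: ler_wpM2l => //; apply: le_trans (sj_le j).
  rewrite -lee_fin fineK//; rewrite ge0_fin_numE//.
  by apply: le_lt_trans (St j) _; exact: ltry.
have := isoperimetric_band oOm Omlty wg ig c0 iso (t0 j) (tS j) hf (ltW (sj0 j.+1))
  (closed_level_of mOmL Omlty mu (sj0 j.+1) tp).
rewrite ta -/q' => h.
have eE : \int[vol]_(y in band Om u (t j) (t j.+1)) e y =
    La^-1 * \int[vol]_(y in band Om u (t j) (t j.+1)) length_fun g y.
  rewrite -(RintegralZl _ (mband _ _) igb); apply: eq_Rintegral => y _.
  by rewrite mulrC.
rewrite eE ler_pdivlMl//; apply: le_trans h.
have half : sj j `^ q' / 2 <= sj j.+1 `^ q'.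
  rewrite sjS powRM ?(ltW (sj0 j))// ler_pM2l ?powR_gt0//.
  apply: ger1_powR; first by rewrite invr_gt0 ltr0n/= invf_le1 ?ler1n.
  rewrite /q' /conjugate_exponent invf_div; have h1 : (0 : R) < m.+1%:R by [].
  by rewrite ler_pdivrMr// mul1r gerBl.
have sjE : sj j = sj j `^ q' * sj j `^ q.
  rewrite -powRD; last by rewrite (gt_eqF (sj0 j)) implybT.
  rewrite (_ : q' + q = 1) ?powRr1 ?(ltW (sj0 j))//.
  rewrite /q' /q /conjugate_exponent; field.
  rewrite [1 + _ - 1]addrAC subrr add0r pnatr_eq0 -lt0n m0 andbT.
  by rewrite -(natrD _ 1 m) pnatr_eq0.
rewrite {1}sjE.
rewrite (_ : La * _ = c * (sj j `^ q' / 2) * (C0 * (a j * sj j `^ q))); last first.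
  by rewrite /C0; field; rewrite gt_eqF.
apply: ler_wpM2r; first by rewrite mulr_ge0 ?(ltW C00)// mulr_ge0// ltW.
by apply: ler_wpM2l half; exact: ltW.
Qed.

(** Dividing by [cp] turns the bound on A(a_j) into one on A'(a_j / cp), the function in the Sobolev
    integral. *)
Let b := running_max tau (fun j => a j / cp).

Let b_tau j : tau <= b j. Proof. exact: running_max_ge. Qed.

Let level_bound J : t J <= t 0%N + C0 * cp * (1 - 2^-1 `^ q)^-1 *
  (tau * s `^ q + eps `^ q * I (b J) `^ q').
Proof.
have n2 : (2 <= m.+1)%N by [].
have A'a j : tau <= a j / cp -> (A' (a j / cp) <= (x j / sj j)%:E)%E.
  move=> /AA' /le_trans; apply; rewrite mulrC divfK ?gt_eqF//; exact: Aa.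
have := sum_estimate n2 yA' tau0 eps0 A'tau x0 sj0 sjS A'a Ige0 Ige (sum_x J).
rewrite -/b {2}/sj expr0 divr1 => h.
rewrite -lerBlDl; have -> : t J - t 0%N = C0 * cp * \sum_(j < J) a j / cp * sj j `^ q.
  rewrite -(telescope_sumr t (leq0n J)) big_mkord mulr_sumr; apply: eq_bigr => j _.
  by rewrite ta; field; rewrite gt_eqF.
rewrite -[leRHS]mulrA; apply: ler_wpM2l => //.
by rewrite mulr_ge0 ?ltW.
Qed.

(** A maximum costs at most a sum under [A], so A(b_j) <= y_j with y_j = A(tau) + sum of the x_l /
    s_l over l < j. As s_j halves, the weighted sum of the y_j is computed exactly by parts in
    [W]. *)
Let sum_energy J : (A tau < +oo)%E ->
  (\sum_(j < J) (sj j)%:E * A (b j.+1) <= (2 * s)%:E * A tau + (2 * eps)%:E)%E.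
Proof.
move=> Atau; have fAt : A tau \is a fin_num by rewrite ge0_fin_numE ?young_ge0// ltW.
pose y j := fine (A tau) + \sum_(l < j) x l / sj l.
have Ab j : (A (b j) <= (y j)%:E)%E.
  elim: j => [|j IH]; first by rewrite /y big_ord0 addr0 fineK.
  rewrite /y big_ord_recr addrA EFinD.
  have acp : 0 <= a j / cp by rewrite divr_ge0// ltW.
  have bj0 : 0 <= b j by apply: le_trans (b_tau j); exact: ltW.
  have : (A (b j.+1) <= A (b j) + A (a j / cp))%E by exact: young_max.
  move=> /le_trans; apply; apply: leeD; first exact: IH.
  apply: le_trans (Aa j); apply: young_nd => //.
  by rewrite ler_pdivrMr// ler_peMr.
have yS j : y j.+1 = y j + x j / sj j by rewrite /y big_ord_recr addrA.
have W : \sum_(j < J) sj j * y j.+1 + 2 * sj J * y J = 2 * s * fine (A tau) + 2 * \sum_(j < J) x j.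
  elim: J => [|J IH]; first by rewrite !big_ord0 add0r mulr0 addr0 /y big_ord0 addr0 /sj expr0 divr1.
  transitivity (2 * s * fine (A tau) + 2 * (\sum_(j < J) x j) + 2 * x J); last first.
    by rewrite big_ord_recr /=; ring.
  by rewrite -IH big_ord_recr /= yS sjS; field; rewrite gt_eqF.
have y0 j : 0 <= y j by rewrite addr_ge0 ?fine_ge0 ?young_ge0 ?(ltW tau0)// sumr_ge0// => l _; rewrite divr_ge0// ltW.
apply: (@le_trans _ _ (\sum_(j < J) sj j * y j.+1)%:E).
  rewrite -sumEFin; apply: lee_sum => j _; rewrite [leRHS]EFinM.
  by apply: lee_wpmul2l; [rewrite lee_fin ltW|exact: Ab].
rewrite -(fineK fAt) -EFinM -EFinD lee_fin.
apply: (@le_trans _ _ (2 * s * fine (A tau) + 2 * \sum_(j < J) x j)).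
  by rewrite -W lerDl mulr_ge0// mulr_ge0// ltW.
by rewrite lerD2l ler_wpM2l// sum_x.
Qed.

Lemma layers : exists t b : nat -> R, [/\ t 0%N = level_of Om u s /\ (forall j, t j <= t j.+1),
  forall j, (vol (super_level Om u (t j)) <= (s / 2 ^+ j)%:E)%E,
  (forall j, tau <= b j) /\ (forall j, b j <= b j.+1),
  forall J, t J <= t 0%N + 4 / c * La * cp * (1 - 2^-1 `^ q)^-1 *
    (tau * s `^ q + eps `^ q * I (b J) `^ q') &
  (A tau < +oo)%E -> forall J,
    (\sum_(j < J) (s / 2 ^+ j)%:E * A (b j.+1) <= (2 * s)%:E * A tau + (2 * eps)%:E)%E].
Proof.
exists t, b; split.
- by split => //; rewrite /t /sj expr0 divr1.
- exact: St.
- by split => // j; exact: running_max_nd.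
- exact: level_bound.
- by move=> Atau J; exact: sum_energy.
Qed.

End layers.

(** * Strong convergence of bounded coefficients *)

Lemma measurable_sgr (R : realType) : measurable_fun [set: R] (@Num.sg R).
Proof.
rewrite (_ : @Num.sg R = \1_`]0, +oo[%classic \- \1_`]-oo, 0[%classic).
  by apply: measurable_funB; apply: measurable_indic; exact: measurable_itv.
apply/funext => x /=; rewrite !indicE !mem_setE !in_itv/= andbT.
by case: (sgrP x) => h; rewrite ?ltxx ?h ?(lt_gtF h) ?subr0 ?sub0r.
Qed.

Section bounded_primitive.
Context {R : realType}.
Notation leb := (@lebesgue_measure R).
Variables (h : R -> R) (L : R).
Hypotheses (mh : measurable_fun setT h) (hL : forall t, `|h t| <= L).

Let ih s t : leb.-integrable `[s, t] (EFin \o h).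
Proof.
have mst : measurable (`[s, t]%classic : set (measurableTypeR R)) by exact: measurable_itv.
apply: (integrable_Rle mst (g := cst L)); first exact: measurable_funTS.
  by apply: integrable_Rcst => //; exact: lebesgue_itv_lty.
by move=> x _; exact: hL.
Qed.

Let split p q r : p <= q -> q <= r ->
  \int[leb]_(x in `[p, r]) h x = \int[leb]_(x in `[p, q]) h x + \int[leb]_(x in `[q, r]) h x.
Proof.
move=> pq qr; have := @Rintegral_itvB R h (BLeft p) (BRight r) q.
rewrite !bnd_simp => /(_ (ih p r) pq qr) E.
rewrite [X in _ + X](_ : _ = \int[leb]_(x in `]q, r]) h x).
  by rewrite -E addrC subrK.
rewrite Rintegral_itv_obnd_cbnd//; apply: integrableS (ih q r) => //.
by apply: subset_itvr; rewrite bnd_simp.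
Qed.

(** The primitive vanishing at 0: its Lipschitz bound then reads |F(w)| <= L |w|, so compositions
    with integrable functions are integrable. *)
Definition signed_primitive (t : R) : R :=
  if 0 <= t then \int[leb]_(x in `[0, t]) h x else - \int[leb]_(x in `[t, 0]) h x.

Lemma primitive_signed : primitive signed_primitive h.
Proof.
move=> s t st; rewrite /signed_primitive; case: (leP 0 s) => s0; case: (leP 0 t) => t0.
- by rewrite (split s0 st) addrC addKr.
- by move: (le_lt_trans (le_trans s0 st) t0); rewrite ltxx.
- by rewrite opprK addrC -split// ltW.
- by rewrite opprK addrC (split st (ltW t0)) addrK.
Qed.

Lemma signed_primitive_lipschitz s t :
  `|signed_primitive s - signed_primitive t| <= L * `|s - t|.
Proof.
wlog st : s t / s <= t.
  move=> H; have /orP[st|ts] := le_total s t; first exact: H.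
  by rewrite distrC (distrC s); exact: H.
rewrite distrC (distrC s) primitive_signed//.
rewrite (ger0_norm (_ : 0 <= t - s)) ?subr_ge0//.
exact: (Rintegral_itv_le st mh (fun x _ => hL x)).
Qed.

Lemma signed_primitive0 : signed_primitive 0 = 0.
Proof. by rewrite /signed_primitive lexx set_itv1 Rintegral_set1. Qed.

End bounded_primitive.

(** * Multipliers against which a bounded sequence tends weakly to 0 *)

Section asymptotically_null.
Context d (T : measurableType d) (R : realType).
Variables (mu : {measure set T -> \bar R}) (D : set T) (mD : measurable D).
Variables (G : T -> R) (d_ : nat -> T -> R) (C : R).
Hypotheses (iG : mu.-integrable D (EFin \o G))
  (md : forall k, measurable_fun D (d_ k)) (dC : forall k x, `|d_ k x| <= C).

Implicit Types psi : T -> R.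

Definition asymptotically_null (psi : T -> R) :=
  \int[mu]_(x in D) (d_ k x * (G x * psi x)) @[k --> \oo] --> (0 : R).

Let iGpsi psi (L : R) : measurable_fun D psi -> (forall x, D x -> `|psi x| <= L) ->
  mu.-integrable D (EFin \o (fun x => G x * psi x)).
Proof. by move=> mpsi psiL; exact: (integrable_mul_bounded mD mpsi iG psiL). Qed.

Let idG k psi (L : R) : measurable_fun D psi -> (forall x, D x -> `|psi x| <= L) ->
  mu.-integrable D (EFin \o (fun x => d_ k x * (G x * psi x))).
Proof.
move=> mpsi psiL; exact: (integrableMb mD (md k) (iGpsi mpsi psiL) (fun x _ => dC k x)).
Qed.

Lemma asymptotically_nullD psi psi' (L L' : R) :
  measurable_fun D psi -> measurable_fun D psi' ->
  (forall x, D x -> `|psi x| <= L) -> (forall x, D x -> `|psi' x| <= L') ->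
  asymptotically_null psi -> asymptotically_null psi' -> asymptotically_null (psi \+ psi').
Proof.
move=> m1 m2 b1 b2 a1 a2.
rewrite /asymptotically_null -[X in _ --> X]addr0.
rewrite (_ : (fun k => _) = (fun k => \int[mu]_(x in D) (d_ k x * (G x * psi x)) +
    \int[mu]_(x in D) (d_ k x * (G x * psi' x)))); first exact: cvgD a1 a2.
apply/funext => k; rewrite -(RintegralD mD (idG k m1 b1) (idG k m2 b2)).
by apply: eq_Rintegral => x _ /=; rewrite -mulrDr -mulrDr.
Qed.

Lemma asymptotically_nullZ psi (c L : R) :
  measurable_fun D psi -> (forall x, D x -> `|psi x| <= L) ->
  asymptotically_null psi -> asymptotically_null (c \*o psi).
Proof.
move=> m1 b1 a1; rewrite /asymptotically_null -[X in _ --> X](mulr0 c).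
rewrite (_ : (fun k => _) = (fun k => c * \int[mu]_(x in D) (d_ k x * (G x * psi x)))).
  by apply: cvgM; [exact: cvg_cst|exact: a1].
apply/funext => k; rewrite -(RintegralZl _ mD (idG k m1 b1)).
by apply: eq_Rintegral => x _ /=; ring.
Qed.

(** The uniform bound [C] on the [d_] makes the error of replacing psi by psi_l, namely C times the
    integral of |G (psi_l - psi)|, independent of [k]. *)
Lemma asymptotically_null_lim (psi_ : nat -> T -> R) psi (L : R) :
  (forall l, measurable_fun D (psi_ l)) -> measurable_fun D psi ->
  (forall l x, D x -> `|psi_ l x| <= L) ->
  (forall x, D x -> psi_ l x @[l --> \oo] --> psi x) ->
  (forall l, asymptotically_null (psi_ l)) -> asymptotically_null psi.
Proof.
move=> m_ m b_ cv a_.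
have C0 : 0 <= C by exact: le_trans (dC 0 point).
have b x : D x -> `|psi x| <= L.
  move=> Dx; have h : `|psi_ l x| @[l --> \oo] --> `|psi x| by apply: cvg_norm; exact: cv.
  rewrite -(cvg_lim (@Rhausdorff R) h).
  by apply: limr_le; [apply/cvg_ex; eexists; exact: h|apply: nearW => l; exact: b_].
have cv2 : \int[mu]_(x in D) `|G x * (psi_ l x - psi x)| @[l --> \oo] --> (0 : R).
  rewrite (_ : 0 = \int[mu]_(x in D) cst (0 : R) x); last by rewrite /Rintegral integral0.
  apply: (Rdominated_convergence mD (g := fun x => `|G x| * (2 * L))).
  - move=> l; apply: measurableT_comp => //; apply: measurable_funM.
      by apply/measurable_EFinP; exact: measurable_int iG.
    exact: measurable_funB.
  - exact: measurable_cst.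
  - apply: aeW => x Dx; rewrite -[X in _ --> X](_ : `|G x * (psi x - psi x)| = 0); last first.
      by rewrite subrr mulr0 normr0.
    apply: cvg_norm; apply: cvgM; first exact: cvg_cst.
    by apply: cvgB; [exact: cv|exact: cvg_cst].
  - have := integrableZl mD (2 * L) (integrable_abse iG).
    by apply: eq_integrable => // x _; rewrite /= -EFinM mulrC.
  - move=> l x Dx; rewrite normr_id normrM; apply: ler_wpM2l => //.
    apply: le_trans (ler_normB _ _) _; rewrite mulr_natl mulr2n.
    by apply: lerD; [exact: b_|exact: b].
apply/cvgrPdist_le => e e0.
have e2 : 0 < e / 2 / (C + 1) by rewrite !divr_gt0// ltr_wpDl.
have /cvgrPdist_le/(_ _ e2)[l _ /(_ l (leqnn l))] := cv2.
rewrite sub0r normrN => hl.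
have e20 : 0 < e / 2 by rewrite divr_gt0.
have /cvgrPdist_le/(_ _ e20) := a_ l; apply: filterS => k; rewrite !sub0r !normrN => hk.
have mdif : measurable_fun D (psi \- psi_ l) by exact: measurable_funB.
have bdif x : D x -> `|(psi \- psi_ l) x| <= L + L.
  by move=> Dx; apply: le_trans (ler_normB _ _) _; apply: lerD; [exact: b|exact: b_].
have -> : \int[mu]_(x in D) (d_ k x * (G x * psi x)) =
   \int[mu]_(x in D) (d_ k x * (G x * psi_ l x)) +
   \int[mu]_(x in D) (d_ k x * (G x * (psi \- psi_ l) x)).
  rewrite -(RintegralD mD (idG k (m_ l) (b_ l)) (idG k mdif bdif)).
  by apply: eq_Rintegral => x _ /=; ring.
rewrite (splitr e); apply: le_trans (ler_normD _ _) _; apply: lerD => //.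
apply: le_trans (le_normr_Rintegral mD (idG k mdif bdif)) _.
have ia : mu.-integrable D (EFin \o (fun x => `|G x * (psi_ l x - psi x)|)).
  have := integrable_abse (iGpsi mdif bdif); apply: eq_integrable => // x _ /=.
  by rewrite !normrM distrC.
apply: le_trans (_ : C * \int[mu]_(x in D) `|G x * (psi_ l x - psi x)| <= _).
  rewrite -(RintegralZl _ mD ia); apply: (le_Rintegral mD).
  - exact: integrable_abse (idG k mdif bdif).
  - by have := integrableZl mD C ia; apply: eq_integrable.
  - move=> x Dx; rewrite normrM !normrM (distrC (psi_ l x)); exact: ler_wpM2r.
apply: le_trans (_ : (C + 1) * (e / 2 / (C + 1)) <= _); last first.
  by rewrite mulrC divfK// gt_eqF// ltr_wpDl.
apply: ler_pM => //; first by apply: Rintegral_ge0.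
  by rewrite lerDl.
by move: hl; rewrite ger0_norm//; apply: Rintegral_ge0.
Qed.

End asymptotically_null.

(** * Convergence of h(u_k) grad u for bounded Borel h *)

Section strong_convergence.
Context {R : realType} {m : nat}.
Notation LS := (lebesgue_space R m.+1).
Notation vol := (@volume R m.+1).
Notation bl := (@borel_lebesgue_rV R m.+1).
Variables (Om : set 'rV[R]_m.+1) (u_ : nat -> 'rV[R]_m.+1 -> R) (u : 'rV[R]_m.+1 -> R).
Variables (g_ : nat -> 'rV[R]_m.+1 -> 'rV[R]_m.+1) (g : 'rV[R]_m.+1 -> 'rV[R]_m.+1).
Hypotheses (oOm : open Om) (Omlty : (vol Om < +oo)%E).
Hypotheses (wg_ : forall k, is_weak_gradient Om (u_ k) (g_ k)) (wg : is_weak_gradient Om u g).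
Hypotheses (iu_ : forall k, vol.-integrable Om (EFin \o u_ k)) (iu : vol.-integrable Om (EFin \o u)).
Hypotheses (ig_ : forall k i, vol.-integrable Om (EFin \o (fun x => g_ k x ord0 i)))
  (ig : forall i, vol.-integrable Om (EFin \o (fun x => g x ord0 i))).
Hypothesis cvu : \int[vol]_(x in Om) `|u_ k x - u x| @[k --> \oo] --> (0 : R).
Hypothesis cvg : forall i, \int[vol]_(x in Om) `|g_ k x ord0 i - g x ord0 i| @[k --> \oo] --> (0 : R).

Let mOm : measurable Om. Proof. exact: measurable_open_rV. Qed.
Let mOmL : measurable (Om : set LS). Proof. exact: measurable_lebesgue_space. Qed.
Let mu_ k : measurable_fun (Om : set LS) (u_ k).
Proof. by apply/measurable_EFinP; exact: measurable_int (iu_ k). Qed.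
Let mu : measurable_fun (Om : set LS) u.
Proof. by apply/measurable_EFinP; exact: measurable_int iu. Qed.

Section bounded_coefficient.
Variable h : R -> R.
Hypotheses (mh : measurable_fun setT h) (h1 : forall t, `|h t| <= 1).
Variable i : 'I_m.+1.

Let F := signed_primitive h.
Let hloc : forall M : R, exists L, forall t, `|t| <= M -> `|h t| <= L.
Proof. by move=> M; exists 1. Qed.
Let pF : primitive F h. Proof. exact: (primitive_signed mh h1). Qed.
Let mF : measurable_fun setT F.
Proof. by apply: continuous_measurable_fun; exact: (primitive_continuous mh hloc pF). Qed.

Let iF (w : 'rV[R]_m.+1 -> R) : vol.-integrable Om (EFin \o w) ->
  vol.-integrable Om (EFin \o (F \o w)).
Proof.
move=> iw; have mw : measurable_fun (Om : set LS) w by apply/measurable_EFinP; exact: measurable_int iw.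
apply: (integrable_Rle mOmL (g := fun x => `|w x|)).
- exact: measurableT_comp mF mw.
- exact: integrable_abse iw.
- move=> x _ /=; have := signed_primitive_lipschitz mh h1 (w x) 0.
  by rewrite signed_primitive0 !subr0 mul1r.
Qed.

Let ihg (w : 'rV[R]_m.+1 -> R) (w' : 'rV[R]_m.+1 -> R) : vol.-integrable Om (EFin \o w) ->
  measurable_fun (Om : set LS) w' ->
  vol.-integrable Om (EFin \o (fun x => h (w' x) * w x)).
Proof.
move=> iw mw'; apply: (integrableMb mOmL _ iw (fun x _ => h1 _)).
exact: measurableT_comp mh mw'.
Qed.

Let d_ k x := h (u_ k x) - h (u x).
Let G x := g x ord0 i.
Let md k : measurable_fun (Om : set LS) (d_ k).
Proof. by apply: measurable_funB; exact: (measurableT_comp mh). Qed.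
Let d2 k x : `|d_ k x| <= 2.
Proof. by apply: le_trans (ler_normB _ _) _; have := h1 (u_ k x); have := h1 (u x); lra. Qed.

(** The chain rule for u_k and for [u] rewrites the integral as minus that of (F(u_k) - F(u)) d_i
    phi plus that of h(u_k) (d_i u_k - d_i u) phi. Both vanish in the limit since [F] is 1-Lipschitz
    and |h| <= 1; no continuity of [h] enters. *)
Let null_test phi : class_C 1 phi -> compactly_supported Om phi ->
  asymptotically_null vol Om G d_ phi.
Proof.
move=> C1 cs; have [M hM] := test_bounded i C1 cs.
have M0 : 0 <= M by have [+ _] := hM 0; exact: le_trans.
have [cphi /(_ i)[_ cp]] := (class_C1P _).1 C1.
have mc (f : 'rV[R]_m.+1 -> R) : continuous f -> measurable_fun (Om : set LS) f.
  move=> cf; apply: measurable_fun_lebesgue_space; first exact: mOm.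
  by apply: measurable_funTS; exact: continuous_measurable_rV.
have b1 x : Om x -> `|phi x| <= M by move=> _; have [] := hM x.
have b2 x : Om x -> `|partial i phi x| <= M by move=> _; have [] := hM x.
have E k : \int[vol]_(x in Om) (d_ k x * (G x * phi x)) =
    - ((\int[vol]_(x in Om) ((F (u_ k x) - F (u x)) * partial i phi x))
    + (\int[vol]_(x in Om) (h (u_ k x) * (g_ k x ord0 i - g x ord0 i) * phi x))).
  have c1 := weak_gradient_chain oOm (wg_ k) mh hloc pF (iF (iu_ k)) (ihg (ig_ k i) (mu_ k)) C1 cs.
  have c2 := weak_gradient_chain oOm wg mh hloc pF (iF iu) (ihg (ig i) mu) C1 cs.
  have j1 := integrable_mul_bounded mOmL (mc _ cp) (iF (iu_ k)) b2.
  have j2 := integrable_mul_bounded mOmL (mc _ cp) (iF iu) b2.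
  have j3 := integrable_mul_bounded mOmL (mc _ cphi) (ihg (ig_ k i) (mu_ k)) b1.
  have j4 := integrable_mul_bounded mOmL (mc _ cphi) (ihg (ig i) mu) b1.
  have j5 := integrable_mul_bounded mOmL (mc _ cphi) (ihg (ig i) (mu_ k)) b1.
  have -> : \int[vol]_(x in Om) ((F (u_ k x) - F (u x)) * partial i phi x) =
      \int[vol]_(x in Om) (F (u_ k x) * partial i phi x) - \int[vol]_(x in Om) (F (u x) * partial i phi x).
    by rewrite -(RintegralB mOmL j1 j2); apply: eq_Rintegral => x _; rewrite mulrBl.
  have -> : \int[vol]_(x in Om) (h (u_ k x) * (g_ k x ord0 i - g x ord0 i) * phi x) =
      \int[vol]_(x in Om) (h (u_ k x) * g_ k x ord0 i * phi x) - \int[vol]_(x in Om) (h (u_ k x) * g x ord0 i * phi x).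
    by rewrite -(RintegralB mOmL j3 j5); apply: eq_Rintegral => x _; ring.
  rewrite c1 c2.
  have -> : \int[vol]_(x in Om) (d_ k x * (G x * phi x)) =
      \int[vol]_(x in Om) (h (u_ k x) * g x ord0 i * phi x) - \int[vol]_(x in Om) (h (u x) * g x ord0 i * phi x).
    by rewrite -(RintegralB mOmL j5 j4); apply: eq_Rintegral => x _; rewrite /d_ /G; ring.
  by move: (\int[vol]_(x in Om) (h (u_ k x) * g_ k x ord0 i * phi x)) (\int[vol]_(x in Om) (h (u x) * g x ord0 i * phi x)) (\int[vol]_(x in Om) (h (u_ k x) * g x ord0 i * phi x)) => a b c; ring.
have dom k : `|\int[vol]_(x in Om) (d_ k x * (G x * phi x))| <=
    M * \int[vol]_(x in Om) `|u_ k x - u x| + M * \int[vol]_(x in Om) `|g_ k x ord0 i - g x ord0 i|.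
  rewrite E normrN; apply: le_trans (ler_normD _ _) _; apply: lerD.
    have iud : vol.-integrable Om (EFin \o (fun x => u_ k x - u x)).
      by have := integrableB mOmL (iu_ k) iu; apply: eq_integrable.
    have iFd : vol.-integrable Om (EFin \o (fun x => F (u_ k x) - F (u x))).
      by have := integrableB mOmL (iF (iu_ k)) (iF iu); apply: eq_integrable.
    have j := integrable_mul_bounded mOmL (mc _ cp) iFd b2.
    apply: le_trans (le_normr_Rintegral mOmL j) _.
    rewrite -(RintegralZl _ mOmL (integrable_abse iud)); apply: (le_Rintegral mOmL).
    - exact: integrable_abse j.
    - by have := integrableZl mOmL M (integrable_abse iud); apply: eq_integrable.
    - move=> x Omx; rewrite normrM mulrC; apply: ler_pM => //; first exact: b2.
      by have := signed_primitive_lipschitz mh h1 (u_ k x) (u x); rewrite mul1r.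
  have igd : vol.-integrable Om (EFin \o (fun x => g_ k x ord0 i - g x ord0 i)).
    by have := integrableB mOmL (ig_ k i) (ig i); apply: eq_integrable.
  have j := integrable_mul_bounded mOmL (mc _ cphi) (ihg igd (mu_ k)) b1.
  apply: le_trans (le_normr_Rintegral mOmL j) _.
  rewrite -(RintegralZl _ mOmL (integrable_abse igd)); apply: (le_Rintegral mOmL).
  - exact: integrable_abse j.
  - by have := integrableZl mOmL M (integrable_abse igd); apply: eq_integrable.
  - move=> x Omx; rewrite normrM mulrC; apply: ler_pM => //; first exact: b1.
    by rewrite normrM -[leRHS]mul1r; apply: ler_wpM2r.
have cv0 : M * \int[vol]_(x in Om) `|u_ k x - u x| + M * \int[vol]_(x in Om) `|g_ k x ord0 i - g x ord0 i|
    @[k --> \oo] --> (0 : R).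
  rewrite -[X in _ --> X]addr0 -[X in _ --> X + _](mulr0 M) -[X in _ --> _ + X](mulr0 M).
  apply: cvgD; (apply: cvgM; first exact: cvg_cst); [exact: cvu|exact: cvg].
have cvn : `|\int[vol]_(x in Om) (d_ k x * (G x * phi x))| @[k --> \oo] --> (0 : R).
  by apply: squeeze_cvgr (cvg_cst 0) cv0; apply: nearW => k; rewrite dom andbT.
exact: norm_cvg0.
Qed.


Let good psi := asymptotically_null vol Om G d_ psi.

Let good_eq psi psi' : (forall x, Om x -> psi x = psi' x) -> good psi -> good psi'.
Proof.
move=> E; rewrite /good /asymptotically_null.
rewrite (_ : (fun k => \int[vol]_(x in Om) (d_ k x * (G x * psi' x))) =
  (fun k => \int[vol]_(x in Om) (d_ k x * (G x * psi x))))//.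
by apply/funext => k; apply: eq_Rintegral => x /set_mem Omx; rewrite E.
Qed.

Let mindic (S : set 'rV[R]_m.+1) : measurable S ->
  measurable_fun (Om : set LS) (\1_S : 'rV[R]_m.+1 -> R).
Proof.
move=> mS; apply: measurable_fun_lebesgue_space => //; exact: measurable_indic.
Qed.

Let indic_le (S : set 'rV[R]_m.+1) x : Om x -> `|(\1_S x : R)| <= 1.
Proof. by move=> _; rewrite indicE; case: (x \in S); rewrite ?normr1 ?normr0. Qed.

Let null_borel_sub S : measurable S -> S `<=` Om -> good \1_S.
Proof.
move: S; apply: (@box_induction R m.+1 Om (fun S => good \1_S)) => //.
- rewrite /good /asymptotically_null (_ : (fun k => _) = cst 0); first exact: cvg_cst.
  apply/funext => k; rewrite (_ : \int[vol]_(x in Om) _ = \int[vol]_(x in Om) cst (0 : R) x).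
    by rewrite /Rintegral integral0.
  by apply: eq_Rintegral => x _; rewrite indic0 /= !mulr0.
- move=> a b [ab abOm]; apply: (@asymptotically_null_lim _ _ _ _ _ mOmL G d_ 2 (ig i) md d2
      (fun l => box_bump l.+1%:R a b) _ 1).
  + move=> l; apply: measurable_fun_lebesgue_space => //.
    by apply: measurable_funTS; exact: box_bump_measurable.
  + by apply: mindic; exact: measurable_obox.
  + move=> l x _; have /andP[? ?] := box_bump_ge0 l.+1%:R a b x; by rewrite ger0_norm.
  + by move=> x _; exact: box_indic_cvg.
  + move=> l; apply: null_test.
      by apply: tens_class_C => j; exact: sbump_smooth.
    apply: (support_in_cbox abOm) => x nx; apply: box_bump_out => // /sub_obox_cbox; exact: nx.
- move=> S S' mS mS' SS' S'Om gS gS'.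
  apply: (@good_eq (\1_S' \+ (-1) \*o \1_S)).
    move=> x _ /=; rewrite !indicE in_setD.
    have [xS|xS] := boolP (x \in S); last by rewrite mulr0 addr0 andbT.
    by rewrite andbF mulr1 mem_set ?subrr//; apply: SS'; exact: set_mem.
  apply: (asymptotically_nullD mOmL (ig i) md d2 (L := 1) (L' := 1)) => //.
  + exact: mindic.
  + by apply: measurable_funM => //; exact: mindic.
  + exact: indic_le.
  + by move=> x Omx; rewrite /= mulN1r normrN; exact: indic_le.
  + by apply: (asymptotically_nullZ mOmL (ig i) md d2 _ (mindic mS) (@indic_le S)).
- move=> D mD DOm tD gD.
  have E k : \1_(\bigcup_(j < k) D j) = (fun x => \sum_(j < k) \1_(D j) x) :> ('rV[R]_m.+1 -> R).
    apply/funext => x; rewrite -[RHS](big_mkord xpredT (fun j => \1_(D j) x)).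
    elim: k => [|k IH]; first by rewrite big_geq// bigcup_mkord big_ord0 indic0.
    rewrite big_nat_recr//= -IH bigcup_mkord big_ord_recr /= -bigcup_mkord !indicE in_setU.
    have [xk|xk] := boolP (x \in D k); last by rewrite orbF addr0.
    rewrite orbT memNset ?add0r// => -[j /= jk Djx].
    have /trivIsetP/(_ j k I I) := tD; rewrite lt_eqF// => /(_ isT)/seteqP[+ _].
    by move=> /(_ x); apply; split => //; exact: set_mem.
  have mU k : measurable (\bigcup_(j < k) D j) by apply: bigcup_measurable.
  apply: (@asymptotically_null_lim _ _ _ _ _ mOmL G d_ 2 (ig i) md d2
    (fun k => \1_(\bigcup_(j < k) D j)) _ 1).
  + by move=> k; exact: mindic.
  + by apply: mindic; exact: bigcupT_measurable.
  + by move=> k; exact: indic_le.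
  + move=> x _; rewrite indicE; have [[j _ Djx]|nx] := pselect ((\bigcup_j D j) x).
      rewrite mem_set//; last by exists j.
      apply: cvg_near_cst; near=> k; rewrite indicE mem_set//.
      by exists j => //=; near: k; exists j.+1.
    rewrite memNset//; apply: cvg_near_cst; apply: nearW => k.
    by rewrite indicE memNset// => -[j _ Djx]; apply: nx; exists j.
  + elim=> [|k IH].
      apply: (@good_eq (0 \*o \1_(D 0%N))); first by move=> x _; rewrite /= E big_ord0 mul0r.
      exact: (asymptotically_nullZ mOmL (ig i) md d2 _ (mindic (mD 0%N)) (@indic_le _) (gD 0%N)).
    apply: (@good_eq (\1_(\bigcup_(j < k) D j) \+ \1_(D k))).
      by move=> x _; rewrite /= !E big_ord_recr.
    exact: (asymptotically_nullD mOmL (ig i) md d2 (mindic (mU k)) (mindic (mD k)) (@indic_le _) (@indic_le _) IH (gD k)).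
Unshelve. all: by end_near. Qed.

Let mG : measurable_fun (Om : set LS) G.
Proof. by apply/measurable_EFinP; exact: measurable_int (ig i). Qed.

Let mfull (psi : 'rV[R]_m.+1 -> R) : measurable_fun [set: LS] psi ->
  measurable_fun (Om : set LS) psi.
Proof. by move=> mpsi; exact: measurable_funTS. Qed.

(** Box induction yields Borel sets only; a Lebesgue set equals a Borel one off a null set, which
    the integrals ignore. *)
Let null_set (S : set 'rV[R]_m.+1) : measurable (S : set LS) -> good \1_S.
Proof.
move=> mS; have [B [N [mB mN N0 SB]]] := borel_modification_set mS.
have gB : good \1_(B `&` Om).
  by apply: null_borel_sub; [exact: measurableI|exact: subIsetr].
rewrite /good /asymptotically_null (_ : (fun k => _) =
  (fun k => \int[vol]_(x in Om) (d_ k x * (G x * \1_(B `&` Om) x))))//.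
have mdG (p : 'rV[R]_m.+1 -> R) k : measurable_fun (Om : set LS) p ->
    measurable_fun (Om : set LS) (fun x => d_ k x * (G x * p x)).
  by move=> mp; exact: (measurable_funM (md k) (measurable_funM mG mp)).
apply/funext => k; apply: (ae_eq_Rintegral mOmL).
- by apply: mdG; apply: mfull; exact: measurable_indic.
- by apply: mdG; apply: mindic; exact: measurableI.
- apply: (null_set_ae mN N0) => x Nx Omx; rewrite !indicE.
  congr (_ * (_ * (nat_of_bool _)%:R)); apply/idP/idP => /set_mem; rewrite inE.
    by move=> Sx; split => //; apply/(SB _ Nx).
  by case=> Bx _; apply/(SB _ Nx).
Qed.

Let null_bounded (psi : 'rV[R]_m.+1 -> R) : measurable_fun (Om : set LS) psi ->
  (forall x, Om x -> `|psi x| <= 1) -> good psi.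
Proof.
move=> mpsi psi1; apply: (@good_eq (psi \_ Om)); first by move=> x Omx; rewrite patchE mem_set.
have mP : measurable_fun [set: LS] (psi \_ Om) by apply/(measurable_restrictT _ mOmL).
have P1 x : `|(psi \_ Om) x| <= 1.
  by rewrite patchE; case: ifP => [/set_mem/psi1//|_]; rewrite normr0.
suff [] : (exists L : R, forall x, `|(psi \_ Om) x| <= L) /\ good (psi \_ Om) by [].
apply: (@bounded_class_sets _ LS R
  (fun p => (exists L : R, forall x, `|p x| <= L) /\ good p) _ _ _ (psi \_ Om) 1) => //.
- move=> p p' mp mp' [[L pL] gp] [[L' pL'] gp']; split.
    by exists (L + L') => x; apply: le_trans (ler_normD _ _) _; apply: lerD.
  exact: (asymptotically_nullD mOmL (ig i) md d2 (mfull mp) (mfull mp') (fun x _ => pL x) (fun x _ => pL' x) gp gp').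
- move=> c p mp [[L pL] gp]; split.
    by exists (`|c| * L) => x; rewrite normrM; apply: ler_wpM2l.
  exact: (asymptotically_nullZ mOmL (ig i) md d2 c (mfull mp) (fun x _ => pL x) gp).
- move=> p_ p L mp_ mp pL cvp gp; split.
    exists L => x; have cvn : `|p_ l x| @[l --> \oo] --> `|p x| by apply: cvg_norm; exact: cvp.
    rewrite -(cvg_lim (@Rhausdorff R) cvn).
    by apply: limr_le; [apply/cvg_ex; eexists; exact: cvn|apply: nearW => l; exact: pL].
  exact: (asymptotically_null_lim mOmL (ig i) md d2 (fun l => mfull (mp_ l)) (mfull mp) (fun l x _ => pL l x) (fun x _ => cvp x) (fun l => (gp l).2)).
- move=> S mS; split; last exact: null_set.
  by exists 1 => x; rewrite indicE; case: (x \in S); rewrite ?normr1 ?normr0.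
Qed.

Lemma bounded_coefficient_null (psi : 'rV[R]_m.+1 -> R) :
  measurable_fun (Om : set LS) psi -> (forall x, Om x -> `|psi x| <= 1) ->
  \int[vol]_(x in Om) ((h (u_ k x) - h (u x)) * (g x ord0 i * psi x)) @[k --> \oo] --> (0 : R).
Proof. exact: null_bounded. Qed.

End bounded_coefficient.

(* Weak convergence of [h (u_ k) * g] to [h u * g], applied to both [h] and
   [h ^+ 2], gives the strong one. *)
Lemma coefficient_strong_cvg (h : R -> R) i :
  measurable_fun setT h -> (forall t, `|h t| <= 1) ->
  \int[vol]_(x in Om) ((h (u_ k x) - h (u x)) ^+ 2 * `|g x ord0 i|) @[k --> \oo] --> (0 : R).
Proof.
move=> mh h1; pose G x := g x ord0 i.
have mG : measurable_fun (Om : set LS) G by apply/measurable_EFinP; exact: measurable_int (ig i).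
have msg : measurable_fun (Om : set LS) (fun x => Num.sg (G x)).
  by apply: (measurableT_comp _ mG); exact: measurable_sgr.
have sg1 x : `|Num.sg (G x)| <= 1 by rewrite normr_sg; case: (_ != _).
have h21 t : `|h t ^+ 2| <= 1 by rewrite normrX expr_le1.
have mh2 : measurable_fun setT (fun t => h t ^+ 2) by exact: measurable_funX.
have c1 := bounded_coefficient_null mh2 h21 i msg (fun x _ => sg1 x).
have mp : measurable_fun (Om : set LS) (fun x => h (u x) * Num.sg (G x)).
  exact: (measurable_funM (measurableT_comp mh mu) msg).
have p1 x : Om x -> `|h (u x) * Num.sg (G x)| <= 1.
  by move=> _; rewrite normrM mulr_ile1.
have c2 := bounded_coefficient_null mh h1 i mp p1.
have c3 : \int[vol]_(x in Om) ((h (u_ k x) ^+ 2 - h (u x) ^+ 2) * (G x * Num.sg (G x))) -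
    2 * \int[vol]_(x in Om) ((h (u_ k x) - h (u x)) * (G x * (h (u x) * Num.sg (G x))))
    @[k --> \oo] --> (0 : R).
  rewrite -[X in _ --> X]subr0 -[X in _ --> _ - X](mulr0 2).
  by apply: cvgB; [exact: c1|apply: cvgM; [exact: cvg_cst|exact: c2]].
(* The expansion (a - b)^2 = (a^2 - b^2) - 2 b (a - b), with |G| = G sg(G): the multipliers are
   sg(G) for h^2 and h(u) sg(G) for h. *)
rewrite (_ : (fun k => _) = (fun k =>
    \int[vol]_(x in Om) ((h (u_ k x) ^+ 2 - h (u x) ^+ 2) * (G x * Num.sg (G x))) -
    2 * \int[vol]_(x in Om) ((h (u_ k x) - h (u x)) * (G x * (h (u x) * Num.sg (G x))))))//.
apply/funext => k.
have bd (a : R -> R) (p : 'rV[R]_m.+1 -> R) : measurable_fun setT a -> (forall t, `|a t| <= 1) ->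
    measurable_fun (Om : set LS) p -> (forall x, Om x -> `|p x| <= 1) ->
    vol.-integrable Om (EFin \o (fun x => (a (u_ k x) - a (u x)) * (G x * p x))).
  move=> ma a1 mp' p1'; apply: (integrableMb mOmL (C := 2)).
  - by apply: measurable_funB; exact: (measurableT_comp ma).
  - exact: (integrable_mul_bounded mOmL mp' (ig i) p1').
  - by move=> x _; apply: le_trans (ler_normB _ _) _; have := a1 (u_ k x); have := a1 (u x); lra.
have i1 := bd _ _ mh2 h21 msg (fun x _ => sg1 x).
have i2 := bd _ _ mh h1 mp p1.
have i2' := integrableZl mOmL 2 i2.
rewrite -(RintegralZl 2 mOmL i2) -(RintegralB mOmL i1 i2').
apply: eq_Rintegral => x _ /=; rewrite normrEsg -/(G x) ; ring.
Qed.

End strong_convergence.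

Lemma ereal_cvg0P {R : realType} (a : nat -> \bar R) : (forall k, (0 <= a k)%E) ->
  a @ \oo --> 0%E <-> (forall e : R, 0 < e -> exists N, forall k, (N <= k)%N -> (a k <= e%:E)%E).
Proof.
move=> a0; split=> [cv e e0|H].
  have /cv[N _ aN] : nbhs (0%:E : \bar R) [set y | (y < e%:E)%E].
    exact: (@nbhs_open_ereal_lt R 0 (fun=> e)).
  by exists N => k Nk; apply: ltW; exact: aN.
have fin e : 0 < e -> \forall k \near \oo, (a k <= e%:E)%E.
  by move=> /H[N aN]; exists N => // k /= Nk; exact: aN.
apply/fine_cvgP; split.
  apply: filterS (fin 1 ltr01) => k ak1.
  by rewrite ge0_fin_numE//; apply: le_lt_trans ak1 _; exact: ltry.
apply/cvgrPdist_le => e e0; apply: filterS (fin e e0) => k ake.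
rewrite sub0r normrN ger0_norm ?fine_ge0//= -lee_fin fineK//.
by rewrite ge0_fin_numE//; apply: le_lt_trans ake _; exact: ltry.
Qed.

(** * Subsequences, domination and absolute continuity of the integral *)

Section measure_tools.
Context d (T : measurableType d) (R : realType).
Variables (mu : {measure set T -> \bar R}) (D : set T) (mD : measurable D).

Lemma ae_subsequence (w_ : nat -> T -> \bar R) :
  (forall k, measurable_fun D (w_ k)) -> (forall k x, D x -> (0 <= w_ k x)%E) ->
  (\int[mu]_(x in D) w_ k x)%E @[k --> \oo] --> 0%E ->
  exists phi : nat -> nat, (forall k, (k <= phi k)%N) /\
    {ae mu, forall x, D x -> w_ (phi k) x @[k --> \oo] --> 0%E}.
Proof.
move=> mw w0 /ereal_cvg0P cv.
have {}cv := cv (fun k => integral_ge0 mu (w0 k)).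
have /choice[phi phiP] (k : nat) : exists N, (k <= N)%N /\
    (\int[mu]_(x in D) w_ N x <= (1 / (2 ^ (k + 1))%:R)%:E)%E.
  have [|N NP] := cv (1 / (2 ^ (k + 1))%:R); first by rewrite divr_gt0// ltr0n expn_gt0.
  by exists (maxn k N); split; [exact: leq_maxl|apply: NP; exact: leq_maxr].
exists phi; split => [k|]; first by have [] := phiP k.
have mS := integral_nneseries mu mD (fun k => mw (phi k)) (fun k => w0 (phi k)).
have iS : (\int[mu]_(x in D) (\sum_(0 <= k <oo) w_ (phi k) x) < +oo)%E.
  rewrite mS; apply: (@le_lt_trans _ _ (\sum_(0 <= k <oo) (1 / (2 ^ (k + 1))%:R)%:E)%E).
    by apply: lee_nneseries => [k _ _|k _]; [apply: integral_ge0; exact: w0|have [] := phiP k].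
  have /cvg_lim := @cvg_geometric_eseries_half R 1 0.
  by rewrite /eseries /= => ->//; exact: ltry.
have int : mu.-integrable D (fun x => \sum_(0 <= k <oo) w_ (phi k) x)%E.
  apply/integrableP; split.
    apply: ge0_emeasurable_sum => //; first by move=> k x Dx _; exact: w0.
  under eq_integral => x /set_mem Dx.
    by rewrite gee0_abs; [over|apply: nneseries_ge0 => k _ _; exact: w0].
  exact: iS.
have FF := ae_filter_ringOfSetsType mu.
apply: filterS (integrable_ae mD int) => x + Dx => /(_ Dx).
rewrite ge0_fin_numE; last by apply: nneseries_ge0 => k _ _; exact: w0.
move=> /nneseries_tail_cvg => /(_ (fun k _ => w0 _ _ Dx)) cv0.
apply: (squeeze_cvge _ (cvg_cst 0%E) cv0); apply: nearW => k; rewrite w0//=.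
rewrite (@nneseries_split _ _ k 1) => [|j _]; last exact: w0.
by rewrite addn1 big_nat1 leeDl// nneseries_ge0// => j _ _; exact: w0.
Qed.

(** Dominated convergence applies to min(X_k, M), and X_k exceeds this minimum by at most Z_k. The
    part Z_k need not converge, only have small integral. *)
Lemma dominated_small (X_ Z_ : nat -> T -> \bar R) (M : T -> \bar R) (e : R) :
  (forall k, measurable_fun D (X_ k)) -> (forall k x, D x -> (0 <= X_ k x)%E) ->
  (forall k, measurable_fun D (Z_ k)) -> (forall k x, D x -> (0 <= Z_ k x)%E) ->
  measurable_fun D M -> (forall x, D x -> (0 <= M x)%E) ->
  (\int[mu]_(x in D) M x < +oo)%E ->
  {ae mu, forall x, D x -> X_ k x @[k --> \oo] --> 0%E} ->
  (forall k, {ae mu, forall x, D x -> (X_ k x <= M x + Z_ k x)%E}) ->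
  0 < e -> (forall k, (\int[mu]_(x in D) Z_ k x <= e%:E)%E) ->
  exists k, (\int[mu]_(x in D) X_ k x <= (e + e)%:E)%E.
Proof.
move=> mX X0 mZ Z0 mM M0 Mlty cvX XMZ e0 Ze.
have FF := ae_filter_ringOfSetsType mu.
pose Y_ k x := mine (X_ k x) (M x).
have mY k : measurable_fun D (Y_ k) by apply: measurable_mine.
have Y0 k x : D x -> (0 <= Y_ k x)%E by move=> Dx; rewrite le_min X0//= M0.
have [|||| _ _] := @dominated_convergence d T R mu D mD Y_ (cst 0%E) M mY.
- exact: measurable_cst.
- apply: filterS cvX => x cvx Dx; apply: (squeeze_cvge _ (cvg_cst 0%E) (cvx Dx)).
  by apply: nearW => k; rewrite Y0//= ge_min lexx.
- apply/integrableP; split => //; under eq_integral => x /set_mem Dx do rewrite gee0_abs ?M0//.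
  exact: Mlty.
- by apply: aeW => x k Dx; rewrite gee0_abs ?Y0// ge_min lexx orbT.
rewrite integral0 /= => cvY.
have /(ereal_cvg0P (fun k => integral_ge0 mu (Y0 k)))/(_ e e0)[N NP] := cvY.
exists N.
apply: (@le_trans _ _ (\int[mu]_(x in D) (Y_ N x + Z_ N x))%E).
  apply: (ae_ge0_le_integral mD) => //; [exact: X0| |exact: emeasurable_funD|].
    by move=> x Dx; rewrite adde_ge0// ?Y0 ?Z0.
  apply: filterS (XMZ N) => x h Dx; rewrite /Y_; case: (leP (X_ N x) (M x)) => _.
    by rewrite leeDl// Z0.
  exact: h.
rewrite (ge0_integralD mu mD (Y0 N) (mY N) (Z0 N) (mZ N)) EFinD.
by apply: leeD; [exact: NP|exact: Ze].
Qed.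

Lemma integral_absolutely_continuous (F : T -> \bar R) : measurable_fun D F ->
  (forall x, D x -> (0 <= F x)%E) -> (\int[mu]_(x in D) F x < +oo)%E ->
  forall e : R, 0 < e -> exists2 dl : R, 0 < dl & forall S, measurable S -> S `<=` D ->
    (mu S < dl%:E)%E -> (\int[mu]_(x in S) F x <= e%:E)%E.
Proof.
move=> mF F0 Flty e e0.
have FF := ae_filter_ringOfSetsType mu.
have iF : mu.-integrable D F.
  apply/integrableP; split => //; under eq_integral => x /set_mem Dx do rewrite gee0_abs ?F0//.
  exact: Flty.
have finF := integrable_ae mD iF.
have mfF : measurable_fun D (fine \o F) by apply: measurableT_comp => //; exact: fine_measurable.
pose f := (fine \o F) \_ D.
have mf : measurable_fun setT f by apply/(measurable_restrictT _ mD).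
have fE x : D x -> F x \is a fin_num -> (f x)%:E = F x.
  by move=> Dx Fx; rewrite /f patchE mem_set//= fineK.
have f0 x : 0 <= f x.
  by rewrite /f patchE; case: ifP => // /set_mem Dx; rewrite /= fine_ge0// F0.
have ifD : (\int[mu]_x (f x)%:E = \int[mu]_(x in D) F x)%E.
  transitivity (\int[mu]_(x in D) (f x)%:E)%E.
    rewrite [RHS]integral_mkcond; apply: eq_integral => x _; rewrite !patchE.
    by rewrite /f patchE; case: ifP.
  apply: (ae_eq_integral _ _ mD); [|exact: mF|].
    by apply/measurable_EFinP; exact: measurable_funTS.
  by apply: filterS finF => x h Dx; rewrite fE// h.
have intf : mu.-integrable setT (EFin \o f).
  apply/integrableP; split; first exact/measurable_EFinP.
  rewrite -ifD in Flty; apply: le_lt_trans Flty.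
  rewrite le_eqVlt; apply/orP; left; apply/eqP; apply: eq_integral => x _.
  by rewrite gee0_abs// lee_fin.
have [dl [dl0 H]] := integral_normr_continuous intf e0.
exists dl => // S mS SD Sdl.
have -> : (\int[mu]_(x in S) F x = \int[mu]_(x in S) (f x)%:E)%E.
  apply: (ae_eq_integral _ _ mS); [exact: measurable_funS mF| |].
    by apply/measurable_EFinP; exact: measurable_funTS.
  by apply: filterS finF => x h Sx; rewrite fE//; [exact: SD|apply: h; exact: SD].
have ifS : mu.-integrable S (EFin \o f) by exact: integrableS intf.
rewrite -EFin_Rintegral// lee_fin; apply: ltW; apply: le_lt_trans (H S mS Sdl).
rewrite le_eqVlt; apply/orP; left; apply/eqP; apply: eq_Rintegral => x _.
by rewrite ger0_norm.
Qed.

End measure_tools.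

(** * Young functions and modular convergence *)

Section young_modular.
Context {R : realType}.
Variable A : R -> \bar R.
Hypothesis yA : young_function A.

(* The second alternative makes [C = 1] work when [A] is infinite beyond [e]. *)
Lemma young_affine_at (e : R) : 0 < e -> (0 < A e)%E -> exists2 C : R, 0 <= C &
  forall t, 0 <= t -> (t%:E <= e%:E + C%:E * A t)%E.
Proof.
move=> e0 Ae0; have [Aoo|Afin] := eqVneq (A e) +oo%E.
  exists 1 => // t t0; have [te|et] := leP t e.
    by apply: (@le_trans _ _ e%:E); [rewrite lee_fin|rewrite leeDl// mul1e young_ge0].
  have -> : A t = +oo%E by apply/eqP; rewrite -leye_eq -Aoo young_nd// ltW.
  by rewrite mul1e addeC addye// leey.
have fA : A e \is a fin_num by rewrite ge0_fin_numE ?ltey// ltW.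
have F0 : 0 < fine (A e) by rewrite fine_gt0// Ae0 ltey.
exists (e / fine (A e)); first by rewrite divr_ge0 ?ltW.
move=> t t0; have [te|et] := leP t e.
  apply: (@le_trans _ _ e%:E); [by rewrite lee_fin|rewrite leeDl//].
  by apply: mule_ge0; [rewrite lee_fin divr_ge0 ?ltW|exact: young_ge0].
apply: (@le_trans _ _ ((e / fine (A e))%:E * A t)%E); last by rewrite leeDr// lee_fin ltW.
have := young_slope yA (ltW e0) (ltW et); rewrite -{1}(fineK fA) -EFinM.
have Fi : (0 <= (fine (A e))^-1%:E)%E by rewrite lee_fin invr_ge0 ltW.
move=> /(lee_wpmul2l Fi); rewrite -EFinM mulrCA mulVf ?gt_eqF// mulr1.
by rewrite muleA -EFinM mulrC.
Qed.

Lemma young_affine : exists e C : R, [/\ 0 < e, 0 <= C &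
  forall t, 0 <= t -> (t%:E <= e%:E + C%:E * A t)%E].
Proof.
have [e e0 Ae] : exists2 e, 0 < e & A e != 0%E.
  have [_ _ _ _ nc] := yA; apply: contrapT => h; apply: nc; exists 0%E => t t0.
  by apply/eqP/negPn/negP => At; apply: h; exists t.
have [|C C0 CP] := @young_affine_at e e0.
  by rewrite lt_neqAle eq_sym Ae young_ge0// ltW.
by exists e, C.
Qed.

Lemma young_cvg0 (t : nat -> R) : (forall k, 0 <= t k) ->
  t k @[k --> \oo] --> (0 : R) -> A (t k) @[k --> \oo] --> 0%E.
Proof.
move=> t0 cv; have [p p0 Ap] := young_finite_near0 yA.
have fA : A p \is a fin_num by rewrite ge0_fin_numE// young_ge0// ltW.
apply/ereal_cvg0P => [k|e e0]; first exact: young_ge0.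
pose q := Num.min p (e * p / (fine (A p) + 1)).
have F0 : 0 < fine (A p) + 1 by rewrite ltr_wpDl// fine_ge0// young_ge0// ltW.
have q0 : 0 < q by rewrite lt_min p0 divr_gt0// mulr_gt0.
have /cvgrPdist_le/(_ _ q0)[N _ NP] := cv.
exists N => k /NP; rewrite sub0r normrN ger0_norm//= le_min => /andP[tp te].
have a01 : 0 <= t k / p <= 1 by rewrite divr_ge0 ?(ltW p0)//= ler_pdivrMr// mul1r.
have := young_scale yA a01 (ltW p0); rewrite divfK ?gt_eqF// => /le_trans; apply.
rewrite -(fineK fA) -EFinM lee_fin.
apply: le_trans (_ : t k / p * (fine (A p) + 1) <= _).
  by apply: ler_wpM2l; [case/andP: a01|rewrite lerDl].
by rewrite mulrAC ler_pdivrMr// -ler_pdivlMr.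
Qed.

End young_modular.

Section modular_tools.
Context {R : realType} {n : nat}.
Notation LS := (lebesgue_space R n).
Notation vol := (@volume R n).
Variables (A : R -> \bar R) (Om : set 'rV[R]_n).
Hypotheses (yA : young_function A) (mOmL : measurable (Om : set LS)) (Omlty : (vol Om < +oo)%E).
Implicit Types w : 'rV[R]_n -> R.

Lemma measurable_young_comp w (l : R) : measurable_fun (Om : set LS) w ->
  (forall x, 0 <= w x) -> 0 < l -> measurable_fun (Om : set LS) (fun x => A (w x / l)).
Proof.
move=> mw w0 l0; have mf : measurable_fun (Om : set LS) (fun x => w x / l).
  exact: (measurable_funM mw (measurable_cst _)).
apply: (measurable_comp (F := `[0, +oo[%classic : set (measurableTypeR R)) _ _ (measurable_young yA) mf).
  exact: measurable_itv.
by move=> _ [x _ <-]; rewrite /= in_itv /= andbT; exact: (divr_ge0 (w0 x) (ltW l0)).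
Qed.

Let integral_le_modular w (l e C : R) : measurable_fun (Om : set LS) w ->
  (forall x, 0 <= w x) -> 0 < l -> 0 <= e -> 0 <= C ->
  (forall t, 0 <= t -> (t%:E <= e%:E + C%:E * A t)%E) ->
  (\int[vol]_(x in Om) (w x)%:E <= l%:E * (e%:E * vol Om + C%:E * modular A Om w l))%E.
Proof.
move=> mw w0 l0 e0 C0 H; have mA := measurable_young_comp mw w0 l0.
have A0 x : Om x -> (0 <= A (w x / l))%E by move=> _; rewrite young_ge0// divr_ge0// ltW.
have mCA : measurable_fun (Om : set LS) (fun x => C%:E * A (w x / l))%E.
  exact: measurable_funeM.
have CA0 x : Om x -> (0 <= C%:E * A (w x / l))%E by move=> Omx; rewrite mule_ge0// A0.
have e0' x : Om x -> (0 <= cst e%:E x)%E by rewrite lee_fin.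
rewrite -(integral_cst vol mOmL e%:E) /modular -(ge0_integralZl vol mOmL mA A0 (_ : (0 <= C%:E)%E)) ?lee_fin//.
rewrite -(ge0_integralD vol mOmL e0' (measurable_cst _) CA0 mCA).
rewrite -(@ge0_integralZl _ _ _ vol _ mOmL); last 3 first.
- exact: emeasurable_funD (measurable_cst _) mCA.
- by move=> x Omx; rewrite adde_ge0 ?CA0 ?e0'.
- by rewrite lee_fin ltW.
apply: ge0_le_integral; [exact: mOmL| | | |].
- by move=> x _; rewrite lee_fin.
- exact/measurable_EFinP.
- by apply: measurable_funeM; exact: emeasurable_funD (measurable_cst _) mCA.
- move=> x Omx; have := H _ (divr_ge0 (w0 x) (ltW l0)) => /(lee_wpmul2l (_ : (0 <= l%:E)%E)).
  by rewrite lee_fin => /(_ (ltW l0)); rewrite -EFinM mulrC divfK// gt_eqF.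
Qed.

Lemma modular_integrable w (l : R) : measurable_fun (Om : set LS) w ->
  (forall x, 0 <= w x) -> 0 < l -> (modular A Om w l < +oo)%E ->
  vol.-integrable Om (EFin \o w).
Proof.
move=> mw w0 l0 Al; have [e [C [e0 C0 H]]] := young_affine yA.
apply/integrableP; split; first exact/measurable_EFinP.
under eq_integral => x _ do rewrite gee0_abs ?lee_fin//.
apply: le_lt_trans (integral_le_modular mw w0 l0 (ltW e0) C0 H) _.
apply: lte_mul_pinfty; rewrite ?lee_fin ?(ltW l0)//.
apply: lte_add_pinfty; apply: lte_mul_pinfty; rewrite ?lee_fin ?(ltW e0)//.
Qed.

(** Nondegeneracy allows an arbitrarily small additive constant in [young_affine_at]; the modular
    takes care of the other term. *)
Lemma modular_cvg_integral (w_ : nat -> 'rV[R]_n -> R) (l : R) :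
  nondegenerate_young A -> (forall k, measurable_fun (Om : set LS) (w_ k)) ->
  (forall k x, 0 <= w_ k x) -> 0 < l -> modular A Om (w_ k) l @[k --> \oo] --> 0%E ->
  (\int[vol]_(x in Om) (w_ k x)%:E)%E @[k --> \oo] --> 0%E.
Proof.
move=> nA mw w0 l0 cv; have A0 k : (0 <= modular A Om (w_ k) l)%E.
  by apply: integral_ge0 => x _; rewrite young_ge0// divr_ge0// ltW.
apply/ereal_cvg0P => [k|e e0]; first by apply: integral_ge0 => x _; rewrite lee_fin.
have fV : vol Om \is a fin_num by rewrite ge0_fin_numE.
set V := fine (vol Om); have V0 : 0 <= V by rewrite fine_ge0.
pose e' := e / 2 / l / (V + 1); have V1 : 0 < V + 1 by rewrite ltr_wpDl.
have e'0 : 0 < e' by rewrite !divr_gt0.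
have [C C0 CP] := young_affine_at yA e'0 (nA _ e'0).
have C1 : 0 < C + 1 by rewrite ltr_wpDl.
have d0 : 0 < e / 2 / l / (C + 1) by rewrite !divr_gt0.
have /(ereal_cvg0P A0)/(_ _ d0)[N NP] := cv; exists N => k Nk.
apply: le_trans (integral_le_modular (mw k) (w0 k) l0 (ltW e'0) C0 CP) _.
apply: (@le_trans _ _ (l%:E * (e' * V + C * (e / 2 / l / (C + 1)))%:E)%E).
  apply: lee_wpmul2l; first by rewrite lee_fin ltW.
  rewrite EFinD !EFinM fineK//; apply: leeD => //; apply: lee_wpmul2l; first by rewrite lee_fin.
  by rewrite -!EFinM; exact: NP.
rewrite -EFinM lee_fin mulrDr; apply: le_trans (_ : e / 2 + e / 2 <= _); last by rewrite -splitr.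
apply: lerD.
  rewrite (_ : l * (e' * V) = e / 2 * (V / (V + 1))); last by rewrite /e'; field; rewrite !gt_eqF.
  by rewrite ler_piMr ?divr_ge0 ?(ltW e0)// ler_pdivrMr// mul1r lerDl.
rewrite (_ : l * _ = e / 2 * (C / (C + 1))); last by field; rewrite !gt_eqF.
by rewrite ler_piMr ?divr_ge0 ?(ltW e0)// ler_pdivrMr// mul1r lerDl.
Qed.

End modular_tools.

(** * Superposition under a growth bound *)

Section euclidean_norm_theory.
Context {R : realType} {n : nat}.
Implicit Types v w : 'rV[R]_n.

Lemma euclidean_normZ (c : R) v : euclidean_norm (c *: v) = `|c| * euclidean_norm v.
Proof.
apply/eqP; rewrite -(eqrXn2 (n := 2)) ?mulr_ge0 ?euclidean_norm_ge0//; apply/eqP.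
rewrite exprMn !sqr_euclidean_norm real_normK ?num_real// mulr_sumr.
by apply: eq_bigr => i _; rewrite mxE exprMn.
Qed.

Lemma euclidean_normD v w : euclidean_norm (v + w) <= euclidean_norm v + euclidean_norm w.
Proof.
rewrite -ler_sqr ?nnegrE ?addr_ge0 ?euclidean_norm_ge0//.
rewrite sqrrD !sqr_euclidean_norm.
rewrite (_ : \sum_i (v + w) ord0 i ^+ 2 = \sum_i v ord0 i ^+ 2 + (\sum_i v ord0 i * w ord0 i) *+ 2 +
    \sum_i w ord0 i ^+ 2).
  rewrite lerD2r lerD2l lerMn2r /=; apply: le_trans (ler_norm _) _; exact: cauchy_schwarz.
rewrite -sumrMnl -!big_split /=; apply: eq_bigr => i _.
by rewrite mxE sqrrD.
Qed.

Lemma euclidean_norm_le_sum v : euclidean_norm v <= \sum_i `|v ord0 i|.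
Proof.
rewrite -ler_sqr ?nnegrE ?euclidean_norm_ge0 ?sumr_ge0//.
rewrite sqr_euclidean_norm expr2 mulr_suml; apply: ler_sum => i _.
rewrite -real_normK ?num_real// expr2; apply: ler_wpM2l => //.
by rewrite (bigD1 i)//= lerDl sumr_ge0.
Qed.

End euclidean_norm_theory.

Section measurable_length.
Context d (T : measurableType d) (R : realType) (D : set T).

Lemma measurable_fun_normr (u : T -> R) : measurable_fun D u ->
  measurable_fun D (fun x => `|u x|).
Proof. by move=> mu; exact: measurableT_comp. Qed.

Lemma measurable_fun_euclidean_norm n (g : T -> 'rV[R]_n) :
  (forall i, measurable_fun D (fun x => g x ord0 i)) ->
  measurable_fun D (fun x => euclidean_norm (g x)).
Proof.
move=> mg; have ms : measurable_fun setT (Num.sqrt : R -> R).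
  by apply: continuous_measurable_fun; exact: sqrt_continuous.
have mS : measurable_fun D (fun x => \sum_i g x ord0 i ^+ 2).
  by apply: measurable_sum => i; exact: measurable_funX.
exact: (measurableT_comp ms mS).
Qed.

End measurable_length.

Section measurable_length_fun.
Context {R : realType} {n : nat}.
Variable Om : set 'rV[R]_n.

Lemma measurable_length_fun (g : 'rV[R]_n -> 'rV[R]_n) :
  (forall i, measurable_fun (Om : set (lebesgue_space R n)) (fun x => g x ord0 i)) ->
  measurable_fun (Om : set (lebesgue_space R n)) (length_fun g).
Proof. by move=> mg; exact: (measurable_fun_euclidean_norm mg). Qed.

Lemma measurable_abs_fun (u : 'rV[R]_n -> R) :
  measurable_fun (Om : set (lebesgue_space R n)) u ->
  measurable_fun (Om : set (lebesgue_space R n)) (abs_fun u).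
Proof. by move=> mu; exact: (measurable_fun_normr mu). Qed.

Lemma abs_fun_ge0 (u : 'rV[R]_n -> R) x : 0 <= abs_fun u x.
Proof. exact: normr_ge0. Qed.

Lemma length_fun_ge0 (g : 'rV[R]_n -> 'rV[R]_n) x : 0 <= length_fun g x.
Proof. exact: euclidean_norm_ge0. Qed.

End measurable_length_fun.

Section controlled.
Context {R : realType} {m : nat}.
Notation LS := (lebesgue_space R m.+1).
Notation vol := (@volume R m.+1).
Variables (A B : R -> \bar R) (W : R -> R) (Om : set 'rV[R]_m.+1).

(* The superposition theorem follows once [B (W |v| s) - A s] has, uniformly in
   [s], a bound that is a constant plus a function of small integral. *)
Definition controlled (v : 'rV[R]_m.+1 -> R) (C e : R) :=
  exists Q : 'rV[R]_m.+1 -> \bar R,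
    [/\ measurable_fun (Om : set LS) Q, forall x, Om x -> (0 <= Q x)%E,
        (\int[vol]_(x in Om) Q x <= e%:E)%E &
        {ae vol, forall x, Om x -> forall s, 0 <= s ->
           (B (W `|v x| * s)%R <= C%:E + Q x + A s)%E}].

Hypotheses (oOm : open Om) (Omlty : (vol Om < +oo)%E).
Hypotheses (yA : young_function A) (yB : young_function B).

Let mOmL : measurable (Om : set LS).
Proof. by apply: measurable_lebesgue_space; exact: measurable_open_rV. Qed.

Lemma controlled_integral_lty (v w : 'rV[R]_m.+1 -> R) (l C e : R) (c : R)
    (X : 'rV[R]_m.+1 -> \bar R) : 0 <= C -> controlled v C e ->
  measurable_fun (Om : set LS) w -> (forall x, 0 <= w x) -> 0 < l ->
  (modular A Om w l < +oo)%E -> 0 <= c ->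
  measurable_fun (Om : set LS) X -> (forall x, (0 <= X x)%E) ->
  (forall x, (X x <= c%:E + B (W `|v x| * (w x / l))%R)%E) ->
  (\int[vol]_(x in Om) X x < +oo)%E.
Proof.
move=> C0 [Q [mQ Q0 Qe QB]] mw w0 l0 Al c0 mX X0 XB.
have mA := measurable_young_comp yA mw w0 l0.
have A0 x : Om x -> (0 <= A (w x / l))%E by move=> _; rewrite young_ge0// divr_ge0// ltW.
have cC0 x : Om x -> (0 <= cst (c + C)%:E x)%E by rewrite lee_fin addr_ge0.
have mQA : measurable_fun (Om : set LS) (fun x => Q x + A (w x / l))%E by exact: emeasurable_funD.
have QA0 x : Om x -> (0 <= Q x + A (w x / l))%E by move=> Omx; rewrite adde_ge0 ?Q0 ?A0.
have FF := ae_filter_ringOfSetsType vol.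
apply: (@le_lt_trans _ _ (\int[vol]_(x in Om) (cst (c + C)%:E x + (Q x + A (w x / l))))%E).
  apply: (ae_ge0_le_integral mOmL).
  - by move=> x _.
  - exact: mX.
  - by move=> x Omx; rewrite adde_ge0 ?cC0 ?QA0.
  - exact: emeasurable_funD (measurable_cst _) mQA.
  - apply: filterS QB => x h Omx; apply: le_trans (XB x) _.
    have := h Omx _ (divr_ge0 (w0 x) (ltW l0)).
    by move=> /(leeD2l c%:E) /le_trans; apply; rewrite /= EFinD -!addeA.
rewrite (ge0_integralD vol mOmL cC0 (measurable_cst _) QA0 mQA) (ge0_integralD vol mOmL Q0 mQ A0 mA).
apply: lte_add_pinfty.
  rewrite integral_cst//; apply: lte_mul_pinfty; rewrite ?lee_fin ?addr_ge0//.
apply: lte_add_pinfty => //; exact: le_lt_trans Qe (ltry _).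
Qed.

Variables (f h : R -> R) (kappa : R).
Hypotheses (nA : nondegenerate_young A).
Hypotheses (mh : measurable_fun setT h)
  (hloc : forall M : R, exists L, forall t, `|t| <= M -> `|h t| <= L)
  (fh : primitive f h).
Hypotheses (k0 : 0 < kappa) (W0 : forall t, 0 <= t -> 0 <= W t)
  (Wmono : forall s t, 0 <= s -> s <= t -> W s <= W t)
  (hW : forall t, `|h t| <= kappa * W `|t|).

Let mf : measurable_fun setT f.
Proof. by apply: continuous_measurable_fun; exact: (primitive_continuous mh hloc fh). Qed.

(** Between [a] and [b] the modulus never exceeds that of the larger endpoint, and [W] is
    monotone. *)
Lemma superposition_increment (a b : R) :
  `|f a - f b| <= kappa * Num.max (W `|a|) (W `|b|) * `|a - b|.
Proof.
wlog ab : a b / a <= b.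
  move=> H; have /orP[ab|ba] := le_total a b; first exact: H.
  by rewrite distrC (distrC a) maxC; exact: H.
rewrite distrC (distrC a) fh// (ger0_norm (_ : 0 <= b - a)) ?subr_ge0//.
apply: Rintegral_itv_le => // t /andP[at_ tb]; apply: le_trans (hW t) _.
apply: ler_wpM2l; first exact: ltW.
have [tb'|at'] : `|t| <= `|b| \/ `|t| <= `|a|.
- have [t0|t0] := leP 0 t.
    left; rewrite ger0_norm//; apply: le_trans tb _; exact: ler_norm.
  right; rewrite ltr0_norm//; apply: le_trans (_ : - a <= _); first by rewrite lerN2.
  by rewrite -normrN; exact: ler_norm.
- by rewrite le_max (Wmono _ tb') ?orbT.
- by rewrite le_max (Wmono _ at').
Qed.

Lemma orlicz_sobolevP (u : 'rV[R]_m.+1 -> R) (Y : R -> \bar R) : young_function Y ->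
  orlicz_sobolev Y Om u ->
  [/\ is_weak_gradient Om u (weak_gradient Om u),
      vol.-integrable Om (EFin \o u) &
      vol.-integrable Om (EFin \o length_fun (weak_gradient Om u))].
Proof.
move=> yY [wd [mu [l l0 ul]] [mg [l' l'0 gl]]]; split; first exact: xgetPex.
  have ia : vol.-integrable Om (EFin \o abs_fun u).
    exact: (modular_integrable yY mOmL Omlty (measurable_abs_fun mu) (abs_fun_ge0 u) l0 ul).
  exact: (integrable_Rle mOmL mu ia).
apply: (modular_integrable yY mOmL Omlty _ _ l'0 gl).
  exact: measurable_length_fun.
by move=> x; exact: euclidean_norm_ge0.
Qed.

Lemma integrable_coord (g : 'rV[R]_m.+1 -> 'rV[R]_m.+1) i :
  measurable_fun (Om : set LS) (fun x => g x ord0 i) ->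
  vol.-integrable Om (EFin \o length_fun g) -> vol.-integrable Om (EFin \o (fun x => g x ord0 i)).
Proof.
by move=> mg ig; apply: (integrable_Rle mOmL mg ig) => x _; exact: norm_coord_le.
Qed.

Lemma controlled_superposition (u : 'rV[R]_m.+1 -> R) (C e : R) :
  orlicz_sobolev A Om u -> 0 <= C -> controlled u C e ->
  [/\ orlicz B Om (superposition f u),
      finite_modular B Om (length_fun (fun x => h (u x) *: weak_gradient Om u x)) &
      is_weak_gradient Om (superposition f u) (fun x => h (u x) *: weak_gradient Om u x)].
Proof.
move=> Wu C0 cu; have [wg iu ig] := orlicz_sobolevP yA Wu.
have [wd [mu [l l0 ul]] [mg [l' l'0 gl]]] := Wu; set g := weak_gradient Om u in wg ig mg gl *.
have mfu : measurable_fun (Om : set LS) (superposition f u) by exact: measurableT_comp mf mu.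
have mhg i : measurable_fun (Om : set LS) (fun x => (h (u x) *: g x) ord0 i).
  rewrite (_ : (fun x => _) = (fun x => h (u x) * g x ord0 i)); last first.
    by apply/funext => x; rewrite mxE.
  exact: (measurable_funM (measurableT_comp mh mu) (mg i)).
have ou : finite_modular B Om (abs_fun (superposition f u)).
  have [p p0 Bp] := young_finite_near0 yB.
  (* Midpoint convexity separates |f 0| from the increment of [f]. The second summand of [M] brings
     2 |f 0| / M below [p], where [B] is finite; the first brings 2 kappa / M below 1 / l. *)
  pose M := 2 * kappa * l + 2 * `|f 0| / p.
  have M0 : 0 < M by rewrite ltr_pwDl// ?mulr_gt0// divr_ge0// ?mulr_ge0// ltW.
  have fBp : B p \is a fin_num by rewrite ge0_fin_numE// young_ge0// ltW.
  exists M => //; rewrite /modular.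
  apply: (@controlled_integral_lty u (abs_fun u) l C e (fine (B p))); [exact: C0|exact: cu| | |exact: l0|exact: ul| | | |].
  - exact: measurable_abs_fun.
  - by move=> x; exact: normr_ge0.
  - by rewrite fine_ge0// young_ge0// ltW.
  - exact: (measurable_young_comp yB (measurable_abs_fun mfu) (abs_fun_ge0 _) M0).
  - by move=> x; apply: (young_ge0 yB); exact: (divr_ge0 (abs_fun_ge0 _ _) (ltW M0)).
  - move=> x; rewrite fineK//; set t := u x; rewrite /abs_fun /superposition /= -/t.
    have W00 := W0 (normr_ge0 t).
    have h1 : `|f t| <= `|f 0| + kappa * W `|t| * `|t|.
      have := superposition_increment t 0; rewrite subr0 normr0 max_l ?Wmono// => h2.
      by rewrite -[f t](subrK (f 0)) addrC; apply: le_trans (ler_normD _ _) _; rewrite lerD2l.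
    have a0 : 0 <= 2 * `|f 0| / M by rewrite divr_ge0 ?mulr_ge0// ltW.
    have b0 : 0 <= 2 * (kappa * W `|t| * `|t|) / M.
      by rewrite divr_ge0 ?(ltW M0)// !mulr_ge0// ltW.
    apply: (@le_trans _ _ (B ((2 * `|f 0| / M + 2 * (kappa * W `|t| * `|t|) / M) / 2)%R)).
      apply: young_nd => //; first by rewrite divr_ge0// ltW.
      rewrite (_ : (_ + _) / 2 = (`|f 0| + kappa * W `|t| * `|t|) / M); last by field; rewrite gt_eqF.
      by rewrite ler_pM2r// invr_gt0.
    apply: le_trans (young_add yB a0 b0) _; apply: leeD.
      apply: young_nd => //; rewrite ler_pdivrMr// mulrDr (mulrC p (_ / p)) divfK ?gt_eqF// lerDr.
      by rewrite !mulr_ge0// ltW.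
    apply: young_nd => //.
    rewrite (_ : _ / M = W `|t| * (`|t| * (2 * kappa / M))); last by ring.
    apply: ler_wpM2l => //; apply: ler_wpM2l => //.
    by rewrite ler_pdivrMr// ler_pdivlMl// /M (mulrC l) lerDl divr_ge0 ?mulr_ge0// ltW.
have og : finite_modular B Om (length_fun (fun x => h (u x) *: g x)).
  exists (kappa * l'); first exact: mulr_gt0.
  rewrite /modular; apply: (@controlled_integral_lty u (length_fun g) l' C e 0); [exact: C0|exact: cu| | |exact: l'0|exact: gl|exact: lexx| | |].
  - exact: measurable_length_fun.
  - by move=> x; exact: euclidean_norm_ge0.
  - apply: measurable_young_comp => //; [exact: measurable_length_fun| |exact: mulr_gt0].
    by move=> x; exact: euclidean_norm_ge0.
  - by move=> x; rewrite young_ge0// divr_ge0 ?euclidean_norm_ge0 ?mulr_ge0// ltW.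
  - move=> x; rewrite add0e; apply: young_nd => //.
      by rewrite divr_ge0 ?euclidean_norm_ge0 ?mulr_ge0// ltW.
    rewrite /length_fun euclidean_normZ invfM !mulrA ler_pM2r ?invr_gt0// mulrAC.
    apply: ler_wpM2r; first exact: euclidean_norm_ge0.
    by rewrite ler_pdivrMr// mulrC.
split => //; apply: (weak_gradient_superposition oOm wg mh hloc fh).
  have [l1 l10 ul1] := ou.
  have ia : vol.-integrable Om (EFin \o abs_fun (superposition f u)).
    exact: (modular_integrable yB mOmL Omlty (measurable_abs_fun mfu) (abs_fun_ge0 _) l10 ul1).
  exact: (integrable_Rle mOmL mfu ia).
move=> i; have [l1 l10 gl1] := og.
have := integrable_coord (mhg i) (modular_integrable yB mOmL Omlty (measurable_length_fun mhg) (fun x => euclidean_norm_ge0 _) l10 gl1).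
by apply: eq_integrable => // x _; rewrite /= mxE.
Qed.

Lemma controlled_maps (u : 'rV[R]_m.+1 -> R) (C e : R) :
  orlicz_sobolev A Om u -> 0 <= C -> controlled u C e ->
  orlicz_sobolev B Om (superposition f u) /\
  {ae vol, forall x, Om x ->
    weak_gradient Om (superposition f u) x = h (u x) *: weak_gradient Om u x}.
Proof.
move=> Wu C0 cu; have [ou og wg] := controlled_superposition Wu C0 cu.
have wd : weakly_differentiable Om (superposition f u) by eexists; exact: wg.
have wg' : is_weak_gradient Om (superposition f u) (weak_gradient Om (superposition f u)) by exact: xgetPex.
have E := weak_gradient_unique oOm wg' wg.
have mg' i : measurable_fun (Om : set LS) (fun x => weak_gradient Om (superposition f u) x ord0 i).
  by have [_ /(_ i)[]] := wg'.
have mg i : measurable_fun (Om : set LS) (fun x => (h (u x) *: weak_gradient Om u x) ord0 i).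
  by have [_ /(_ i)[]] := wg.
split; last exact: E.
split => //; split; first exact: mg'.
have [l l0 gl] := og; exists l => //; apply: le_lt_trans gl; rewrite /modular.
have FF := ae_filter_ringOfSetsType vol.
rewrite le_eqVlt; apply/orP; left; apply/eqP; apply: (ae_eq_integral _ _ mOmL).
- by apply: measurable_young_comp => //; [exact: measurable_length_fun|move=> x; exact: euclidean_norm_ge0].
- by apply: measurable_young_comp => //; [exact: measurable_length_fun|move=> x; exact: euclidean_norm_ge0].
- by apply: filterS E => x h1 /h1; rewrite /length_fun => ->.
Qed.

End controlled.

(** * Reduction of unbounded coefficients to bounded ones *)

Section saturation.
Context {R : realType}.

(** A homeomorphism onto ]-1, 1[: it makes a coefficient bounded, and its continuous inverse
    recovers convergence of the coefficient itself. *)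
Definition saturate (t : R) : R := t / (1 + `|t|).

Let pos (t : R) : 0 < 1 + `|t|. Proof. by rewrite ltr_pwDl. Qed.

Lemma saturate_lt1 t : `|saturate t| < 1.
Proof.
by rewrite /saturate normrM normfV (ger0_norm (ltW (pos t))) ltr_pdivrMr// mul1r ltrDr.
Qed.

Lemma saturate_continuous : continuous saturate.
Proof.
move=> t; apply: cvgM; first exact: cvg_id.
apply: cvgV; first by rewrite gt_eqF.
by apply: cvgD; [exact: cvg_cst|apply: cvg_norm; exact: cvg_id].
Qed.

Lemma saturateK t : saturate t / (1 - `|saturate t|) = t.
Proof.
rewrite /saturate normrM normfV (ger0_norm (ltW (pos t))).
have := pos t; set p := 1 + `|t| => p0.
have -> : 1 - `|t| / p = p^-1 by rewrite (_ : `|t| = p - 1); [field; rewrite gt_eqF|rewrite /p; ring].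
by rewrite invrK divfK// gt_eqF.
Qed.

Lemma saturate_cvg (s : nat -> R) (s0 : R) :
  (saturate (s k) - saturate s0) ^+ 2 @[k --> \oo] --> (0 : R) -> s k @[k --> \oo] --> s0.
Proof.
move=> cv; have cvs : saturate (s k) @[k --> \oo] --> saturate s0.
  have : Num.sqrt ((saturate (s k) - saturate s0) ^+ 2) @[k --> \oo] --> (Num.sqrt 0 : R).
    by apply: continuous_cvg cv; exact: sqrt_continuous.
  under eq_fun do rewrite sqrtr_sqr; rewrite sqrtr0 => cvn.
  have : (saturate (s k) - saturate s0) + saturate s0 @[k --> \oo] --> 0 + saturate s0.
    by apply: cvgD; [exact: norm_cvg0|exact: cvg_cst].
  by rewrite add0r; under eq_fun do rewrite subrK.
rewrite -[s0]saturateK (_ : s = (fun k => saturate (s k) / (1 - `|saturate (s k)|))); last first.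
  by apply/funext => k; rewrite saturateK.
apply: cvgM; first exact: cvs.
apply: cvgV; first by rewrite gt_eqF// subr_gt0 saturate_lt1.
by apply: cvgB; [exact: cvg_cst|exact: cvg_norm].
Qed.

(** Componentwise: where v0 has a zero component nothing is asked of [s]; if some component is
    nonzero, the weighted convergence forces s_k -> s0. The bound on [s] handles the part s_k (v_k -
    v0). *)
Lemma scaled_cvg n (s : nat -> R) (s0 L : R) (v : nat -> 'rV[R]_n) (v0 : 'rV[R]_n) :
  (forall k, `|s k| <= L) ->
  euclidean_norm (v k - v0) @[k --> \oo] --> (0 : R) ->
  (forall i, (saturate (s k) - saturate s0) ^+ 2 * `|v0 ord0 i| @[k --> \oo] --> (0 : R)) ->
  euclidean_norm (s k *: v k - s0 *: v0) @[k --> \oo] --> (0 : R).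
Proof.
move=> sL cv cs.
have c1 i : `|(s k - s0) * v0 ord0 i| @[k --> \oo] --> (0 : R).
  have [v0z|v0n] := eqVneq (v0 ord0 i) 0.
    by under eq_fun do rewrite v0z mulr0 normr0; exact: cvg_cst.
  have sc : s k @[k --> \oo] --> s0.
    apply: saturate_cvg.
    have : (saturate (s k) - saturate s0) ^+ 2 * `|v0 ord0 i| * `|v0 ord0 i|^-1 @[k --> \oo] -->
        0 * `|v0 ord0 i|^-1 by apply: cvgM; [exact: cs|exact: cvg_cst].
    by rewrite mul0r; under eq_fun do rewrite mulfK ?normr_eq0//.
  rewrite -[X in _ --> X](_ : `|(s0 - s0) * v0 ord0 i| = 0); last by rewrite subrr mul0r normr0.
  by apply: cvg_norm; apply: cvgM; [apply: cvgB; [exact: sc|exact: cvg_cst]|exact: cvg_cst].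
have c2 : L * euclidean_norm (v k - v0) + \sum_i `|(s k - s0) * v0 ord0 i| @[k --> \oo] --> (0 : R).
  rewrite -[X in _ --> X]addr0; apply: cvgD.
    by rewrite -[X in _ --> X](mulr0 L); apply: cvgM; [exact: cvg_cst|exact: cv].
  rewrite -[X in _ --> X](_ : \sum_(i < n) (0 : R) = 0); last by rewrite big1.
  by apply: cvg_big => // -[y z]; exact: add_continuous.
apply: squeeze_cvgr (cvg_cst 0) c2; apply: nearW => k; rewrite euclidean_norm_ge0/=.
rewrite (_ : _ - _ = s k *: (v k - v0) + (s k - s0) *: v0); last first.
  by rewrite scalerBr scalerBl addrA subrK.
apply: le_trans (euclidean_normD _ _) _; apply: lerD.
  by rewrite euclidean_normZ; apply: ler_wpM2r; [exact: euclidean_norm_ge0|exact: sL].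
apply: le_trans (euclidean_norm_le_sum _) _.
by apply: ler_sum => i _; rewrite mxE.
Qed.

End saturation.

(** * Modular convergence of the compositions *)

Section controlled_convergence.
Context {R : realType} {m : nat}.
Notation LS := (lebesgue_space R m.+1).
Notation vol := (@volume R m.+1).
Variables (A B : R -> \bar R) (W : R -> R) (Om : set 'rV[R]_m.+1).
Hypotheses (oOm : open Om) (Omlty : (vol Om < +oo)%E).
Hypotheses (yA : young_function A) (yB : young_function B).
Variables (f h : R -> R) (kappa : R).
Hypotheses (nA : nondegenerate_young A).
Hypotheses (mh : measurable_fun setT h)
  (hloc : forall M : R, exists L, forall t, `|t| <= M -> `|h t| <= L)
  (fh : primitive f h).
Hypotheses (k0 : 0 < kappa) (W0 : forall t, 0 <= t -> 0 <= W t)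
  (Wmono : forall s t, 0 <= s -> s <= t -> W s <= W t)
  (hW : forall t, `|h t| <= kappa * W `|t|).

Let mOmL : measurable (Om : set LS).
Proof. by apply: measurable_lebesgue_space; exact: measurable_open_rV. Qed.

Let cf : continuous f. Proof. exact: (primitive_continuous mh hloc fh). Qed.
Let mf : measurable_fun setT f. Proof. exact: continuous_measurable_fun. Qed.

Let function_bound (a b L : R) : 0 < L ->
  (B (`|f a - f b| / (12 * kappa * L))%R <=
   B (W `|a| * (`|a - b| / L))%R + B (W `|b| * (`|a - b| / L))%R)%E.
Proof.
move=> L0; have Wa := W0 (normr_ge0 a); have Wb := W0 (normr_ge0 b).
have M0 : 0 < 12 * kappa * L by rewrite !mulr_gt0.
have s0 : 0 <= `|a - b| / L by rewrite divr_ge0// ltW.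
apply: le_trans (young_max yB (mulr_ge0 Wa s0) (mulr_ge0 Wb s0)).
apply: young_nd => //; first by rewrite divr_ge0// ltW.
rewrite -maxr_pMl// ler_pdivrMr//.
apply: le_trans (superposition_increment mh fh k0 Wmono hW a b) _.
set w := Num.max _ _; have w0 : 0 <= w by rewrite le_max Wa.
rewrite (_ : w * _ * _ = 12 * (kappa * w * `|a - b|)); last by field; rewrite gt_eqF.
by rewrite ler_peMl ?ler1n// !mulr_ge0// ltW.
Qed.

(** With h(a) p - h(b) r = h(a)(p - r) + (h(a) - h(b)) r, midpoint convexity is used twice, giving
    weights 1/2, 1/4, 1/4. The two coefficients of [r] stay separate, so each is controlled by its
    own function. *)
Let gradient_bound (a b L : R) (p r : 'rV[R]_m.+1) : 0 < L ->
  (B (euclidean_norm (h a *: p - h b *: r)%R / (12 * kappa * L))%R <=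
   B (W `|a| * (euclidean_norm (p - r)%R / L))%R +
   (B (W `|a| * (euclidean_norm r / L))%R + B (W `|b| * (euclidean_norm r / L))%R))%E.
Proof.
move=> L0; have Wa := W0 (normr_ge0 a); have Wb := W0 (normr_ge0 b).
have M0 : 0 < 12 * kappa * L by rewrite !mulr_gt0.
have s0 : 0 <= euclidean_norm (p - r) / L by rewrite divr_ge0 ?euclidean_norm_ge0// ltW.
have s1 : 0 <= euclidean_norm r / L by rewrite divr_ge0 ?euclidean_norm_ge0// ltW.
have P0 := mulr_ge0 Wa s0; have P1 := mulr_ge0 Wa s1; have P2 := mulr_ge0 Wb s1.
set x := W `|a| * _ in P0 *; set y := W `|a| * _ in P1 *; set z := W `|b| * _ in P2 *.
have yz0 : 0 <= (y + z) / 2 by rewrite divr_ge0// addr_ge0.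
apply: le_trans (_ : (B x + B ((y + z) / 2)%R <= _)%E); last first.
  by apply: leeD => //; exact: young_add.
apply: le_trans (young_add yB P0 yz0).
apply: young_nd => //; first by rewrite divr_ge0 ?euclidean_norm_ge0// ltW.
rewrite ler_pdivrMr//.
rewrite (_ : h a *: p - h b *: r = h a *: (p - r) + (h a - h b) *: r); last first.
  by rewrite scalerBr scalerBl addrA subrK.
apply: le_trans (euclidean_normD _ _) _; rewrite !euclidean_normZ.
have ha : `|h a| * euclidean_norm (p - r) <= kappa * L * x.
  rewrite (_ : kappa * L * x = kappa * W `|a| * euclidean_norm (p - r)); last first.
    by rewrite /x; field; rewrite gt_eqF.
  by apply: ler_wpM2r; [exact: euclidean_norm_ge0|exact: hW].
have hb : `|h a - h b| * euclidean_norm r <= kappa * L * (y + z).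
  rewrite (_ : kappa * L * (y + z) = (kappa * W `|a| + kappa * W `|b|) * euclidean_norm r); last first.
    by rewrite /y /z; field; rewrite gt_eqF.
  apply: ler_wpM2r; first exact: euclidean_norm_ge0.
  by apply: le_trans (ler_normB _ _) _; apply: lerD.
apply: le_trans (lerD ha hb) _.
rewrite (_ : _ * (12 * kappa * L) = kappa * L * (6 * x + 3 * (y + z))); last by field.
have kL : 0 <= kappa * L by rewrite mulr_ge0 ?ltW.
by rewrite -mulrDr; apply: ler_wpM2l => //; lra.
Qed.

Let fine_cvg0 (w : nat -> 'rV[R]_m.+1 -> R) :
  (\int[vol]_(x in Om) (w k x)%:E)%E @[k --> \oo] --> 0%E ->
  \int[vol]_(x in Om) w k x @[k --> \oo] --> (0 : R).
Proof. by move=> cv; exact: (fine_cvg cv). Qed.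

Section small.
Variables (u_ : nat -> 'rV[R]_m.+1 -> R) (u : 'rV[R]_m.+1 -> R) (l L C e : R).
Hypotheses (Wu_ : forall k, orlicz_sobolev A Om (u_ k)) (Wu : orlicz_sobolev A Om u).
Hypotheses (l0 : 0 < l) (lL : l <= L) (ucv : sobolev_modular_cvg A Om u_ u l).
Hypothesis gL : (modular A Om (length_fun (weak_gradient Om u)) L < +oo)%E.
Hypotheses (C0 : 0 <= C) (e0 : 0 < e) (cu : controlled A B W Om u C e)
  (cu_ : forall k, controlled A B W Om (u_ k) C e).

Let g_ k := weak_gradient Om (u_ k).
Let g := weak_gradient Om u.
Let L0 : 0 < L. Proof. exact: lt_le_trans lL. Qed.
Let mu_ k : measurable_fun (Om : set LS) (u_ k). Proof. by have [_ []] := Wu_ k. Qed.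
Let mu : measurable_fun (Om : set LS) u. Proof. by have [_ []] := Wu. Qed.
Let mg_ k i : measurable_fun (Om : set LS) (fun x => g_ k x ord0 i).
Proof. by have [_ _ []] := Wu_ k. Qed.
Let mg i : measurable_fun (Om : set LS) (fun x => g x ord0 i).
Proof. by have [_ _ []] := Wu. Qed.

Let wg_ k : is_weak_gradient Om (u_ k) (g_ k). Proof. by have [] := orlicz_sobolevP oOm Omlty yA (Wu_ k). Qed.
Let wg : is_weak_gradient Om u g. Proof. by have [] := orlicz_sobolevP oOm Omlty yA Wu. Qed.
Let iu_ k : vol.-integrable Om (EFin \o u_ k). Proof. by have [] := orlicz_sobolevP oOm Omlty yA (Wu_ k). Qed.
Let iu : vol.-integrable Om (EFin \o u). Proof. by have [] := orlicz_sobolevP oOm Omlty yA Wu. Qed.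
Let ig_ k i : vol.-integrable Om (EFin \o (fun x => g_ k x ord0 i)).
Proof. by apply: (integrable_coord oOm); [exact: mg_|have [] := orlicz_sobolevP oOm Omlty yA (Wu_ k)]. Qed.
Let ig i : vol.-integrable Om (EFin \o (fun x => g x ord0 i)).
Proof. by apply: (integrable_coord oOm); [exact: mg|have [] := orlicz_sobolevP oOm Omlty yA Wu]. Qed.

Let mud k : measurable_fun (Om : set LS) (abs_fun (u_ k \- u)).
Proof. by apply: measurable_abs_fun; exact: (measurable_funB (mu_ k) mu). Qed.
Let mgd k : measurable_fun (Om : set LS) (length_fun (g_ k \- g)).
Proof.
apply: measurable_length_fun => i.
rewrite (_ : (fun x => _) = (fun x => g_ k x ord0 i - g x ord0 i)).
  exact: (measurable_funB (mg_ k i) (mg i)).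
by apply/funext => x; rewrite !mxE.
Qed.

Let cvu : (\int[vol]_(x in Om) (abs_fun (u_ k \- u) x)%:E)%E @[k --> \oo] --> 0%E.
Proof. exact: (modular_cvg_integral yA mOmL Omlty nA mud (fun k x => abs_fun_ge0 _ x) l0 ucv.1). Qed.
Let cvg : (\int[vol]_(x in Om) (length_fun (g_ k \- g) x)%:E)%E @[k --> \oo] --> 0%E.
Proof. exact: (modular_cvg_integral yA mOmL Omlty nA mgd (fun k x => length_fun_ge0 _ x) l0 ucv.2). Qed.

Let iud k : vol.-integrable Om (EFin \o abs_fun (u_ k \- u)).
Proof.
have := integrable_abse (integrableB mOmL (iu_ k) iu).
by apply: eq_integrable.
Qed.
Let igd k i : vol.-integrable Om (EFin \o (fun x => `|g_ k x ord0 i - g x ord0 i|)).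
Proof.
have := integrable_abse (integrableB mOmL (ig_ k i) (ig i)).
by apply: eq_integrable.
Qed.
Let ilen k : vol.-integrable Om (EFin \o length_fun (g_ k \- g)).
Proof.
apply: (integrable_Rle mOmL (g := fun x => length_fun (g_ k) x + length_fun g x)); first exact: mgd.
  have [_ _ i1] := orlicz_sobolevP oOm Omlty yA (Wu_ k).
  have [_ _ i2] := orlicz_sobolevP oOm Omlty yA Wu.
  by have := integrableD mOmL i1 i2; apply: eq_integrable.
move=> x _; rewrite ger0_norm ?length_fun_ge0//.
apply: le_trans (euclidean_normD _ _) _.
by rewrite lerD2l -scaleN1r euclidean_normZ normrN1 mul1r.
Qed.

Let cvgi i : \int[vol]_(x in Om) `|g_ k x ord0 i - g x ord0 i| @[k --> \oo] --> (0 : R).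
Proof.
apply: squeeze_cvgr (cvg_cst 0) (fine_cvg0 cvg); apply: nearW => k.
rewrite Rintegral_ge0//=; apply: (le_Rintegral mOmL (igd k i) (ilen k)) => x _.
by have := norm_coord_le ((g_ k \- g) x) i; rewrite !mxE.
Qed.

Let q t := saturate (h t).
Let mq : measurable_fun setT q.
Proof.
apply: (measurableT_comp _ mh); apply: continuous_measurable_fun.
exact: saturate_continuous.
Qed.
Let q1 t : `|q t| <= 1. Proof. exact/ltW/saturate_lt1. Qed.

Let cvq i : \int[vol]_(x in Om) ((q (u_ k x) - q (u x)) ^+ 2 * `|g x ord0 i|) @[k --> \oo] --> (0 : R).
Proof.
exact: (coefficient_strong_cvg oOm wg_ wg iu_ iu ig_ ig (fine_cvg0 cvu) cvgi i mq q1).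
Qed.

Let iq k i : vol.-integrable Om (EFin \o (fun x => (q (u_ k x) - q (u x)) ^+ 2 * `|g x ord0 i|)).
Proof.
apply: (integrableMb mOmL (C := 4) _ (integrable_abse (ig i))).
  apply: measurable_funX; exact: (measurable_funB (measurableT_comp mq (mu_ k)) (measurableT_comp mq mu)).
move=> x _; rewrite normrX (_ : 4 = 2 ^+ 2); last by ring.
rewrite lerXn2r ?nnegrE//; apply: le_trans (ler_normB _ _) _.
by have := q1 (u_ k x); have := q1 (u x); lra.
Qed.

(** A single integrand gathers the convergences of functions, gradients and coefficients, so that
    one subsequence serves all three. *)
Let w k x := abs_fun (u_ k \- u) x + length_fun (g_ k \- g) x +
  \sum_i (q (u_ k x) - q (u x)) ^+ 2 * `|g x ord0 i|.

Let w0 k x : 0 <= w k x.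
Proof.
rewrite /w !addr_ge0 ?abs_fun_ge0 ?length_fun_ge0// sumr_ge0// => i _.
by rewrite mulr_ge0 ?sqr_ge0.
Qed.

Let isum k : vol.-integrable Om (EFin \o (fun x => \sum_i (q (u_ k x) - q (u x)) ^+ 2 * `|g x ord0 i|)).
Proof.
by have [] := Rintegral_sum mOmL (index_enum _) (fun i => iq k i).
Qed.

Let iul k : vol.-integrable Om (EFin \o (fun x => abs_fun (u_ k \- u) x + length_fun (g_ k \- g) x)).
Proof. by have := integrableD mOmL (iud k) (ilen k); apply: eq_integrable. Qed.

Let iw k : vol.-integrable Om (EFin \o w k).
Proof. by have := integrableD mOmL (iul k) (isum k); apply: eq_integrable. Qed.

Let cvw : (\int[vol]_(x in Om) (w k x)%:E)%E @[k --> \oo] --> 0%E.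
Proof.
rewrite (_ : (fun k => _) = (fun k => (\int[vol]_(x in Om) w k x)%:E)); last first.
  by apply/funext => k; rewrite (EFin_Rintegral mOmL (iw k)).
apply: cvg_EFin; first exact: nearW.
have -> : fine \o (fun k => (\int[vol]_(x in Om) w k x)%:E) =
    (fun k => \int[vol]_(x in Om) abs_fun (u_ k \- u) x +
    \int[vol]_(x in Om) length_fun (g_ k \- g) x +
    \sum_i \int[vol]_(x in Om) ((q (u_ k x) - q (u x)) ^+ 2 * `|g x ord0 i|)).
  apply/funext => k /=; rewrite /w (RintegralD mOmL (iul k) (isum k)) (RintegralD mOmL (iud k) (ilen k)).
  by have [_ ->] := Rintegral_sum mOmL (index_enum _) (fun i => iq k i).
rewrite -[X in _ --> X]addr0 -[X in _ --> X + _]addr0.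
rewrite -[X in _ --> _ + X](_ : \sum_(i < m.+1) (0 : R) = 0); last by rewrite big1.
apply: cvgD; first by apply: cvgD; exact: fine_cvg0.
by apply: cvg_big => // -[y z]; exact: add_continuous.
Qed.

Let X k x := (B (`|f (u_ k x) - f (u x)| / (12 * kappa * L))%R +
  B (euclidean_norm (h (u_ k x) *: g_ k x - h (u x) *: g x)%R / (12 * kappa * L))%R)%E.

Let M0 : 0 < 12 * kappa * L. Proof. by rewrite !mulr_gt0. Qed.

Let mX k : measurable_fun (Om : set LS) (X k).
Proof.
have m1 : measurable_fun (Om : set LS) (fun x => `|f (u_ k x) - f (u x)|).
  apply: measurable_fun_normr.
  exact: (measurable_funB (measurableT_comp mf (mu_ k)) (measurableT_comp mf mu)).
have m2 : measurable_fun (Om : set LS) (fun x => euclidean_norm (h (u_ k x) *: g_ k x - h (u x) *: g x)).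
  apply: measurable_fun_euclidean_norm => i.
  rewrite (_ : (fun x => _) = (fun x => h (u_ k x) * g_ k x ord0 i - h (u x) * g x ord0 i)).
    exact: (measurable_funB (measurable_funM (measurableT_comp mh (mu_ k)) (mg_ k i))
      (measurable_funM (measurableT_comp mh mu) (mg i))).
  by apply/funext => x; rewrite !mxE.
apply: emeasurable_funD.
  exact: (measurable_young_comp yB m1 (fun x => normr_ge0 _) M0).
exact: (measurable_young_comp yB m2 (fun x => euclidean_norm_ge0 _) M0).
Qed.

Let X0 k x : (0 <= X k x)%E.
Proof.
rewrite /X adde_ge0//; apply: (young_ge0 yB); rewrite divr_ge0 ?euclidean_norm_ge0//; exact: ltW.
Qed.

Let cvX (psi : nat -> nat) x : (w (psi k) x)%:E @[k --> \oo] --> 0%E ->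
  X (psi k) x @[k --> \oo] --> 0%E.
Proof.
move=> /fine_cvg cv.
have sq (a : nat -> R) : (forall k, 0 <= a k <= w (psi k) x) -> a k @[k --> \oo] --> (0 : R).
  by move=> aw; apply: squeeze_cvgr (cvg_cst 0) cv; exact: nearW.
have c1 : u_ (psi k) x - u x @[k --> \oo] --> (0 : R).
  apply: norm_cvg0; apply: sq => k; rewrite normr_ge0 /w -addrA lerDl.
  by rewrite addr_ge0 ?length_fun_ge0 ?sumr_ge0// => i _; rewrite mulr_ge0 ?sqr_ge0.
have c2 : euclidean_norm (g_ (psi k) x - g x) @[k --> \oo] --> (0 : R).
  apply: sq => k; rewrite euclidean_norm_ge0 /w addrAC lerDr.
  by rewrite addr_ge0 ?abs_fun_ge0 ?sumr_ge0// => i _; rewrite mulr_ge0 ?sqr_ge0.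
have c3 i : (q (u_ (psi k) x) - q (u x)) ^+ 2 * `|g x ord0 i| @[k --> \oo] --> (0 : R).
  apply: sq => k; rewrite mulr_ge0 ?sqr_ge0//= /w; apply: ler_wpDl.
    by rewrite addr_ge0 ?abs_fun_ge0 ?length_fun_ge0.
  by rewrite (bigD1 i)//= lerDl sumr_ge0// => j _; rewrite mulr_ge0 ?sqr_ge0.
have c4 : u_ (psi k) x @[k --> \oo] --> u x.
  have : (u_ (psi k) x - u x) + u x @[k --> \oo] --> 0 + u x.
    by apply: cvgD; [exact: c1|exact: cvg_cst].
  by rewrite add0r; under eq_fun do rewrite subrK.
have [K KP] : exists K, forall k, `|u_ (psi k) x| <= K.
  have cn : cvgn (fun k => u_ (psi k) x) by apply/cvg_ex; eexists; exact: c4.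
  have [K [_ KP]] := cvg_seq_bounded cn.
  by exists (K + 1) => k; apply: (KP (K + 1)) => //; rewrite ltrDl.
have [L' L'P] := hloc K.
have c5 : euclidean_norm (h (u_ (psi k) x) *: g_ (psi k) x - h (u x) *: g x) @[k --> \oo] --> (0 : R).
  exact: (scaled_cvg (L := L') (fun k => L'P _ (KP k)) c2 c3).
have c6 : `|f (u_ (psi k) x) - f (u x)| @[k --> \oo] --> (0 : R).
  rewrite -[Y in _ --> Y](_ : `|f (u x) - f (u x)| = 0); last by rewrite subrr normr0.
  apply: cvg_norm; apply: cvgB; last exact: cvg_cst.
  by apply: continuous_cvg c4; exact: cf.
have cdiv (a : nat -> R) : a k @[k --> \oo] --> (0 : R) ->
    a k / (12 * kappa * L) @[k --> \oo] --> (0 : R).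
  by move=> ca; rewrite -[X in _ --> X](mul0r (12 * kappa * L)^-1); apply: cvgM; [exact: ca|exact: cvg_cst].
rewrite -[X in _ --> X]adde0; apply: cvgeD => //.
  apply: (young_cvg0 yB) (cdiv _ c6) => k; rewrite divr_ge0//; exact: ltW.
apply: (young_cvg0 yB) (cdiv _ c5) => k; rewrite divr_ge0 ?euclidean_norm_ge0//; exact: ltW.
Qed.

Let modL (v : 'rV[R]_m.+1 -> R) : measurable_fun (Om : set LS) v -> (forall x, 0 <= v x) ->
  (modular A Om v L <= modular A Om v l)%E.
Proof.
move=> mv v0; apply: ge0_le_integral; [exact: mOmL| | | |].
- by move=> x _; apply: (young_ge0 yA); exact: (divr_ge0 (v0 x) (ltW L0)).
- exact: (measurable_young_comp yA mv v0 L0).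
- exact: (measurable_young_comp yA mv v0 l0).
- move=> x _; apply: (young_nd yA); first exact: (divr_ge0 (v0 x) (ltW L0)).
  by apply: ler_wpM2l => //; rewrite lef_pV2.
Qed.

(** Along the subsequence the integrand [X] tends to 0 almost everywhere and is bounded by a fixed
    integrable [D] plus Z_k of integral at most 6 e; [dominated_small] then gives 12 e. *)
Lemma controlled_small : exists k,
  (modular B Om (abs_fun (superposition f (u_ k) \- superposition f u)%R) (12 * kappa * L) +
   modular B Om (length_fun (weak_gradient Om (superposition f (u_ k)) \-
     weak_gradient Om (superposition f u))%R) (12 * kappa * L) <= (12 * e)%:E)%E.
Proof.
have FF := ae_filter_ringOfSetsType vol.
have pos1 k : (0 <= modular A Om (abs_fun (u_ k \- u)%R) l)%E.
  by apply: integral_ge0 => x _; apply: (young_ge0 yA); exact: (divr_ge0 (abs_fun_ge0 _ _) (ltW l0)).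
have pos2 k : (0 <= modular A Om (length_fun (weak_gradient Om (u_ k) \- weak_gradient Om u)%R) l)%E.
  by apply: integral_ge0 => x _; apply: (young_ge0 yA); exact: (divr_ge0 (length_fun_ge0 _ _) (ltW l0)).
have [N1 N1P] := (ereal_cvg0P pos1).1 ucv.1 e e0.
have [N2 N2P] := (ereal_cvg0P pos2).1 ucv.2 e e0.
(* Past this index both modulars of the differences are below [e]; the subsequence is taken from the
   shifted sequence. *)
pose N := maxn N1 N2.
have cvwN : (\int[vol]_(x in Om) (w (k + N)%N x)%:E)%E @[k --> \oo] --> 0%E.
  by rewrite (cvg_shiftn N (fun k => (\int[vol]_(x in Om) (w k x)%:E)%E)).
have [phi [phik cvphi]] := ae_subsequence mOmL
  (fun k => @measurable_int _ _ _ _ _ _ (iw (k + N)%N)) (fun k x _ => w0 (k + N)%N x : (0%:E <= (w (k + N)%N x)%:E)%E) cvwN.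
pose psi k := (phi k + N)%N.
have [Qu [mQu Qu0 Que QuB]] := cu.
have /choice[Q_ Q_P] := cu_.
have mQ_ k : measurable_fun (Om : set LS) (Q_ k) by have [] := Q_P k.
have Q_0 k x : Om x -> (0 <= Q_ k x)%E by have [_ + _ _] := Q_P k; apply.
have Q_e k : (\int[vol]_(x in Om) Q_ k x <= e%:E)%E by have [] := Q_P k.
have Q_B k := let: And4 _ _ _ H := Q_P k in H.
pose S1 k x := A (abs_fun (u_ k \- u)%R x / L)%R.
pose S2 k x := A (length_fun (g_ k \- g) x / L)%R.
pose S3 x := A (length_fun g x / L)%R.
have mg3 : measurable_fun (Om : set LS) (length_fun g) by exact: measurable_length_fun.
have mS1 k : measurable_fun (Om : set LS) (S1 k) := measurable_young_comp yA (mud k) (abs_fun_ge0 _) L0.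
have mS2 k : measurable_fun (Om : set LS) (S2 k) := measurable_young_comp yA (mgd k) (length_fun_ge0 _) L0.
have mS3 : measurable_fun (Om : set LS) S3 := measurable_young_comp yA mg3 (length_fun_ge0 _) L0.
have S10 k x : Om x -> (0 <= S1 k x)%E.
  by move=> _; apply: (young_ge0 yA); exact: (divr_ge0 (abs_fun_ge0 _ _) (ltW L0)).
have S20 k x : Om x -> (0 <= S2 k x)%E.
  by move=> _; apply: (young_ge0 yA); exact: (divr_ge0 (length_fun_ge0 _ _) (ltW L0)).
have S30 x : Om x -> (0 <= S3 x)%E.
  by move=> _; apply: (young_ge0 yA); exact: (divr_ge0 (length_fun_ge0 _ _) (ltW L0)).
have S1e k : (\int[vol]_(x in Om) S1 (psi k) x <= e%:E)%E.
  apply: le_trans (modL (mud _) (abs_fun_ge0 _)) _; apply: N1P.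
  by rewrite /psi; apply: leq_trans (leq_addl _ _); exact: leq_maxl.
have S2e k : (\int[vol]_(x in Om) S2 (psi k) x <= e%:E)%E.
  apply: le_trans (modL (mgd _) (length_fun_ge0 _)) _; apply: N2P.
  by rewrite /psi; apply: leq_trans (leq_addl _ _); exact: leq_maxr.
(* [controlled] is used five times, twice for [u] and three times for u_k. What does not depend on
   [k] goes into [D], the rest into [Z]. *)
pose D x := ((5 * C)%:E + (Qu x + Qu x + (S3 x + S3 x)))%E.
pose Z k x := (Q_ (psi k) x + Q_ (psi k) x + Q_ (psi k) x + (S1 (psi k) x + S1 (psi k) x + S2 (psi k) x))%E.
have D2 (a b : 'rV[R]_m.+1 -> \bar R) : measurable_fun (Om : set LS) a -> measurable_fun (Om : set LS) b ->
    (forall x, Om x -> (0 <= a x)%E) -> (forall x, Om x -> (0 <= b x)%E) ->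
    [/\ measurable_fun (Om : set LS) (fun x => a x + b x)%E,
      (forall x, Om x -> (0 <= a x + b x)%E) &
      (\int[vol]_(x in Om) (a x + b x) = \int[vol]_(x in Om) a x + \int[vol]_(x in Om) b x)%E].
  move=> ma mb a0 b0; split; first exact: emeasurable_funD.
    by move=> x Omx; rewrite adde_ge0 ?a0 ?b0.
  exact: (ge0_integralD vol mOmL a0 ma b0 mb).
have [mQQ QQ0 QQE] := D2 _ _ mQu mQu Qu0 Qu0.
have [mSS SS0 SSE] := D2 _ _ mS3 mS3 S30 S30.
have [mQS QS0 QSE] := D2 _ _ mQQ mSS QQ0 SS0.
have C5 x : Om x -> (0 <= (cst (5 * C)%:E : 'rV[R]_m.+1 -> \bar R) x)%E by rewrite lee_fin mulr_ge0.
have [mD D0 DE] := D2 _ _ (measurable_cst _) mQS C5 QS0.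
have Dlty : (\int[vol]_(x in Om) D x < +oo)%E.
  have Qulty := le_lt_trans Que (ltry e).
  rewrite /D DE QSE QQE SSE integral_cst//; apply: lte_add_pinfty.
    by apply: lte_mul_pinfty => //; rewrite lee_fin mulr_ge0.
  by apply: lte_add_pinfty; apply: lte_add_pinfty.
have Zk k : [/\ measurable_fun (Om : set LS) (Z k), forall x, Om x -> (0 <= Z k x)%E &
    (\int[vol]_(x in Om) Z k x <= (6 * e)%:E)%E].
  have [m1 p1 E1] := D2 _ _ (mQ_ (psi k)) (mQ_ (psi k)) (Q_0 (psi k)) (Q_0 (psi k)).
  have [m2 p2 E2] := D2 _ _ m1 (mQ_ (psi k)) p1 (Q_0 (psi k)).
  have [m3 p3 E3] := D2 _ _ (mS1 (psi k)) (mS1 (psi k)) (S10 (psi k)) (S10 (psi k)).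
  have [m4 p4 E4] := D2 _ _ m3 (mS2 (psi k)) p3 (S20 (psi k)).
  have [m5 p5 E5] := D2 _ _ m2 m4 p2 p4.
  split => //; rewrite /Z E5 E2 E1 E4 E3.
  apply: (@le_trans _ _ (e%:E + e%:E + e%:E + (e%:E + e%:E + e%:E))%E).
    by rewrite !leeD.
  by rewrite -!EFinD lee_fin; lra.
have e6 : 0 < 6 * e by rewrite mulr_gt0.
have cvXpsi : {ae vol, forall x, Om x -> X (psi k) x @[k --> \oo] --> 0%E}.
  by apply: filterS cvphi => x cvx Omx; apply: cvX; exact: cvx.
have Xdom k : {ae vol, forall x, Om x -> (X (psi k) x <= D x + Z k x)%E}.
  apply: filterS2 QuB (Q_B (psi k)) => x /[swap] Hk /[swap] Omx /(_ Omx) Hu.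
  have {}Hk := Hk Omx.
  have p1 : 0 <= `|u_ (psi k) x - u x| / L by exact: (divr_ge0 (normr_ge0 _) (ltW L0)).
  have p2 : 0 <= euclidean_norm (g_ (psi k) x - g x) / L by exact: (divr_ge0 (euclidean_norm_ge0 _) (ltW L0)).
  have p3 : 0 <= euclidean_norm (g x) / L by exact: (divr_ge0 (euclidean_norm_ge0 _) (ltW L0)).
  apply: le_trans (leeD (function_bound (u_ (psi k) x) (u x) L0)
    (gradient_bound (u_ (psi k) x) (u x) (g_ (psi k) x) (g x) L0)) _.
  apply: le_trans (leeD (leeD (Hk _ p1) (Hu _ p1)) (leeD (Hk _ p2) (leeD (Hk _ p3) (Hu _ p3)))) _.
  rewrite -/(S1 (psi k) x) -/(S2 (psi k) x) -/(S3 x) /D /Z.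
  rewrite (_ : 5 * C = C + C + C + C + C); last by ring.
  rewrite !EFinD; move: (C%:E) (Q_ (psi k) x) (Qu x) (S1 (psi k) x) (S2 (psi k) x) (S3 x) => c a b s1 s2 s3.
  rewrite le_eqVlt; apply/orP; left; apply/eqP.
  by rewrite [LHS](AC ((3*3)*(3*(3*3))) ((1*4*7*10*13*((5*14)*(12*15)))*((2*8*11)*((3*6)*9)))).
have [j jP] := dominated_small mOmL (fun k => mX (psi k)) (fun k x _ => X0 (psi k) x)
  (fun k => let: And3 H _ _ := Zk k in H) (fun k => let: And3 _ H _ := Zk k in H) mD D0 Dlty
  cvXpsi Xdom e6 (fun k => let: And3 _ _ H := Zk k in H).
exists (psi j).
have [_ E1] := controlled_maps oOm Omlty yA yB mh hloc fh k0 W0 Wmono hW Wu C0 cu.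
have [_ E2] := controlled_maps oOm Omlty yA yB mh hloc fh k0 W0 Wmono hW (Wu_ (psi j)) C0 (cu_ (psi j)).
apply: le_trans (_ : (\int[vol]_(x in Om) X (psi j) x <= _)%E); last first.
  by apply: le_trans jP _; rewrite lee_fin; lra.
have mu' k : measurable_fun (Om : set LS) (superposition f (u_ k) \- superposition f u).
  exact: (measurable_funB (measurableT_comp mf (mu_ k)) (measurableT_comp mf mu)).
have p1 x : Om x -> (0 <= B (abs_fun (superposition f (u_ (psi j)) \- superposition f u)%R x / (12 * kappa * L))%R)%E.
  by move=> _; apply: (young_ge0 yB); exact: (divr_ge0 (abs_fun_ge0 _ _) (ltW M0)).
have m1 := measurable_young_comp yB (measurable_abs_fun (mu' (psi j))) (abs_fun_ge0 _) M0.
have m2 : measurable_fun (Om : set LS) (fun x => euclidean_norm (h (u_ (psi j) x) *: g_ (psi j) x - h (u x) *: g x)).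
  apply: measurable_fun_euclidean_norm => i.
  rewrite (_ : (fun x => _) = (fun x => h (u_ (psi j) x) * g_ (psi j) x ord0 i - h (u x) * g x ord0 i)).
    exact: (measurable_funB (measurable_funM (measurableT_comp mh (mu_ (psi j))) (mg_ (psi j) i))
      (measurable_funM (measurableT_comp mh mu) (mg i))).
  by apply/funext => x; rewrite !mxE.
have m2' := measurable_young_comp yB m2 (fun x => euclidean_norm_ge0 _) M0.
have p2 x : Om x -> (0 <= B (euclidean_norm (h (u_ (psi j) x) *: g_ (psi j) x - h (u x) *: g x)%R / (12 * kappa * L))%R)%E.
  by move=> _; apply: (young_ge0 yB); exact: (divr_ge0 (euclidean_norm_ge0 _) (ltW M0)).
rewrite /X (ge0_integralD vol mOmL p1 m1 p2 m2'); apply: leeD => //.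
have [[_ _ [mg2 _]] [_ _ [mg1 _]]] :
    orlicz_sobolev B Om (superposition f (u_ (psi j))) /\ orlicz_sobolev B Om (superposition f u).
  have [S1u _] := controlled_maps oOm Omlty yA yB mh hloc fh k0 W0 Wmono hW Wu C0 cu.
  by have [S2u _] := controlled_maps oOm Omlty yA yB mh hloc fh k0 W0 Wmono hW (Wu_ (psi j)) C0 (cu_ (psi j)).
have m3 : measurable_fun (Om : set LS) (length_fun (weak_gradient Om (superposition f (u_ (psi j))) \-
     weak_gradient Om (superposition f u))).
  apply: measurable_length_fun => i.
  rewrite (_ : (fun x => _) = (fun x => weak_gradient Om (superposition f (u_ (psi j))) x ord0 i -
      weak_gradient Om (superposition f u) x ord0 i)); last by apply/funext => x; rewrite !mxE.
  exact: (measurable_funB (mg2 i) (mg1 i)).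
have m3' := measurable_young_comp yB m3 (length_fun_ge0 _) M0.
rewrite le_eqVlt; apply/orP; left; apply/eqP; apply: (ae_eq_integral _ _ mOmL m3' m2').
by apply: filterS2 E1 E2 => x h1 h2 Omx; rewrite /length_fun /= (h1 Omx) (h2 Omx).
Qed.

End small.

(** Were convergence to fail, a sequence of indices tending to infinity would keep the sum of the
    modulars above [e]; [controlled_small] applied to it gives a contradiction. *)
Lemma controlled_cvg (u_ : nat -> 'rV[R]_m.+1 -> R) (u : 'rV[R]_m.+1 -> R) (l L : R) :
  (forall k, orlicz_sobolev A Om (u_ k)) -> orlicz_sobolev A Om u -> 0 < l -> l <= L ->
  sobolev_modular_cvg A Om u_ u l ->
  (modular A Om (length_fun (weak_gradient Om u)) L < +oo)%E ->
  (forall e : R, 0 < e -> exists C : R, exists K : nat, [/\ 0 <= C,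
     controlled A B W Om u C e & forall k, (K <= k)%N -> controlled A B W Om (u_ k) C e]) ->
  sobolev_modular_cvg B Om (fun k => superposition f (u_ k)) (superposition f u) (12 * kappa * L).
Proof.
move=> Wu_ Wu l0 lL ucv gL H.
have L0 : 0 < L by exact: lt_le_trans lL.
have M0 : 0 < 12 * kappa * L by rewrite !mulr_gt0.
set X1 := fun k => modular B Om (abs_fun (superposition f (u_ k) \- superposition f u)) (12 * kappa * L).
set X2 := fun k => modular B Om (length_fun (weak_gradient Om (superposition f (u_ k)) \-
     weak_gradient Om (superposition f u))) (12 * kappa * L).
have X10 k : (0 <= X1 k)%E.
  by apply: integral_ge0 => x _; apply: (young_ge0 yB); exact: (divr_ge0 (abs_fun_ge0 _ _) (ltW M0)).
have X20 k : (0 <= X2 k)%E.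
  by apply: integral_ge0 => x _; apply: (young_ge0 yB); exact: (divr_ge0 (length_fun_ge0 _ _) (ltW M0)).
suff main (e : R) : 0 < e -> exists N, forall k, (N <= k)%N -> (X1 k + X2 k <= e%:E)%E.
  split; apply/ereal_cvg0P => // e /main[N NP]; exists N => k /NP; apply: le_trans.
    by rewrite leeDl.
  by rewrite leeDr.
(* The factor 12 lost in [controlled_small] leaves 12 e / 13, which is below [e]. *)
move=> e0; have e12 : 0 < e / 13 by rewrite divr_gt0.
have [C [K [C0 cu cu_]]] := H _ e12.
apply: contrapT => /forallNP N_; have /choice[phi phiP] (N : nat) :
    exists k, [/\ (N <= k)%N, (K <= k)%N & ~~ (X1 k + X2 k <= e%:E)%E].
  have /existsNP[k /not_implyP[Nk /negP Xk]] := N_ (maxn N K).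
  by exists k; split => //; apply: leq_trans Nk; [exact: leq_maxl|exact: leq_maxr].
have sub (a : nat -> \bar R) : (forall k, (0 <= a k)%E) -> a @ \oo --> 0%E ->
    a (phi k) @[k --> \oo] --> 0%E.
  move=> a0 /(ereal_cvg0P a0) cva; apply/(ereal_cvg0P (fun k => a0 (phi k))) => e' /cva[N NP].
  by exists N => k Nk; apply: NP; apply: leq_trans Nk _; have [] := phiP k.
have [k] := @controlled_small (fun k => u_ (phi k)) u l L C (e / 13) (fun k => Wu_ (phi k)) Wu l0 lL
  (conj (sub _ (fun k => integral_ge0 _ (fun x _ => young_ge0 yA (divr_ge0 (abs_fun_ge0 _ _) (ltW l0)))) ucv.1)
     (sub _ (fun k => integral_ge0 _ (fun x _ => young_ge0 yA (divr_ge0 (length_fun_ge0 _ _) (ltW l0)))) ucv.2))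
  gL C0 e12 cu (fun k => cu_ (phi k) (let: And3 _ H _ := phiP k in H)).
move=> h1; have [_ _ /negP] := phiP k; apply.
by apply: le_trans h1 _; rewrite lee_fin; lra.
Qed.

End controlled_convergence.

(** * Growth of the Sobolev function *)

Lemma ge0_le_inve (R : realType) (x y : \bar R) : (0 <= x)%E -> (x <= y)%E ->
  (y^-1 <= x^-1)%E.
Proof.
move=> x0 xy; have [->|xn] := eqVneq x 0%E; first by rewrite inve0 leey.
have [->|yn] := eqVneq y +oo%E; first by rewrite invey inve_ge0.
have xp : (0 < x)%E by rewrite lt_neqAle eq_sym xn.
have yp : (0 < y)%E by exact: lt_le_trans xy.
have fy : y \is a fin_num by rewrite ge0_fin_numE ?(ltW yp)// ltey.
have fx : x \is a fin_num by rewrite ge0_fin_numE// (le_lt_trans xy)// ltey.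
move: xy xp yp; rewrite -(fineK fx) -(fineK fy) !lte_fin lee_fin => xy xp yp.
by rewrite !inver !gt_eqF// lee_fin lef_pV2.
Qed.

Section dilation.
Context {R : realType}.
Notation leb := (@lebesgue_measure R).

Let dil (c : R) : measurableTypeR R -> measurableTypeR R := fun t => c * t.

Let measurable_dil c : measurable_fun setT (dil c).
Proof. exact: measurable_funM (measurable_cst _) (@measurable_id _ _ _). Qed.

(** Lebesgue measure equals [c] times its image under dilation by [c], as both agree on half-open
    intervals. *)
Lemma ge0_integral_dilation (c s : R) (k : R -> \bar R) : 0 < c ->
  measurable_fun (`]c * s, +oo[%classic : set (measurableTypeR R)) k ->
  (forall t, c * s < t -> (0 <= k t)%E) ->
  (\int[leb]_(t in `](c * s)%R, +oo[) k t = c%:E * \int[leb]_(t in `]s, +oo[) k (c * t)%R)%E.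
Proof.
move=> c0 mk k0.
have mD : measurable (`]c * s, +oo[%classic : set (measurableTypeR R)) by exact: measurable_itv.
pose nu_ : {measure set (measurableTypeR R) -> \bar R} := mscale (NngNum (ltW c0)) (pushforward leb (dil c)).
pose nu := nu_ (measurable_dil c).
transitivity (\int[nu]_(t in `](c * s)%R, +oo[) k t)%E.
  apply: eq_measure_integral => S mS _.
  apply: (lebesgue_measure_unique (mu := nu) _ mS) => X [[a b] _ <-].
  rewrite /= /mscale /= /pushforward.
  have -> : dil c @^-1` `]a, b] = `]a / c, b / c]%classic.
    by apply/seteqP; split => t; rewrite /= !in_itv/= ltr_pdivrMr// ler_pdivlMr// /dil (mulrC c).
  rewrite !lebesgue_measure_itv/= !lte_fin.
  rewrite ltr_pM2r ?invr_gt0//; case: ifP => _; last by rewrite mule0.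
  by rewrite -!EFinB -EFinM; congr (_%:E); field; rewrite gt_eqF.
have kp : forall t : measurableTypeR R, (`]c * s, +oo[%classic : set (measurableTypeR R)) t -> (0 <= k t)%E.
  by move=> t; rewrite /= in_itv/= andbT => /k0.
rewrite (ge0_integral_mscale _ mD _ mk kp) /=; congr (_ * _)%E.
rewrite (ge0_integral_pushforward (measurable_dil c) leb mD mk) => [|t /set_mem/kp//].
rewrite (_ : dil c @^-1` _ = `]s, +oo[%classic)//.
by apply/seteqP; split => t; rewrite /= !in_itv/= !andbT /dil ltr_pM2l.
Qed.

End dilation.

Section sobolev_growth.
Context {R : realType}.
Notation leb := (@lebesgue_measure R).
Variables (n : nat).
Hypothesis n2 : (2 <= n)%N.
Let n1 : (0 : R) < n%:R - 1. Proof. by rewrite subr_gt0 ltr1n. Qed.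

Let mray (s : R) : measurable (`]s, +oo[%classic : set (measurableTypeR R)).
Proof. exact: measurable_itv. Qed.

Let mk (A : R -> \bar R) (s : R) : young_function A -> 0 <= s ->
  measurable_fun (`]s, +oo[%classic : set (measurableTypeR R)) (sobolev_integrand n A).
Proof.
move=> yA s0; apply: measurable_funS (measurable_sobolev_integrand n2 yA).
  exact: measurable_itv.
by move=> x /=; rewrite !in_itv/= !andbT; exact: le_lt_trans.
Qed.

(** After the substitution t -> c t, the bound A'(t) <= A(c t) dominates the integrand of [A] by a
    constant multiple of that of A'. Used in contrapositive form: divergence for [A] passes to its
    representative. *)
Lemma converges_at_infinity_equiv (A A' : R -> \bar R) : young_function A -> young_function A' ->
  equiv_near_infinity A A' -> converges_at_infinity n A' -> converges_at_infinity n A.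
Proof.
move=> yA yA' [c [t0 [c0 t00 H]]] [s s0 h].
pose s1 := Num.max s t0.
have s10 : 0 < s1 by rewrite lt_max s0.
exists (c * s1); first exact: mulr_gt0.
rewrite (ge0_integral_dilation c0); last 2 first.
- by apply: mk => //; rewrite mulr_ge0// ltW.
- by move=> t _; exact: sobolev_integrand_ge0.
have mkc : measurable_fun (`]s1, +oo[%classic : set (measurableTypeR R)) (fun t => sobolev_integrand n A (c * t)).
  apply: (measurable_comp (mray (c * s1)) _ (mk yA _)).
  - by move=> _ [t /= + <-]; rewrite !in_itv/= !andbT ltr_pM2l.
  - by rewrite mulr_ge0// ltW.
  - exact: measurable_funM (measurable_cst _) (@measurable_id _ _ _).
apply: lte_mul_pinfty => //; first by rewrite lee_fin ltW.
apply: (@le_lt_trans _ _ (\int[leb]_(t in `]s1, +oo[)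
    ((poweR c%:E (n%:R - 1)^-1) * sobolev_integrand n A' t))%E).
  apply: ge0_le_integral; [exact: mray| | exact: mkc| |].
  - by move=> t _; exact: sobolev_integrand_ge0.
  - by apply: measurable_funeM; apply: mk => //; exact: ltW.
  - move=> t /=; rewrite in_itv/= andbT gt_max => /andP[st t0t].
    have tp : 0 < t by exact: lt_trans t0t.
    have [_ A'A] := H t (ltW t0t).
    rewrite -poweR_EFin /sobolev_integrand -poweRM; last 2 first.
    + by rewrite lee_fin ltW.
    + by apply: sobolev_ratio_ge0 => //; exact: ltW.
    apply: gt0_ler_poweR; first by rewrite invr_ge0 ltW.
    + rewrite in_itv/= leey andbT; apply: sobolev_ratio_ge0 => //.
      by rewrite mulr_ge0// ltW.
    + rewrite in_itv/= leey andbT mule_ge0 ?lee_fin ?(ltW c0)//.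
      by apply: sobolev_ratio_ge0 => //; exact: ltW.
    rewrite EFinM -muleA; apply: lee_wpmul2l; first by rewrite lee_fin ltW.
    apply: lee_wpmul2l; first by rewrite lee_fin ltW.
    by apply: ge0_le_inve => //; apply: young_ge0 => //; exact: ltW.
rewrite ge0_integralZl//; last 3 first.
- by apply: mk => //; exact: ltW.
- by move=> t _; exact: sobolev_integrand_ge0.
- exact: poweR_ge0.
apply: lte_mul_pinfty; first exact: poweR_ge0.
  by rewrite ge0_fin_numE ?poweR_ge0// poweR_lty// ltry.
apply: le_lt_trans h; apply: ge0_subset_integral => //.
- by apply: mk => //; exact: ltW.
- by move=> t _; exact: sobolev_integrand_ge0.
- by move=> t /=; rewrite !in_itv/= !andbT; apply: le_lt_trans; rewrite le_max lexx.
Qed.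

(** Beyond a point where [A] is infinite the integrand is 0. Divergence thus makes [A] finite
    everywhere. *)
Lemma converges_at_infinity_infinite (A : R -> \bar R) (t : R) : young_function A ->
  0 < t -> A t = +oo%E -> converges_at_infinity n A.
Proof.
move=> yA t0 At; exists t => //; rewrite (_ : (\int[leb]_(x in _) _)%E = 0%E) ?ltry//.
apply: integral0_eq => x; rewrite /= in_itv/= andbT => tx.
have -> : sobolev_integrand n A x = poweR 0 (n%:R - 1)^-1.
  rewrite /sobolev_integrand (_ : A x = +oo%E); first by rewrite invey mule0.
  by apply/eqP; rewrite -leye_eq -At young_nd// ltW.
by rewrite poweR0r// invr_neq0// gt_eqF.
Qed.

Lemma partial_sobolev_unbounded (A : R -> \bar R) : young_function A ->
  ~ converges_at_infinity n A -> (forall s, (partial_sobolev n A 0 s < +oo)%E) ->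
  forall M T0 : R, exists2 T, T0 <= T & M <= fine (partial_sobolev n A 0 T).
Proof.
move=> yA nc fin M T0; apply: contrapT => h; apply: nc.
pose s := Num.max T0 1; have s0 : 0 < s by rewrite lt_max ltr01 orbT.
exists s => //.
have mI k : measurable (`]s, s + k%:R[%classic : set (measurableTypeR R)) by exact: measurable_itv.
have mkI k : measurable_fun (`]s, s + k%:R[%classic : set (measurableTypeR R)) (sobolev_integrand n A).
  apply: measurable_funS (mk yA (ltW s0)) => //.
  by move=> x /=; rewrite !in_itv/= => /andP[->].
have cv := @ge0_nondecreasing_set_cvg_integral _ (measurableTypeR R) R (fun k : nat => `]s, s + k%:R[%classic) (sobolev_integrand n A) leb.
have U : \bigcup_k `]s, s + k%:R[%classic = `]s, +oo[%classic :> set R.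
  apply/seteqP; split => [x [k _ /=]|x /=]; rewrite !in_itv/= ?andbT; first by case/andP.
  move=> sx; exists (Num.bound (x - s)) => //=; rewrite in_itv/= sx -ltrBlDl.
  by apply: archi_boundP; rewrite subr_ge0 ltW.
apply: (@le_lt_trans _ _ M%:E); last exact: ltry.
have cv' : (\int[leb]_(x in `]s, (s + i%:R)%R[) sobolev_integrand n A x)%E @[i --> \oo] -->
   (\int[leb]_(x in `]s, +oo[) sobolev_integrand n A x)%E.
  rewrite -U; apply: cv => //; last by move=> k x _; exact: sobolev_integrand_ge0.
  move=> k l kl; apply/subsetPset => x /=; rewrite !in_itv/= => /andP[-> xs] /=.
  by apply: lt_le_trans xs _; rewrite lerD2l ler_nat.
rewrite -(cvg_lim _ cv')//; apply: lime_le; first by apply/cvg_ex; eexists; exact: cv'.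
apply: nearW => k; apply: (@le_trans _ _ (partial_sobolev n A 0 (s + k%:R))).
  apply: le_trans (partial_sobolev_split n2 yA (lexx 0) (ltW s0) (_ : s <= s + k%:R)); last first.
    by rewrite lerDl.
  by rewrite leeDr// partial_sobolev_ge0.
rewrite leNgt; apply/negP => MT; apply: h; exists (s + k%:R).
  by apply: ler_wpDr => //; rewrite le_max lexx.
rewrite -lee_fin fineK ?(ltW MT)// ge0_fin_numE// partial_sobolev_ge0//.
Qed.

Lemma partial_sobolev_mono (A : R -> \bar R) (l s t : R) : young_function A -> 0 <= l -> s <= t ->
  (partial_sobolev n A l s <= partial_sobolev n A l t)%E.
Proof.
move=> yA l0 st; apply: ge0_subset_integral => //; try exact: measurable_itv.
- apply: measurable_funS (mk yA l0) => //.
  by move=> x /=; rewrite !in_itv/= andbT => /andP[->].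
- by move=> x _; exact: sobolev_integrand_ge0.
- by move=> x /=; rewrite !in_itv/= => /andP[-> xs]; exact: lt_le_trans st.
Qed.

End sobolev_growth.

(** * Bounds on levels from the L^1 norm *)

Section level_bounds.
Context {R : realType} {m : nat}.
Notation LS := (lebesgue_space R m.+1).
Notation vol := (@volume R m.+1).
Variables (Om : set 'rV[R]_m.+1) (v : 'rV[R]_m.+1 -> R) (N : R).
Hypotheses (oOm : open Om) (Omlty : (vol Om < +oo)%E) (mv : measurable_fun (Om : set LS) v).
Hypotheses (N0 : 0 < N) (vN : (\int[vol]_(x in Om) `|v x|%:E <= N%:E)%E).
Let mOmL : measurable (Om : set LS).
Proof. by apply: measurable_lebesgue_space; exact: measurable_open_rV. Qed.
Let mS t : measurable (super_level Om v t : set LS).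
Proof.
have := measurable_fun_normr mv => /(_ mOmL `]t, +oo[%classic (measurable_itv _)); congr (measurable _).
by apply/seteqP; split => x [Omx] /=; rewrite in_itv/= andbT.
Qed.

Lemma super_level_chebyshev t : 0 < t -> (vol (super_level Om v t) <= (N / t)%:E)%E.
Proof.
move=> t0; rewrite mulrC EFinM.
have fS : vol (super_level Om v t) \is a fin_num.
  rewrite ge0_fin_numE//; apply: le_lt_trans Omlty.
  by apply: le_measure; rewrite ?inE//; move=> x [].
have : (t%:E * vol (super_level Om v t) <= N%:E)%E.
  apply: le_trans vN; rewrite -(integral_cst vol (mS t) t%:E).
  apply: (@le_trans _ _ (\int[vol]_(x in super_level Om v t) `|v x|%:E)%E).
    apply: ge0_le_integral; [exact: mS| | | |].
    - by move=> x _; rewrite lee_fin ltW.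
    - exact: measurable_cst.
    - apply/measurable_EFinP; apply: (measurable_funS mOmL); first by move=> x [].
      exact: measurable_fun_normr.
    - by move=> x [_ /= tx]; rewrite lee_fin ltW.
  apply: ge0_subset_integral; [exact: mS|exact: mOmL| | |].
  - by apply/measurable_EFinP; exact: measurable_fun_normr.
  - by move=> x _; rewrite lee_fin.
  - by move=> x [].
rewrite -(fineK fS) -!EFinM !lee_fin => h.
by rewrite mulrC ler_pdivlMr// mulrC.
Qed.

Lemma level_of_chebyshev s : 0 < s -> level_of Om v s <= N / s.
Proof.
move=> s0; have Ns : 0 < N / s by rewrite divr_gt0.
apply: level_of_le; first exact: ltW.
apply: le_trans (super_level_chebyshev Ns) _.
by rewrite lee_fin invf_div mulrC divfK// gt_eqF.
Qed.

End level_bounds.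

Lemma le0_halving (R : realType) (x : \bar R) (s : R) : 0 <= s ->
  (forall J, (x <= (s / 2 ^+ J)%:E)%E) -> (x <= 0)%E.
Proof.
move=> s0 xs; apply/lee_addgt0Pr => e e0; rewrite add0e.
apply: le_trans (xs (Num.bound (s / e))) _; rewrite lee_fin.
rewrite ler_pdivrMr ?exprn_gt0// mulrC -ler_pdivrMr//.
apply: le_trans (ltW (archi_boundP (divr_ge0 s0 (ltW e0)))) _.
by rewrite -natrX ler_nat ltnW// ltn_expl.
Qed.

Lemma ge0_integral_indic_scaled d (T : measurableType d) (R : realType)
    (mu : {measure set T -> \bar R}) (D S : set T) (a : R) : measurable D -> measurable S ->
  S `<=` D -> 0 <= a -> (\int[mu]_(x in D) (a * \1_S x)%:E = a%:E * mu S)%E.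
Proof.
move=> mD mS SD a0; under eq_integral do rewrite EFinM.
have mI : measurable_fun D (fun x => (\1_S x : R)%:E).
  by apply/measurable_EFinP; exact: measurable_indic.
have I0 x : D x -> (0 <= (\1_S x : R)%:E)%E by move=> _; rewrite lee_fin indicE.
rewrite (ge0_integralZl mu mD mI I0) ?lee_fin//.
by rewrite integral_indic// setIidl.
Qed.

(** * The control function built from the layers *)

Section layered_weight.
Context {R : realType} {m : nat}.
Notation LS := (lebesgue_space R m.+1).
Notation vol := (@volume R m.+1).
Variables (A A' B : R -> \bar R) (E : R -> R) (kappa t0 : R).
Hypotheses (m0 : (0 < m)%N) (yA : young_function A) (yA' : young_function A') (yB : young_function B).
Hypotheses (k0 : 0 < kappa) (t00 : 0 <= t0) (E0 : forall t, 0 <= t -> 0 <= E t)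
  (Emono : forall s t, 0 <= s -> s <= t -> E s <= E t).
Hypothesis finI : forall s, (partial_sobolev m.+1 A' 0 s < +oo)%E.
Hypothesis hB : forall t, t0 <= t -> (B (t * E (sobolev_H m.+1 A' t))%R <= A t)%E.
Hypothesis Afin : forall t, 0 <= t -> (A t < +oo)%E.

Let n2 : (2 <= m.+1)%N. Proof. exact: m0. Qed.
Let I (t : R) := fine (partial_sobolev m.+1 A' 0 t).
Let q : R := m.+1%:R^-1.
Let q' : R := (@conjugate_exponent R m.+1)^-1.
Let I0 t : 0 <= I t. Proof. by rewrite fine_ge0// partial_sobolev_ge0. Qed.
Let q'0 : 0 <= q'.
Proof. by rewrite invr_ge0 divr_ge0// subr_ge0 ler1n. Qed.

Let Imono s t : s <= t -> I s <= I t.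
Proof.
move=> st; apply: fine_le; [|  |exact: partial_sobolev_mono].
- by rewrite ge0_fin_numE ?partial_sobolev_ge0.
- by rewrite ge0_fin_numE ?partial_sobolev_ge0.
Qed.

Lemma sobolev_H_mono s t : s <= t -> sobolev_H m.+1 A' s <= sobolev_H m.+1 A' t.
Proof. by move=> st; apply: ge0_ler_powR; rewrite ?nnegrE//; [exact: I0|exact: I0|exact: Imono]. Qed.

Lemma sobolev_H_ge0 t : 0 <= sobolev_H m.+1 A' t. Proof. exact: powR_ge0. Qed.

(** The growth condition is used at the larger of [s] and beta: if s <= beta, then E(kappa t) s <=
    beta E(H(beta)); otherwise kappa t <= H(beta) <= H(s). *)
Lemma weight_estimate (beta t s : R) : t0 <= beta -> 0 <= t ->
  kappa * t <= sobolev_H m.+1 A' beta -> 0 <= s -> (B (E (kappa * t) * s)%R <= A beta + A s)%E.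
Proof.
move=> tb tt kt s0; have b0 : 0 <= beta by exact: le_trans tb.
have kt0 : 0 <= kappa * t by rewrite mulr_ge0// ltW.
have Hb0 := sobolev_H_ge0 beta.
have [sb|bs] := leP s beta.
  apply: (@le_trans _ _ (A beta)); last by rewrite leeDl// young_ge0.
  apply: le_trans (hB tb); apply: young_nd => //; first by rewrite mulr_ge0// E0.
  by rewrite mulrC; apply: ler_pM => //; [exact: E0|exact: Emono].
apply: (@le_trans _ _ (A s)); last by rewrite leeDr// young_ge0.
apply: le_trans (hB (le_trans tb (ltW bs))); apply: young_nd => //; first by rewrite mulr_ge0// E0.
rewrite mulrC; apply: ler_wpM2l; first exact: s0.
apply: Emono; first exact: kt0.
by apply: le_trans kt _; apply: sobolev_H_mono; exact: ltW.
Qed.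

Section single.
Variables (Om : set 'rV[R]_m.+1) (v : 'rV[R]_m.+1 -> R) (g : 'rV[R]_m.+1 -> 'rV[R]_m.+1).
Hypotheses (oOm : open Om) (Omlty : (vol Om < +oo)%E) (wg : is_weak_gradient Om v g).
Hypothesis ig : vol.-integrable Om (EFin \o length_fun g).
Variable c : R.
Hypotheses (c0 : 0 < c) (iso : forall G, measurable (G : set LS) -> G `<=` Om ->
      (c%:E * poweR (mine (vol G) (vol (Om `\` G)))
                (conjugate_exponent m.+1)^-1 <= perimeter G Om)%E).
Variables (La cp tau s eps T0 T N : R).
Hypotheses (La0 : 0 < La) (cp1 : 1 <= cp) (tau0 : 0 < tau) (s0 : 0 < s) (eps0 : 0 < eps) (N0 : 0 < N).
Hypotheses (A'tau : (0 < A' tau)%E) (s2 : 2 * s <= fine (vol Om)).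
Hypothesis AA' : forall t, tau <= t -> (A' t <= A (cp * t)%R)%E.
Hypothesis Aeps : (\int[vol]_(x in super_level Om v (level_of Om v s))
   A (length_fun g x / La)%R <= eps%:E)%E.
Hypothesis vN : (\int[vol]_(x in Om) `|v x|%:E <= N%:E)%E.
Let C0 := 4 / c * La * cp * (1 - 2^-1 `^ q)^-1.
Hypotheses (NT : N / s <= T) (tT0 : t0 <= T0).
Hypotheses (hT0 : kappa * (N / s + C0 * (tau * s `^ q)) <= sobolev_H m.+1 A' T0 / 2)
  (heps : kappa * (C0 * eps `^ q) <= 2^-1).

Let mOmL : measurable (Om : set LS).
Proof. by apply: measurable_lebesgue_space; exact: measurable_open_rV. Qed.
Let mv : measurable_fun (Om : set LS) v. Proof. by have [[]] := wg. Qed.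
Let mS t : measurable (super_level Om v t : set LS). Proof. exact: (measurable_super_level oOm wg). Qed.
Let T_gt0 : 0 < T. Proof. by apply: lt_le_trans NT; rewrite divr_gt0. Qed.

Let Ige p b : tau <= p -> p <= b -> (A' b < +oo)%E ->
  (b - p) * (b / fine (A' b)) `^ (m.+1%:R - 1)^-1 <= I b - I p.
Proof.
move=> tp pb Ab; apply: (partial_sobolev_increment n2 yA') => //.
- by apply: le_trans tp; exact: ltW.
- exact: lt_le_trans tp.
- by apply: lt_le_trans A'tau _; apply: young_nd => //; exact: ltW.
Qed.

(** Q is A(T0) on {|v| > T} plus the sum of A(b_(j+1)) over the layers with |v| > t_j. When t_j <
    |v| <= t_(j+1), [hT0] bounds the fixed part of kappa |v| by H(T0)/2 and [heps] the other part by
    H(b_(j+1))/2, so [weight_estimate] applies with beta = max(T0, b_(j+1)). *)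
Lemma layered_weight : exists Q : 'rV[R]_m.+1 -> \bar R,
  [/\ measurable_fun (Om : set LS) Q, forall x, Om x -> (0 <= Q x)%E,
    (\int[vol]_(x in Om) Q x <= (fine (A T0) * (N / T) + (2 * s * fine (A tau) + 2 * eps))%:E)%E &
    {ae vol, forall x, Om x -> T < `|v x| -> forall r, 0 <= r ->
      (B (E (kappa * `|v x|) * r)%R <= Q x + A r)%E}].
Proof.
have FF := ae_filter_ringOfSetsType vol.
have [t [b [[t0E tS] St [tb bS] tJ sumE]]] :=
  layers m0 oOm Omlty wg ig c0 iso yA yA' La0 cp1 tau0 s0 eps0 A'tau s2 AA' Aeps I0 Ige.
have {}sumE := sumE (Afin (ltW tau0)).
have b0 j : 0 <= b j by apply: le_trans (tb j); exact: ltW.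
have fA r : 0 <= r -> A r \is a fin_num by move=> r0; rewrite ge0_fin_numE ?Afin// young_ge0.
have A0 r : 0 <= r -> 0 <= fine (A r) by move=> r0; rewrite fine_ge0// young_ge0.
have T00 : 0 <= T0 by exact: le_trans tT0.
pose Q0 x := (fine (A T0) * \1_(super_level Om v T) x)%:E.
pose Q1 j x := (fine (A (b j.+1)) * \1_(super_level Om v (t j)) x)%:E.
have mQ0 : measurable_fun (Om : set LS) Q0.
  apply/measurable_EFinP; apply: measurable_funM; first exact: measurable_cst.
  by apply: measurable_funTS; exact: measurable_indic.
have mQ1 j : measurable_fun (Om : set LS) (Q1 j).
  apply/measurable_EFinP; apply: measurable_funM; first exact: measurable_cst.
  by apply: measurable_funTS; exact: measurable_indic.
have Q00 x : Om x -> (0 <= Q0 x)%E by move=> _; rewrite lee_fin mulr_ge0 ?A0// indicE.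
have Q10 j x : Om x -> (0 <= Q1 j x)%E by move=> _; rewrite lee_fin mulr_ge0 ?A0// indicE.
have mQs : measurable_fun (Om : set LS) (fun x => \sum_(0 <= j <oo) Q1 j x)%E.
  by apply: ge0_emeasurable_sum => // j x Omx _; exact: Q10.
have Qs0 x : Om x -> (0 <= \sum_(0 <= j <oo) Q1 j x)%E.
  by move=> Omx; apply: nneseries_ge0 => j _ _; exact: Q10.
exists (fun x => Q0 x + \sum_(0 <= j <oo) Q1 j x)%E; split.
- exact: emeasurable_funD.
- by move=> x Omx; rewrite adde_ge0 ?Q00 ?Qs0.
- rewrite (ge0_integralD vol mOmL Q00 mQ0 Qs0 mQs) EFinD; apply: leeD.
    rewrite /Q0 (ge0_integral_indic_scaled vol mOmL (mS T) (@subIsetl _ _ _) (A0 _ T00)) EFinM.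
    apply: lee_wpmul2l; first by rewrite lee_fin A0.
    exact: super_level_chebyshev.
  rewrite (integral_nneseries vol mOmL mQ1 Q10); apply: lime_le.
    by apply: is_cvg_nneseries => j _ _; apply: integral_ge0; exact: Q10.
  apply: nearW => J; rewrite big_mkord EFinD.
  apply: (@le_trans _ _ ((2 * s)%:E * A tau + (2 * eps)%:E)%E); last first.
    by rewrite (EFinM (2 * s)) fineK//; exact: (fA _ (ltW tau0)).
  apply: le_trans (sumE J); apply: lee_sum => j _.
  rewrite /Q1 (ge0_integral_indic_scaled vol mOmL (mS (t j)) (@subIsetl _ _ _) (A0 _ (b0 _))).
  rewrite fineK ?fA// muleC; apply: lee_wpmul2r; first by rewrite young_ge0.
  exact: St.
(* The superlevel sets at t_j have measure at most s / 2^j, so almost every point lies below some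
   t_j. *)
have nul : {ae vol, forall x, Om x -> exists j, `|v x| <= t j}.
  exists (\bigcap_j super_level Om v (t j)); split.
  - by apply: bigcap_measurable => // j _; exact: mS.
  - apply/eqP; rewrite eq_le measure_ge0 andbT; apply: (le0_halving (ltW s0)) => J.
    apply: le_trans (St J); apply: le_measure; rewrite ?inE; last by move=> x; apply.
    + by apply: bigcap_measurable => // j _; exact: mS.
    + exact: mS.
  - move=> x /not_implyP[Omx /forallNP nj] j _; split => //=.
    by rewrite ltNge; apply/negP; exact: nj.
apply: filterS nul => x exj Omx Tx r r0.
have [Pj|] := pselect (exists j, `|v x| <= t j); last by move=> /(_ (exj Omx)).
have tT : t 0%N <= T.
  by rewrite t0E; apply: le_trans NT; exact: (level_of_chebyshev oOm Omlty mv N0 vN s0).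
(* The least index with |v x| <= t_j is not 0, because t_0 <= N / s <= T < |v x|; its predecessor is
   [j]. *)
have [j /andP[tj tj1]] : exists j, t j < `|v x| <= t j.+1.
  case: (ex_minnP Pj) => -[|j] hj minj.
    by move: (lt_le_trans Tx (le_trans hj tT)); rewrite ltxx.
  by exists j; rewrite hj andbT ltNge; apply/negP => /minj; rewrite ltnn.
pose beta := Num.max T0 (b j.+1).
have key : kappa * `|v x| <= sobolev_H m.+1 A' beta.
  apply: (@le_trans _ _ (sobolev_H m.+1 A' T0 / 2 + sobolev_H m.+1 A' (b j.+1) / 2)).
    apply: (@le_trans _ _ (kappa * (N / s + C0 * (tau * s `^ q)) + kappa * (C0 * eps `^ q) * sobolev_H m.+1 A' (b j.+1))).
      rewrite -mulrA -mulrDr; apply: ler_wpM2l; first exact: ltW.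
      apply: le_trans tj1 _; apply: le_trans (tJ j.+1) _.
      rewrite -addrA; apply: lerD; first by rewrite t0E; exact: (level_of_chebyshev oOm Omlty mv N0 vN s0).
      by rewrite -(mulrA C0) -mulrDr.
    apply: lerD; first exact: hT0.
    by rewrite [leRHS]mulrC; exact: (ler_wpM2r (sobolev_H_ge0 _) heps).
  have h1 : sobolev_H m.+1 A' T0 <= sobolev_H m.+1 A' beta by apply: sobolev_H_mono; rewrite le_max lexx.
  have h2 : sobolev_H m.+1 A' (b j.+1) <= sobolev_H m.+1 A' beta by apply: sobolev_H_mono; rewrite le_max lexx orbT.
  have i2 : (0 : R) <= 2^-1 by rewrite invr_ge0.
  apply: le_trans (lerD (ler_wpM2r i2 h1) (ler_wpM2r i2 h2)) _.
  rewrite -splitr; exact: lexx.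
have tbeta : t0 <= beta by rewrite le_max tT0.
apply: le_trans (weight_estimate tbeta (normr_ge0 _) key r0) _; apply: leeD => //.
apply: le_trans (young_max yA T00 (b0 _)) _; apply: leeD.
  by rewrite /Q0 indicE mem_set ?mulr1 ?fineK ?fA.
apply: le_trans (_ : (Q1 j x <= _)%E).
  by rewrite /Q1 indicE mem_set ?mulr1 ?fineK ?fA.
have := @nneseries_lim_ge R (fun j => Q1 j x) xpredT 0%N j.+1 (fun k _ _ => Q10 k x Omx).
apply: le_trans; rewrite big_nat_recr//= leeDr// sume_ge0// => k _; exact: Q10.
Qed.

End single.
End layered_weight.

(** * Uniformly small energy on small sets *)

Section uniform_energy.
Context {R : realType} {m : nat}.
Notation LS := (lebesgue_space R m.+1).
Notation vol := (@volume R m.+1).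
Variables (A : R -> \bar R) (Om : set 'rV[R]_m.+1).
Hypotheses (oOm : open Om) (Omlty : (vol Om < +oo)%E) (yA : young_function A)
  (nA : nondegenerate_young A).
Variables (u_ : nat -> 'rV[R]_m.+1 -> R) (u : 'rV[R]_m.+1 -> R) (l L : R).
Hypotheses (Wu_ : forall k, orlicz_sobolev A Om (u_ k)) (Wu : orlicz_sobolev A Om u).
Hypotheses (l0 : 0 < l) (lL : l <= L) (ucv : sobolev_modular_cvg A Om u_ u l).

Let mOmL : measurable (Om : set LS).
Proof. by apply: measurable_lebesgue_space; exact: measurable_open_rV. Qed.
Let L0 : 0 < L. Proof. exact: lt_le_trans lL. Qed.
Let g := weak_gradient Om u.
Let g_ k := weak_gradient Om (u_ k).

(** The scale is 2 L rather than [L]: the gradient of u_k is a difference plus grad u, and midpoint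
    convexity splits the two at scale [L]. *)
Definition energy_bound (v : 'rV[R]_m.+1 -> R) (N eps sl : R) :=
  (\int[vol]_(x in Om) `|v x|%:E <= N%:E)%E /\
  forall S, measurable (S : set LS) -> S `<=` Om -> (vol S < sl%:E)%E ->
    (\int[vol]_(x in S) A (length_fun (weak_gradient Om v) x / (2 * L))%R <= eps%:E)%E.

Let mu_ k : measurable_fun (Om : set LS) (u_ k). Proof. by have [_ []] := Wu_ k. Qed.
Let mu : measurable_fun (Om : set LS) u. Proof. by have [_ []] := Wu. Qed.
Let mg_ k i : measurable_fun (Om : set LS) (fun x => g_ k x ord0 i).
Proof. by have [_ _ []] := Wu_ k. Qed.
Let mg i : measurable_fun (Om : set LS) (fun x => g x ord0 i).
Proof. by have [_ _ []] := Wu. Qed.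
Let mud k : measurable_fun (Om : set LS) (abs_fun (u_ k \- u)).
Proof. by apply: measurable_abs_fun; exact: (measurable_funB (mu_ k) mu). Qed.
Let mgd k : measurable_fun (Om : set LS) (length_fun (g_ k \- g)).
Proof.
apply: measurable_length_fun => i.
rewrite (_ : (fun x => _) = (fun x => g_ k x ord0 i - g x ord0 i)).
  exact: (measurable_funB (mg_ k i) (mg i)).
by apply/funext => x; rewrite !mxE.
Qed.

Lemma energy_bound_sequence (eps sl : R) : 0 < eps ->
  (forall S, measurable (S : set LS) -> S `<=` Om -> (vol S < sl%:E)%E ->
    (\int[vol]_(x in S) A (length_fun g x / L)%R <= eps%:E)%E) ->
  exists N : R, exists K : nat, [/\ 0 < N, energy_bound u N (2 * eps) sl &
    forall k, (K <= k)%N -> energy_bound (u_ k) N (2 * eps) sl].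
Proof.
move=> eps0 Heps.
have [_ iu _] := orlicz_sobolevP oOm Omlty yA Wu.
have fu : (\int[vol]_(x in Om) `|u x|%:E)%E \is a fin_num.
  exact: (integrable_fin_num mOmL (integrable_abse iu)).
have u0 : (0 <= \int[vol]_(x in Om) `|u x|%:E)%E by apply: integral_ge0 => x _; rewrite lee_fin.
pose N := fine (\int[vol]_(x in Om) `|u x|%:E) + 1.
have p1 k : (0 <= \int[vol]_(x in Om) (abs_fun (u_ k \- u)%R x)%:E)%E.
  by apply: integral_ge0 => x _; rewrite lee_fin abs_fun_ge0.
have p2 k : (0 <= modular A Om (length_fun (g_ k \- g)%R) l)%E.
  by apply: integral_ge0 => x _; apply: (young_ge0 yA); exact: (divr_ge0 (length_fun_ge0 _ _) (ltW l0)).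
have cvu := modular_cvg_integral yA mOmL Omlty nA mud (fun k x => abs_fun_ge0 _ x) l0 ucv.1.
have [K1 K1P] := (ereal_cvg0P p1).1 cvu 1 ltr01.
have [K2 K2P] := (ereal_cvg0P p2).1 ucv.2 eps eps0.
exists N, (maxn K1 K2); split; first by rewrite ltr_wpDl// fine_ge0.
  split; first by rewrite -(fineK fu) lee_fin lerDl.
  move=> S mS SOm Ssl; apply: (@le_trans _ _ eps%:E); last by rewrite lee_fin; lra.
  apply: le_trans (Heps S mS SOm Ssl).
  have mgS : measurable_fun (S : set LS) (length_fun g).
    exact: (measurable_funS mOmL SOm (measurable_length_fun mg)).
  have L20 : 0 < 2 * L by rewrite mulr_gt0.
  apply: ge0_le_integral; [exact: mS| | | |].
  - by move=> x _; apply: (young_ge0 yA); exact: (divr_ge0 (length_fun_ge0 _ _) (ltW L20)).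
  - exact: (measurable_young_comp yA mgS (length_fun_ge0 _) L20).
  - exact: (measurable_young_comp yA mgS (length_fun_ge0 _) L0).
  - move=> x _; apply: (young_nd yA); first exact: (divr_ge0 (length_fun_ge0 _ _) (ltW L20)).
    apply: ler_wpM2l; first exact: length_fun_ge0.
    by rewrite lef_pV2 ?posrE// ler_peMl ?ler1n// ltW.
move=> k kK; have kK1 : (K1 <= k)%N by apply: leq_trans kK; exact: leq_maxl.
have kK2 : (K2 <= k)%N by apply: leq_trans kK; exact: leq_maxr.
split.
  apply: (@le_trans _ _ (\int[vol]_(x in Om) (`|u x|%:E + (abs_fun (u_ k \- u)%R x)%:E))%E).
    apply: ge0_le_integral; [exact: mOmL| | | |].
    - by move=> x _; rewrite lee_fin.
    - by apply/measurable_EFinP; exact: (measurable_fun_normr (mu_ k)).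
    - apply: emeasurable_funD; apply/measurable_EFinP; [exact: (measurable_fun_normr mu)|exact: mud].
    - move=> x _; rewrite -EFinD lee_fin /abs_fun /=.
      by rewrite -{1}(subrK (u x) (u_ k x)) addrC; exact: ler_normD.
  rewrite (ge0_integralD vol mOmL); last 4 first.
  - by move=> x _; rewrite lee_fin.
  - by apply/measurable_EFinP; exact: (measurable_fun_normr mu).
  - by move=> x _; rewrite lee_fin abs_fun_ge0.
  - by apply/measurable_EFinP; exact: mud.
  by rewrite /N EFinD fineK//; apply: leeD => //; exact: K1P.
move=> S mS SOm Ssl.
have mgS : measurable_fun (S : set LS) (length_fun g).
  exact: (measurable_funS mOmL SOm (measurable_length_fun mg)).
have mgkS : measurable_fun (S : set LS) (length_fun (g_ k)).
  exact: (measurable_funS mOmL SOm (measurable_length_fun (mg_ k))).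
have mgdS : measurable_fun (S : set LS) (length_fun (g_ k \- g)).
  by apply: (measurable_funS mOmL SOm); exact: mgd.
have L20 : 0 < 2 * L by rewrite mulr_gt0.
have q1 x : S x -> (0 <= A (length_fun (g_ k \- g)%R x / L)%R)%E.
  by move=> _; apply: (young_ge0 yA); exact: (divr_ge0 (length_fun_ge0 _ _) (ltW L0)).
have q2 x : S x -> (0 <= A (length_fun g x / L)%R)%E.
  by move=> _; apply: (young_ge0 yA); exact: (divr_ge0 (length_fun_ge0 _ _) (ltW L0)).
have n1 := measurable_young_comp yA mgdS (length_fun_ge0 _) L0.
have n2 := measurable_young_comp yA mgS (length_fun_ge0 _) L0.
apply: (@le_trans _ _ (\int[vol]_(x in S) (A (length_fun (g_ k \- g)%R x / L)%R + A (length_fun g x / L)%R))%E).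
  apply: ge0_le_integral; [exact: mS| | | |].
  - by move=> x _; apply: (young_ge0 yA); exact: (divr_ge0 (length_fun_ge0 _ _) (ltW L20)).
  - exact: (measurable_young_comp yA mgkS (length_fun_ge0 _) L20).
  - exact: emeasurable_funD n1 n2.
  - move=> x _; apply: le_trans (young_add yA (divr_ge0 (length_fun_ge0 _ _) (ltW L0)) (divr_ge0 (length_fun_ge0 _ _) (ltW L0))).
    apply: (young_nd yA); first exact: (divr_ge0 (length_fun_ge0 _ _) (ltW L20)).
    rewrite -mulrDl -mulrA -invfM (mulrC L); apply: ler_wpM2r; first by rewrite invr_ge0 ltW.
    rewrite /length_fun /=; apply: le_trans (euclidean_normD _ _).
    by rewrite /g_ /g subrK.
rewrite (ge0_integralD vol mS q1 n1 q2 n2) (_ : 2 * eps = eps + eps); last by ring.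
rewrite EFinD; apply: leeD; last exact: Heps.
apply: le_trans (K2P k kK2).
apply: (@le_trans _ _ (\int[vol]_(x in Om) A (length_fun (g_ k \- g)%R x / L)%R)%E).
  apply: ge0_subset_integral; [exact: mS|exact: mOmL| | |exact: SOm].
  - exact: (measurable_young_comp yA (mgd k) (length_fun_ge0 _) L0).
  - by move=> x _; apply: (young_ge0 yA); exact: (divr_ge0 (length_fun_ge0 _ _) (ltW L0)).
apply: ge0_le_integral; [exact: mOmL| | | |].
- by move=> x _; apply: (young_ge0 yA); exact: (divr_ge0 (length_fun_ge0 _ _) (ltW L0)).
- exact: (measurable_young_comp yA (mgd k) (length_fun_ge0 _) L0).
- exact: (measurable_young_comp yA (mgd k) (length_fun_ge0 _) l0).
- move=> x _; apply: (young_nd yA); first exact: (divr_ge0 (length_fun_ge0 _ _) (ltW L0)).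
  by apply: ler_wpM2l; [exact: length_fun_ge0|rewrite lef_pV2].
Qed.

End uniform_energy.

Section constant_sequence.
Context {R : realType} {n : nat}.
Variables (A : R -> \bar R) (Om : set 'rV[R]_n) (yA : young_function A).

(** A constant sequence converges, so statements about sequences also yield the mapping
    properties. *)
Lemma sobolev_modular_cvg_cst u (l : R) : sobolev_modular_cvg A Om (fun=> u) u l.
Proof.
have z (w : 'rV[R]_n -> R) : (forall x, w x = 0) -> modular A Om w l = 0%E.
  by move=> w0; apply: integral0_eq => x _; rewrite w0 mul0r young0.
split.
  rewrite (_ : (fun k => _) = cst 0%E); first exact: cvg_cst.
  by apply/funext => k /=; apply: z => x; rewrite /abs_fun /= subrr normr0.
rewrite (_ : (fun k => _) = cst 0%E); first exact: cvg_cst.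
apply/funext => k /=; apply: z => x; rewrite /length_fun /= subrr.
by rewrite /euclidean_norm big1 ?sqrtr0// => i _; rewrite mxE expr0n.
Qed.

End constant_sequence.

(** * Bounds along modularly convergent sequences *)

Section controlled_cases.
Context {R : realType} {m : nat}.
Notation LS := (lebesgue_space R m.+1).
Notation vol := (@volume R m.+1).
Variables (A : R -> \bar R) (Om : set 'rV[R]_m.+1).
Hypotheses (m0 : (0 < m)%N) (oOm : open Om) (Omlty : (vol Om < +oo)%E) (yA : young_function A)
  (nA : nondegenerate_young A).
Variable c : R.
Hypotheses (c0 : 0 < c) (iso : forall G, measurable (G : set LS) -> G `<=` Om ->
      (c%:E * poweR (mine (vol G) (vol (Om `\` G)))
                (conjugate_exponent m.+1)^-1 <= perimeter G Om)%E).

Let mOmL : measurable (Om : set LS).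
Proof. by apply: measurable_lebesgue_space; exact: measurable_open_rV. Qed.
Let n2 : (2 <= m.+1)%N. Proof. exact: m0. Qed.
Let q : R := m.+1%:R^-1.
Let q0 : 0 < q. Proof. by rewrite invr_gt0. Qed.

Let rho_lt1 : (2^-1 : R) `^ q < 1.
Proof.
rewrite [X in _ < X](_ : 1 = 1 `^ q); last by rewrite powR1.
apply: gt0_ltr_powR => //; rewrite ?nnegrE//.
by rewrite invf_lt1// ltr1n.
Qed.

Lemma controlled_null (B : R -> \bar R) (W : R -> R) (v : 'rV[R]_m.+1 -> R) (C e : R) :
  vol Om = 0%E -> 0 <= e -> controlled A B W Om v C e.
Proof.
move=> Om0 e0; exists (cst 0%E); split => //; first by rewrite integral0 lee_fin.
by exists Om; split => // x /not_implyP[].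
Qed.

Section growth.
Variables (A' B : R -> \bar R) (E : R -> R) (kappa t0 cp tau : R).
Hypotheses (yA' : young_function A') (yB : young_function B).
Hypotheses (k0 : 0 < kappa) (t00 : 0 <= t0) (E0 : forall t, 0 <= t -> 0 <= E t)
  (Emono : forall s t, 0 <= s -> s <= t -> E s <= E t).
Hypothesis finI : forall s, (partial_sobolev m.+1 A' 0 s < +oo)%E.
Hypothesis hB : forall t, t0 <= t -> (B (t * E (sobolev_H m.+1 A' t))%R <= A t)%E.
Hypothesis Afin : forall t, 0 <= t -> (A t < +oo)%E.
Hypotheses (cp1 : 1 <= cp) (tau0 : 0 < tau) (A'tau : (0 < A' tau)%E).
Hypothesis AA' : forall t, tau <= t -> (A' t <= A (cp * t)%R)%E.
Hypothesis Hunbounded : forall M T0 : R, exists2 T, T0 <= T & M <= sobolev_H m.+1 A' T.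

Let W t := E (kappa * t).

Let controlled_of_energy (v : 'rV[R]_m.+1 -> R) (L N eps sl s T0 T T1 e : R) :
  orlicz_sobolev A Om v -> 0 < L -> 0 < N -> 0 < eps ->
  energy_bound A Om L v N eps sl -> 0 < s -> s < sl -> 2 * s <= fine (vol Om) ->
  N / s <= T -> t0 <= T0 ->
  kappa * (N / s + 4 / c * (2 * L) * cp * (1 - 2^-1 `^ q)^-1 * (tau * s `^ q)) <= sobolev_H m.+1 A' T0 / 2 ->
  kappa * (4 / c * (2 * L) * cp * (1 - 2^-1 `^ q)^-1 * eps `^ q) <= 2^-1 ->
  t0 <= T1 -> kappa * T <= sobolev_H m.+1 A' T1 ->
  fine (A T0) * (N / T) + (2 * s * fine (A tau) + 2 * eps) <= e ->
  controlled A B W Om v (fine (A T1)) e.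
Proof.
move=> Wv L0 N0 eps0 [vN en] s0 ssl s2 NT tT0 hT0 heps tT1 hT1 he.
have FF := ae_filter_ringOfSetsType vol.
have [wg iv ig] := orlicz_sobolevP oOm Omlty yA Wv.
have mv : measurable_fun (Om : set LS) v by have [_ []] := Wv.
have L20 : 0 < 2 * L by rewrite mulr_gt0.
have Aeps : (\int[vol]_(x in super_level Om v (level_of Om v s))
   A (length_fun (weak_gradient Om v) x / (2 * L))%R <= eps%:E)%E.
  apply: en; [exact: (measurable_super_level oOm wg)|by move=> x []|].
  by apply: le_lt_trans (super_level_of mOmL Omlty mv s0) _; rewrite lte_fin.
have [Q [mQ Q0 Qe QB]] := layered_weight m0 yA yA' yB k0 t00 E0 Emono finI hB Afin oOm Omlty wg ig
  c0 iso L20 cp1 tau0 s0 eps0 N0 A'tau s2 AA' Aeps vN NT tT0 hT0 heps.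
have T10 : 0 <= T1 by exact: le_trans tT1.
have fA : A T1 \is a fin_num by rewrite ge0_fin_numE ?Afin// young_ge0.
exists Q; split; [exact: mQ|exact: Q0|by apply: le_trans Qe _; rewrite lee_fin|].
apply: filterS QB => x QBx Omx r r0; rewrite fineK//.
have [Tx|xT] := ltP T `|v x|.
  apply: le_trans (QBx Omx Tx r r0) _; apply: leeD => //.
  by rewrite leeDr// young_ge0.
have kx : kappa * `|v x| <= sobolev_H m.+1 A' T1.
  by apply: le_trans hT1; apply: ler_wpM2l => //; exact: ltW.
apply: le_trans (weight_estimate m0 yA yA' yB k0 t00 E0 Emono finI hB tT1 (normr_ge0 _) kx r0) _.
by apply: leeD => //; rewrite leeDl// Q0.
Qed.

(** The parameters are fixed in an order where each depends only on earlier ones: eps, the threshold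
    [dl], the bound [N], the measure [s], the level T0, the truncation [T], and T1 with C = A(T1).
    The first terms of the energy budget are e/4 and e/4, and 2 eps adds at most e/4. *)
Lemma growth_controlled (u_ : nat -> 'rV[R]_m.+1 -> R) (u : 'rV[R]_m.+1 -> R) (l L : R) :
  (forall k, orlicz_sobolev A Om (u_ k)) -> orlicz_sobolev A Om u ->
  0 < l -> l <= L -> sobolev_modular_cvg A Om u_ u l ->
  (modular A Om (length_fun (weak_gradient Om u)) L < +oo)%E ->
  forall e : R, 0 < e -> exists C : R, exists K : nat, [/\ 0 <= C,
     controlled A B W Om u C e & forall k, (K <= k)%N -> controlled A B W Om (u_ k) C e].
Proof.
move=> Wu_ Wu l0 lL ucv gL e e0.
have [V0|Vn] := eqVneq (vol Om) 0%E.
  by exists 0, 0%N; split => // [|k _]; apply: controlled_null => //; exact: ltW.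
have L0 : 0 < L by exact: lt_le_trans lL.
have V_gt0 : 0 < fine (vol Om).
  by rewrite fine_gt0// Omlty andbT lt_neqAle eq_sym Vn measure_ge0.
set V := fine (vol Om) in V_gt0.
set C0 := 4 / c * (2 * L) * cp * (1 - 2^-1 `^ q)^-1.
have C00 : 0 < C0.
  have cp0 : 0 < cp by exact: lt_le_trans cp1.
  by rewrite /C0 ?mulr_gt0 ?invr_gt0 ?subr_gt0 ?rho_lt1.
have kC : 0 < kappa * C0 by exact: mulr_gt0.
have d0 : 0 < (2 * (kappa * C0))^-1 by rewrite invr_gt0; exact: mulr_gt0.
(* The power m+1 inverts [^ q], so that kappa C0 eps^q <= 1/2. *)
pose eps := Num.min (e / 8) ((2 * (kappa * C0))^-1 ^+ m.+1).
have eps0 : 0 < eps by rewrite lt_min divr_gt0// exprn_gt0.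
have epsq : eps `^ q <= (2 * (kappa * C0))^-1.
  apply: (@le_trans _ _ (((2 * (kappa * C0))^-1 ^+ m.+1) `^ q)).
    apply: ge0_ler_powR; rewrite ?nnegrE ?(ltW eps0) ?(ltW q0)// ?exprn_ge0 ?(ltW d0)//.
    by rewrite ge_min lexx orbT.
  rewrite -powR_mulrn ?(ltW d0)// -powRrM /q mulfV ?pnatr_eq0// powRr1; first exact: lexx.
  exact: ltW.
have heps : kappa * (C0 * eps `^ q) <= 2^-1.
  rewrite mulrA mulrC -ler_pdivlMr; last exact: kC.
  by apply: le_trans epsq _; rewrite invfM.
have mg : measurable_fun (Om : set LS) (length_fun (weak_gradient Om u)).
  by apply: measurable_length_fun => i; have [_ _ []] := Wu.
have [dl dl0 Hdl] := integral_absolutely_continuous mOmL (measurable_young_comp yA mg (length_fun_ge0 _) L0)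
  (fun x _ => young_ge0 yA (divr_ge0 (length_fun_ge0 _ _) (ltW L0))) gL (divr_gt0 eps0 (ltr0Sn R 1)).
have [N [K [N0 enu en_]]] := energy_bound_sequence oOm Omlty yA nA Wu_ Wu l0 lL ucv
  (divr_gt0 eps0 (ltr0Sn R 1)) Hdl.
have e2 : 2 * (eps / 2) = eps by rewrite mulrC divfK.
rewrite e2 in enu en_.
have At0 : 0 <= fine (A tau) by rewrite fine_ge0// young_ge0// ltW.
have At1 : 0 < fine (A tau) + 1 by rewrite ltr_wpDl.
(* The three entries ensure 2 s <= vol Om, the smallness of the energy on sets of measure [s], and 2
   s A(tau) <= e/4. *)
pose s := Num.min (V / 2) (Num.min (dl / 2) (e / 8 / (fine (A tau) + 1))).
have s0 : 0 < s by rewrite !lt_min !divr_gt0.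
have sV : 2 * s <= V.
  by rewrite mulrC -ler_pdivlMr// ge_min lexx.
have sdl : s < dl.
  apply: (@le_lt_trans _ _ (dl / 2)); first by rewrite !ge_min lexx orbT.
  by rewrite ltr_pdivrMr// ltr_pMr// ltr1n.
have sA : 2 * s * fine (A tau) <= e / 4.
  have h1 : s <= e / 8 / (fine (A tau) + 1) by rewrite !ge_min lexx !orbT.
  rewrite -mulrA; apply: (@le_trans _ _ (2 * (e / 8))); last by rewrite le_eqVlt; apply/orP; left; apply/eqP; field.
  apply: ler_wpM2l => //; apply: (@le_trans _ _ (s * (fine (A tau) + 1))).
    by apply: ler_wpM2l; [exact: ltW|rewrite lerDl].
  by rewrite -ler_pdivlMr.
have [T0 tT0 hT0] := Hunbounded (2 * (kappa * (N / s + C0 * (tau * s `^ q)))) t0.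
have T00 : 0 <= T0 by exact: le_trans tT0.
have AT0 : 0 <= fine (A T0) by rewrite fine_ge0// young_ge0.
(* The second entry gives A(T0) N / T <= e/4 by Chebyshev; T0 is already fixed. *)
pose T := Num.max (N / s) (4 * fine (A T0) * N / e).
have NT : N / s <= T by rewrite le_max lexx.
have T_gt0 : 0 < T by apply: lt_le_trans NT; rewrite divr_gt0.
have hT : fine (A T0) * (N / T) <= e / 4.
  rewrite mulrA ler_pdivrMr//; apply: (@le_trans _ _ (e / 4 * (4 * fine (A T0) * N / e))).
    by rewrite le_eqVlt; apply/orP; left; apply/eqP; field; rewrite gt_eqF.
  by apply: ler_wpM2l; [rewrite divr_ge0// ltW|rewrite le_max lexx orbT].
(* Where |v| <= T the weight is bounded through H(T1), at the cost of the constant A(T1). *)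
have [T1 tT1 hT1] := Hunbounded (kappa * T) t0.
have he : fine (A T0) * (N / T) + (2 * s * fine (A tau) + 2 * eps) <= e.
  have he8 : eps <= e / 8 by rewrite ge_min lexx.
  have he2 : 2 * eps <= 2 * (e / 8) by apply: ler_wpM2l.
  apply: le_trans (lerD hT (lerD sA he2)) _.
  rewrite (_ : _ + _ = e * (3 / 4)); last by field.
  by rewrite ler_piMr ?(ltW e0)// ler_pdivrMr// mul1r ler_nat.
have hT0' : kappa * (N / s + C0 * (tau * s `^ q)) <= sobolev_H m.+1 A' T0 / 2.
  have := hT0; rewrite mulrC -ler_pdivlMr; last exact: (ltr0Sn R 1).
  exact.
exists (fine (A T1)), K; split.
- by rewrite fine_ge0// young_ge0//; exact: le_trans tT1.
- exact: (controlled_of_energy Wu L0 N0 eps0 enu s0 sdl sV NT tT0 hT0' heps tT1 hT1 he).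
- move=> k kK; exact: (controlled_of_energy (Wu_ k) L0 N0 eps0 (en_ k kK) s0 sdl sV NT tT0 hT0' heps tT1 hT1 he).
Qed.

End growth.

Section bounded_case.
Hypothesis Aconv : converges_at_infinity m.+1 A.

(** The layers are used with A' = A and integrals starting at [tau]. These stay below the convergent
    integral [Kc], so all levels t_j lie below one [M] that does not depend on [v]. *)
Let bounded_of_energy (L N eps sl : R) : 0 < L -> 0 < N -> 0 < eps -> (vol Om < sl%:E)%E ->
  exists M : R, forall v, orlicz_sobolev A Om v -> energy_bound A Om L v N eps sl ->
    {ae vol, forall x, Om x -> `|v x| <= M}.
Proof.
move=> L0 N0 eps0 Omsl; have [tau tau0 Iy] := Aconv.
have [V0|Vn] := eqVneq (vol Om) 0%E.
  by exists 0 => v _ _; exists Om; split => // x /not_implyP[].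
have V_gt0 : 0 < fine (vol Om).
  by rewrite fine_gt0// Omlty andbT lt_neqAle eq_sym Vn measure_ge0.
have L20 : 0 < 2 * L by rewrite mulr_gt0.
pose s := fine (vol Om) / 2; have s0 : 0 < s by rewrite divr_gt0.
have s2 : 2 * s <= fine (vol Om) by rewrite mulrC divfK.
pose I (t : R) := fine (partial_sobolev m.+1 A tau t).
have Atau := nA tau0.
have finI t : (partial_sobolev m.+1 A tau t < +oo)%E.
  by apply: (partial_sobolev_lty n2 yA) => //; exact: sobolev_integrand_lty.
have I0 t : 0 <= I t by rewrite fine_ge0// partial_sobolev_ge0.
have Ige p b : tau <= p -> p <= b -> (A b < +oo)%E ->
    (b - p) * (b / fine (A b)) `^ (m.+1%:R - 1)^-1 <= I b - I p.
  move=> tp pb Ab; apply: (partial_sobolev_increment n2 yA) => //.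
  - exact: ltW.
  - exact: lt_le_trans tp.
  - by apply: nA; exact: lt_le_trans tp.
pose Kc := fine (\int[lebesgue_measure]_(t in `]tau, +oo[) sobolev_integrand m.+1 A t)%E.
have IK t : I t <= Kc.
  apply: fine_le.
  - by rewrite ge0_fin_numE ?partial_sobolev_ge0.
  - by rewrite ge0_fin_numE// integral_ge0// => x _; exact: sobolev_integrand_ge0.
  - apply: ge0_subset_integral; [exact: measurable_itv|exact: measurable_itv| | |].
    + apply: measurable_funS (measurable_sobolev_integrand n2 yA); first exact: measurable_itv.
      by move=> x /=; rewrite !in_itv/= !andbT; exact: lt_trans.
    + by move=> x _; exact: sobolev_integrand_ge0.
    + by move=> x /=; rewrite !in_itv/= andbT => /andP[].
pose q' : R := (@conjugate_exponent R m.+1)^-1.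
have q'0 : 0 <= q' by rewrite invr_ge0 divr_ge0// subr_ge0 ler1n.
pose M := N / s + 4 / c * (2 * L) * 1 * (1 - 2^-1 `^ q)^-1 * (tau * s `^ q + eps `^ q * Kc `^ q').
have AA : forall t, tau <= t -> (A t <= A (1 * t)%R)%E by move=> t _; rewrite mul1r.
exists M => v Wv [vN en].
have [wg iv ig] := orlicz_sobolevP oOm Omlty yA Wv.
have mv : measurable_fun (Om : set LS) v by have [_ []] := Wv.
have mS t : measurable (super_level Om v t : set LS) by exact: (measurable_super_level oOm wg).
have Aeps : (\int[vol]_(x in super_level Om v (level_of Om v s))
   A (length_fun (weak_gradient Om v) x / (2 * L))%R <= eps%:E)%E.
  apply: en; [exact: mS|by move=> x []|].
  apply: le_lt_trans Omsl; apply: le_measure; rewrite ?inE; [exact: mS|exact: mOmL|by move=> x []].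
have [t [b [[t0E tS] St [tb bS] tJ _]]] :=
  layers m0 oOm Omlty wg ig c0 iso yA yA L20 (lexx 1) tau0 s0 eps0 Atau s2 AA Aeps I0 Ige.
have tM J : t J <= M.
  apply: le_trans (tJ J) _; apply: lerD.
    by rewrite t0E; exact: (level_of_chebyshev oOm Omlty mv N0 vN s0).
  apply: ler_wpM2l.
    by rewrite !mulr_ge0 ?invr_ge0 ?subr_ge0 ?(ltW c0) ?(ltW L0) ?(ltW rho_lt1).
  rewrite lerD2l; apply: ler_wpM2l; first exact: powR_ge0.
  apply: (ge0_ler_powR q'0 _ _ (IK _)); rewrite nnegrE; [exact: I0|exact: le_trans (I0 tau) (IK tau)].
exists (super_level Om v M); split.
- exact: mS.
- apply/eqP; rewrite eq_le measure_ge0 andbT; apply: (@le0_halving _ _ s (ltW s0)) => J.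
  apply: le_trans (St J); apply: le_measure; rewrite ?inE; [exact: mS|exact: mS|].
  by move=> x [Omx /= h]; split => //=; apply: le_lt_trans h; exact: tM.
- by move=> x /not_implyP[Omx /negP]; rewrite -ltNge => h; split.
Qed.

Lemma bounded_sequence (u_ : nat -> 'rV[R]_m.+1 -> R) (u : 'rV[R]_m.+1 -> R) (l L : R) :
  (forall k, orlicz_sobolev A Om (u_ k)) -> orlicz_sobolev A Om u ->
  0 < l -> l <= L -> sobolev_modular_cvg A Om u_ u l ->
  (modular A Om (length_fun (weak_gradient Om u)) L < +oo)%E ->
  exists M : R, exists K : nat, {ae vol, forall x, Om x -> `|u x| <= M} /\
    forall k, (K <= k)%N -> {ae vol, forall x, Om x -> `|u_ k x| <= M}.
Proof.
move=> Wu_ Wu l0 lL ucv gL; have L0 : 0 < L by exact: lt_le_trans lL.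
have mg : measurable_fun (Om : set LS) (length_fun (weak_gradient Om u)).
  by apply: measurable_length_fun => i; have [_ _ []] := Wu.
have mA := measurable_young_comp yA mg (length_fun_ge0 _) L0.
have A0 x : Om x -> (0 <= A (length_fun (weak_gradient Om u) x / L)%R)%E.
  by move=> _; apply: (young_ge0 yA); exact: (divr_ge0 (length_fun_ge0 _ _) (ltW L0)).
have F0 : (0 <= modular A Om (length_fun (weak_gradient Om u)) L)%E by exact: integral_ge0.
have fF : modular A Om (length_fun (weak_gradient Om u)) L \is a fin_num by rewrite ge0_fin_numE.
pose eps := fine (modular A Om (length_fun (weak_gradient Om u)) L) + 1.
have eps0 : 0 < eps by rewrite ltr_wpDl// fine_ge0.
have Hen S : measurable (S : set LS) -> S `<=` Om -> (vol S < (fine (vol Om) + 1)%:E)%E ->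
    (\int[vol]_(x in S) A (length_fun (weak_gradient Om u) x / L)%R <= eps%:E)%E.
  move=> mS SOm _; apply: (@le_trans _ _ (modular A Om (length_fun (weak_gradient Om u)) L)).
    exact: ge0_subset_integral.
  by rewrite -(fineK fF) lee_fin lerDl.
have [N [K [N0 enu en_]]] := energy_bound_sequence oOm Omlty yA nA Wu_ Wu l0 lL ucv eps0 Hen.
have Omsl : (vol Om < (fine (vol Om) + 1)%:E)%E.
  by rewrite EFinD fineK ?ge0_fin_numE// lteDl ?ge0_fin_numE// lte_fin.
have e20 : 0 < 2 * eps by rewrite mulr_gt0.
have [M HM] := bounded_of_energy L0 N0 e20 Omsl.
exists M, K; split; first exact: (HM _ Wu enu).
by move=> k kK; exact: (HM _ (Wu_ k) (en_ k kK)).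
Qed.

(** With target A and W = 1 on the range of |v|, the required bound is A(r) <= A(r). *)
Lemma bounded_controlled (W : R -> R) (v : 'rV[R]_m.+1 -> R) (M e : R) : 0 <= e ->
  (forall t, 0 <= t -> t <= M -> W t = 1) ->
  {ae vol, forall x, Om x -> `|v x| <= M} -> controlled A A W Om v 0 e.
Proof.
move=> e0 W1 vM; have FF := ae_filter_ringOfSetsType vol.
exists (cst 0%E); split => //; first by rewrite integral0 lee_fin.
by apply: filterS vM => x vx Omx r r0; rewrite W1 ?vx// mul1r !add0e.
Qed.

End bounded_case.
End controlled_cases.

(** W(t) = max(1, sup over |r| <= t of |h r|, divided by kappa), where kappa exceeds that supremum
    on [-M, M]. So [W] is 1 up to [M] while kappa W bounds |h| everywhere, as the general framework
    asks. *)
Lemma bounded_weight (R : realType) (h : R -> R) (M : R) :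
  (forall T : R, exists L, forall t, `|t| <= T -> `|h t| <= L) ->
  exists kappa : R, exists W : R -> R, [/\ 0 < kappa, forall t, 0 <= t -> 0 <= W t,
    (forall s t, 0 <= s -> s <= t -> W s <= W t),
    (forall t, `|h t| <= kappa * W `|t|) & forall t, 0 <= t -> t <= M -> W t = 1].
Proof.
move=> hloc; pose S (t : R) := [set `|h r| | r in [set r | `|r| <= t]].
have hsS t : 0 <= t -> has_sup (S t).
  move=> t0; split; first by exists `|h 0|; exists 0 => //=; rewrite normr0.
  by have [L hL] := hloc t; exists L => _ [r /= rt <-]; exact: hL.
have Sle t r : `|r| <= t -> `|h r| <= sup (S t).
  by move=> rt; apply: ub_le_sup; [exact: (hsS t (le_trans (normr_ge0 _) rt)).2|exists r].
have S0 t : 0 <= t -> 0 <= sup (S t).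
  by move=> t0; apply: le_trans (Sle t 0 _); rewrite ?normr0.
have Smono s t : 0 <= s -> s <= t -> sup (S s) <= sup (S t).
  move=> s0 st; apply: ge_sup; first by have [] := hsS s s0.
  by move=> _ [r /= rs <-]; apply: Sle; exact: le_trans st.
pose kappa := sup (S (Num.max M 0)) + 1.
have k0 : 0 < kappa by rewrite ltr_wpDl// S0// le_max lexx orbT.
exists kappa, (fun t => Num.max 1 (sup (S t) / kappa)); split => //.
- by move=> t _; rewrite le_max ler01.
- move=> s t s0 st; rewrite ge_max !le_max lexx/= ler_pM2r ?invr_gt0// Smono// orbT//.
- move=> t; apply: le_trans (Sle `|t| t (lexx _)) _.
  rewrite -ler_pdivrMl// mulrC le_max lexx orbT//.
- move=> t t0 tM; apply/max_idPl; rewrite ler_pdivrMr// mul1r.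
  apply: (@le_trans _ _ (sup (S (Num.max M 0)))); last by rewrite lerDl.
  by apply: Smono => //; rewrite le_max tM.
Qed.

(** * Modulars at scales above the Luxemburg norm *)

Section luxemburg.
Context {R : realType} {n : nat}.
Notation LS := (lebesgue_space R n).
Variables (A : R -> \bar R) (Om : set 'rV[R]_n).
Hypotheses (yA : young_function A) (mOmL : measurable (Om : set LS)).
Implicit Types w : 'rV[R]_n -> R.

Lemma modular_anti w (l l' : R) : measurable_fun (Om : set LS) w -> (forall x, 0 <= w x) ->
  0 < l -> l <= l' -> (modular A Om w l' <= modular A Om w l)%E.
Proof.
move=> mw w0 l0 ll'; have l'0 : 0 < l' by exact: lt_le_trans ll'.
apply: ge0_le_integral; [exact: mOmL| | | |].
- by move=> x _; apply: (young_ge0 yA); exact: (divr_ge0 (w0 x) (ltW l'0)).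
- exact: (measurable_young_comp yA mw w0 l'0).
- exact: (measurable_young_comp yA mw w0 l0).
- move=> x _; apply: (young_nd yA); first exact: (divr_ge0 (w0 x) (ltW l'0)).
  by apply: ler_wpM2l => //; rewrite lef_pV2.
Qed.

Lemma luxemburg_norm_ge0 w : 0 <= luxemburg_norm A Om w.
Proof.
have [[l Sl]|/nonemptyPn S0] := pselect ([set l : R | 0 < l /\ (modular A Om w l <= 1)%E] !=set0).
  by apply: lb_le_inf; [exists l|move=> x [x0 _]; exact: ltW].
by rewrite /luxemburg_norm S0 inf0.
Qed.

(** The infimum is informative only if some scale has modular at most 1, since the infimum of the
    empty set is 0. Convexity provides one: the scale k l, with k the modular at [l] plus 1. *)
Lemma modular_above_norm w (L : R) : measurable_fun (Om : set LS) w -> (forall x, 0 <= w x) ->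
  finite_modular A Om w -> luxemburg_norm A Om w < L -> (modular A Om w L < +oo)%E.
Proof.
move=> mw w0 [l l0 wl] nL.
have p0 (l' : R) : 0 < l' -> (0 <= modular A Om w l')%E.
  by move=> l'0; apply: integral_ge0 => x _; apply: (young_ge0 yA); exact: (divr_ge0 (w0 x) (ltW l'0)).
have fw : modular A Om w l \is a fin_num by rewrite ge0_fin_numE ?p0.
pose k := fine (modular A Om w l) + 1.
have k0 : 0 < k by rewrite ltr_wpDl// fine_ge0// p0.
have k1 : 1 <= k by rewrite lerDr fine_ge0// p0.
have kl0 : 0 < k * l by rewrite mulr_gt0.
have mkl : (modular A Om w (k * l) <= 1)%E.
  apply: (@le_trans _ _ (k^-1%:E * modular A Om w l)%E).
    rewrite -(ge0_integralZl _ mOmL (measurable_young_comp yA mw w0 l0)); last 2 first.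
    - by move=> x _; apply: (young_ge0 yA); exact: (divr_ge0 (w0 x) (ltW l0)).
    - by rewrite lee_fin invr_ge0 ltW.
    apply: ge0_le_integral; [exact: mOmL| | | |].
    - by move=> x _; apply: (young_ge0 yA); exact: (divr_ge0 (w0 x) (ltW kl0)).
    - exact: (measurable_young_comp yA mw w0 kl0).
    - by apply: measurable_funeM; exact: (measurable_young_comp yA mw w0 l0).
    - move=> x _; rewrite invfM mulrCA.
      apply: young_scale => //; last exact: (divr_ge0 (w0 x) (ltW l0)).
      by rewrite invr_ge0 (ltW k0)/= invf_le1.
  by rewrite -(fineK fw) -EFinM lee_fin mulrC ler_pdivrMr// mul1r lerDl.
have ne : [set l : R | 0 < l /\ (modular A Om w l <= 1)%E] !=set0 by exists (k * l); split.
have [l' [l'0 wl'] l'L] := inf_lt ne nL.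
apply: le_lt_trans (modular_anti mw w0 l'0 (ltW l'L)) _.
exact: le_lt_trans wl' (ltry _).
Qed.

End luxemburg.

(** Clamping to [-b, b] alters [h0] on a null set only, so the primitive is unchanged. The bound
    becomes valid everywhere, as composition with functions that charge null sets demands, and |h|
    <= |h0| preserves local boundedness. *)
Lemma primitive_clamp_ae (R : realType) (f h0 b : R -> R) :
  measurable_fun setT h0 -> measurable_fun setT b -> (forall t, 0 <= b t) ->
  {ae (@lebesgue_measure R), forall t : R, `|h0 t| <= b t} -> primitive f h0 ->
  exists h : R -> R, [/\ measurable_fun setT h, forall t, `|h t| <= b t,
    forall t, `|h t| <= `|h0 t| & primitive f h].
Proof.
move=> mh0 mb b0 h0b fh0; pose h t := Num.max (- b t) (Num.min (b t) (h0 t)).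
have mh : measurable_fun setT h.
  apply: (measurable_maxr (f := fun t => - b t) (g := fun t => Num.min (b t) (h0 t))).
    exact: measurableT_comp.
  exact: (measurable_minr mb mh0).
have hE t : `|h0 t| <= b t -> h t = h0 t.
  rewrite ler_norml => /andP[h1 h2]; rewrite /h min_r// max_r//.
have hb t : `|h t| <= b t.
  rewrite /h ler_norml le_max lexx/= ge_max ge_min lexx/= andbT.
  by apply: le_trans (b0 t); rewrite oppr_le0.
exists h; split => // [t|s t st].
  have [h1|h1] := leP `|h0 t| (b t); first by rewrite hE.
  by apply: le_trans (hb t) (ltW h1).
rewrite fh0//; apply: ae_eq_Rintegral; first exact: measurable_itv.
- exact: measurable_funTS.
- exact: measurable_funTS.
- have FF := ae_filter_ringOfSetsType (@lebesgue_measure R).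
  by apply: filterS h0b => x h1 _; rewrite hE.
Qed.

(** * The two cases of the theorem *)

Section theorem_cases.
Context {R : realType} {m : nat}.
Notation LS := (lebesgue_space R m.+1).
Notation vol := (@volume R m.+1).
Variables (Om : set 'rV[R]_m.+1) (A B : R -> \bar R) (f : R -> R).
Hypotheses (m0 : (0 < m)%N) (isoOm : isoperimetric_class Om) (yA : young_function A)
  (nA : nondegenerate_young A) (yB : young_function B) (flip : locally_lipschitz f).

Let oOm : open Om. Proof. by have [] := isoOm. Qed.
Let Omlty : (vol Om < +oo)%E. Proof. by have [] := isoOm. Qed.
Let mOmL : measurable (Om : set LS).
Proof. by apply: measurable_lebesgue_space; exact: measurable_open_rV. Qed.
Let n2 : (2 <= m.+1)%N. Proof. exact: m0. Qed.
Let h0 := upper_derivative f.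
Let mh0 : measurable_fun setT h0. Proof. exact: measurable_upper_derivative. Qed.
Let fh0 : primitive f h0. Proof. exact: locally_lipschitz_primitive. Qed.
Let hloc0 : forall M : R, exists L, forall t, `|t| <= M -> `|h0 t| <= L.
Proof. exact: upper_derivative_bounded. Qed.

Let mgu u : orlicz_sobolev A Om u -> measurable_fun (Om : set LS) (length_fun (weak_gradient Om u)).
Proof. by move=> [_ _ [mg _]]; exact: measurable_length_fun. Qed.

Lemma bounded_superposition (u_ : nat -> 'rV[R]_m.+1 -> R) (u : 'rV[R]_m.+1 -> R) (l : R) :
  converges_at_infinity m.+1 A ->
  (forall k, orlicz_sobolev A Om (u_ k)) -> orlicz_sobolev A Om u -> 0 < l ->
  sobolev_modular_cvg A Om u_ u l ->
  orlicz_sobolev A Om (superposition f u) /\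
  exists2 l', 0 < l' & sobolev_modular_cvg A Om (fun k => superposition f (u_ k)) (superposition f u) l'.
Proof.
move=> Aconv Wu_ Wu l0 ucv; have [_ _ [c c0 iso]] := isoOm.
have [_ _ [_ [l1 l10 gl1]]] := Wu.
pose L := Num.max l l1.
have lL : l <= L by rewrite le_max lexx.
have L0 : 0 < L by exact: lt_le_trans lL.
have gL : (modular A Om (length_fun (weak_gradient Om u)) L < +oo)%E.
  apply: le_lt_trans gl1; apply: (modular_anti yA mOmL (mgu Wu) (length_fun_ge0 _) l10).
  by rewrite le_max lexx orbT.
have [M [K [uM u_M]]] := bounded_sequence m0 oOm Omlty yA nA c0 iso Aconv Wu_ Wu l0 lL ucv gL.
have [kappa [W [k0 W0 Wmono hW W1]]] := bounded_weight M hloc0.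
have ctl v e : 0 <= e -> {ae vol, forall x, Om x -> `|v x| <= M} -> controlled A A W Om v 0 e.
  by move=> e0 vM; exact: (bounded_controlled A e0 W1 vM).
split.
  by have [] := controlled_maps oOm Omlty yA yA mh0 hloc0 fh0 k0 W0 Wmono hW Wu (lexx 0) (ctl u 1 ler01 uM).
exists (12 * kappa * L); first by rewrite !mulr_gt0.
apply: (controlled_cvg oOm Omlty yA yA nA mh0 hloc0 fh0 k0 W0 Wmono hW Wu_ Wu l0 lL ucv gL) => e e0.
exists 0, K; split; [exact: lexx|exact: (ctl u e (ltW e0) uM)|].
by move=> k kK; exact: (ctl _ e (ltW e0) (u_M k kK)).
Qed.

Section growth_case.
Variables (kappa : R) (E : R -> R) (A' : R -> \bar R) (t0 : R).
Hypotheses (Adiv : ~ converges_at_infinity m.+1 A) (k0 : 0 < kappa) (E0 : forall t, 0 <= t -> 0 <= E t)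
  (Ehomo : {in `[0, +oo[ &, {homo E : s t / s <= t}})
  (fE : {ae lebesgue_measure, forall t : R,
          derivable f t 1 -> `|derive1 f t| <= kappa * E (kappa * `|t|)})
  (rep : sobolev_representative m.+1 A A') (t00 : 0 <= t0)
  (hB : forall t, t0 <= t -> (B (t * E (sobolev_H m.+1 A' t))%R <= A t)%E).

Let Emono s t : 0 <= s -> s <= t -> E s <= E t.
Proof.
move=> s0 st; apply: Ehomo => //; rewrite in_itv/= andbT//.
exact: le_trans st.
Qed.

Let W t := E (kappa * t).
Let W0 t : 0 <= t -> 0 <= W t. Proof. by move=> t0'; apply: E0; rewrite mulr_ge0// ltW. Qed.
Let Wmono s t : 0 <= s -> s <= t -> W s <= W t.
Proof.
move=> s0 st; apply: Emono; first by rewrite mulr_ge0// ltW.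
by apply: ler_wpM2l => //; exact: ltW.
Qed.

Let coefficient : exists h : R -> R, [/\ measurable_fun setT h, forall t, `|h t| <= kappa * W `|t|,
    forall t, `|h t| <= `|h0 t| & primitive f h].
Proof.
apply: (primitive_clamp_ae mh0 _ _ _ fh0).
- apply: measurable_funM; first exact: measurable_cst.
  (* [E] is monotone only on [0, +oo[; this extension is monotone on the line, hence Borel. *)
  pose E1 t := E (Num.max t 0).
  have mE : measurable_fun setT E1.
    apply: nondecreasing_measurable => // s t st; apply: Emono; first by rewrite le_max lexx orbT.
    by rewrite ge_max !le_max st lexx orbT.
  rewrite (_ : (fun t => _) = (fun t => E1 (kappa * `|t|))); last first.
    by apply/funext => t; rewrite /E1 max_l// mulr_ge0// ltW.
  apply: (measurableT_comp mE); apply: measurable_funM; first exact: measurable_cst.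
  exact: (measurable_fun_normr (@measurable_id _ _ _)).
- by move=> t; rewrite mulr_ge0 ?W0// ltW.
- have FF := ae_filter_ringOfSetsType (@lebesgue_measure R).
  apply: filterS2 fE (locally_lipschitz_ae_derivable flip) => t h1 h2.
  by rewrite /h0 upper_derivativeE//; exact: h1.
Qed.

Let Afin t : 0 <= t -> (A t < +oo)%E.
Proof.
rewrite le_eqVlt => /predU1P[<-|tp]; first by rewrite young0// ltry.
rewrite ltey; apply/eqP => At; apply: Adiv.
exact: (converges_at_infinity_infinite n2 yA tp At).
Qed.

(** If [A] itself is used, the comparison constant is 1. Otherwise equivalence near infinity gives
    it, positivity of A' at [tau] coming from A(t/c) <= A'(t), and the divergence at infinity is
    inherited. *)
Let representative : [/\ young_function A', converges_at_zero m.+1 A', ~ converges_at_infinity m.+1 A' &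
  exists cp tau : R, [/\ 1 <= cp, 0 < tau, (0 < A' tau)%E &
    forall t, tau <= t -> (A' t <= A (cp * t)%R)%E]].
Proof.
case: rep => [[cz ->]|[ncz yA' eq cz]].
  split => //; exists 1, 1; split => //; first exact: nA.
  by move=> t _; rewrite mul1r.
split => //; first by move=> /(converges_at_infinity_equiv n2 yA yA' eq).
have [c [t1 [c0 t10 H]]] := eq.
exists (Num.max c 1), t1; split => //; first by rewrite le_max lexx orbT.
  by apply: lt_le_trans (H t1 (lexx _)).1; apply: nA; rewrite divr_gt0.
move=> t t1t; have tp : 0 < t by exact: lt_le_trans t1t.
apply: le_trans (H t t1t).2 _; apply: (young_nd yA); first by rewrite mulr_ge0// ltW.
by apply: ler_wpM2r; [exact: ltW|rewrite le_max lexx].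
Qed.

(** H_n is the power 1/n' of a divergent integral, hence unbounded; the level asked of the integral
    is max(M, 0)^n'. *)
Let unbounded M T0 : exists2 T, T0 <= T & M <= sobolev_H m.+1 A' T.
Proof.
have [yA' cz nci _] := representative.
have finI := converges_at_zero_lty n2 yA' cz.
pose q' : R := (@conjugate_exponent R m.+1)^-1.
have q'0 : 0 < q' by rewrite invr_gt0 divr_gt0// subr_gt0 ltr1n.
have [T T0T hT] := partial_sobolev_unbounded n2 yA' nci finI (Num.max M 0 `^ q'^-1) T0.
exists T => //; apply: (@le_trans _ _ (Num.max M 0)); first by rewrite le_max lexx.
have M0 : 0 <= Num.max M 0 by rewrite le_max lexx orbT.
rewrite -[leLHS](powRr1 M0) -(mulVf (lt0r_neq0 q'0)) powRrM.
apply: (ge0_ler_powR (ltW q'0)) hT; rewrite nnegrE; first exact: powR_ge0.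
by rewrite fine_ge0// partial_sobolev_ge0.
Qed.

Lemma growth_superposition (u_ : nat -> 'rV[R]_m.+1 -> R) (u : 'rV[R]_m.+1 -> R) (l L : R) :
  (forall k, orlicz_sobolev A Om (u_ k)) -> orlicz_sobolev A Om u -> 0 < l -> l <= L ->
  sobolev_modular_cvg A Om u_ u l ->
  (modular A Om (length_fun (weak_gradient Om u)) L < +oo)%E ->
  orlicz_sobolev B Om (superposition f u) /\
  sobolev_modular_cvg B Om (fun k => superposition f (u_ k)) (superposition f u) (12 * kappa * L).
Proof.
move=> Wu_ Wu l0 lL ucv gL; have [_ _ [c c0 iso]] := isoOm.
have [h [mh hW hh0 fh]] := coefficient.
have hloc M : exists L, forall t, `|t| <= M -> `|h t| <= L.
  by have [L' hL'] := hloc0 M; exists L' => t tM; apply: le_trans (hh0 t) _; exact: hL'.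
have [yA' cz _ [cp [tau [cp1 tau0 A'tau AA']]]] := representative.
have finI := converges_at_zero_lty n2 yA' cz.
have ctl := growth_controlled m0 oOm Omlty yA nA c0 iso yA' yB k0 t00 E0 Emono finI hB Afin
  cp1 tau0 A'tau AA' unbounded Wu_ Wu l0 lL ucv gL.
split; last exact: (controlled_cvg oOm Omlty yA yB nA mh hloc fh k0 W0 Wmono hW Wu_ Wu l0 lL ucv gL ctl).
have [C [K [C0 cu _]]] := ctl 1 ltr01.
by have [] := controlled_maps oOm Omlty yA yB mh hloc fh k0 W0 Wmono hW Wu C0 cu.
Qed.

(** At scale exactly the norm the modular of the gradient is not known to be finite from
    [modular_above_norm]; doubling makes the inequality strict and turns 12 into 24. *)
Lemma growth_superposition_norm (u_ : nat -> 'rV[R]_m.+1 -> R) (u : 'rV[R]_m.+1 -> R) (l : R) :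
  (forall k, orlicz_sobolev A Om (u_ k)) -> orlicz_sobolev A Om u -> 0 < l ->
  sobolev_modular_cvg A Om u_ u l ->
  sobolev_modular_cvg B Om (fun k => superposition f (u_ k)) (superposition f u)
    (24 * kappa * Num.max l (orlicz_sobolev_norm A Om u)).
Proof.
move=> Wu_ Wu l0 ucv; set L := Num.max _ _.
have lL : l <= L by rewrite le_max lexx.
have L0 : 0 < L by exact: lt_le_trans lL.
rewrite (_ : 24 * kappa * L = 12 * kappa * (2 * L)); last by ring.
have L2 : L < 2 * L by rewrite ltr_pMl// ltr1n.
apply: (growth_superposition Wu_ Wu l0 _ ucv _).2; first exact: le_trans lL (ltW L2).
have [_ _ [_ fg]] := Wu.
apply: (modular_above_norm yA mOmL (mgu Wu) (length_fun_ge0 _) fg).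
apply: le_lt_trans L2; rewrite /L le_max; apply/orP; right.
by rewrite /orlicz_sobolev_norm lerDr luxemburg_norm_ge0.
Qed.

End growth_case.
End theorem_cases.

Theorem theorem3p5 (R : realType) (n : nat) (Om : set 'rV[R]_n)
    (A B : R -> \bar R) (f : R -> R) :
  (2 <= n)%N ->
  isoperimetric_class Om ->
  young_function A -> nondegenerate_young A -> young_function B ->
  locally_lipschitz f ->
  (converges_at_infinity n A ->
     maps_sobolev f A A Om /\ modularly_continuous f A A Om) /\
  (~ converges_at_infinity n A ->
     forall (kappa : R) (E : R -> R) (A' : R -> \bar R),
       0 < kappa ->
       (forall t, 0 <= t -> 0 <= E t) ->
       {in `[0, +oo[ &, {homo E : s t / s <= t}} ->
       {within `[0, +oo[, continuous E} ->
       (exists2 t, 0 <= t & E t != 0) ->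
       {ae lebesgue_measure, forall t : R,
          derivable f t 1 -> `|derive1 f t| <= kappa * E (kappa * `|t|)} ->
       sobolev_representative n A A' ->
       (exists2 t0 : R, 0 <= t0 & forall t, t0 <= t ->
          (B (t * E (sobolev_H n A' t))%R <= A t)%E) ->
       [/\ maps_sobolev f A B Om,
           modularly_continuous f A B Om &
           forall (u_ : nat -> 'rV[R]_n -> R) (u : 'rV[R]_n -> R) (l : R),
             (forall k, orlicz_sobolev A Om (u_ k)) ->
             orlicz_sobolev A Om u ->
             0 < l -> sobolev_modular_cvg A Om u_ u l ->
             sobolev_modular_cvg B Om (fun k => superposition f (u_ k))
               (superposition f u)
               (24 * kappa * Num.max l (orlicz_sobolev_norm A Om u))]).
Proof.
move=> n2 isoOm yA nA yB flip.
case: n n2 Om isoOm => [//|[//|m]] _ Om isoOm; have m0 : (0 < m.+1)%N by [].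
have mOmL : measurable (Om : set (lebesgue_space R m.+2)).
  by apply: measurable_lebesgue_space; apply: measurable_open_rV; have [] := isoOm.
split=> [Aconv|Adiv kappa E A' k0 E0 Ehomo _ _ fE rep [t0 t00 hB]].
  split=> [u Wu|u_ u Wu_ Wu [l l0 ucv]].
    (* The mapping property is the first conclusion for the constant sequence [u], with scale 1. *)
    by have [] := bounded_superposition m0 isoOm yA nA flip Aconv (fun=> Wu) Wu ltr01
      (sobolev_modular_cvg_cst Om yA u 1).
  by have [] := bounded_superposition m0 isoOm yA nA flip Aconv Wu_ Wu l0 ucv.
have main := growth_superposition_norm m0 isoOm yA nA yB flip Adiv k0 E0 Ehomo fE rep t00 hB.
split=> [u Wu|u_ u Wu_ Wu [l l0 ucv]|u_ u l Wu_ Wu l0 ucv]; last exact: main.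
  have [_ _ [_ [l l0 gl]]] := Wu.
  by have [] := growth_superposition m0 isoOm yA nA yB flip Adiv k0 E0 Ehomo fE rep t00 hB
    (fun=> Wu) Wu l0 (lexx l) (sobolev_modular_cvg_cst Om yA u l) gl.
exists (24 * kappa * Num.max l (orlicz_sobolev_norm A Om u)); last exact: main.
by rewrite !mulr_gt0// lt_max l0.
Qed.
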